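(* Let $L$ be a Lie algebra of compact operators on a complex Banach space and let $L_0$ be an $E$-solvable Lie subalgebra of $L$. If $a,b\in L_0$ are Engel elements of $L$, then $a+b$ is an Engel element of $L$.
   Context: An operator Lie algebra is a linear subspace $L\subseteq\mathcal{B}(\mathcal{X})$ closed under $[a,b]=ab-ba$, normed by the operator norm; $\operatorname{ad}a:x\mapsto[a,x]$ on $L$. An element $a$ of a normed Lie algebra $L$ is an Engel element of $L$ if $\lim_n\|(\operatorname{ad}a)^n\|^{1/n}=0$; $L$ is Engel if all its elements are. A normed Lie algebra $L$ is $E$-solvable if for every closed ideal $I\neq L$ the quotient $L/I$ contains a nonzero closed ideal which is an Engel Lie algebra. *)

(* Defs.v *)
From Stdlib Require Import Reals Lra Classical ClassicalEpsilon FunctionalExtensionality.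
Open Scope R_scope.

Definition C := (R * R)%type.
Definition Cadd (z w : C) : C := (fst z + fst w, snd z + snd w).
Definition Cmul (z w : C) : C :=
  (fst z * fst w - snd z * snd w, fst z * snd w + snd z * fst w).
Definition Cone : C := (1, 0).
Definition Cmod (z : C) : R := sqrt (fst z * fst z + snd z * snd z).

Record CBanach := {
  carrier :> Type;
  vzero : carrier;
  vadd : carrier -> carrier -> carrier;
  vopp : carrier -> carrier;
  vscal : C -> carrier -> carrier;
  vnorm : carrier -> R;
  vadd_assoc : forall x y z, vadd x (vadd y z) = vadd (vadd x y) z;
  vadd_comm : forall x y, vadd x y = vadd y x;
  vadd_zero : forall x, vadd x vzero = x;
  vadd_opp : forall x, vadd x (vopp x) = vzero;
  vscal_one : forall x, vscal Cone x = x;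
  vscal_assoc : forall a b x, vscal a (vscal b x) = vscal (Cmul a b) x;
  vscal_distr_v : forall a x y, vscal a (vadd x y) = vadd (vscal a x) (vscal a y);
  vscal_distr_s : forall a b x, vscal (Cadd a b) x = vadd (vscal a x) (vscal b x);
  vnorm_nonneg : forall x, 0 <= vnorm x;
  vnorm_def : forall x, vnorm x = 0 -> x = vzero;
  vnorm_scal : forall a x, vnorm (vscal a x) = Cmod a * vnorm x;
  vnorm_triangle : forall x y, vnorm (vadd x y) <= vnorm x + vnorm y;
  vcomplete : forall u : nat -> carrier,
    (forall eps, eps > 0 -> exists N, forall n m, (n >= N)%nat -> (m >= N)%nat ->
        vnorm (vadd (u n) (vopp (u m))) < eps) ->
    exists l, forall eps, eps > 0 -> exists N, forall n, (n >= N)%nat ->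
        vnorm (vadd (u n) (vopp l)) < eps
}.

Section Ops.
Variable X : CBanach.

Definition vconv (u : nat -> X) (l : X) : Prop :=
  forall eps, eps > 0 -> exists N, forall n, (n >= N)%nat ->
    vnorm X (vadd X (u n) (vopp X l)) < eps.

Definition op := X -> X.
Definition linear_op (T : op) : Prop :=
  (forall x y, T (vadd X x y) = vadd X (T x) (T y)) /\
  (forall a x, T (vscal X a x) = vscal X a (T x)).

(* compact operator: linear, maps the closed unit ball to a relatively
   compact set (sequential characterisation, X being a metric space) *)
Definition compact_op (T : op) : Prop :=
  linear_op T /\
  forall u : nat -> X, (forall n, vnorm X (u n) <= 1) ->
    exists (phi : nat -> nat) (l : X),
      (forall n, (phi n < phi (S n))%nat) /\ vconv (fun n => T (u (phi n))) l.

Definition opzero : op := fun _ => vzero X.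
Definition opadd (S T : op) : op := fun x => vadd X (S x) (T x).
Definition opopp (T : op) : op := fun x => vopp X (T x).
Definition opscal (a : C) (T : op) : op := fun x => vscal X a (T x).
Definition bracket (S T : op) : op := fun x => vadd X (S (T x)) (vopp X (T (S x))).
Definition opsub (S T : op) : op := opadd S (opopp T).

End Ops.

(* least upper bound (meaningful when it exists) *)
Definition Rsup (E : R -> Prop) : R := epsilon (inhabits 0) (is_lub E).
Definition Rinf (E : R -> Prop) : R := - Rsup (fun r => E (- r)).
Definition rootn (x : R) (n : nat) : R :=
  if Rlt_dec 0 x then Rpower x (/ INR n) else 0.

Section Lie.
Variable X : CBanach.

Definition opnorm (T : op X) : R :=
  Rsup (fun r => exists x, vnorm X x <= 1 /\ r = vnorm X (T x)).

Definition lie_subalg (L : op X -> Prop) : Prop :=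
  L (opzero X) /\
  (forall S T, L S -> L T -> L (opadd X S T)) /\
  (forall a T, L T -> L (opscal X a T)) /\
  (forall S T, L S -> L T -> L (bracket X S T)).

Definition subset_op (A B : op X -> Prop) : Prop := forall T, A T -> B T.

(* A normed Lie algebra given by a set S of operators with a seminorm q.
   Engel element: lim_n ||(ad a)^n||^{1/n} = 0 where ||.|| is the
   operator norm of the map (ad a)^n : S -> S w.r.t. q. *)
Definition engel_in (S : op X -> Prop) (q : op X -> R) (a : op X) : Prop :=
  S a /\
  Un_cv (fun n => rootn
     (Rsup (fun r => exists x, S x /\ q x <= 1 /\
                               r = q (Nat.iter n (bracket X a) x))) n) 0.

Definition engel_elem (L : op X -> Prop) (a : op X) : Prop :=
  engel_in L opnorm a.

Definition qnorm (I : op X -> Prop) (x : op X) : R :=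
  Rinf (fun r => exists i, I i /\ r = opnorm (opsub X x i)).

Definition closed_ideal (L0 I : op X -> Prop) : Prop :=
  subset_op I L0 /\ lie_subalg I /\
  (forall a x, L0 a -> I x -> I (bracket X a x)) /\
  (forall (u : nat -> op X) x, (forall n, I (u n)) -> L0 x ->
      Un_cv (fun n => opnorm (opsub X (u n) x)) 0 -> I x).

(* Subsets of L0/I are encoded by their preimages J in L0 (J contains I,
   hence is I-saturated when J is a subspace); L0/I carries the quotient
   norm qnorm I. A nonzero closed ideal of L0/I which is an Engel Lie
   algebra is then: *)
Definition quot_engel_ideal (L0 I J : op X -> Prop) : Prop :=
  subset_op J L0 /\ subset_op I J /\ lie_subalg J /\
  (forall a x, L0 a -> J x -> J (bracket X a x)) /\
  (forall (u : nat -> op X) x, (forall n, J (u n)) -> L0 x ->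
      Un_cv (fun n => qnorm I (opsub X (u n) x)) 0 -> J x) /\
  (exists x, J x /\ ~ I x) /\
  (forall x, J x -> engel_in J (qnorm I) x).

Definition E_solvable (L0 : op X -> Prop) : Prop :=
  forall I, closed_ideal L0 I -> (exists x, L0 x /\ ~ I x) ->
    exists J, quot_engel_ideal L0 I J.

End Lie.

(* Main.v *)
Require Import Defs.
From Stdlib Require Import Reals Lra Lia List Classical ClassicalEpsilon FunctionalExtensionality PropExtensionality ProofIrrelevance.
From Coquelicot Require Import Coquelicot.
From mathcomp Require classical_sets.
Import ListNotations.
Set Implicit Arguments.
Unset Strict Implicit.
Open Scope R_scope.
Tactic Notation "le_mid" uconstr(t) := apply Rle_trans with t.
Tactic Notation "contra" simple_intropattern(h) := apply NNPP; intros h.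
Tactic Notation "fext" simple_intropattern(n) := apply functional_extensionality; intros n.
Tactic Notation "have" ident(x) ":=" lconstr(t) := assert (x := t).
Tactic Notation "have" ident(x) ":" lconstr(t) := assert (x : t).
Tactic Notation "have" ident(x) ":" lconstr(t) "by" tactic3(k) := assert (x : t) by k.
Tactic Notation "le_by" uconstr(t) := eapply Rle_trans; [apply t|].
Tactic Notation "le_to" uconstr(t) := eapply Rle_trans; [|apply t].
Notation mul_le_l := Rmult_le_compat_l (only parsing).
Notation mul_le_r := Rmult_le_compat_r (only parsing).
Notation mul_ge0 := Rmult_le_pos (only parsing).
Notation div_gt0 := Rdiv_lt_0_compat (only parsing).
Notation div_ge0 := Rdiv_le_0_compat (only parsing).
Notation inv_gt0 := Rinv_0_lt_compat (only parsing).

Implicit Type V : CBanach.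
Notation C := Coquelicot.Complex.C.
Notation Cmod := Coquelicot.Complex.Cmod.

Declare Scope vec_scope.
Delimit Scope vec_scope with V.
Open Scope vec_scope.
Notation "x +v y" := (@vadd _ x y) (at level 50, left associativity) : vec_scope.
Notation "-v x" := (@vopp _ x) (at level 35, right associativity) : vec_scope.
Notation "x -v y" := (@vadd _ x (@vopp _ y)) (at level 50, left associativity) : vec_scope.
Notation "c *v x" := (@vscal _ (c%C : C) x) (at level 40, left associativity) : vec_scope.
Notation "0v" := (@vzero _) : vec_scope.
Notation nm := (@vnorm _).

(** Put D = ad a + ad b, acting on L; the powers of D must decay faster than every geometric
    sequence. Two norms are played against each other. In the operator norm on L the powers of ad a
    and ad b decay fast, so the normally ordered sum A of the terms binom(M,i) (ad a)^i (ad b)^(M-i)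
    ([SM]) is very small for large M. The difference G = D^M - A is a combination of products
    containing the commutator [ad a, ad b] = ad [a,b] ([Gam_small]). In a second norm, equivalent to
    the first, a and b keep a fixed bound while [a,b] is as small as desired ([adapted_norm]), so
    that G is small there. In the expansion of (A + G)^(2m), the words with at most m letters G are
    estimated in the first norm and the others in the second ([wsum_power]). This bounds the growth
    of D by an arbitrary eta > 0 ([engel_add]).

    The second norm comes from a theorem of Berger-Wang type ([BW]): if finitely many operators are
    scalar plus compact with scalars of modulus at most c0, and each word in them has spectral
    radius at most c0 to its length, then for every kap > c0 an equivalent norm makes them all
    bounded by kap. It is applied to a, b and R [a,b] with R large. The hypothesis requires that
    every word containing [a,b] be quasinilpotent ([word_quasinilpotent]). Otherwise an eigenvector
    of the compact word for a nonzero eigenvalue would survive in an irreducible subquotient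
    ([irr_subquotient]); but there the image of [a,b] is 0, since E-solvability makes the image of
    L0 commutative in every irreducible representation by compact operators ([all_central]).

    For [all_central], the elements of L0 that are central in all such representations form a closed
    ideal. If it were proper, E-solvability would give a larger ideal J, Engel modulo it, whose
    image in an irreducible representation is an ideal of Engel elements. Such an ideal is central
    ([engel_ideal_central]): an Engel element of an irreducible algebra with a nonzero eigenvalue
    forces finite dimension and a single eigenvalue ([eig_dense]), which is excluded for
    combinations of commutators by the trace ([trace_zero]). So the part of the ideal spanned by
    commutators is quasinilpotent, and an irreducible Lie algebra of compact operators has no
    nonzero ideal of quasinilpotent operators ([theoremV]).

    For [theoremV], let G now be the group generated by the exponentials of the algebra. A Lomonosov
    argument combined with [BW] gives a group element with an eigenvalue outside the unit disc
    ([step1]). Limits of normalised powers give compact elements, then idempotents of minimal range,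
    and at last a rank-one idempotent e in the closure of the scalar multiples of G ([rank_one]).
    For x in the ideal, e x e = 0 ([corner_SS]): a spectral filter for conjugation by g would
    otherwise produce an element x' of the closed ideal with p x' a nonzero multiple of p, which is
    not quasinilpotent ([corner_zero]). Moving e by the group and using irreducibility gives x = 0.

    Contour integrals are replaced throughout by averages over roots of unity ([LB], [rb_compact],
    [bexp_extract]), and spectral projections of operators that are not compact by a Newton
    iteration for idempotents ([BLK]). *)

Lemma Cmod_Defs (z : C) : Defs.Cmod z = Cmod z.
Proof. unfold Defs.Cmod, Cmod. f_equal. nra. Qed.

Ltac ceq := match goal with |- @eq _ ?a ?b => change (@eq C a b); ring end.

(** * Elementary identities in complex Banach spaces *)

Section VecBasics.
Variable V : CBanach.
Implicit Types x y z : V.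

Lemma vaddA x y z : x +v (y +v z) = x +v y +v z.
Proof. apply vadd_assoc. Qed.
Lemma vaddC x y : x +v y = y +v x.
Proof. apply vadd_comm. Qed.
Lemma vadd0r x : x +v 0v = x.
Proof. apply vadd_zero. Qed.
Lemma vadd0l x : 0v +v x = x.
Proof. rewrite vaddC. apply vadd0r. Qed.
Lemma vaddN x : x -v x = 0v.
Proof. apply vadd_opp. Qed.
Lemma vcancel x y z : x +v y = x +v z -> y = z.
Proof.
 intros H. rewrite <- (vadd0l y), <- (vadd0l z), <- (vaddN x), (vaddC x).
 rewrite <- !vaddA, H. auto.
Qed.
Lemma vs1 x : 1%C *v x = x.
Proof. exact (vscal_one V x). Qed.
Lemma vsA (a b : C) x : a *v (b *v x) = (a * b)%C *v x.
Proof. exact (vscal_assoc V a b x). Qed.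
Lemma vsDr (a : C) x y : a *v (x +v y) = a *v x +v a *v y.
Proof. exact (vscal_distr_v V a x y). Qed.
Lemma vsDl (a b : C) x : (a + b)%C *v x = a *v x +v b *v x.
Proof. exact (vscal_distr_s V a b x). Qed.
Lemma vs0l x : 0%C *v x = 0v.
Proof.
 apply (@vcancel (0%C *v x)). rewrite <- vsDl, vadd0r. f_equal. ceq.
Qed.
Lemma vs0r (a : C) : a *v (0v : V) = 0v.
Proof. apply (@vcancel (a *v 0v)). rewrite <- vsDr, !vadd0r. auto. Qed.
Lemma voppE x : -v x = (-1)%C *v x.
Proof.
 apply (@vcancel x). rewrite vaddN. rewrite <- (vs1 x) at 1.
 rewrite <- vsDl. rewrite <- (vs0l x) at 1. f_equal. ceq.
Qed.
Lemma nm_ge0 x : 0 <= nm x.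
Proof. apply vnorm_nonneg. Qed.
Lemma nm_eq0 x : nm x = 0 -> x = 0v.
Proof. apply vnorm_def. Qed.
Lemma nm_scal (a : C) x : nm (a *v x) = Cmod a * nm x.
Proof. rewrite <- Cmod_Defs. apply vnorm_scal. Qed.
Lemma nm_tri x y : nm (x +v y) <= nm x + nm y.
Proof. apply vnorm_triangle. Qed.
Lemma nm0 : nm (0v : V) = 0.
Proof. rewrite <- (vs0l 0v), nm_scal, Cmod_0. ring. Qed.
Lemma nm_opp x : nm (-v x) = nm x.
Proof. rewrite voppE, nm_scal. rewrite Cmod_R, Rabs_left; lra. Qed.
Lemma nm_sub x y : nm (x -v y) <= nm x + nm y.
Proof. rewrite <- (nm_opp y). apply nm_tri. Qed.
End VecBasics.
Ltac pos := first [lra | match goal with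
 | |- 0 <= vnorm _ => apply nm_ge0
 | |- 0 <= Cmod _ => apply Cmod_ge_0
 | |- _ <= INR _ => apply pos_INR
 | |- _ < INR _ => apply lt_0_INR; lia
 | |- _ < exp _ => apply exp_pos
 | |- _ <= exp _ => apply Rlt_le, exp_pos
 | |- _ <= _ * _ => apply mul_ge0; pos
 | |- _ < _ * _ => apply Rmult_lt_0_compat; pos
 | |- _ <= _ ^ _ => apply pow_le; pos
 | |- _ < _ ^ _ => apply pow_lt; pos
 | |- _ <= _ / _ => apply div_ge0; pos
 | |- _ < _ / _ => apply div_gt0; pos
 | |- _ < / _ => apply inv_gt0; pos
 | |- _ <= / _ => apply Rlt_le, inv_gt0; pos
 | |- 0 <= _ + _ => apply Rplus_le_le_0_compat; pos
 end | solve [auto]].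
Ltac mono := first [lra | solve [auto] | match goal with
 | |- ?a * _ <= ?a * _ => apply mul_le_l; [pos | mono]
 | |- _ * ?a <= _ * ?a => apply mul_le_r; [pos | mono]
 | |- _ * _ <= _ * _ => apply Rmult_le_compat; [pos | pos | mono | mono]
 | |- _ + _ <= _ + _ => apply Rplus_le_compat; mono
 | |- _ ^ ?n <= _ ^ ?n => apply pow_incr; split; [pos | mono]
 | |- / _ <= / _ => apply Rinv_le_contravar; [pos | mono]
 end | pos].
Ltac triv := intros; first [assumption | reflexivity | lia | mono].

(** * Deciding linear identities between vectors by reflection *)

Section Reflect.
Variable V : CBanach.
Inductive vexp := VA (n : nat) | VZ | VP (a b : vexp) | VO (a : vexp) | VS (c : C) (a : vexp).
Fixpoint vden (env : list V) (e : vexp) : V :=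
 match e with
 | VA n => nth n env 0v
 | VZ => 0v
 | VP a b => vden env a +v vden env b
 | VO a => -v (vden env a)
 | VS c a => c *v vden env a
 end.
Fixpoint lunit (k n : nat) : list C :=
 match k with
 | O => nil
 | S k' => match n with O => RtoC 1 :: lunit k' (S k') | S n' => RtoC 0 :: lunit k' n' end
 end.
Fixpoint lzero (k : nat) : list C := match k with O => nil | S k => RtoC 0 :: lzero k end.
Fixpoint lplus (a b : list C) : list C :=
 match a, b with x :: a, y :: b => Cplus x y :: lplus a b | _, _ => nil end.
Definition lscal (c : C) (a : list C) := map (fun x => Cmult c x) a.
Fixpoint vcl (k : nat) (e : vexp) : list C :=
 match e with
 | VA n => lunit k n
 | VZ => lzero k
 | VP a b => lplus (vcl k a) (vcl k b)
 | VO a => lscal (Copp 1) (vcl k a)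
 | VS c a => lscal c (vcl k a)
 end.
Fixpoint lcomb (cs : list C) (env : list V) : V :=
 match cs, env with c :: cs, x :: env => c *v x +v lcomb cs env | _, _ => 0v end.
Lemma lcomb_zero env : lcomb (lzero (length env)) env = 0v.
Proof. induction env; simpl; auto. now rewrite IHenv, vs0l, vadd0r. Qed.
Lemma lcomb_unit0 env n : (length env <= n)%nat -> lcomb (lunit (length env) n) env = 0v.
Proof.
 revert n; induction env; intros n Hn; simpl; auto.
 destruct n; simpl in *. lia. rewrite IHenv by lia. now rewrite vs0l, vadd0r.
Qed.
Lemma lcomb_unit env n : lcomb (lunit (length env) n) env = nth n env 0v.
Proof.
 revert n; induction env; intros n; simpl. now destruct n.
 destruct n; simpl. rewrite lcomb_unit0 by lia. now rewrite vs1, vadd0r.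
 now rewrite IHenv, vs0l, vadd0l.
Qed.
Lemma lcomb_plus a b env : length a = length env -> length b = length env ->
 lcomb (lplus a b) env = lcomb a env +v lcomb b env.
Proof.
 revert a b; induction env; intros [|x a'] [|y b']; simpl; intros; try lia.
 now rewrite vadd0r.
 rewrite IHenv by lia. rewrite vsDl. rewrite !vaddA. f_equal.
 rewrite <- !vaddA. f_equal. apply vaddC.
Qed.
Lemma lcomb_scal c a env : lcomb (lscal c a) env = c *v lcomb a env.
Proof.
 revert a; induction env; intros [|x a']; simpl; try now rewrite vs0r.
 now rewrite IHenv, vsDr, vsA.
Qed.
Lemma len_unit k n : length (lunit k n) = k.
Proof. revert n; induction k; intros; simpl; auto. destruct n; simpl; now rewrite IHk. Qed.
Lemma len_zero k : length (lzero k) = k.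
Proof. induction k; simpl; auto. Qed.
Lemma len_plus a b : length a = length b -> length (lplus a b) = length a.
Proof. revert b; induction a; intros [|y b]; simpl; intros; try lia. triv. Qed.
Lemma len_vcl k e : length (vcl k e) = k.
Proof.
 induction e; simpl. apply len_unit. apply len_zero.
 rewrite len_plus; congruence. unfold lscal; now rewrite length_map. unfold lscal; now rewrite length_map.
Qed.
Lemma vden_lcomb env e : vden env e = lcomb (vcl (length env) e) env.
Proof.
 induction e; simpl.
 now rewrite lcomb_unit. now rewrite lcomb_zero.
 rewrite lcomb_plus by apply len_vcl. congruence.
 rewrite lcomb_scal, voppE, IHe. f_equal. ceq.
 rewrite lcomb_scal. congruence.
Qed.
(** A conjunction of scalar equations instead of an equality of lists, so that [ring] or [field]
    meets one coefficient at a time. Nothing is asked beyond the end of the shorter list, whence the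
    length hypothesis of [leq_eq]. *)
Fixpoint leq (a b : list C) : Prop :=
 match a, b with
 | x :: a, y :: b => x = y /\ leq a b
 | _, _ => True
 end.
Lemma leq_eq a b : length a = length b -> leq a b -> a = b.
Proof. revert b; induction a; intros [|y b]; simpl; intros; try lia; auto. destruct H0; subst. f_equal. auto. Qed.
(** Soundness of [vring] and [vfield]: each side becomes its list of coefficients over the atoms,
    and one scalar identity per atom is left. *)
Lemma vreflect env e1 e2 : leq (vcl (length env) e1) (vcl (length env) e2) -> vden env e1 = vden env e2.
Proof. intros H. rewrite !vden_lcomb. f_equal. apply leq_eq; auto. now rewrite !len_vcl. Qed.
End Reflect.

Ltac vmem x l :=
 match l with
 | nil => constr:(false)
 | cons ?y ?l' => match constr:(Set) with _ => let _ := constr:(eq_refl : x = y) in constr:(true) | _ => vmem x l' end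
 end.
Ltac vidx x l :=
 match l with
 | cons x _ => constr:(O)
 | cons _ ?l' => let n := vidx x l' in constr:(S n)
 end.
Ltac vatoms e l :=
 match e with
 | @vadd _ ?a ?b => let l := vatoms a l in vatoms b l
 | @vopp _ ?a => vatoms a l
 | @vscal _ _ ?a => vatoms a l
 | @vzero _ => l
 | ?x => match l with
  | context [cons x _] => l
  | _ => constr:(cons x l)
  end
 end.
Ltac vreify e l :=
 match e with
 | @vadd _ ?a ?b => let a' := vreify a l in let b' := vreify b l in constr:(VP a' b')
 | @vopp _ ?a => let a' := vreify a l in constr:(VO a')
 | @vscal _ ?c ?a => let a' := vreify a l in constr:(VS c a')
 | @vzero _ => constr:(VZ)
 | ?x => let n := vidx x l in constr:(VA n)
 end.
Ltac vreduce :=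
 match goal with
 | |- @eq ?T ?a ?b =>
  let V := match a with @vadd ?V _ _ => V | @vopp ?V _ => V | @vscal ?V _ _ => V | @vzero ?V => V
  | _ => match b with @vadd ?V _ _ => V | @vopp ?V _ => V | @vscal ?V _ _ => V | @vzero ?V => V end end in
  let l0 := constr:(@nil (carrier V)) in
  let l1 := vatoms a l0 in
  let l := vatoms b l1 in
  let ea := vreify a l in
  let eb := vreify b l in
  change (vden l ea = vden l eb); apply vreflect;
  cbv [vcl length lunit lzero lplus lscal map leq]
 end.
Ltac cring := try ring.
Ltac vring := vreduce; repeat split; try ring.
Ltac vfield := vreduce; repeat split; try (field; repeat split; auto).

(** * Choice principles and extraction of subsequences *)

Lemma fun_choice (A B : Type) (R : A -> B -> Prop) :
 (forall x, exists y, R x y) -> exists f, forall x, R x (f x).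
Proof.
 intros H. exists (fun x => proj1_sig (constructive_indefinite_description _ (H x))).
 intros x. apply proj2_sig.
Qed.

Lemma dep_choice (A : Type) (P : A -> Prop) (R : nat -> A -> A -> Prop) (a0 : A) :
 P a0 -> (forall n x, P x -> exists y, P y /\ R n x y) ->
 exists f : nat -> A, f O = a0 /\ (forall n, P (f n)) /\ forall n, R n (f n) (f (S n)).
Proof.
 intros H0 Hs.
 assert (Hs' : forall p : nat * {x | P x}, exists y : {x | P x}, R (fst p) (proj1_sig (snd p)) (proj1_sig y)).
 { intros [n [x Hx]]. destruct (Hs n x Hx) as [y [Hy Hr]]. exists (exist _ y Hy). triv. }
 destruct (fun_choice Hs') as [g Hg].
 set (F := fix F n : {x | P x} := match n with O => exist _ a0 H0 | S n => g (n, F n) end).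
 exists (fun n => proj1_sig (F n)). split; [reflexivity|split].
 - intros n. apply proj2_sig.
 - intros n. exact (Hg (n, F n)).
Qed.

Lemma small_inv (eps : R) : 0 < eps -> exists N, forall n, (N <= n)%nat -> / INR (S n) < eps.
Proof.
 intros He. destruct (archimed_cor1 eps He) as [N [HN HN0]]. exists N. intros n Hn.
 apply Rle_lt_trans with (/ INR N); auto. apply Rinv_le_contravar.
 triv. apply le_INR; lia.
Qed.

Lemma inv_S_pos n : 0 < / INR (S n).
Proof. triv. Qed.

Definition incr (p : nat -> nat) := forall n, (p n < p (S n))%nat.

Lemma incr_lt p : incr p -> forall m n, (m < n)%nat -> (p m < p n)%nat.
Proof. intros H m n Hmn. induction Hmn. apply H. specialize (H m0). lia. Qed.
Lemma incr_le p : incr p -> forall m n, (m <= n)%nat -> (p m <= p n)%nat.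
Proof. intros H m n Hmn. destruct (Nat.eq_dec m n). subst; lia. apply Nat.lt_le_incl, incr_lt; auto; lia. Qed.
Lemma incr_ge p : incr p -> forall n, (n <= p n)%nat.
Proof. intros H n; induction n. lia. specialize (H n). lia. Qed.
Lemma incr_comp p q : incr p -> incr q -> incr (fun n => p (q n)).
Proof. intros Hp Hq n. apply incr_lt; auto. Qed.
Lemma incr_id : incr (fun n => n).
Proof. intros n; lia. Qed.

Lemma inf_sub (P : nat -> Prop) : (forall N, exists n, (N <= n)%nat /\ P n) ->
 exists p, incr p /\ forall k, P (p k).
Proof.
 intros H. destruct (H O) as [n0 [_ H0]].
 destruct (@dep_choice nat P (fun _ x y => (x < y)%nat) n0 H0) as [f [_ [Hf Hi]]].
 - intros _ x _. destruct (H (S x)) as [y [Hy Py]]. exists y. triv.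
 - exists f; split; auto.
Qed.

(** The recursion runs over pairs, keeping beside each chosen value the index of the predicate that
    it has to satisfy. *)
Lemma sub_pred (R : nat -> nat -> Prop) : (forall k N, exists n, (N <= n)%nat /\ R k n) ->
 exists p, incr p /\ forall k, R k (p k).
Proof.
 intros H. destruct (H O O) as [n0 [_ H0]].
 destruct (@dep_choice (nat * nat) (fun x => R (fst x) (snd x)) (fun _ x y => fst y = S (fst x) /\ (snd x < snd y)%nat) (O, n0) H0) as [f [F0 [Hf Hi]]].
 - intros _ [k x] _. destruct (H (S k) (S x)) as [y [Hy Py]]. exists (S k, y). triv.
 - have Hk : forall n, fst (f n) = n. { induction n. now rewrite F0. destruct (Hi n). lia. }
  exists (fun n => snd (f n)); split. intros n; apply Hi. intros n. rewrite <- (Hk n) at 1. triv.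
Qed.

Lemma pigeon (A : Type) (l : list A) (f : nat -> A) : (forall n, In (f n) l) ->
 exists a, In a l /\ exists p, incr p /\ forall k, f (p k) = a.
Proof.
 revert f. induction l; intros f Hf. destruct (Hf O).
 destruct (classic (forall N, exists n, (N <= n)%nat /\ f n = a)).
 - exists a. split. now left. apply (inf_sub H).
 - apply not_all_ex_not in H. destruct H as [N HN].
  destruct (IHl (fun n => f (n + N)%nat)) as [b [Hb [p [Hp Hpb]]]].
  + intros n. destruct (Hf (n + N)%nat) as [E|E]; auto. exfalso. apply HN. exists (n + N)%nat. split; [lia|auto].
  + exists b. split. now right. exists (fun k => (p k + N)%nat). split; auto.
  intros n. specialize (Hp n). lia.
Qed.

(** * Convergence, precompactness, closures and spans *)

Section Seq.
Variable V : CBanach.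
Implicit Types (u v w : nat -> V) (x y z l : V).

Definition cv u l := forall eps, 0 < eps -> exists N, forall n, (N <= n)%nat -> nm (u n -v l) < eps.
Definition vcauchy u := forall eps, 0 < eps -> exists N, forall n m, (N <= n)%nat -> (N <= m)%nat -> nm (u n -v u m) < eps.

Lemma nm_subC x y : nm (x -v y) = nm (y -v x).
Proof. rewrite <- nm_opp. f_equal. vring. Qed.
Lemma nm_sub_tri x y z : nm (x -v z) <= nm (x -v y) + nm (y -v z).
Proof. replace (x -v z) with ((x -v y) +v (y -v z)) by vring. apply nm_tri. Qed.
Lemma nm_rev x y : nm x - nm y <= nm (x -v y).
Proof. assert (nm x <= nm (x -v y) + nm y). { replace x with ((x -v y) +v y) at 1 by vring. apply nm_tri. } lra. Qed.
Lemma nm_rev2 x y : nm y - nm (x -v y) <= nm x.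
Proof. rewrite nm_subC. have H := nm_rev y x. lra. Qed.
Lemma nm_tri_le x y a b : nm x <= a -> nm y <= b -> nm (x +v y) <= a + b.
Proof. intros; assert (H1 := nm_tri x y); lra. Qed.
Lemma nm_sub_le x y a b : nm x <= a -> nm y <= b -> nm (x -v y) <= a + b.
Proof. intros; assert (H1 := nm_sub x y); lra. Qed.
Lemma vsub_eq0 x y : x -v y = 0v -> x = y.
Proof. intros H. replace x with ((x -v y) +v y) by vring. rewrite H. vring. Qed.
Lemma nm_small0 x : (forall eps, 0 < eps -> nm x <= eps) -> x = 0v.
Proof.
 intros H. apply nm_eq0. destruct (Rle_lt_or_eq_dec _ _ (nm_ge0 x)) as [Hx|]; auto.
 specialize (H (nm x / 2) ltac:(lra)). lra.
Qed.

Lemma cv_cauchy u : vcauchy u -> exists l, cv u l.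
Proof.
 intros H. destruct (vcomplete V u) as [l Hl].
 - triv.
 - exists l. triv.
Qed.
Lemma cauchy_cv u l : cv u l -> vcauchy u.
Proof.
 intros H eps He. destruct (H (eps/2) ltac:(lra)) as [N HN]. exists N. intros n m Hn Hm.
 have A := nm_sub_tri (u n) l (u m). rewrite (nm_subC l) in A.
 have B := HN n Hn. have D := HN m Hm. lra.
Qed.
Lemma cv_unique u l l' : cv u l -> cv u l' -> l = l'.
Proof.
 intros H H'. apply vsub_eq0, nm_small0. intros eps He.
 destruct (H (eps/2) ltac:(lra)) as [N HN]. destruct (H' (eps/2) ltac:(lra)) as [N' HN'].
 specialize (HN (N+N')%nat ltac:(lia)). specialize (HN' (N+N')%nat ltac:(lia)).
 have A := nm_sub_tri l (u (N+N')%nat) l'. rewrite (nm_subC l (u _)) in A. lra.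
Qed.
Lemma cv_sub u l p : incr p -> cv u l -> cv (fun n => u (p n)) l.
Proof.
 intros Hp H eps He. destruct (H eps He) as [N HN]. exists N. intros n Hn. apply HN.
 have A := incr_ge Hp n. lia.
Qed.
Lemma cv_const l : cv (fun _ => l) l.
Proof. intros eps He. exists O. intros. now rewrite vaddN, nm0. Qed.
Lemma cv_ext u v l : (forall n, u n = v n) -> cv u l -> cv v l.
Proof. intros E H eps He. destruct (H eps He) as [N HN]. exists N. intros. rewrite <- E. auto. Qed.
Lemma cv_shift u l k : cv u l <-> cv (fun n => u (n + k)%nat) l.
Proof.
 split; intros H eps He; destruct (H eps He) as [N HN].
 - exists N. intros. apply HN. lia.
 - exists (N + k)%nat. intros n Hn. specialize (HN (n - k)%nat ltac:(lia)).
  now replace (n - k + k)%nat with n in HN by lia.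
Qed.
Lemma cv_le u l (b : nat -> R) : (forall n, nm (u n -v l) <= b n) ->
 (forall eps, 0 < eps -> exists N, forall n, (N <= n)%nat -> b n < eps) -> cv u l.
Proof. intros H Hb eps He. destruct (Hb eps He) as [N HN]. exists N. intros n Hn. specialize (HN n Hn). specialize (H n). lra. Qed.
Lemma cv_plus u v l m : cv u l -> cv v m -> cv (fun n => u n +v v n) (l +v m).
Proof.
 intros H H' eps He.
 destruct (H (eps/2) ltac:(lra)) as [N HN]. destruct (H' (eps/2) ltac:(lra)) as [N' HN'].
 exists (N+N')%nat. intros n Hn. specialize (HN n ltac:(lia)). specialize (HN' n ltac:(lia)).
 replace (u n +v v n -v (l +v m)) with ((u n -v l) +v (v n -v m)) by vring.
 have A := nm_tri (u n -v l) (v n -v m). lra.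
Qed.
Lemma cv_scal (c : C) u l : cv u l -> cv (fun n => c *v u n) (c *v l).
Proof.
 intros H eps He. have Hc := Cmod_ge_0 c.
 destruct (H (eps / (Cmod c + 1))) as [N HN]. triv.
 exists N. intros n Hn. specialize (HN n Hn).
 replace (c *v u n -v c *v l) with (c *v (u n -v l)) by vring. rewrite nm_scal.
 apply Rlt_div_r in HN; [|lra]. nra.
Qed.
Lemma cv_opp u l : cv u l -> cv (fun n => -v (u n)) (-v l).
Proof. intros H. apply cv_ext with (fun n => (-1)%C *v u n). intros; now rewrite voppE. rewrite voppE. now apply cv_scal. Qed.
Lemma cv_nm_le u l M : cv u l -> (exists N, forall n, (N <= n)%nat -> nm (u n) <= M) -> nm l <= M.
Proof.
 intros H [N0 H0]. apply Rnot_lt_le. intros Hl. destruct (H (nm l - M) ltac:(lra)) as [N HN].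
 specialize (HN (N + N0)%nat ltac:(lia)). specialize (H0 (N+N0)%nat ltac:(lia)).
 rewrite nm_subC in HN. have A := nm_rev l (u (N+N0)%nat). lra.
Qed.
Lemma cv_nm_ge u l M : cv u l -> (exists N, forall n, (N <= n)%nat -> M <= nm (u n)) -> M <= nm l.
Proof.
 intros H [N0 H0]. apply Rnot_lt_le. intros Hl. destruct (H (M - nm l) ltac:(lra)) as [N HN].
 specialize (HN (N + N0)%nat ltac:(lia)). specialize (H0 (N+N0)%nat ltac:(lia)).
 have A := nm_rev (u (N+N0)%nat) l. lra.
Qed.
Lemma cv_bounded u l : cv u l -> exists M, 0 <= M /\ forall n, nm (u n) <= M.
Proof.
 intros H. destruct (H 1 ltac:(lra)) as [N HN].
 have B : forall k, exists M, 0 <= M /\ forall n, (n < k)%nat -> nm (u n) <= M.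
 { induction k. exists 0. split. lra. intros; lia. destruct IHk as [M [HM0 HM]]. exists (M + nm (u k)).
  have A := nm_ge0 (u k). split. lra. intros n Hn. destruct (Nat.eq_dec n k). subst; lra.
  specialize (HM n ltac:(lia)). lra. }
 destruct (B N) as [M [HM0 HM]]. exists (M + (nm l + 1)). have A := nm_ge0 l. split. lra.
 intros n. destruct (Nat.le_gt_cases N n) as [l0|l0].
 - specialize (HN n l0). assert (A' := nm_rev (u n) l). lra.
 - specialize (HM n l0). lra.
Qed.

(* Every subsequence has, for each tolerance, a further subsequence that is pairwise close: the form
 of precompactness from which Cauchy subsequences are extracted diagonally. *)
Definition prec u := forall eps p, 0 < eps -> incr p ->
 exists q, incr q /\ forall i j, nm (u (p (q i)) -v u (p (q j))) <= eps.

(** Diagonal argument: the successive refinements are nested ([Hfac]), so from each stage on the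
    diagonal sequence takes its values in the refinement of that stage. *)
Lemma prec_cauchy u : prec u -> exists p, incr p /\ vcauchy (fun n => u (p n)).
Proof.
 intros H.
 destruct (@dep_choice (nat -> nat) incr
  (fun k p p' => (exists q, incr q /\ forall n, p' n = p (q n)) /\ forall i j, nm (u (p' i) -v u (p' j)) <= / INR (S k))
  (fun n => n) incr_id) as [f [_ [Hf Hi]]].
 { intros k p Hp. destruct (H (/ INR (S k)) p (inv_S_pos k) Hp) as [q [Hq HQ]].
  exists (fun n => p (q n)). split. now apply incr_comp. split; auto. exists q; auto. }
 have Hfac : forall k m, exists q, incr q /\ forall n, f (m + k)%nat n = f k (q n).
 { intros k m. induction m. exists (fun n => n). split; auto using incr_id.
  destruct IHm as [q [Hq HQ]]. destruct (Hi (m + k)%nat) as [[q' [Hq' HQ']] _].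
  exists (fun n => q (q' n)). split. now apply incr_comp. intros n. now rewrite HQ', HQ. }
 exists (fun n => f n n). split.
 - intros n. destruct (Hi n) as [[q [Hq HQ]] _]. rewrite HQ.
  apply Nat.lt_le_trans with (f n (S n)). apply Hf. apply incr_le. apply Hf. apply incr_ge; auto.
 (* Closeness within [/ INR (S N)] belongs to the refinement of index [S N], the one produced at
    step [N]; hence the shift by one. *)
 - intros eps He. destruct (small_inv He) as [N HN]. exists (S N).
  have Hr : forall n, (S N <= n)%nat -> exists m, f n n = f (S N) m.
  { intros n Hn. destruct (Hfac (S N) (n - S N)%nat) as [q [Hq HQ]].
  replace (n - S N + S N)%nat with n in HQ by lia. exists (q n). triv. }
  intros n m Hn Hm. destruct (Hr n Hn) as [a Ha]. destruct (Hr m Hm) as [b Hb]. rewrite Ha, Hb.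
  destruct (Hi N) as [_ HH]. specialize (HH a b). specialize (HN N ltac:(lia)). lra.
Qed.
Lemma prec_cv u : prec u -> exists p l, incr p /\ cv (fun n => u (p n)) l.
Proof. intros H. destruct (prec_cauchy H) as [p [Hp Hc]]. destruct (cv_cauchy Hc) as [l Hl]. exists p, l; auto. Qed.

Lemma cauchy_close u eps : vcauchy u -> 0 < eps -> exists q, incr q /\ forall i j, nm (u (q i) -v u (q j)) <= eps.
Proof.
 intros H He. destruct (H eps He) as [N HN]. exists (fun n => (n + N)%nat). split.
 intros n; lia. intros i j. left. apply HN; lia.
Qed.
Lemma prec_sub u p : prec u -> incr p -> prec (fun n => u (p n)).
Proof. intros H Hp eps q He Hq. apply (H eps (fun n => p (q n)) He). now apply incr_comp. Qed.

Definition vsubspace (W : V -> Prop) :=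
 W 0v /\ (forall x y, W x -> W y -> W (x +v y)) /\ (forall (c : C) x, W x -> W (c *v x)).
Definition vclosed (W : V -> Prop) := forall u l, (forall n, W (u n)) -> cv u l -> W l.
Definition vclosure (W : V -> Prop) (x : V) := forall eps, 0 < eps -> exists y, W y /\ nm (x -v y) < eps.

Lemma vsub_opp W x : vsubspace W -> W x -> W (-v x).
Proof. intros H Hx. rewrite voppE. now apply H. Qed.
Lemma vsub_minus W x y : vsubspace W -> W x -> W y -> W (x -v y).
Proof. intros H Hx Hy. apply H; auto. now apply vsub_opp. Qed.
Lemma vclosure_in W x : W x -> vclosure W x.
Proof. intros H eps He. exists x. now rewrite vaddN, nm0. Qed.
Lemma vclosure_cv W x : vclosure W x -> exists u, (forall n, W (u n)) /\ cv u x.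
Proof.
 intros H. destruct (@fun_choice nat V (fun n y => W y /\ nm (x -v y) < / INR (S n))) as [u Hu].
 intros n. apply H, inv_S_pos. exists u. split. intros n; apply Hu.
 intros eps He. destruct (small_inv He) as [N HN]. exists N. intros n Hn. rewrite nm_subC.
 destruct (Hu n). specialize (HN n Hn). lra.
Qed.
Lemma cv_vclosure W u x : (forall n, W (u n)) -> cv u x -> vclosure W x.
Proof. intros H Hc eps He. destruct (Hc eps He) as [N HN]. exists (u N). split; auto. rewrite nm_subC. triv. Qed.
Lemma vclosure_closed W : vclosed (vclosure W).
Proof.
 intros u l H Hc eps He. destruct (Hc (eps/2) ltac:(lra)) as [N HN].
 destruct (H N (eps/2) ltac:(lra)) as [y [Hy Hd]]. exists y. split; auto.
 specialize (HN N ltac:(lia)). rewrite nm_subC in HN. have A := nm_sub_tri l (u N) y. lra.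
Qed.
Lemma vclosure_sub W : vsubspace W -> vsubspace (vclosure W).
Proof.
 intros H. split; [|split].
 - apply vclosure_in, H.
 - intros x y Hx Hy eps He. destruct (Hx (eps/2) ltac:(lra)) as [a [Ha Ha']].
  destruct (Hy (eps/2) ltac:(lra)) as [b [Hb Hb']]. exists (a +v b). split. now apply H.
  replace (x +v y -v (a +v b)) with ((x -v a) +v (y -v b)) by vring.
  have A := nm_tri (x -v a) (y -v b). lra.
 - intros c x Hx. destruct (vclosure_cv Hx) as [u [Hu Hc]].
  apply cv_vclosure with (fun n => c *v u n). intros; now apply H. now apply cv_scal.
Qed.
Lemma vclosure_min W W' : (forall x, W x -> W' x) -> vclosed W' -> forall x, vclosure W x -> W' x.
Proof. intros H Hc x Hx. destruct (vclosure_cv Hx) as [u [Hu Hcv]]. apply Hc with u; auto. Qed.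

Inductive vspan (S : V -> Prop) : V -> Prop :=
| span0 : vspan S 0v
| span_cons c x y : S x -> vspan S y -> vspan S (c *v x +v y).
Lemma vspan_sub S : vsubspace (vspan S).
Proof.
 split; [constructor|split].
 - intros x y Hx Hy. induction Hx. now rewrite vadd0l.
  replace (c *v x +v y0 +v y) with (c *v x +v (y0 +v y)) by vring. constructor; auto.
 - intros c x Hx. induction Hx. rewrite vs0r. constructor.
  replace (c *v (c0 *v x +v y)) with ((c * c0)%C *v x +v c *v y) by vring. now constructor.
Qed.
Lemma vspan_in (S : V -> Prop) x : S x -> vspan S x.
Proof. intros H. replace x with (1%C *v x +v 0v) by vring. constructor; auto. constructor. Qed.
Lemma vspan_min (S W : V -> Prop) : vsubspace W -> (forall x, S x -> W x) -> forall x, vspan S x -> W x.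
Proof. intros HW HS x Hx. induction Hx. apply HW. apply HW; auto. apply HW; auto. Qed.
End Seq.

Section Cseq.
Lemma R_BW (u : nat -> R) (M : R) : (forall n, Rabs (u n) <= M) ->
 exists p l, incr p /\ forall eps, 0 < eps -> exists N, forall n, (N <= n)%nat -> Rabs (u (p n) - l) < eps.
Proof.
 intros H. destruct (Bolzano_Weierstrass u (fun x => -M <= x <= M)) as [l Hl].
 apply compact_P3. intros n. specialize (H n). apply Rabs_le_between in H. auto.
 destruct (@sub_pred (fun k n => Rabs (u n - l) < / INR (S k))) as [p [Hp Hpp]].
 { intros k N. destruct (Hl (fun x => Rabs (x - l) < / INR (S k)) N) as [n [Hn1 Hn2]].
  exists (mkposreal _ (inv_S_pos k)). intros x Hx. exact Hx. exists n; auto. }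
 exists p, l. split; auto. intros eps He. destruct (small_inv He) as [N HN]. exists N. intros n Hn.
 specialize (Hpp n). specialize (HN n Hn). lra.
Qed.
Lemma C_BW (z : nat -> C) (M : R) : (forall n, Cmod (z n) <= M) ->
 exists p l, incr p /\ forall eps, 0 < eps -> exists N, forall n, (N <= n)%nat -> Cmod (z (p n) - l)%C < eps.
Proof.
 intros H. destruct (@R_BW (fun n => fst (z n)) M) as [p [a [Hp Ha]]].
 { intros n. eapply Rle_trans; [|apply (H n)]. eapply Rle_trans; [|apply Rmax_Cmod]. apply Rmax_l. }
 destruct (@R_BW (fun n => snd (z (p n))) M) as [q [b [Hq Hb]]].
 { intros n. eapply Rle_trans; [|apply (H (p n))]. eapply Rle_trans; [|apply Rmax_Cmod]. apply Rmax_r. }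
 exists (fun n => p (q n)), (a, b). split. now apply incr_comp.
 intros eps He. destruct (Ha (eps/4) ltac:(lra)) as [N HN]. destruct (Hb (eps/4) ltac:(lra)) as [N' HN'].
 exists (N + N')%nat. intros n Hn. eapply Rle_lt_trans. apply Cmod_2Rmax. simpl.
 specialize (HN (q n)). specialize (HN' n ltac:(lia)).
 have A := incr_ge Hq n. specialize (HN ltac:(lia)).
 assert (sqrt 2 <= 2). { rewrite <- (sqrt_square 2) at 2 by lra. apply sqrt_le_1; lra. }
 have Hm : Rmax (Rabs (fst (z (p (q n))) - a)) (Rabs (snd (z (p (q n))) - b)) < eps / 4 by (apply Rmax_lub_lt; auto).
 assert (0 <= Rmax (Rabs (fst (z (p (q n))) - a)) (Rabs (snd (z (p (q n))) - b))).
 { eapply Rle_trans; [apply Rabs_pos|apply Rmax_l]. }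
 unfold Rminus in *. nra.
Qed.
End Cseq.
Lemma pow_half_small (M eps : R) : 0 < eps -> exists N, forall n, (N <= n)%nat -> M * (1/2)^n < eps.
Proof.
 intros He. destruct (pow_lt_1_zero (1/2) ltac:(rewrite Rabs_pos_eq; lra) (eps / (Rabs M + 1))) as [N HN].
 apply div_gt0; auto. assert (A := Rabs_pos M); lra.
 exists N. intros n Hn. specialize (HN n Hn). have A := Rabs_pos M.
 rewrite Rabs_pos_eq in HN by (apply pow_le; lra). apply Rlt_div_r in HN; [|lra].
 have B := Rle_abs M. assert (0 <= (1/2)^n) by triv. nra.
Qed.

Lemma geo_cauchy V (u : nat -> V) M :
 (forall n, nm (u (S n) -v u n) <= M * (1/2)^n) -> vcauchy u.
Proof.
 intros H.
 have A : forall k n, nm (u (k + n)%nat -v u n) <= 2 * M * (1/2)^n - 2 * M * (1/2)^(k+n).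
 { induction k; intros n; simpl. rewrite vaddN, nm0. lra.
  have B := nm_sub_tri (u (S (k+n))) (u (k+n)%nat) (u n).
  specialize (IHk n). specialize (H (k+n)%nat). lra. }
 have HM : 0 <= M. { specialize (H O). have B := nm_ge0 (u 1%nat -v u O). lra. }
 assert (A' : forall k n, nm (u (k + n)%nat -v u n) <= 2 * M * (1/2)^n).
 { intros k n. specialize (A k n). assert (0 <= (1/2)^(k+n)) by triv. nra. }
 intros eps He. destruct (pow_half_small (2 * M) (eps := eps/2) ltac:(lra)) as [N HN]. exists N. intros n m Hn Hm.
 have B := A' (n - N)%nat N. have D := A' (m - N)%nat N.
 replace (n - N + N)%nat with n in B by lia. replace (m - N + N)%nat with m in D by lia.
 specialize (HN N ltac:(lia)). have F := nm_sub_tri (u n) (u N) (u m). rewrite (nm_subC (u N) (u m)) in F. lra.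
Qed.

Lemma inf_exists (E : R -> Prop) : (exists r, E r) -> (forall r, E r -> 0 <= r) ->
 exists m, (forall r, E r -> m <= r) /\ forall eps, 0 < eps -> exists r, E r /\ r < m + eps.
Proof.
 intros [r0 H0] Hb. destruct (completeness (fun r => E (- r))) as [m [Hu Hl]].
 - exists 0. intros r Hr. specialize (Hb _ Hr). lra.
 - exists (- r0). now rewrite Ropp_involutive.
 - exists (- m). split.
  + intros r Hr. have A : - r <= m by (apply Hu; now rewrite Ropp_involutive). lra.
  + intros eps He. contra Hn. assert (m <= m - eps); [|lra].
  apply Hl. intros r Hr. apply Rnot_lt_le. intros Hlt. apply Hn. exists (- r). split; auto. lra.
Qed.

(** * Distance to a subspace *)

Section Dist.
Variables (V : CBanach) (W : V -> Prop).
Definition isdist (x : V) (m : R) := (forall w, W w -> m <= nm (x -v w)) /\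
 forall eps, 0 < eps -> exists w, W w /\ nm (x -v w) < m + eps.
Definition vdist (x : V) : R := epsilon (inhabits 0) (isdist x).
Hypothesis HW : vsubspace W.
Lemma vdistP x : isdist x (vdist x).
Proof.
 unfold vdist. apply epsilon_spec.
 destruct (@inf_exists (fun r => exists w, W w /\ r = nm (x -v w))) as [m [H1 H2]].
 - exists (nm (x -v 0v)), 0v. split; auto. apply HW.
 - intros r [w [_ ->]]. apply nm_ge0.
 - exists m. split. intros w Hw. apply H1. exists w; auto.
  intros eps He. destruct (H2 eps He) as [r [[w [Hw ->]] Hr]]. exists w; auto.
Qed.
Lemma vdist_le x w : W w -> vdist x <= nm (x -v w).
Proof. apply vdistP. Qed.
Lemma vdist_appr x eps : 0 < eps -> exists w, W w /\ nm (x -v w) < vdist x + eps.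
Proof. apply vdistP. Qed.
Lemma vdist_glb x m : (forall w, W w -> m <= nm (x -v w)) -> m <= vdist x.
Proof.
 intros H. apply Rnot_lt_le. intros Hl. destruct (@vdist_appr x (m - vdist x)) as [w [Hw Hn]]. lra.
 specialize (H w Hw). lra.
Qed.
Lemma vdist_ge0 x : 0 <= vdist x.
Proof. apply vdist_glb. intros. apply nm_ge0. Qed.
Lemma vdist_nm x : vdist x <= nm x.
Proof. replace (nm x) with (nm (x -v 0v)). apply vdist_le, HW. f_equal. vring. Qed.
Lemma vdist_tri x y : vdist (x +v y) <= vdist x + vdist y.
Proof.
 apply Rnot_lt_le. intros H. set (e := (vdist (x +v y) - vdist x - vdist y) / 2).
 destruct (@vdist_appr x e) as [a [Ha Ha']]. unfold e; lra.
 destruct (@vdist_appr y e) as [b [Hb Hb']]. unfold e; lra.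
 have A := @vdist_le (x +v y) (a +v b) ltac:(apply HW; auto).
 replace (x +v y -v (a +v b)) with ((x -v a) +v (y -v b)) in A by vring.
 have B := nm_tri (x -v a) (y -v b). unfold e in *. lra.
Qed.
Lemma vdist_scal_le (c : C) x : vdist (c *v x) <= Cmod c * vdist x.
Proof.
 apply Rnot_lt_le. intros H. have Hc := Cmod_ge_0 c.
 destruct (@vdist_appr x ((vdist (c *v x) - Cmod c * vdist x) / (Cmod c + 1))) as [a [Ha Ha']].
 triv.
 have A := @vdist_le (c *v x) (c *v a) ltac:(apply HW; auto).
 replace (c *v x -v c *v a) with (c *v (x -v a)) in A by vring. rewrite nm_scal in A.
 have B : nm (x -v a) - vdist x < (vdist (c *v x) - Cmod c * vdist x) / (Cmod c + 1) by lra.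
 apply Rlt_div_r in B; [|lra]. nra.
Qed.
Lemma vdist_scal (c : C) x : vdist (c *v x) = Cmod c * vdist x.
Proof.
 apply Rle_antisym. apply vdist_scal_le. destruct (classic (c = 0%C)) as [->|Hc].
 - rewrite Cmod_0, Rmult_0_l. apply vdist_ge0.
 - have A := @vdist_scal_le (/c)%C (c *v x). rewrite vsA in A.
  replace (/ c * c)%C with (RtoC 1) in A. 2: symmetry; now apply Cinv_l.
  rewrite vs1 in A. rewrite Cmod_inv in A by auto. assert (0 < Cmod c) by now apply Cmod_gt_0.
  apply Rmult_le_reg_l with (/ Cmod c). triv.
  rewrite <- Rmult_assoc, Rinv_l by lra. lra.
Qed.
Lemma vdist_opp x : vdist (-v x) = vdist x.
Proof. rewrite voppE, vdist_scal, Cmod_R, Rabs_left by lra. ring. Qed.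
Lemma vdist_in x : W x -> vdist x = 0.
Proof. intros H. apply Rle_antisym. replace 0 with (nm (x -v x)). now apply vdist_le. now rewrite vaddN, nm0. apply vdist_ge0. Qed.
Lemma vdist0_in x : vclosed W -> vdist x = 0 -> W x.
Proof.
 intros Hc H0. have Hcl : vclosure W x. { intros eps He. destruct (@vdist_appr x eps He) as [w [Hw Hn]]. exists w. split; auto. lra. }
 destruct (vclosure_cv Hcl) as [u [Hu Hcv]]. now apply Hc with u.
Qed.
Lemma vdist_pos x : vclosed W -> ~ W x -> 0 < vdist x.
Proof.
 intros Hc Hx. destruct (Rle_lt_or_eq_dec _ _ (vdist_ge0 x)) as [|E]; auto.
 exfalso. apply Hx, vdist0_in; auto.
Qed.
Lemma vdist_addW x w : W w -> vdist (x +v w) = vdist x.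
Proof.
 intros Hw. apply Rle_antisym. have A := vdist_tri x w. rewrite (vdist_in Hw) in A. lra.
 have A := vdist_tri (x +v w) (-v w). rewrite vdist_opp, (vdist_in Hw) in A.
 replace (x +v w +v -v w) with x in A by vring. lra.
Qed.
Lemma vdist_sub x y : vdist x - vdist y <= nm (x -v y).
Proof. have A := vdist_tri (x -v y) y. replace (x -v y +v y) with x in A by vring. have B := vdist_nm (x -v y). lra. Qed.

(* Riesz lemma *)
Lemma riesz x : vclosed W -> ~ W x -> exists (c : C) w, W w /\ c <> 0%C /\ nm (c *v (x -v w)) = 1 /\
 forall w', W w' -> 1/2 <= nm (c *v (x -v w) -v w').
Proof.
 intros Hc Hx. have Hd := vdist_pos Hc Hx. destruct (@vdist_appr x _ Hd) as [w [Hw Hn]].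
 have Hp := vdist_le x Hw.
 have Hn0 : 0 < nm (x -v w) by lra.
 exists (RtoC (/ nm (x -v w))), w. split; auto. split; [|split].
 - intros E. apply RtoC_inj in E. have A := inv_gt0 _ Hn0. lra.
 - rewrite nm_scal, Cmod_R, Rabs_pos_eq. field; lra. triv.
 - intros w' Hw'. le_mid (vdist (RtoC (/ nm (x -v w)) *v (x -v w))). 2: now apply vdist_le.
  rewrite vdist_scal, Cmod_R, Rabs_pos_eq by (left; now apply inv_gt0).
  rewrite vdist_addW by now apply vsub_opp.
  apply Rmult_le_reg_l with (nm (x -v w)); auto. rewrite <- Rmult_assoc, Rinv_r by lra. lra.
Qed.
End Dist.

(** * The Banach space of bounded operators *)

Section Bop.
Variables V W : CBanach.
(** Bundled so that bounded operators form a [CBanach] again: all that is shown for vectors applies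
    to operators, and to operators acting on operators such as multiplications. *)
Record bop := Bop { bf :> V -> W;
 bf_P : (forall x y, bf (x +v y) = bf x +v bf y) /\ (forall (c : C) x, bf (c *v x) = c *v bf x) /\
  exists M, forall x, nm (bf x) <= M * nm x }.
Implicit Types f g : bop.
Lemma bop_ext f g : (forall x, f x = g x) -> f = g.
Proof.
 intros H. destruct f as [f Pf], g as [g Pg].
 assert (f = g) by now apply functional_extensionality. subst. f_equal. triv.
Qed.
Lemma bD f x y : f (x +v y) = f x +v f y.
Proof. apply bf_P. Qed.
Lemma bZ f (c : C) x : f (c *v x) = c *v f x.
Proof. apply bf_P. Qed.
Lemma b0 f : f 0v = 0v.
Proof. rewrite <- (vs0l 0v), bZ. vring. Qed.
Lemma bN f x : f (-v x) = -v (f x).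
Proof. rewrite voppE, bZ. vring. Qed.
Definition bset f (r : R) := exists x, nm x <= 1 /\ r = nm (f x).
Lemma bnorm_ex f : exists m, is_lub (bset f) m.
Proof.
 destruct f as [f [PD [PZ [M HM]]]]. destruct (completeness (bset (Bop (conj PD (conj PZ (ex_intro _ M HM)))))) as [m Hm].
 - exists (Rmax M 0). intros r [x [Hx ->]]. simpl. specialize (HM x). have A := nm_ge0 x.
  have B := Rmax_l M 0. assert (B' := Rmax_r M 0). nra.
 - exists (nm (f 0v)). exists 0v. rewrite nm0. split; [lra|reflexivity].
 - exists m. auto.
Qed.
Definition bnorm f : R := epsilon (inhabits 0) (is_lub (bset f)).
Lemma bnormP f : is_lub (bset f) (bnorm f).
Proof. unfold bnorm. apply epsilon_spec, bnorm_ex. Qed.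
Lemma bnorm_ge0 f : 0 <= bnorm f.
Proof. destruct (bnormP f) as [H _]. apply H. exists 0v. rewrite nm0. split. lra. now rewrite b0, nm0. Qed.
Lemma bn_ub f x : nm (f x) <= bnorm f * nm x.
Proof.
 destruct (classic (nm x = 0)) as [E|E].
 - rewrite (nm_eq0 E), b0, !nm0. lra.
 - have Hx : 0 < nm x by (assert (A := nm_ge0 x); lra).
  destruct (bnormP f) as [H _]. specialize (H (nm (f (RtoC (/ nm x) *v x)))).
  have A : nm (f (RtoC (/ nm x) *v x)) <= bnorm f.
  { apply H. exists (RtoC (/ nm x) *v x). split; auto. rewrite nm_scal, Cmod_R, Rabs_pos_eq.
  right. field. lra. triv. }
  rewrite bZ, nm_scal, Cmod_R, Rabs_pos_eq in A by (left; now apply inv_gt0).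
  apply Rmult_le_reg_l with (/ nm x). triv.
  replace (/ nm x * (bnorm f * nm x)) with (bnorm f) by (field; lra). auto.
Qed.
Lemma bn_le f M : 0 <= M -> (forall x, nm (f x) <= M * nm x) -> bnorm f <= M.
Proof.
 intros HM H. destruct (bnormP f) as [_ Hl]. apply Hl. intros r [x [Hx ->]].
 specialize (H x). nra.
Qed.
Lemma bn_le1 f M : (forall x, nm x <= 1 -> nm (f x) <= M) -> bnorm f <= M.
Proof. intros H. destruct (bnormP f) as [_ Hl]. apply Hl. intros r [x [Hx ->]]. auto. Qed.

Program Definition bzero : bop := @Bop (fun _ => 0v) _.
Next Obligation. split; [|split]; intros. vring. vring. exists 0. intros. rewrite nm0. lra. Qed.
Program Definition badd f g : bop := @Bop (fun x => f x +v g x) _.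
Next Obligation.
 split; [|split]; intros. rewrite !bD. vring. rewrite !bZ. vring.
 exists (bnorm f + bnorm g). intros x. have A := nm_tri (f x) (g x).
 have B := bn_ub f x. have D := bn_ub g x. lra.
Qed.
Program Definition bscal (c : C) f : bop := @Bop (fun x => c *v f x) _.
Next Obligation.
 split; [|split]; intros. rewrite !bD. vring. rewrite !bZ. vring.
 exists (Cmod c * bnorm f). intros x. rewrite nm_scal.
 have B := bn_ub f x. have D := Cmod_ge_0 c. nra.
Qed.
Program Definition bopp f : bop := @Bop (fun x => -v (f x)) _.
Next Obligation.
 split; [|split]; intros. rewrite !bD. vring. rewrite !bZ. vring.
 exists (bnorm f). intros x. rewrite nm_opp. apply bn_ub.
Qed.
Lemma bnorm_scal_le (c : C) f : bnorm (bscal c f) <= Cmod c * bnorm f.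
Proof.
 apply bn_le. apply mul_ge0. triv. apply bnorm_ge0.
 intros x. simpl. rewrite nm_scal. have B := bn_ub f x. have D := Cmod_ge_0 c. nra.
Qed.
Lemma bnorm_def f : bnorm f = 0 -> f = bzero.
Proof.
 intros H. apply bop_ext. intros x. apply nm_eq0. have A := bn_ub f x. rewrite H in A.
 have B := nm_ge0 (f x). lra.
Qed.
Lemma bnorm_scal (c : C) f : bnorm (bscal c f) = Cmod c * bnorm f.
Proof.
 apply Rle_antisym. apply bnorm_scal_le. destruct (classic (c = 0%C)) as [->|Hc].
 - rewrite Cmod_0, Rmult_0_l. apply bnorm_ge0.
 - have A := bnorm_scal_le (/c)%C (bscal c f).
  replace (bscal (/ c)%C (bscal c f)) with f in A. 2: { apply bop_ext. intros x. simpl. vfield. }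
  rewrite Cmod_inv in A by auto. assert (0 < Cmod c) by now apply Cmod_gt_0.
  apply Rmult_le_reg_l with (/ Cmod c). triv.
  rewrite <- Rmult_assoc, Rinv_l by lra. lra.
Qed.
Lemma bnorm_tri f g : bnorm (badd f g) <= bnorm f + bnorm g.
Proof.
 apply bn_le. have A := bnorm_ge0 f. have B := bnorm_ge0 g. lra.
 intros x. simpl. have A := nm_tri (f x) (g x). have B := bn_ub f x. have D := bn_ub g x. lra.
Qed.
Lemma bop_complete (u : nat -> bop) :
 (forall eps, eps > 0 -> exists N, forall n m, (n >= N)%nat -> (m >= N)%nat -> bnorm (badd (u n) (bopp (u m))) < eps) ->
 exists l, forall eps, eps > 0 -> exists N, forall n, (n >= N)%nat -> bnorm (badd (u n) (bopp l)) < eps.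
Proof.
 intros H.
 have Hpt : forall x n m, nm (u n x -v u m x) <= bnorm (badd (u n) (bopp (u m))) * nm x.
 { intros x n m. apply (bn_ub (badd (u n) (bopp (u m))) x). }
 have Hc : forall x, exists l, cv (fun n => u n x) l.
 { intros x. apply cv_cauchy. intros eps He. have Hx := nm_ge0 x.
  destruct (H (eps / (nm x + 1))) as [N HN]. apply div_gt0; lra.
  exists N. intros n m Hn Hm. specialize (HN n m Hn Hm). specialize (Hpt x n m).
  have A := bnorm_ge0 (badd (u n) (bopp (u m))). apply Rlt_div_r in HN; [|lra]. nra. }
 destruct (fun_choice Hc) as [l Hl].
 have Hb : forall eps, 0 < eps -> exists N, forall n, (N <= n)%nat -> forall x, nm (u n x -v l x) <= eps * nm x.
 { intros eps He. destruct (H eps He) as [N HN]. exists N. intros n Hn x.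
  apply cv_nm_le with (fun m => u n x -v u m x).
  - apply cv_plus. apply cv_const. apply cv_opp, Hl.
  - exists N. intros m Hm. specialize (HN n m Hn Hm). specialize (Hpt x n m). have A := nm_ge0 x. nra. }
 have Pl : (forall x y, l (x +v y) = l x +v l y) /\ (forall (c : C) x, l (c *v x) = c *v l x) /\
  exists M, forall x, nm (l x) <= M * nm x.
 { split; [|split].
  - intros x y. apply cv_unique with (fun n => u n (x +v y)). apply Hl.
  apply cv_ext with (fun n => u n x +v u n y). intros; now rewrite bD. apply cv_plus; apply Hl.
  - intros c x. apply cv_unique with (fun n => u n (c *v x)). apply Hl.
  apply cv_ext with (fun n => c *v u n x). intros; now rewrite bZ. apply cv_scal; apply Hl.
  - destruct (Hb 1 ltac:(lra)) as [N HN]. exists (bnorm (u N) + 1). intros x. specialize (HN N ltac:(lia) x).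
  have A := bn_ub (u N) x. have B := nm_rev (l x) (u N x). rewrite nm_subC in B. lra. }
 exists (Bop Pl). intros eps He. destruct (Hb (eps/2) ltac:(lra)) as [N HN]. exists N. intros n Hn.
 apply Rle_lt_trans with (eps/2); [|lra]. apply bn_le. lra. intros x. apply HN; auto.
Qed.
End Bop.
Tactic Notation "bext" simple_intropattern(x) := apply bop_ext; intros x.
Arguments bzero {V W}.

Definition BLH (V W : CBanach) : CBanach.
refine (@Build_CBanach (bop V W) bzero (@badd V W) (@bopp V W) (@bscal V W) (@bnorm V W) _ _ _ _ _ _ _ _ _ _ _ _ _).
all: try (solve [intros; apply bop_ext; intros; simpl; first [apply vs1 | apply vsA | apply vsDl | vring]]).
- intros; apply bnorm_ge0.
- intros; now apply bnorm_def.
- intros; rewrite Cmod_Defs; apply bnorm_scal.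
- intros; apply bnorm_tri.
- apply bop_complete.
Defined.
Canonical BLH.
Arguments BLH : simpl never.
Notation BL V := (BLH V V).
Arguments bop_ext {V W f g} _.

Definition bcomp (U V W : CBanach) (g : bop V W) (f : bop U V) : bop U W.
refine (@Bop U W (fun x => g (f x)) _).
split; [|split]; intros. now rewrite !bD. now rewrite !bZ.
exists (bnorm g * bnorm f). intros x. have A := bn_ub g (f x). have B := bn_ub f x.
have D := bnorm_ge0 g. nra.
Defined.
Notation "g ** f" := (bcomp g f) (at level 39, left associativity) : vec_scope.
Definition bid V : bop V V.
refine (@Bop V V (fun x => x) _).
split; [|split]; auto. exists 1. intros; lra.
Defined.
Notation I1 := (@bid _).

Section BopAlg.
Variables U V W Z : CBanach.
Lemma baA (f g : bop V W) x : (f +v g) x = f x +v g x.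
Proof. triv. Qed.
Lemma boA (f : bop V W) x : (-v f) x = -v (f x).
Proof. triv. Qed.
Lemma bsA (c : C) (f : bop V W) x : (c *v f) x = c *v (f x).
Proof. triv. Qed.
Lemma b0A x : (0v : bop V W) x = 0v.
Proof. triv. Qed.
Lemma bmA (g : bop V W) (f : bop U V) x : (g ** f) x = g (f x).
Proof. triv. Qed.
Lemma b1A (x : V) : bid V x = x.
Proof. triv. Qed.
Lemma nm_app (f : bop V W) x : nm (f x) <= nm f * nm x.
Proof. apply bn_ub. Qed.
Lemma nm_app1 (f : bop V W) x : nm x <= 1 -> nm (f x) <= nm f.
Proof. intros H. have A := nm_app f x. have B := nm_ge0 f. nra. Qed.
Lemma nm_le (f : bop V W) M : 0 <= M -> (forall x, nm (f x) <= M * nm x) -> nm f <= M.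
Proof. apply bn_le. Qed.
Lemma nm_le1 (f : bop V W) M : (forall x, nm x <= 1 -> nm (f x) <= M) -> nm f <= M.
Proof. apply bn_le1. Qed.
End BopAlg.
Section BopAlg2.
Variables U V W Z : CBanach.
Lemma nm_comp (g : bop V W) (f : bop U V) : nm (g ** f) <= nm g * nm f.
Proof.
 apply nm_le. apply mul_ge0; apply nm_ge0. intros x. rewrite bmA.
 have A := nm_app g (f x). have B := nm_app f x. have D := nm_ge0 g. nra.
Qed.
Lemma nm_id : nm (bid V) <= 1.
Proof. apply nm_le. lra. intros. rewrite b1A. lra. Qed.
Lemma bcA (h : bop W Z) (g : bop V W) (f : bop U V) : h ** (g ** f) = h ** g ** f.
Proof. now apply bop_ext. Qed.
Lemma bc1l (f : bop V W) : bid W ** f = f.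
Proof. now apply bop_ext. Qed.
Lemma bc1r (f : bop V W) : f ** bid V = f.
Proof. now apply bop_ext. Qed.
Lemma nm_comp_le (g : bop V W) (f : bop U V) a b : nm g <= a -> nm f <= b -> nm (g ** f) <= a * b.
Proof. intros. have A := nm_comp g f. have B := nm_ge0 g. have D := nm_ge0 f. nra. Qed.
Lemma cv_app (f : bop V W) u l : cv u l -> cv (fun n => f (u n)) (f l).
Proof.
 intros H eps He. have Hf := nm_ge0 f. destruct (H (eps / (nm f + 1))) as [N HN]. triv.
 exists N. intros n Hn. specialize (HN n Hn). apply Rlt_div_r in HN; [|lra].
 replace (f (u n) -v f l) with (f (u n -v l)) by now rewrite bD, bN.
 have A := nm_app f (u n -v l). nra.
Qed.
Lemma cv_app2 (f : nat -> bop V W) l x : cv f l -> cv (fun n => f n x) (l x).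
Proof.
 intros H eps He. have Hx := nm_ge0 x. destruct (H (eps / (nm x + 1))) as [N HN]. triv.
 exists N. intros n Hn. specialize (HN n Hn). apply Rlt_div_r in HN; [|lra].
 have A := nm_app (f n -v l) x. rewrite baA, boA in A. nra.
Qed.
End BopAlg2.
#[export] Hint Rewrite baA boA bsA b0A bmA b1A bD bZ bN b0 : bop.
Ltac bpush := autorewrite with bop.
Ltac bring := intros; try (apply bop_ext; intros ?x); bpush; try reflexivity; vring.
Tactic Notation "bstep" uconstr(t) := refine (@eq_trans _ _ t _ _ _); [bring|].

Lemma cv_comp (U V W : CBanach) (g : nat -> bop V W) (f : nat -> bop U V) g' f' :
 cv g g' -> cv f f' -> cv (fun n => g n ** f n) (g' ** f').
Proof.
 intros Hg Hf. destruct (cv_bounded Hg) as [M [HM0 HM]].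
 intros eps He. assert (Hf' := nm_ge0 f').
 destruct (Hg (eps / (2 * (nm f' + 1)))) as [N HN]. apply div_gt0; lra.
 destruct (Hf (eps / (2 * (M + 1)))) as [N' HN']. apply div_gt0; lra.
 exists (N + N')%nat. intros n Hn. specialize (HN n ltac:(lia)). specialize (HN' n ltac:(lia)).
 replace (g n ** f n -v g' ** f') with (g n ** (f n -v f') +v (g n -v g') ** f') by bring.
 eapply Rle_lt_trans. apply nm_tri.
 have A := nm_comp (g n) (f n -v f'). have B := nm_comp (g n -v g') f'.
 apply Rlt_div_r in HN; [|lra]. apply Rlt_div_r in HN'; [|lra]. specialize (HM n).
 have E := nm_ge0 (f n -v f'). have F := nm_ge0 (g n -v g'). nra.
Qed.

(** * Closed subspaces and quotients as Banach spaces *)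

Section Sub.
Variables (V : CBanach) (W : V -> Prop).
Hypotheses (HW : vsubspace W) (HC : vclosed W).
Definition subT := {x : V | W x}.
Definition sv (x : subT) : V := proj1_sig x.
Lemma sub_ext (x y : subT) : sv x = sv y -> x = y.
Proof. destruct x as [x Hx], y as [y Hy]. intros H. simpl in H. subst y. f_equal. triv. Qed.
Definition subB : CBanach.
refine (@Build_CBanach subT (exist _ 0v (proj1 HW))
 (fun x y => exist _ (sv x +v sv y) (proj1 (proj2 HW) _ _ (proj2_sig x) (proj2_sig y)))
 (fun x => exist _ (-v (sv x)) (vsub_opp HW (proj2_sig x)))
 (fun c x => exist _ (c *v sv x) (proj2 (proj2 HW) c _ (proj2_sig x)))
 (fun x => nm (sv x)) _ _ _ _ _ _ _ _ _ _ _ _ _).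
all: try (solve [intros; apply sub_ext; simpl; first [apply vs1 | apply vsA | apply vsDl | vring]]).
- intros; apply nm_ge0.
- intros x H. apply sub_ext. simpl. now apply nm_eq0.
- intros; simpl; rewrite Cmod_Defs; apply nm_scal.
- intros; simpl; apply nm_tri.
- intros u H. destruct (@cv_cauchy V (fun n => sv (u n))) as [l Hl].
 + intros eps He. destruct (H eps He) as [N HN]. exists N. intros; apply HN; auto.
 + have Wl : W l by (apply HC with (fun n => sv (u n)); auto; intros n; exact (proj2_sig (u n))).
  exists (exist _ l Wl). intros eps He. destruct (Hl eps He) as [N HN]. exists N. intros; apply HN; auto.
Defined.
Definition sinc : bop subB V.
refine (@Bop subB V (fun x => sv x) _).
split; [|split]; auto. exists 1. intros; simpl. lra.
Defined.
Lemma sinc_nm (x : subB) : nm (sinc x) = nm x.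
Proof. triv. Qed.
Lemma sinc_in (x : subB) : W (sinc x).
Proof. exact (proj2_sig x). Qed.
Lemma sinc_inj (x y : subB) : sinc x = sinc y -> x = y.
Proof. apply sub_ext. Qed.
Lemma sinc_surj x : W x -> exists y : subB, sinc y = x.
Proof. intros H. exists (exist _ x H). triv. Qed.
Lemma sub_lift (U : CBanach) (f : bop U V) : (forall x, W (f x)) ->
 exists g : bop U subB, (forall x, sinc (g x) = f x) /\ nm g <= nm f.
Proof.
 intros H.
 have P : let g := fun x => (exist _ (f x) (H x) : subB) in
  (forall x y, g (x +v y) = g x +v g y) /\ (forall (c : C) x, g (c *v x) = c *v g x) /\
  exists M, forall x, nm (g x) <= M * nm x.
 { split; [|split].
  intros; apply sub_ext; simpl; apply bD. intros; apply sub_ext; simpl; apply bZ.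
  exists (nm f). intros; simpl. apply nm_app. }
 exists (Bop P). split. reflexivity. triv.
Qed.
End Sub.

Section Quo.
Variables (V : CBanach) (W : V -> Prop).
Hypotheses (HW : vsubspace W) (HC : vclosed W).
(** A coset is the set of its members, so that equal cosets are equal predicates by extensionality;
    the operations of the quotient pass through the chosen representative [qrep]. *)
Definition cls (x : V) : V -> Prop := fun y => W (y -v x).
Definition quoT := {S : V -> Prop | exists x, S = cls x}.
Definition qpi (x : V) : quoT := exist _ (cls x) (ex_intro _ x eq_refl).
Definition qrep (q : quoT) : V := proj1_sig (constructive_indefinite_description _ (proj2_sig q)).
Lemma quo_ext (p q : quoT) : proj1_sig p = proj1_sig q -> p = q.
Proof. destruct p as [x Hx], q as [y Hy]. simpl. intros ->. f_equal. triv. Qed.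
Lemma qpi_rep q : qpi (qrep q) = q.
Proof. apply quo_ext. unfold qrep. destruct (constructive_indefinite_description _ _) as [x Hx]. auto. Qed.
Lemma qpi_eq x y : qpi x = qpi y <-> W (x -v y).
Proof.
 split.
 - intros H. have A : cls x x by (unfold cls; rewrite vaddN; apply HW).
  have E : cls x = cls y by (now inversion H). rewrite E in A. triv.
 - intros H. apply quo_ext. simpl. unfold cls. fext z.
  apply propositional_extensionality. split; intros Hz.
  + replace (z -v y) with ((z -v x) +v (x -v y)) by vring. now apply HW.
  + replace (z -v x) with ((z -v y) -v (x -v y)) by vring. now apply vsub_minus.
Qed.
Lemma qrepW x : W (qrep (qpi x) -v x).
Proof. apply qpi_eq, qpi_rep. Qed.
Definition qadd (p q : quoT) := qpi (qrep p +v qrep q).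
Definition qopp (p : quoT) := qpi (-v (qrep p)).
Definition qscal (c : C) (p : quoT) := qpi (c *v qrep p).
Definition qnm (p : quoT) := vdist W (qrep p).
Lemma qaddE x y : qadd (qpi x) (qpi y) = qpi (x +v y).
Proof.
 apply qpi_eq. replace (qrep (qpi x) +v qrep (qpi y) -v (x +v y)) with ((qrep (qpi x) -v x) +v (qrep (qpi y) -v y)) by vring.
 apply HW; apply qrepW.
Qed.
Lemma qoppE x : qopp (qpi x) = qpi (-v x).
Proof.
 apply qpi_eq. replace (-v (qrep (qpi x)) -v (-v x)) with (-v (qrep (qpi x) -v x)) by vring.
 apply vsub_opp; auto. apply qrepW.
Qed.
Lemma qscalE c x : qscal c (qpi x) = qpi (c *v x).
Proof.
 apply qpi_eq. replace (c *v qrep (qpi x) -v c *v x) with (c *v (qrep (qpi x) -v x)) by vring.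
 apply HW; apply qrepW.
Qed.
Lemma qnmE x : qnm (qpi x) = vdist W x.
Proof.
 unfold qnm. replace (qrep (qpi x)) with (x +v (qrep (qpi x) -v x)) by vring.
 apply vdist_addW; auto. apply qrepW.
Qed.
Lemma qind (P : quoT -> Prop) : (forall x, P (qpi x)) -> forall q, P q.
Proof. intros H q. rewrite <- qpi_rep. triv. Qed.
Lemma qlift x q eps : 0 < eps -> exists y, qpi y = q /\ nm (y -v x) < qnm (qadd q (qopp (qpi x))) + eps.
Proof.
 intros He. revert q. apply qind. intros z. rewrite qoppE, qaddE, qnmE.
 destruct (vdist_appr HW (z -v x) He) as [w [Hw Hn]]. exists (z -v w). split.
 - apply qpi_eq. replace (z -v w -v z) with (-v w) by vring. now apply vsub_opp.
 - replace (z -v w -v x) with (z -v x -v w) by vring. auto.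
Qed.
Lemma quo_complete (u : nat -> quoT) :
 (forall eps, eps > 0 -> exists N, forall n m, (n >= N)%nat -> (m >= N)%nat -> qnm (qadd (u n) (qopp (u m))) < eps) ->
 exists l, forall eps, eps > 0 -> exists N, forall n, (n >= N)%nat -> qnm (qadd (u n) (qopp l)) < eps.
Proof.
 intros H.
 have Htri : forall p q r, qnm (qadd p (qopp r)) <= qnm (qadd p (qopp q)) + qnm (qadd q (qopp r)).
 { intros p q r. revert p; apply qind; intros x. revert q; apply qind; intros y. revert r; apply qind; intros z.
  rewrite !qoppE, !qaddE, !qnmE. replace (x +v -v z) with ((x -v y) +v (y -v z)) by vring. now apply vdist_tri. }
 destruct (@fun_choice nat nat (fun k N => forall n m, (N <= n)%nat -> (N <= m)%nat -> qnm (qadd (u n) (qopp (u m))) < (1/2)^k)) as [N0 HN0].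
 { intros k. destruct (H ((1/2)^k)) as [N HN]. apply pow_lt; lra. exists N. triv. }
 set (M := fix M k := match k with O => N0 O | S k => (M k + N0 (S k))%nat end).
 have HM : forall k, (N0 k <= M k)%nat by (intros [|k]; simpl; lia).
 assert (HM' : forall k, (M k <= M (S k))%nat) by (intros k; simpl; lia).
 (* That the vector chosen at step [k] represents [u (M k)] depends on [k], which the invariant of
    [dep_choice] cannot see. It is made a premise of the relation and established afterwards as
    [Fp]. *)
 destruct (@dep_choice V (fun _ => True) (fun k x y => qpi x = u (M k) -> qpi y = u (M (S k)) /\ nm (y -v x) <= 2 * (1/2)^k) (qrep (u (M O))) I) as [f [F0 [_ Fr]]].
 { intros k x _. destruct (classic (qpi x = u (M k))) as [E|E].
  - destruct (@qlift x (u (M (S k))) ((1/2)^k)) as [y [Hy Hn]]. triv.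
  exists y. split; auto. intros _. split; auto. rewrite E in Hn.
  specialize (HN0 k (M (S k)) (M k)). specialize (HM' k). specialize (HM k). 
  specialize (HN0 ltac:(lia) ltac:(lia)). lra.
  - exists x. split; auto. intros E'; contradiction. }
 have Fp : forall k, qpi (f k) = u (M k).
 { induction k. rewrite F0. apply qpi_rep. now apply Fr. }
 have Hc : vcauchy f.
 { apply geo_cauchy with 2. intros n. apply Fr; auto. }
 destruct (cv_cauchy Hc) as [x Hx]. exists (qpi x). intros eps He.
 destruct (Hx (eps/2) ltac:(lra)) as [N HN].
 destruct (pow_half_small 1 (eps := eps/2) ltac:(lra)) as [N' HN'].
 exists (M (N + N')%nat). intros n Hn.
 specialize (HM (N + N')%nat). specialize (HN0 (N+N')%nat n (M (N + N')%nat) ltac:(lia) ltac:(lia)).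
 eapply Rle_lt_trans. apply (Htri _ (u (M (N + N')%nat))).
 rewrite <- Fp in HN0 |- *. rewrite (qoppE x), qaddE, qnmE.
 specialize (HN (N + N')%nat ltac:(lia)). specialize (HN' (N + N')%nat ltac:(lia)).
 have D := vdist_nm HW (f (N+N')%nat -v x). nra.
Qed.
Definition quoB : CBanach.
refine (@Build_CBanach quoT (qpi 0v) qadd qopp qscal qnm _ _ _ _ _ _ _ _ _ _ _ _ quo_complete).
all: try (solve [intros; repeat match goal with x : quoT |- _ => revert x; apply qind; intros ? end;
 repeat (rewrite ?qaddE, ?qoppE, ?qscalE); f_equal; first [apply vs1 | apply vsA | apply vsDl | vring]]).
- intros x. apply vdist_ge0; auto.
- intros q. revert q. apply (qind (P := fun q => qnm q = 0 -> q = qpi 0v)). intros x. rewrite qnmE. intros E.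
 apply qpi_eq. replace (x -v 0v) with x by vring. now apply vdist0_in.
- intros a q. revert q. apply (qind (P := fun q => qnm (qscal a q) = Defs.Cmod a * qnm q)). intros x.
 rewrite qscalE, !qnmE, Cmod_Defs. now apply vdist_scal.
- intros p q. revert p. apply (qind (P := fun p => qnm (qadd p q) <= qnm p + qnm q)). intros x.
 revert q. apply (qind (P := fun q => qnm (qadd (qpi x) q) <= qnm (qpi x) + qnm q)). intros y.
 rewrite qaddE, !qnmE. now apply vdist_tri.
Defined.
Definition quo : bop V quoB.
refine (@Bop V quoB (fun x => qpi x) _).
split; [|split].
- intros x y. symmetry. apply qaddE.
- intros c x. symmetry. apply qscalE.
- exists 1. intros x. rewrite Rmult_1_l. change (qnm (qpi x) <= nm x). rewrite qnmE. now apply vdist_nm.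
Defined.
Lemma quo_nm x : nm (quo x) = vdist W x.
Proof. apply qnmE. Qed.
Lemma quo_surj (q : quoB) : exists x, quo x = q.
Proof. exists (qrep q). apply qpi_rep. Qed.
Lemma quo_eq x y : quo x = quo y <-> W (x -v y).
Proof. apply qpi_eq. Qed.
Lemma quo_eq0 x : quo x = 0v <-> W x.
Proof. replace (0v : quoB) with (quo 0v) by apply b0. rewrite quo_eq. replace (x -v 0v) with x by vring. tauto. Qed.
Lemma quo_lift (q : quoB) eps : 0 < eps -> exists x, quo x = q /\ nm x < nm q + eps.
Proof.
 intros He. destruct (quo_surj q) as [x <-]. rewrite quo_nm.
 destruct (vdist_appr HW x He) as [w [Hw Hn]]. exists (x -v w). split; auto.
 apply quo_eq. replace (x -v w -v x) with (-v w) by vring. now apply vsub_opp.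
Qed.
Lemma quo_factor (U : CBanach) (f : bop V U) : (forall x, W x -> f x = 0v) ->
 exists g : bop quoB U, (forall x, g (quo x) = f x) /\ nm g <= nm f.
Proof.
 intros Hf.
 have E : forall x, f (qrep (qpi x)) = f x.
 { intros x. apply vsub_eq0. rewrite <- bN, <- bD. apply Hf, qrepW. }
 have E1 : forall x, f (qrep (quo x)) = f x by triv.
 have B : forall x, nm (f x) <= nm f * vdist W x.
 { intros x. apply le_epsilon. intros e He. have Hn := nm_ge0 f.
  destruct (@vdist_appr V W HW x (e / (nm f + 1))) as [w [Hw Hx]]. triv.
  replace (f x) with (f (x -v w)). 2: { rewrite bD, bN, (Hf w Hw). vring. }
  have A := nm_app f (x -v w). assert (Hx' : nm (x -v w) - vdist W x < e / (nm f + 1)) by lra.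
  apply Rlt_div_r in Hx'; [|lra]. nra. }
 have P : let g := fun q : quoB => f (qrep q) in
  (forall x y, g (x +v y) = g x +v g y) /\ (forall (c : C) x, g (c *v x) = c *v g x) /\
  exists M, forall x, nm (g x) <= M * nm x.
 { split; [|split].
  - intros p q. destruct (quo_surj p) as [x <-], (quo_surj q) as [y <-]. rewrite <- (bD quo).
  rewrite !E1. bring.
  - intros c p. destruct (quo_surj p) as [x <-]. rewrite <- (bZ quo).
  rewrite !E1. bring.
  - exists (nm f). triv. }
 exists (Bop P). assert (E' : forall x, (Bop P) (quo x) = f x) by auto. split; auto.
 apply nm_le. apply nm_ge0. intros p. destruct (quo_surj p) as [x <-]. rewrite quo_nm, E'. triv.
Qed.
Lemma quo_ind (f : bop V V) : (forall x, W x -> W (f x)) ->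
 exists g : bop quoB quoB, (forall x, g (quo x) = quo (f x)) /\ nm g <= nm f.
Proof.
 intros H. destruct (@quo_factor quoB (quo ** f)) as [g [Hg Hn]].
 - intros x Hx. rewrite bmA. apply quo_eq0; auto.
 - exists g. split. exact Hg. le_by Hn. apply nm_le. apply nm_ge0.
  intros x. rewrite bmA, quo_nm. eapply Rle_trans. now apply vdist_nm. apply nm_app.
Qed.
End Quo.
Opaque subB quoB sinc quo.

(** * Powers of operators, spectral radius bounds and the Neumann series *)

Lemma geo_cauchy_r V (u : nat -> V) M r : 0 <= r < 1 ->
 (forall n, nm (u (S n) -v u n) <= M * r^n) -> vcauchy u.
Proof.
 intros Hr H.
 have HM : 0 <= M. { specialize (H O). have B := nm_ge0 (u 1%nat -v u O). lra. }
 set (K := M / (1 - r)). have HK : K * (1 - r) = M by (unfold K; field; lra).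
 have HK0 : 0 <= K by nra.
 have A : forall k n, nm (u (k + n)%nat -v u n) <= K * r^n - K * r^(k+n).
 { induction k; intros n; simpl. rewrite vaddN, nm0. lra.
  have B := nm_sub_tri (u (S (k+n))) (u (k+n)%nat) (u n).
  specialize (IHk n). specialize (H (k+n)%nat). nra. }
 assert (A' : forall k n, nm (u (k + n)%nat -v u n) <= K * r^n).
 { intros k n. specialize (A k n). assert (0 <= r^(k+n)) by triv. nra. }
 intros eps He. destruct (pow_lt_1_zero r ltac:(rewrite Rabs_pos_eq; lra) (eps / (2 * (K + 1)))) as [N HN].
 triv. exists N. intros n m Hn Hm.
 have B := A' (n - N)%nat N. have D := A' (m - N)%nat N.
 replace (n - N + N)%nat with n in B by lia. replace (m - N + N)%nat with m in D by lia.
 specialize (HN N (le_n _)). rewrite Rabs_pos_eq in HN by (apply pow_le; lra). apply Rlt_div_r in HN; [|lra].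
 have F := nm_sub_tri (u n) (u N) (u m). rewrite (nm_subC (u N) (u m)) in F. nra.
Qed.

Fixpoint cpow (z : C) (n : nat) : C := match n with O => RtoC 1 | S n => Cmult z (cpow z n) end.
Lemma cpow_add z m n : cpow z (m + n) = (cpow z m * cpow z n)%C.
Proof. induction m; simpl. ring. rewrite IHm. ring. Qed.
Lemma cpow_mod z n : Cmod (cpow z n) = Cmod z ^ n.
Proof. induction n; simpl. apply Cmod_1. now rewrite Cmod_mult, IHn. Qed.
Lemma cpow_mul z m n : cpow z (m * n) = cpow (cpow z m) n.
Proof.
 induction n. now rewrite Nat.mul_0_r. rewrite Nat.mul_succ_r, Nat.add_comm, cpow_add, IHn. triv.
Qed.
Lemma cpow_1 n : cpow 1 n = 1%C.
Proof. induction n; simpl; auto. rewrite IHn. ring. Qed.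
Lemma cpow_cmul a b n : cpow (a * b)%C n = (cpow a n * cpow b n)%C.
Proof. induction n; simpl. ring. rewrite IHn. ring. Qed.
Fixpoint bpow V (A : bop V V) (n : nat) : bop V V := match n with O => bid V | S n => A ** bpow A n end.
Tactic Notation "sim" := cbn [bpow cpow pow Nat.add].
Tactic Notation "sim" "in" "*" := cbn [bpow cpow pow Nat.add] in *.
Tactic Notation "sim" "in" hyp(H) := cbn [bpow cpow pow Nat.add] in H.
Section Pow.
Variable V : CBanach.
Implicit Types A B T : bop V V.
Lemma bpow_add A m n : bpow A (m + n) = bpow A m ** bpow A n.
Proof. induction m; sim. bring. now rewrite IHm, bcA. Qed.
Lemma bpow_S A n : bpow A (S n) = bpow A n ** A.
Proof. replace (S n) with (n + 1)%nat by lia. rewrite bpow_add. bring. Qed.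
Lemma bpow_1 A : bpow A 1 = A.
Proof. bring. Qed.
Lemma bpow_mul A m n : bpow A (m * n) = bpow (bpow A m) n.
Proof.
 induction n. now rewrite Nat.mul_0_r. rewrite Nat.mul_succ_r, Nat.add_comm, bpow_add, IHn. triv.
Qed.
Lemma bpow_nm A n : nm (bpow A n) <= nm A ^ n.
Proof.
 induction n; sim. apply nm_id. apply nm_comp_le; [right; reflexivity | exact IHn].
Qed.
Definition comm A B := A ** B = B ** A.
Lemma comm_sym A B : comm A B -> comm B A.
Proof. unfold comm; auto. Qed.
Lemma comm_refl A : comm A A.
Proof. triv. Qed.
Lemma comm_id A : comm A (bid V).
Proof. bring. Qed.
Lemma comm_add A B T : comm T A -> comm T B -> comm T (A +v B).
Proof.
 intros H1 H2. bext x. bpush.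
 change (T (A x)) with ((T ** A) x). change (T (B x)) with ((T ** B) x). now rewrite H1, H2.
Qed.
Lemma comm_scal (c : C) A T : comm T A -> comm T (c *v A).
Proof.
 intros H1. bext x. bpush.
 change (T (A x)) with ((T ** A) x). now rewrite H1.
Qed.
Lemma comm_opp A T : comm T A -> comm T (-v A).
Proof. intros H. rewrite voppE. now apply comm_scal. Qed.
Lemma comm_comp A B T : comm T A -> comm T B -> comm T (A ** B).
Proof. unfold comm. intros H1 H2. now rewrite bcA, H1, <- bcA, H2, bcA. Qed.
Lemma comm_zero T : comm T 0v.
Proof. bring. Qed.
Lemma comm_pow A T n : comm T A -> comm T (bpow A n).
Proof. intros H. induction n; sim. bring. now apply comm_comp. Qed.
Lemma comm_lim T (u : nat -> bop V V) l : (forall n, comm T (u n)) -> cv u l -> comm T l.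
Proof.
 intros H Hc. apply (@cv_unique (BL V) (fun n => T ** u n)).
 - apply cv_comp; auto. apply cv_const.
 - apply cv_ext with (fun n => u n ** T). intros; symmetry; apply H. apply cv_comp; auto. apply cv_const.
Qed.
Lemma comm_app A B x : comm A B -> A (B x) = B (A x).
Proof. intros H. change ((A ** B) x = (B ** A) x). now rewrite H. Qed.
Lemma bpow_comp A B n : comm A B -> bpow (A ** B) n = bpow A n ** bpow B n.
Proof.
 intros H. induction n; sim. bring. rewrite IHn. rewrite <- !bcA. f_equal.
 rewrite !bcA. f_equal. symmetry. apply (comm_sym (comm_pow n (comm_sym H))).
Qed.
Lemma bpow_scal (c : C) A n : bpow (c *v A) n = cpow c n *v bpow A n.
Proof. induction n; sim. bext x. bpush. vring. rewrite IHn. bring. Qed.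
Lemma bpow_app_S A n x : bpow A (S n) x = A (bpow A n x).
Proof. triv. Qed.
Lemma bpow_id n : bpow (bid V) n = bid V.
Proof. induction n; sim; auto. now rewrite IHn, bc1l. Qed.
Lemma bpow_idem (P : bop V V) n : P ** P = P -> bpow P (S n) = P.
Proof. intros H. induction n. bring. change (P ** bpow P (S n) = P). now rewrite IHn. Qed.

(* [rb A rho] bounds the spectral radius of [A] by [rho]. *)
Definition rb A (rho : R) := forall r, rho < r -> exists M, 0 < M /\ forall n, nm (bpow A n) <= M * r ^ n.
Lemma rb_intro A rho : 0 <= rho -> (exists M, forall n, nm (bpow A n) <= M * rho ^ n) -> rb A rho.
Proof.
 intros H0 [M HM] r Hr. exists (Rabs M + 1). have Hp := Rabs_pos M. split. lra. intros n. le_by HM.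
 assert (rho ^ n <= r ^ n) by triv. assert (0 <= rho ^ n) by triv.
 have Hra := Rle_abs M. nra.
Qed.
Lemma rb_nm A : rb A (nm A).
Proof. apply rb_intro. apply nm_ge0. exists 1. intros n. rewrite Rmult_1_l. apply bpow_nm. Qed.
Lemma rb_le A a b : a <= b -> rb A a -> rb A b.
Proof. intros H HA r Hr. apply HA; lra. Qed.
Lemma rb_nmle A a : nm A <= a -> rb A a.
Proof. intros H. apply rb_le with (nm A); auto. apply rb_nm. Qed.
Lemma rb_scal (c : C) A a : 0 <= a -> rb A a -> rb (c *v A) (Cmod c * a).
Proof.
 intros Ha H r Hr. have Hc := Cmod_ge_0 c.
 destruct (H (a + (r - Cmod c * a) / (Cmod c + 1))) as [M [HM0 HM]].
 assert (0 < (r - Cmod c * a) / (Cmod c + 1)) by triv. lra.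
 exists M. split; auto. intros n. rewrite bpow_scal, nm_scal, cpow_mod. set (a' := a + _) in *.
 assert (Ha' : 0 <= a'). { unfold a'. triv. }
 assert (Cmod c * a' <= r). { unfold a'. assert (Cmod c / (Cmod c + 1) <= 1). apply Rle_div_l; lra. 
  nra. }
 assert (Cmod c ^ n * a' ^ n <= r ^ n). { rewrite <- Rpow_mult_distr. triv. }
 specialize (HM n). assert (0 <= Cmod c ^ n) by triv. nra.
Qed.
Lemma rb_comp A B a b : comm A B -> 0 <= a -> 0 <= b -> rb A a -> rb B b -> rb (A ** B) (a * b).
Proof.
 intros Hc Ha Hb HA HB r Hr. set (e := Rmin 1 ((r - a * b) / (a + b + 1))).
 have He : 0 < e. { apply Rmin_glb_lt. lra. triv. }
 have He1 : e <= 1 by apply Rmin_l. have He2 : e <= (r - a * b) / (a + b + 1) by apply Rmin_r.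
 apply Rle_div_r in He2; [|lra].
 destruct (HA (a + e) ltac:(lra)) as [M [HM0 HM]]. destruct (HB (b + e) ltac:(lra)) as [M' [HM0' HM']].
 exists (M * M'). split. nra. intros n. rewrite bpow_comp by auto. eapply Rle_trans. apply nm_comp_le; [apply HM|apply HM'].
 have Hp : ((a + e) * (b + e)) ^ n <= r ^ n by (apply pow_incr; nra).
 rewrite Rpow_mult_distr in Hp.
 replace (M * (a + e) ^ n * (M' * (b + e) ^ n)) with (M * M' * ((a + e) ^ n * (b + e) ^ n)) by ring.
 triv.
Qed.
(** Induction on [n] for all the products A^p (A+B)^n B^q at once: each step splits one factor A+B
    into the two neighbours, so that no binomial coefficient appears. *)
Lemma rb_add A B a b : comm A B -> 0 <= a -> 0 <= b -> rb A a -> rb B b -> rb (A +v B) (a + b).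
Proof.
 intros Hc Ha Hb HA HB r Hr. set (e := (r - a - b) / 2).
 destruct (HA (a + e) ltac:(unfold e; lra)) as [M [HM0 HM]]. destruct (HB (b + e) ltac:(unfold e; lra)) as [M' [HM0' HM']].
 exists (M * M'). split. nra.
 have H : forall n p q, nm (bpow A p ** (bpow (A +v B) n ** bpow B q)) <= M * M' * (a + e) ^ p * (b + e) ^ q * r ^ n.
 { induction n; intros p q.
  - rewrite bc1l. eapply Rle_trans. apply nm_comp_le; [apply HM|apply HM']. nra.
  - replace (bpow A p ** (bpow (A +v B) (S n) ** bpow B q)) with
  (bpow A (S p) ** (bpow (A +v B) n ** bpow B q) +v bpow A p ** (bpow (A +v B) n ** bpow B (S q))).
  le_by nm_tri. eapply Rle_trans. apply Rplus_le_compat; apply IHn.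
  sim. replace r with ((a + e) + (b + e)) at 3 by (unfold e; field). right; ring.
  bext x. rewrite (bpow_S A p). rewrite baA, !bmA, !bpow_app_S, baA, bD. f_equal.
  rewrite ?bmA. f_equal. apply comm_app. apply comm_sym, comm_pow. apply comm_add. apply comm_sym, Hc. triv. }
 intros n. specialize (H n O O). rewrite bc1l, bc1r in H. lra.
Qed.
Lemma rb_pow_small A a r eps : rb A a -> a < r -> 0 < r < 1 -> 0 < eps -> exists N, forall n, (N <= n)%nat -> nm (bpow A n) < eps.
Proof.
 intros HA Har Hr He. destruct (HA ((r + a) / 2 )) as [M [HM0 HM]]. lra.
 destruct (Rle_lt_dec ((r+a)/2) 0) as [Hneg|Hpos].
 - destruct (HA r ltac:(lra)) as [M' [HM0' HM']].
  destruct (pow_lt_1_zero r ltac:(rewrite Rabs_pos_eq; lra) (eps / M')) as [N HN]. triv.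
  exists N. intros n Hn. specialize (HN n Hn). rewrite Rabs_pos_eq in HN by (apply pow_le; lra).
  apply Rlt_div_r in HN; auto. specialize (HM' n). lra.
 - destruct (pow_lt_1_zero ((r+a)/2) ltac:(rewrite Rabs_pos_eq; lra) (eps / M)) as [N HN]. triv.
  exists N. intros n Hn. specialize (HN n Hn). rewrite Rabs_pos_eq in HN by (apply pow_le; lra).
  apply Rlt_div_r in HN; auto. specialize (HM n). lra.
Qed.
Lemma rb_lt1_small A a eps : rb A a -> a < 1 -> 0 < eps -> exists N, forall n, (N <= n)%nat -> nm (bpow A n) < eps.
Proof. intros HA Ha He. apply rb_pow_small with (a := a) (r := Rmax (1/2) ((a+1)/2)); auto.
 eapply Rlt_le_trans; [|apply Rmax_r]. lra.
 split. eapply Rlt_le_trans; [|apply Rmax_l]. lra. apply Rmax_lub_lt; lra.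
Qed.

Definition inv_of A B := A ** B = bid V /\ B ** A = bid V.
Lemma inv_comm A B T : inv_of A B -> comm T A -> comm T B.
Proof.
 unfold comm. intros [H1 H2] H. rewrite <- (bc1l (T ** B)), <- H2, <- bcA, (bcA A), <- H, <- bcA, H1, bc1r. triv.
Qed.
Lemma inv_comp A A' B B' : inv_of A A' -> inv_of B B' -> inv_of (A ** B) (B' ** A').
Proof.
 intros [H1 H2] [H3 H4]. split. rewrite <- bcA, (bcA B), H3, bc1l. auto.
 rewrite <- bcA, (bcA A'), H2, bc1l. auto.
Qed.
Lemma inv_id : inv_of (bid V) (bid V).
Proof. split; apply bc1l. Qed.
Lemma inv_app A B x : inv_of A B -> B (A x) = x.
Proof. intros [_ H]. change ((B ** A) x = x). now rewrite H. Qed.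
Lemma inv_app2 A B x : inv_of A B -> A (B x) = x.
Proof. intros [H _]. change ((A ** B) x = x). now rewrite H. Qed.
Lemma inv_scal (c : C) A B : c <> 0%C -> inv_of A B -> inv_of (c *v A) ((/c)%C *v B).
Proof.
 intros Hc H. split; apply bop_ext; intros x; bpush.
 rewrite (inv_app2 _ H). vfield. rewrite (inv_app _ H). vfield.
Qed.
(** The inverse is a limit of polynomials in [A]; hence everything that commutes with [A] commutes
    with it. *)
Lemma neumann A a : rb A a -> a < 1 -> exists B, inv_of (bid V -v A) B /\ (forall T, comm T A -> comm T B).
Proof.
 (* The maximum with 1/2 keeps the rate nonnegative, [a] having no prescribed sign. *)
 intros HA Ha. destruct (HA (Rmax (1/2) ((a+1)/2))) as [M [HM0 HM]].
 { eapply Rlt_le_trans; [|apply Rmax_r]. lra. }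
 set (r := Rmax (1/2) ((a+1)/2)) in *.
 have Hr : 0 <= r < 1. { split. eapply Rle_trans; [|apply Rmax_l]. lra. apply Rmax_lub_lt; lra. }
 set (u := fix u n : bop V V := match n with O => 0v | S n => u n +v bpow A n end).
 have Hc : vcauchy (u : nat -> BL V).
 { apply geo_cauchy_r with M r; auto. intros n. change (u (S n)) with (u n +v bpow A n). replace (u n +v bpow A n -v u n) with (bpow A n) by vring. triv. }
 destruct (cv_cauchy Hc) as [B HB]. exists B.
 have Hu1 : forall n, (bid V -v A) ** u n = bid V -v bpow A n.
 { induction n. bring. change (u (S n)) with (u n +v bpow A n). sim. bext x. apply (f_equal (fun f : bop V V => f x)) in IHn.
  revert IHn. bpush. intros IHn.
  transitivity ((u n x -v A (u n x)) +v (bpow A n x -v A (bpow A n x))). vring. rewrite IHn. vring. }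
 have Hu0 : forall T, comm T A -> forall n, comm T (u n).
 { intros T HT n. induction n. bring. apply comm_add; auto. now apply comm_pow. }
 have Hp : cv (fun n => bpow A n) (0v : bop V V).
 { intros eps He. destruct (rb_lt1_small HA Ha He) as [N HN]. exists N. intros n Hn.
  replace (bpow A n -v 0v) with (bpow A n) by vring. auto. }
 have H1 : (bid V -v A) ** B = bid V.
 { apply (@cv_unique (BL V) (fun n => (bid V -v A) ** u n)). apply cv_comp; auto. apply cv_const.
  apply cv_ext with (fun n => bid V -v bpow A n). intros; now rewrite Hu1.
  have Q : cv (fun n => bid V -v bpow A n) (bid V -v (0v : bop V V)).
  { apply (@cv_plus (BL V) (fun _ => bid V) (fun n => -v (bpow A n)) (bid V) (-v 0v)). apply cv_const. apply (@cv_opp (BL V) (fun n => bpow A n) 0v Hp). }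
  replace (bid V -v (0v : bop V V)) with (bid V) in Q by bring. triv. }
 have HBc : forall T, comm T A -> comm T B.
 { intros T HT. apply comm_lim with u; auto. }
 split; auto. split; auto. transitivity ((bid V -v A) ** B); auto. apply comm_sym, HBc.
 bring.
Qed.
(** A negative spectral radius bound is contradictory, since the first power would have negative
    norm; this disposes of [c = 0] and of [a < 0]. *)
Lemma neumann_scal A a (c : C) : rb A a -> a < Cmod c -> exists B, inv_of (A -v c *v bid V) B /\ (forall T, comm T A -> comm T B).
Proof.
 intros HA Ha. have Hc0 : 0 < Cmod c \/ Cmod c = 0 by (assert (H := Cmod_ge_0 c); lra).
 destruct (classic (c = 0%C)) as [E|E].
 - exfalso. subst. rewrite Cmod_0 in Ha.
  destruct (HA 0 Ha) as [M [HM0 HM]]. destruct (HA (a/2) ltac:(lra)) as [M' [_ HM']].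
  specialize (HM 1%nat). specialize (HM' O). specialize (HA (a/2) ltac:(lra)). destruct HA as [M2 [HM2 HA]]. specialize (HA 1%nat).
  have B := nm_ge0 (bpow A 1). nra.
 - destruct (Rle_lt_dec 0 a) as [Ha0|Ha0].
  + have Hcp : 0 < Cmod c by nra.
  destruct (@neumann ((/c)%C *v A) (Cmod (/c)%C * a)) as [B [HB HBc]].
  * now apply rb_scal.
  * rewrite Cmod_inv by auto. apply Rmult_lt_reg_l with (Cmod c); auto. rewrite <- Rmult_assoc, Rinv_r by lra. lra.
  * exists ((/ (- c))%C *v B). split. 
  { replace (A -v c *v bid V) with ((- c)%C *v (bid V -v (/c)%C *v A)).
  apply inv_scal; auto. intros H. apply E. replace c with (- - c)%C by ring. rewrite H. ring.
  apply bop_ext; intros x; bpush. vfield. }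
  intros T HT. apply comm_scal, HBc, comm_scal, HT.
  + exfalso. destruct (HA (a/2) ltac:(lra)) as [M2 [HM2 HA2]]. specialize (HA2 1%nat).
  have B := nm_ge0 (bpow A 1). nra.
Qed.
End Pow.
Notation "A ^^ n" := (bpow A n) (at level 29, left associativity) : vec_scope.

(** * Finite sums and averages over roots of unity *)

Section Vsum.
Variable V : CBanach.
Fixpoint vsum (n : nat) (f : nat -> V) : V := match n with O => 0v | S n => vsum n f +v f n end.
Lemma vsum_ext n f g : (forall k, (k < n)%nat -> f k = g k) -> vsum n f = vsum n g.
Proof. induction n; intros H; cbn [vsum]; auto. rewrite IHn, H; auto. Qed.
Lemma vsum_add n f g : vsum n (fun k => f k +v g k) = vsum n f +v vsum n g.
Proof. induction n; cbn [vsum]. vring. rewrite IHn. vring. Qed.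
Lemma vsum_scal n (c : C) f : vsum n (fun k => c *v f k) = c *v vsum n f.
Proof. induction n; cbn [vsum]. vring. rewrite IHn. vring. Qed.
Lemma vsum_0 n : vsum n (fun _ => 0v) = 0v.
Proof. induction n; cbn [vsum]; auto. rewrite IHn. vring. Qed.
Lemma vsum_nm n f M : (forall k, (k < n)%nat -> nm (f k) <= M) -> nm (vsum n f) <= INR n * M.
Proof.
 induction n; intros H; cbn [vsum]. rewrite nm0. simpl. lra.
 rewrite S_INR. have A := nm_tri (vsum n f) (f n). specialize (H n ltac:(lia)) as B.
 specialize (IHn ltac:(intros; apply H; lia)). lra.
Qed.
Lemma vsum_exch m n (f : nat -> nat -> V) : vsum m (fun i => vsum n (fun j => f i j)) = vsum n (fun j => vsum m (fun i => f i j)).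
Proof. induction m; cbn [vsum]. now rewrite vsum_0. rewrite IHm, <- vsum_add. triv. Qed.
Lemma vsum_one n m (f : nat -> V) : (m < n)%nat -> (forall k, (k < n)%nat -> k <> m -> f k = 0v) -> vsum n f = f m.
Proof.
 induction n; intros Hm H. lia. cbn [vsum]. destruct (Nat.eq_dec m n).
 - subst. rewrite (vsum_ext (g := fun _ => 0v)). rewrite vsum_0. vring. intros; apply H; lia.
 - rewrite IHn. rewrite (H n). vring. lia. auto. lia. triv.
Qed.
End Vsum.
Lemma vsum_app (V W : CBanach) (f : bop V W) n (u : nat -> V) : f (vsum n u) = vsum n (fun k => f (u k)).
Proof. induction n; cbn [vsum]. apply b0. now rewrite bD, IHn. Qed.
Lemma vsum_app2 (V W : CBanach) n (f : nat -> bop V W) x : (vsum n f) x = vsum n (fun k => f k x).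
Proof. induction n; cbn [vsum]. reflexivity. rewrite baA. now rewrite IHn. Qed.

Section Roots.
Definition cexp (t : R) : C := (cos t, sin t).
Lemma cexp_add s t : cexp (s + t) = (cexp s * cexp t)%C.
Proof. unfold cexp, Cmult; simpl. rewrite cos_plus, sin_plus. f_equal. ring. Qed.
Lemma cexp_0 : cexp 0 = 1%C.
Proof. unfold cexp. now rewrite cos_0, sin_0. Qed.
Lemma cexp_mod t : Cmod (cexp t) = 1.
Proof.
 unfold Cmod, cexp; simpl. replace (cos t * (cos t * 1) + sin t * (sin t * 1)) with 1. apply sqrt_1.
 have A := sin2_cos2 t. unfold Rsqr in A. lra.
Qed.
Lemma cexp_pow t n : cpow (cexp t) n = cexp (INR n * t).
Proof.
 induction n. now rewrite Rmult_0_l, cexp_0. rewrite S_INR. cbn [cpow]. rewrite IHn, <- cexp_add. f_equal. ring.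
Qed.
Lemma cexp_2PI n : cexp (2 * PI * INR n) = 1%C.
Proof.
 induction n. now rewrite Rmult_0_r, cexp_0. rewrite S_INR, Rmult_plus_distr_l, cexp_add, IHn, Rmult_1_r.
 unfold cexp. rewrite cos_2PI, sin_2PI. apply injective_projections; simpl; ring.
Qed.
Lemma cexp_neq1 t : 0 < t < 2 * PI -> cexp t <> 1%C.
Proof.
 intros Ht H. have A : cos t = 1 by (apply (f_equal fst) in H; exact H).
 replace t with (2 * (t / 2)) in A by field. rewrite cos_2a_sin in A.
 have B : 0 < sin (t/2) by (apply sin_gt_0; lra). nra.
Qed.
Definition rou (N : nat) : C := cexp (2 * PI / INR N).
Lemma rou_mod N : Cmod (rou N) = 1.
Proof. apply cexp_mod. Qed.
Lemma rou_pow N : (0 < N)%nat -> cpow (rou N) N = 1%C.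
Proof.
 intros H. unfold rou. rewrite cexp_pow. replace (INR N * (2 * PI / INR N)) with (2 * PI * INR 1).
 apply cexp_2PI. simpl. field. apply not_0_INR. lia.
Qed.
Lemma rou_neq1 N l : (0 < l < N)%nat -> cpow (rou N) l <> 1%C.
Proof.
 intros H. unfold rou. rewrite cexp_pow. apply cexp_neq1.
 have A : 0 < INR l by triv. have B : INR l < INR N by (apply lt_INR; lia).
 have P := PI_RGT_0. split. triv.
 unfold Rdiv. rewrite <- Rmult_assoc. apply Rlt_div_l; nra.
Qed.
(* The complex line as a vector of sums: orthogonality of characters of Z/N. *)
Lemma rou_sum V (x : V) N l : (0 < l < N)%nat -> vsum N (fun k => cpow (cpow (rou N) k) l *v x) = 0v.
Proof.
 intros H. set (q := cpow (rou N) l).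
 have E : forall n, (q - 1)%C *v vsum n (fun k => cpow (cpow (rou N) k) l *v x) = (cpow q n - 1)%C *v x.
 { induction n; cbn [vsum cpow]. vring. rewrite vsDr, IHn. rewrite <- cpow_mul.
  rewrite Nat.mul_comm, cpow_mul. fold q. vring. }
 specialize (E N). unfold q in E at 2. rewrite <- cpow_mul, Nat.mul_comm, cpow_mul, rou_pow, cpow_1 in E by lia.
 replace (1 - 1)%C with (RtoC 0) in E by ring. rewrite vs0l in E.
 have Hq : (q - 1)%C <> 0%C. { intros Hq. apply (rou_neq1 H). fold q. replace q with ((q - 1) + 1)%C by ring. rewrite Hq. ring. }
 set (s := vsum N _) in *. replace s with ((/ (q - 1))%C *v ((q - 1)%C *v s)). rewrite E. vring.
 vreduce. split; auto. field. auto.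
Qed.

(** Inversion of the discrete Fourier transform: the weight w^(N-m) stands for w^(-m) and cancels
    every coefficient but the m-th. *)
Lemma rou_avg V N m (c : nat -> V) : (m < N)%nat ->
 vsum N (fun k => cpow (cpow (rou N) k) (N - m) *v vsum N (fun j => cpow (cpow (rou N) k) j *v c j)) = RtoC (INR N) *v c m.
Proof.
 intros Hm.
 rewrite (vsum_ext (g := fun k => vsum N (fun j => cpow (cpow (rou N) k) (N - m + j) *v c j))).
 2: { intros k Hk. rewrite <- vsum_scal. apply vsum_ext. intros j Hj. now rewrite vsA, cpow_add. }
 rewrite vsum_exch. rewrite (@vsum_one V N m); auto.
 - rewrite (vsum_ext (g := fun _ => c m)).
  + clear. induction N; cbn [vsum]. now rewrite vs0l. rewrite IHN, S_INR, RtoC_plus. vring.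
  + intros k Hk. replace (N - m + m)%nat with N by lia. rewrite <- cpow_mul, Nat.mul_comm, cpow_mul, rou_pow, cpow_1 by lia. vring.
 - intros j Hj Hjm. destruct (Nat.lt_ge_cases m j) as [H|H].
  + rewrite (vsum_ext (g := fun k => cpow (cpow (rou N) k) (j - m) *v c j)).
  apply rou_sum. lia. intros k Hk. replace (N - m + j)%nat with (N + (j - m))%nat by lia.
  rewrite cpow_add. rewrite <- (cpow_mul _ k N), Nat.mul_comm, cpow_mul, rou_pow, cpow_1 by lia. vring.
  + apply rou_sum. lia.
Qed.
End Roots.

Section LB.
Variable V : CBanach.
Implicit Types A T : bop V V.
Lemma geo_id A (w : C) N x :
 let y := vsum N (fun k => cpow w k *v bpow A k x) in y -v w *v A y = x -v cpow w N *v bpow A N x.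
Proof.
 induction N; cbn [vsum cpow bpow]. rewrite b0. bpush. vring.
 rewrite bD, bZ, bmA. set (y := vsum N _) in *.
 transitivity ((y -v w *v A y) +v (cpow w N *v bpow A N x -v w *v (cpow w N *v A (bpow A N x)))). vring.
 rewrite IHN. vring.
Qed.
(** A Cauchy estimate without contours. For an N-th root of unity w, applying 1 - wA to the sum of
    the w^j A^j x with j < N gives x - A^N x, so the lower bound controls that sum; averaging over w
    isolates A^m x. *)
Lemma LB A c N m x : 0 < c -> (forall z y, Cmod z = 1 -> c * nm y <= nm (y -v z *v A y)) -> (m < N)%nat ->
 c * nm (bpow A m x) <= nm (x -v bpow A N x).
Proof.
 intros Hc H Hm. have HN : 0 < INR N by triv.
 have E := @rou_avg V N m (fun j => bpow A j x) Hm.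
 have B : nm (RtoC (INR N) *v bpow A m x) <= INR N * (nm (x -v bpow A N x) / c).
 { rewrite <- E. apply vsum_nm. intros k Hk. rewrite nm_scal, !cpow_mod, rou_mod, !pow1, Rmult_1_l.
  set (w := cpow (rou N) k). have Hw : Cmod w = 1 by (unfold w; now rewrite cpow_mod, rou_mod, pow1).
  specialize (H w (vsum N (fun j => cpow w j *v bpow A j x)) Hw). rewrite (geo_id A w N x) in H.
  have Ew : cpow w N = 1%C. { unfold w. rewrite <- cpow_mul, Nat.mul_comm, cpow_mul, rou_pow by lia. apply cpow_1. }
  rewrite Ew, vs1 in H. apply Rle_div_r; lra. }
 rewrite nm_scal, Cmod_R, Rabs_pos_eq in B by lra. apply Rmult_le_reg_l in B; auto. apply Rle_div_r in B; lra.
Qed.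

(* Averaging, over the [N]-th roots of unity [w], the product of the partial geometric sums of lengths [m + 1] and [N] of [w A] picks the term [A^m] out [m + 1] times. *)
Lemma LB_sq A c N m x : 0 < c -> (forall z y, Cmod z = 1 -> c * nm y <= nm (y -v z *v A y)) -> (S m < N)%nat -> nm (bpow A N) <= 1 ->
 INR (S m) * nm (bpow A m x) <= 2 / c * ((1 + 2 / c) / c) * nm x.
Proof.
 intros Hc H Hm HA. have HN : 0 < INR N by triv. set (D := fun n w (y : V) => vsum n (fun j => cpow w j *v bpow A j y)).
 have HD : forall n w y b, Cmod w = 1 -> nm (bpow A n y) <= b * nm y -> nm (D n w y) <= (1 + b) / c * nm y.
 { intros n w y b Hw Hb. replace ((1 + b) / c * nm y) with ((1 + b) * nm y / c) by (field; lra). apply Rle_div_r; auto. rewrite Rmult_comm. eapply Rle_trans. apply (H w); auto. unfold D. rewrite geo_id. le_by nm_sub. rewrite nm_scal, cpow_mod, Hw, pow1. lra. }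
 have HA1 : forall y, nm (bpow A N y) <= 1 * nm y. { intros y. le_by nm_app. apply mul_le_r; auto. apply nm_ge0. }
 have HAm : forall y, nm (bpow A (S m) y) <= 2 / c * nm y.
 { intros y. replace (2 / c * nm y) with (2 * nm y / c) by (field; lra). apply Rle_div_r; auto. rewrite Rmult_comm. eapply Rle_trans. apply (@LB A c N); auto. le_by nm_sub. specialize (HA1 y). lra. }
 have E : vsum N (fun k => cpow (cpow (rou N) k) (N - m) *v D (S m) (cpow (rou N) k) (D N (cpow (rou N) k) x)) = RtoC (INR N) *v vsum (S m) (fun _ => bpow A m x).
 { rewrite <- vsum_scal. rewrite (vsum_ext (g := fun k => vsum (S m) (fun i => bpow A i (cpow (cpow (rou N) k) (N - (m - i)) *v D N (cpow (rou N) k) x)))).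
  2: { intros k Hk. unfold D at 1. rewrite <- vsum_scal. apply vsum_ext. intros i Hi. rewrite bZ, vsA, <- cpow_add. do 2 f_equal. lia. }
  rewrite vsum_exch. apply vsum_ext. intros i Hi. rewrite <- vsum_app. unfold D. rewrite rou_avg, bZ, <- bmA, <- bpow_add by lia. do 3 f_equal. lia. }
 have Hs : vsum (S m) (fun _ => bpow A m x) = RtoC (INR (S m)) *v bpow A m x. { clear. generalize (bpow A m x). generalize (S m). intros n y. induction n; cbn [vsum]. now rewrite vs0l. rewrite IHn, S_INR, RtoC_plus. vring. }
 rewrite Hs in E. apply (f_equal (fun y : V => nm y)) in E. rewrite !nm_scal, !Cmod_R, !Rabs_pos_eq in E by apply pos_INR. apply Rmult_le_reg_l with (INR N); auto. rewrite <- E. apply vsum_nm. intros k Hk. rewrite nm_scal.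
 have Hw : Cmod (cpow (rou N) k) = 1 by now rewrite cpow_mod, rou_mod, pow1. rewrite cpow_mod, Hw, pow1, Rmult_1_l. eapply Rle_trans. apply (HD (S m)); auto.
 have Q := HD N _ x 1 Hw (HA1 x). have Hc2 : 0 <= (1 + 2 / c) / c by (apply div_ge0; auto; assert (0 < 2 / c) by (apply div_gt0; lra); lra).
 nra.
Qed.
End LB.

(** * Equivalent norms adapted to a semigroup of operators *)

Section Renorm.
Variable V : CBanach.
Inductive Wd (F : bop V V -> Prop) : bop V V -> Prop :=
| Wnil : Wd F (bid V)
| Wcons f w : F f -> Wd F w -> Wd F (f ** w).
Lemma Wd_comp F u v : Wd F u -> Wd F v -> Wd F (u ** v).
Proof. intros Hu Hv. induction Hu. now rewrite bc1l. rewrite <- bcA. now constructor. Qed.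
Lemma Wd_1 (F : bop V V -> Prop) f : F f -> Wd F f.
Proof. intros H. rewrite <- (bc1r f). constructor; auto. constructor. Qed.
Definition isnm (N : V -> R) (M : R) := 0 < M /\ (forall x, nm x <= N x <= M * nm x) /\
 (forall x y, N (x +v y) <= N x + N y) /\ (forall (c : C) x, N (c *v x) <= Cmod c * N x).
Lemma isnm_ge0 N M x : isnm N M -> 0 <= N x.
Proof. intros H. le_by (nm_ge0 x). apply H. Qed.
(** The new norm of x is the supremum of the norms of w x over all words w in [F]. The empty word
    makes it at least the old norm, and applying a member of [F] restricts the supremum. *)
Lemma renorm (F : bop V V -> Prop) M : 0 < M -> (forall w, Wd F w -> nm w <= M) ->
 exists N, isnm N M /\ forall f, F f -> forall x, N (f x) <= N x.
Proof.
 intros HM0 HM. set (E := fun x r => exists w, Wd F w /\ r = nm (w x)).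
 have Hex : forall x, exists m, is_lub (E x) m.
 { intros x. destruct (completeness (E x)) as [m Hm].
  - exists (M * nm x). intros r [w [Hw ->]]. have A := nm_app w x. specialize (HM w Hw). have B := nm_ge0 x. nra.
  - exists (nm (bid V x)), (bid V). split; auto. constructor.
  - exists m; auto. }
 destruct (fun_choice Hex) as [N HN]. exists N.
 have Hub : forall x w, Wd F w -> nm (w x) <= N x.
 { intros x w Hw. apply (HN x). exists w; auto. }
 have Hle : forall x b, (forall w, Wd F w -> nm (w x) <= b) -> N x <= b.
 { intros x b Hb. apply (HN x). intros r [w [Hw ->]]. auto. }
 split; [split; [|split; [|split]]|]; auto.
 - intros x. split. apply (Hub x (bid V)). constructor.
  apply Hle. intros w Hw. have A := nm_app w x. specialize (HM w Hw). have B := nm_ge0 x. nra.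
 - intros x y. apply Hle. intros w Hw. rewrite bD. have A := nm_tri (w x) (w y).
  have B := Hub x w Hw. have D := Hub y w Hw. lra.
 - intros c x. apply Hle. intros w Hw. rewrite bZ, nm_scal. triv.
 - intros f Hf x. apply Hle. intros w Hw. change (w (f x)) with ((w ** f) x). apply Hub.
  apply Wd_comp; auto. now apply Wd_1.
Qed.
End Renorm.

(** * The operator exponential *)

Lemma exp_pow c n : exp c ^ n = exp (INR n * c).
Proof.
 induction n. now rewrite Rmult_0_l, exp_0. rewrite S_INR. cbn [pow]. rewrite IHn, <- exp_plus. f_equal. ring.
Qed.
Lemma exp_ge1 c : 0 <= c -> 1 <= exp c.
Proof. intros H. have A := exp_ineq1_le c. lra. Qed.
Lemma exp_le c d : c <= d -> exp c <= exp d.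
Proof. intros H; destruct (Rle_lt_or_eq_dec _ _ H). left; now apply exp_increasing. subst; lra. Qed.
Lemma exp_lin c : 1 + c <= exp c.
Proof. destruct (Req_dec c 0). subst. rewrite exp_0. lra. left. now apply exp_ineq1. Qed.
Definition p2 (k : nat) : R := 2 ^ k.
Lemma p2_pos k : 0 < p2 k.
Proof. apply pow_lt; lra. Qed.
Lemma p2_INR k : INR (2 ^ k) = p2 k.
Proof. now rewrite pow_INR. Qed.

Ltac rc := try (unfold Rdiv; repeat first [rewrite <- RtoC_plus | rewrite <- RtoC_mult | rewrite <- RtoC_opp | rewrite <- RtoC_minus]; f_equal; field).
Section Exp.
Variable V : CBanach.
Implicit Types s t u A : bop V V.
Lemma pow_close A B M n : 1 <= M -> nm A <= M -> nm B <= M -> nm (bpow A n -v bpow B n) <= INR n * M ^ n * nm (A -v B).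
Proof.
 intros HM HA HB. induction n. rewrite vaddN, nm0. simpl. lra.
 replace (bpow A (S n) -v bpow B (S n)) with (A ** (bpow A n -v bpow B n) +v (A -v B) ** bpow B n).
 2: { bext x. cbn [bpow]. bring. }
 le_by nm_tri. rewrite S_INR. cbn [pow].
 have E1 := nm_comp_le HA IHn. have E2 := @nm_comp_le _ _ _ (A -v B) (bpow B n) _ (M ^ n) (Rle_refl _).
 have H : nm (bpow B n) <= M ^ n. { le_by bpow_nm. apply pow_incr. split; auto. apply nm_ge0. }
 specialize (E2 H). assert (0 < M ^ n) by triv. have D := nm_ge0 (A -v B).
 assert (nm (A -v B) * M ^ n <= M * M ^ n * nm (A -v B)). { assert (M ^ n * nm (A -v B) <= M * (M ^ n * nm (A -v B))). le_mid (1 * (M ^ n * nm (A -v B))). lra. triv. lra. }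
 lra.
Qed.
(** Exponents 2^k, because consecutive approximants are then powers of the same order of two
    operators that agree to second order, one of them a square. *)
Definition ea (k : nat) t : bop V V := bpow (bid V +v RtoC (/ p2 k) *v t) (2 ^ k).
Lemma lin_nm (c : C) t : nm (bid V +v c *v t) <= exp (Cmod c * nm t).
Proof.
 le_by nm_tri. rewrite nm_scal. have A := nm_id V. have B := exp_lin (Cmod c * nm t). lra.
Qed.
Lemma inv_p2_mod k : Cmod (RtoC (/ p2 k)) = / p2 k.
Proof. rewrite Cmod_R, Rabs_pos_eq; auto. left. apply inv_gt0, p2_pos. Qed.
(** A discrepancy of second order per factor, accumulated over 2^k factors, is of first order. All
    the limit formulas for exponentials rest on this estimate. *)
Lemma pow_close2 A B c d k : 0 <= c -> nm A <= exp (/ p2 k * c) -> nm B <= exp (/ p2 k * c) ->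
 nm (A -v B) <= d * (/ p2 k * / p2 k) -> nm (bpow A (2 ^ k) -v bpow B (2 ^ k)) <= exp c * d * (1/2) ^ k.
Proof.
 intros Hc HA HB Hd. have Hp := p2_pos k. have Hi : 0 < / p2 k by triv.
 eapply Rle_trans. apply pow_close with (M := exp (/ p2 k * c)); auto. apply exp_ge1. nra.
 rewrite exp_pow, p2_INR. replace (p2 k * (/ p2 k * c)) with c by (field; lra).
 replace ((1/2) ^ k) with (/ p2 k) by (unfold p2; rewrite <- pow_inv; f_equal; field).
 le_mid (p2 k * exp c * (d * (/ p2 k * / p2 k))).
 apply mul_le_l; auto. left. triv.
 right. field. lra.
Qed.
Lemma ea_step k t : nm (ea (S k) t -v ea k t) <= exp (nm t) * (nm t * nm t / 4) * (1/2)^k.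
Proof.
 unfold ea. replace (2 ^ S k)%nat with (2 * 2 ^ k)%nat by (simpl; lia). rewrite bpow_mul.
 set (h := / p2 k). have Hh : / p2 (S k) = h / 2. { unfold h, p2. cbn [pow]. field. apply pow_nonzero; lra. }
 have Hp := p2_pos k.
 apply pow_close2. apply nm_ge0.
 - le_by bpow_nm. le_by pow_incr. split. apply nm_ge0. apply lin_nm.
  rewrite exp_pow. right. f_equal. rewrite inv_p2_mod, Hh. simpl INR. fold h. field.
 - le_by lin_nm. unfold h. rewrite inv_p2_mod. lra.
 - fold h. rewrite Hh.
  replace (bpow (bid V +v RtoC (h/2) *v t) 2 -v (bid V +v h *v t)) with (RtoC (h * h / 4) *v (t ** t)).
  + rewrite nm_scal, Cmod_R, Rabs_pos_eq by nra. have B := nm_comp t t. 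
  nra.
  + bext x. cbn [bpow]. bpush. vreduce. 
  repeat split; rc.
Qed.
Lemma geo_lim (W : CBanach) (u : nat -> W) l M : (forall n, nm (u (S n) -v u n) <= M * (1/2)^n) -> cv u l ->
 forall n, nm (u n -v l) <= 2 * M * (1/2)^n.
Proof.
 intros H Hl n. rewrite nm_subC.
 have A : forall k, nm (u (k + n)%nat -v u n) <= 2 * M * (1/2)^n - 2 * M * (1/2)^(k+n).
 { induction k; cbn [Nat.add pow]. rewrite vaddN, nm0. lra.
  have B := nm_sub_tri (u (S (k+n))) (u (k+n)%nat) (u n).
  specialize (H (k+n)%nat). lra. }
 apply cv_nm_le with (fun k => u (k + n)%nat -v u n).
 - apply cv_plus. apply (proj1 (cv_shift u l n) Hl). apply cv_const.
 - exists O. intros k _. specialize (A k). have B := nm_ge0 (u (S O) -v u O). specialize (H O).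
  assert (0 <= (1/2)^(k+n)) by triv. nra.
Qed.
Definition bexp t : bop V V := epsilon (inhabits t) (fun e => cv (fun k => ea k t) e).
Lemma bexpP t : cv (fun k => ea k t) (bexp t).
Proof.
 unfold bexp. apply epsilon_spec. apply (@cv_cauchy (BL V)). 
 apply (@geo_cauchy (BL V)) with (exp (nm t) * (nm t * nm t / 4)). intros n. apply ea_step.
Qed.
Lemma ea_bexp k t : nm (ea k t -v bexp t) <= exp (nm t) * (nm t * nm t / 2) * (1/2) ^ k.
Proof.
 le_by (@geo_lim (BL V) (fun k => ea k t) (bexp t) (exp (nm t) * (nm t * nm t / 4))).
 intros n; apply ea_step. apply bexpP. nra.
Qed.
Lemma cv_half (W : CBanach) (u v : nat -> W) l M : (forall k, nm (u k -v v k) <= M * (1/2)^k) -> cv v l -> cv u l.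
Proof.
 intros H Hv. apply cv_ext with (fun k => (u k -v v k) +v v k). intros; vring.
 replace l with (0v +v l) by vring. apply cv_plus; auto.
 apply cv_le with (fun k => M * (1/2)^k). intros n. replace (u n -v v n -v 0v) with (u n -v v n) by vring. auto.
 intros eps He. now apply pow_half_small.
Qed.
Lemma bexp_add s t : comm s t -> bexp (s +v t) = bexp s ** bexp t.
Proof.
 intros Hc. apply (@cv_unique (BL V) (fun k => ea k s ** ea k t)). 2: apply cv_comp; apply bexpP.
 apply (@cv_half (BL V)) with (v := fun k => ea k (s +v t)) (M := exp (nm s + nm t) * (nm s * nm t)). 2: apply bexpP.
 intros k. unfold ea. rewrite <- bpow_comp.
 2: { apply comm_add. bring. apply comm_scal. apply comm_sym, comm_add. bring. apply comm_scal, comm_sym, Hc. }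
 have Hp := p2_pos k. have Hi : 0 < / p2 k by triv.
 have A1 := nm_ge0 s. have A2 := nm_ge0 t.
 apply pow_close2. lra.
 - eapply Rle_trans. apply nm_comp_le; apply lin_nm. rewrite inv_p2_mod, <- exp_plus. right. f_equal. ring.
 - le_by lin_nm. rewrite inv_p2_mod. apply exp_le. apply mul_le_l. lra. apply nm_tri.
 - replace ((bid V +v RtoC (/ p2 k) *v s) ** (bid V +v RtoC (/ p2 k) *v t) -v (bid V +v RtoC (/ p2 k) *v (s +v t)))
  with ((RtoC (/ p2 k) * RtoC (/ p2 k))%C *v (s ** t)) by (apply bop_ext; intros; bpush; vring).
  rewrite nm_scal, Cmod_mult, inv_p2_mod. have B := nm_comp s t.
  nra.
Qed.
Lemma bexp_0 : bexp 0v = bid V.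
Proof.
 apply (@cv_unique (BL V) (fun k => ea k 0v)). apply bexpP.
 apply cv_ext with (fun _ => bid V). intros k. unfold ea.
 replace (bid V +v RtoC (/ p2 k) *v 0v) with (bid V) by (apply bop_ext; intros; bpush; vring). now rewrite bpow_id.
 apply (@cv_const (BL V)).
Qed.
Lemma bexp_inv t : inv_of (bexp t) (bexp (-v t)).
Proof.
 split; rewrite <- bexp_add.
 rewrite vaddN. apply bexp_0. bring.
 rewrite vaddC, vaddN. apply bexp_0. bring.
Qed.
Lemma pow_lin u m : nm (bpow (bid V +v u) m -v bid V -v RtoC (INR m) *v u) <= INR m * INR m * (nm u * nm u) * exp (INR m * nm u).
Proof.
 induction m. cbn [bpow INR]. replace (bid V -v bid V -v 0 *v u) with (0v : bop V V) by (apply bop_ext; intros; bpush; vring).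
 rewrite nm0. lra.
 replace (bpow (bid V +v u) (S m) -v bid V -v RtoC (INR (S m)) *v u) with
  ((bid V +v u) ** (bpow (bid V +v u) m -v bid V -v RtoC (INR m) *v u) +v RtoC (INR m) *v (u ** u)).
 2: { apply bop_ext; intros. cbn [bpow]. rewrite S_INR, RtoC_plus. bring. }
 have Hu := nm_ge0 u. have Hm := pos_INR m.
 le_by nm_tri. rewrite nm_scal, Cmod_R, Rabs_pos_eq by auto. have B := nm_comp u u.
 have H1 : nm (bid V +v u) <= exp (nm u). { have B1 := nm_tri (bid V) u. have B2 := nm_id V. have B3 := exp_lin (nm u). lra. }
 have H2 := nm_comp_le H1 IHm. set (E := exp (INR m * nm u)) in *.
 have HE : exp (INR (S m) * nm u) = exp (nm u) * E. { unfold E. rewrite <- exp_plus, S_INR. f_equal. ring. }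
 rewrite HE, S_INR. have HE1 : 1 <= E by (apply exp_ge1; nra). have He1 : 1 <= exp (nm u) by now apply exp_ge1.
 have H4 : INR m * (nm u * nm u) <= INR m * (nm u * nm u) * (exp (nm u) * E).
 { rewrite <- (Rmult_1_r (INR m * (nm u * nm u))) at 1. apply mul_le_l; nra. }
 assert (0 <= (INR m + 1) * (nm u * nm u) * (exp (nm u) * E)) by triv.
 nra.
Qed.
Lemma bexp_lin t : nm (bexp t -v bid V -v t) <= nm t * nm t * exp (nm t).
Proof.
 apply cv_nm_le with (fun k => ea k t -v bid V -v t).
 { apply (@cv_plus (BL V) (fun k => ea k t -v bid V) (fun _ => -v t)). 
  apply (@cv_plus (BL V) (fun k => ea k t) (fun _ => -v (bid V))). apply bexpP. apply (@cv_const (BL V)). apply (@cv_const (BL V)). }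
 exists O. intros k _. have Hp := p2_pos k.
 have A := pow_lin (RtoC (/ p2 k) *v t) (2 ^ k). rewrite p2_INR in A.
 replace (RtoC (p2 k) *v (RtoC (/ p2 k) *v t)) with t in A.
 2: { rewrite vsA, <- RtoC_mult, Rinv_r, vs1; auto. lra. }
 le_by A. rewrite nm_scal, inv_p2_mod. right.
 replace (p2 k * (/ p2 k * nm t)) with (nm t) by (field; lra). field. lra.
Qed.
Lemma bexp_close1 t : nm (bexp t -v bid V) <= nm t * exp (2 * nm t).
Proof.
 replace (bexp t -v bid V) with ((bexp t -v bid V -v t) +v t) by (apply bop_ext; intros; bpush; vring).
 have A := nm_tri (bexp t -v bid V -v t) t. have B := bexp_lin t. have D := nm_ge0 t.
 replace (2 * nm t) with (nm t + nm t) by ring. rewrite exp_plus.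
 have E := exp_lin (nm t).
 assert (nm t * exp (nm t) + 1 <= exp (nm t) * exp (nm t)) by nra. nra.
Qed.
Lemma bexp_sub (W : V -> Prop) t : vsubspace W -> vclosed W -> (forall x, W x -> W (t x)) -> forall x, W x -> W (bexp t x).
Proof.
 intros HW HC H x Hx. apply HC with (fun k => ea k t x). 2: apply cv_app2, bexpP.
 intros k. unfold ea. generalize (2 ^ k)%nat. intros n. revert x Hx. induction n; intros x Hx; auto.
 rewrite bpow_S, bmA. apply IHn. bpush. apply HW; auto. apply HW; auto.
Qed.
Lemma vsum_shift (W : CBanach) n (f : nat -> W) : vsum (S n) f = f O +v vsum n (fun k => f (S k)).
Proof. induction n. cbn [vsum]. vring. cbn [vsum] in *. rewrite IHn. vring. Qed.
(** Displays the power as a polynomial in [w], so that averaging over roots of unity can extract the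
    linear coefficient n A. *)
Lemma pow_poly A n : exists B : nat -> bop V V, B O = bid V /\ B 1%nat = RtoC (INR n) *v A /\ (forall j, (n < j)%nat -> B j = 0v) /\
 forall w N, (n < N)%nat -> vsum N (fun j => cpow w j *v B j) = bpow (bid V +v w *v A) n.
Proof.
 induction n.
 - exists (fun j => match j with O => bid V | _ => 0v end). split; [|split; [|split]]; auto.
  + symmetry. apply vs0l.
  + intros j Hj. destruct j; [lia|auto].
  + intros w N HN. destruct N; [lia|]. rewrite vsum_shift. rewrite (vsum_ext (g := fun _ => 0v)), vsum_0.
  cbn [cpow bpow]. vring. bring.
 - destruct IHn as [B [B0 [B1 [Bz BE]]]].
  exists (fun j => match j with O => bid V | S j' => B j +v A ** B j' end). split; [|split; [|split]]; auto.
  + rewrite B1, B0, S_INR, RtoC_plus. bring.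
  + intros j Hj. destruct j; [lia|]. rewrite !Bz by lia. bring.
  + intros w N HN. destruct N; [lia|]. rewrite vsum_shift.
  rewrite (vsum_ext (g := fun k => cpow w (S k) *v B (S k) +v (w *v A) ** (cpow w k *v B k))).
  2: { intros k Hk. cbn [cpow]. bring. }
  rewrite vsum_add. cbn [bpow]. rewrite <- (BE w (S N)) by lia. 
  have E : vsum (S N) (fun j => cpow w j *v B j) = vsum N (fun j => cpow w j *v B j).
  { cbn [vsum]. rewrite (Bz N) by lia. vring. }
  have E2 : vsum N (fun k => (w *v A) ** (cpow w k *v B k)) = (w *v A) ** vsum N (fun k => cpow w k *v B k).
  { bext x. rewrite bmA, !vsum_app2, (vsum_app (w *v A)). triv. }
  rewrite E2, <- E, vsum_shift, B0. bring.
Qed.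
(* Cauchy's formula for the linear coefficient, with an average over roots of unity for the contour. *)
Lemma bexp_extract A R eps : 0 < R -> 0 < eps -> exists N, (0 < N)%nat /\
 nm (RtoC (/ (INR N * R)) *v vsum N (fun k => cpow (cpow (rou N) k) (N - 1) *v bexp ((RtoC R * cpow (rou N) k)%C *v A)) -v A) <= eps.
Proof.
 intros HR He. set (c := R * nm A).
 destruct (pow_half_small (exp c * (c * c / 2)) (eps := eps * R)) as [k Hk]. nra. specialize (Hk k (le_n _)).
 set (n := (2 ^ k)%nat). have Hn : (0 < n)%nat by (unfold n; assert (D := Nat.pow_nonzero 2 k); lia).
 exists (S n). split. lia. set (N := S n). have HN : 0 < INR N by triv.
 destruct (pow_poly (RtoC (R / p2 k) *v A) n) as [B [_ [B1 [_ BE]]]].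
 have E := @rou_avg (BL V) N 1 B ltac:(unfold N; lia). rewrite B1 in E.
 replace (RtoC (INR n) *v (RtoC (R / p2 k) *v A)) with (R *v A) in E.
 2: { rewrite vsA, <- RtoC_mult. f_equal. unfold n. rewrite p2_INR. f_equal. have D := p2_pos k. field. lra. }
 set (w := fun k => cpow (rou N) k) in *.
 rewrite (vsum_ext (g := fun k0 => cpow (w k0) (N - 1) *v ea k ((RtoC R * w k0)%C *v A))) in E.
 2: { intros j Hj. f_equal. rewrite (BE (w j) N) by (unfold N; lia). unfold ea. f_equal.
  unfold Rdiv. rewrite RtoC_mult. vring. }
 assert (E' : A = RtoC (/ (INR N * R)) *v vsum N (fun k0 => cpow (w k0) (N - 1) *v ea k ((RtoC R * w k0)%C *v A))).
 { rewrite E, !vsA, <- !RtoC_mult. match goal with |- _ = vscal _ (RtoC ?t) _ => replace t with 1 by (field; lra) end. vring. }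
 match goal with |- nm (?T -v _) <= _ => match type of E' with _ = ?U => replace (T -v A) with (T -v U) by (now rewrite <- E') end end.
 replace (RtoC (/ (INR N * R)) *v vsum N (fun k0 => cpow (w k0) (N - 1) *v bexp ((RtoC R * w k0)%C *v A)) -v RtoC (/ (INR N * R)) *v vsum N (fun k0 => cpow (w k0) (N - 1) *v ea k ((RtoC R * w k0)%C *v A)))
 with (RtoC (/ (INR N * R)) *v vsum N (fun k0 => cpow (w k0) (N - 1) *v bexp ((RtoC R * w k0)%C *v A) +v (-1)%C *v (cpow (w k0) (N - 1) *v ea k ((RtoC R * w k0)%C *v A)))).
 2: { rewrite vsum_add, vsum_scal. vring. }
 rewrite nm_scal, Cmod_R, Rabs_pos_eq by (left; apply inv_gt0; nra).
 apply Rmult_le_reg_l with (INR N * R). nra. rewrite <- Rmult_assoc, Rinv_r, Rmult_1_l by nra.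
 replace (INR N * R * eps) with (INR N * (eps * R)) by ring. apply vsum_nm. intros j Hj.
 replace (cpow (w j) (N - 1) *v bexp ((RtoC R * w j)%C *v A) +v (-1)%C *v (cpow (w j) (N - 1) *v ea k ((RtoC R * w j)%C *v A)))
  with (cpow (w j) (N - 1) *v (bexp ((RtoC R * w j)%C *v A) -v ea k ((RtoC R * w j)%C *v A))) by vring.
 have Hw : Cmod (w j) = 1 by (unfold w; now rewrite cpow_mod, rou_mod, pow1).
 rewrite nm_scal, cpow_mod, Hw, pow1, Rmult_1_l, nm_subC.
 le_by ea_bexp.
 have Ht : nm ((RtoC R * w j)%C *v A) = c. { rewrite nm_scal, Cmod_mult, Hw, Cmod_R, Rabs_pos_eq by lra. unfold c. ring. }
 rewrite Ht. lra.
Qed.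
End Exp.
Lemma bexp_intertw (V W : CBanach) (A : bop V W) s t : A ** s = t ** A -> A ** bexp s = bexp t ** A.
Proof.
 intros H. apply (@cv_unique (BLH V W) (fun k => A ** ea k s)). apply cv_comp. apply cv_const. apply bexpP.
 apply cv_ext with (fun k => ea k t ** A). 2: { apply cv_comp. apply bexpP. apply cv_const. }
 intros k. unfold ea. generalize (2 ^ k)%nat. induction n; cbn [bpow]. bring.
 rewrite <- bcA, IHn, !bcA. f_equal. bext x. apply (f_equal (fun f => bf f x)) in H.
 revert H. bpush. intros ->. triv.
Qed.

(** * Compact operators *)

Definition cpt (V W : CBanach) (K : bop V W) := forall u, (forall n, nm (u n) <= 1) -> prec (fun n => K (u n)).

Lemma cv_prec V (u : nat -> V) : (forall p, incr p -> exists q l, incr q /\ cv (fun n => u (p (q n))) l) -> prec u.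
Proof.
 intros H eps p He Hp. destruct (H p Hp) as [q [l [Hq Hl]]]. apply cauchy_cv in Hl.
 destruct (cauchy_close Hl He) as [s [Hs HS]]. exists (fun n => q (s n)). split; auto. now apply incr_comp.
Qed.
Lemma prec_scal V (c : C) (u : nat -> V) : prec u -> prec (fun n => c *v u n).
Proof.
 intros H. apply cv_prec. intros p Hp. destruct (prec_cv (prec_sub H Hp)) as [q [l [Hq Hl]]].
 exists q, (c *v l). split; auto. apply cv_scal with (u := fun n => u (p (q n))). triv.
Qed.
Lemma prec_add V (u v : nat -> V) : prec u -> prec v -> prec (fun n => u n +v v n).
Proof.
 intros H H'. apply cv_prec. intros p Hp. destruct (prec_cv (prec_sub H Hp)) as [q [l [Hq Hl]]].
 destruct (prec_cv (prec_sub H' (incr_comp Hp Hq))) as [q' [l' [Hq' Hl']]].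
 exists (fun n => q (q' n)), (l +v l'). split. now apply incr_comp.
 apply (@cv_plus V (fun n => u (p (q (q' n)))) (fun n => v (p (q (q' n)))) l l'); auto.
 apply (@cv_sub V (fun n => u (p (q n))) l q'); auto.
Qed.
Lemma prec_bop (V W : CBanach) (f : bop V W) u : prec u -> prec (fun n => f (u n)).
Proof.
 intros H. apply cv_prec. intros p Hp. destruct (prec_cv (prec_sub H Hp)) as [q [l [Hq Hl]]].
 exists q, (f l). split; auto. apply (@cv_app V W f (fun n => u (p (q n)))). triv.
Qed.
Lemma prec_approx V (u : nat -> V) : (forall eps, 0 < eps -> exists v, prec v /\ forall n, nm (u n -v v n) <= eps) -> prec u.
Proof.
 intros H eps p He Hp. destruct (H (eps / 3)) as [v [Hv Hc]]. lra.
 destruct (Hv (eps / 3) p ltac:(lra) Hp) as [q [Hq HQ]]. exists q. split; auto. intros i j.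
 have A := Hc (p (q i)). have B := Hc (p (q j)). specialize (HQ i j).
 rewrite nm_subC in B. have D := nm_sub_tri (u (p (q i))) (v (p (q i))) (u (p (q j))).
 assert (D' := nm_sub_tri (v (p (q i))) (v (p (q j))) (u (p (q j)))). lra.
Qed.

Section Cpt.
Variables U V W : CBanach.
Implicit Types K : bop V W.
Lemma cpt_prec K u M : cpt K -> (forall n, nm (u n) <= M) -> prec (fun n => K (u n)).
Proof.
 intros H Hu. have HM : 0 <= M by (eapply Rle_trans; [apply nm_ge0|apply (Hu O)]).
 have P : prec (fun n => K (RtoC (/ (M + 1)) *v u n)).
 { apply H. intros n. rewrite nm_scal, Cmod_R, Rabs_pos_eq by (left; apply inv_gt0; lra).
  apply Rmult_le_reg_l with (M + 1). lra. rewrite <- Rmult_assoc, Rinv_r, Rmult_1_l by lra. specialize (Hu n). lra. }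
 apply (prec_scal (RtoC (M + 1))) in P.
 replace (fun n => K (u n)) with (fun n => RtoC (M + 1) *v K (RtoC (/ (M + 1)) *v u n)); auto.
 fext n. rewrite bZ, vsA, <- RtoC_mult, Rinv_r, vs1 by lra. auto.
Qed.
Lemma cpt_cv K u M : cpt K -> (forall n, nm (u n) <= M) -> exists p l, incr p /\ cv (fun n => K (u (p n))) l.
Proof. intros H Hu. destruct (prec_cv (cpt_prec H Hu)) as [p [l [Hp Hl]]]. exists p, l; auto. Qed.
Lemma cpt_zero : cpt (0v : bop V W).
Proof.
 intros u _. apply cv_prec. intros p _. exists (fun n => n), 0v. split. apply incr_id.
 apply cv_ext with (fun _ => 0v). intros; now rewrite b0A. apply cv_const.
Qed.
Lemma cpt_add K K' : cpt K -> cpt K' -> cpt (K +v K').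
Proof.
 intros H H' u Hu. replace (fun n => (K +v K') (u n)) with (fun n => K (u n) +v K' (u n)). apply prec_add; auto.
 triv.
Qed.
Lemma cpt_scal (c : C) K : cpt K -> cpt (c *v K).
Proof.
 intros H u Hu. replace (fun n => (c *v K) (u n)) with (fun n => c *v K (u n)). apply prec_scal; auto.
 triv.
Qed.
Lemma cpt_opp K : cpt K -> cpt (-v K).
Proof. intros H. rewrite voppE. now apply cpt_scal. Qed.
Lemma cpt_minus K K' : cpt K -> cpt K' -> cpt (K -v K').
Proof. intros. apply cpt_add; auto. now apply cpt_opp. Qed.
Lemma cpt_lim (u : nat -> bop V W) K : (forall n, cpt (u n)) -> cv u K -> cpt K.
Proof.
 intros H Hc x Hx. apply prec_approx. intros eps He. destruct (Hc eps He) as [N HN].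
 exists (fun n => u N (x n)). split. now apply H. intros n.
 replace (K (x n) -v u N (x n)) with ((K -v u N) (x n)) by (bpush; vring).
 eapply Rle_trans. apply nm_app1; auto. rewrite nm_subC. left; apply HN; lia.
Qed.
Lemma cpt_compl (B : bop V W) (K : bop U V) : cpt K -> cpt (B ** K).
Proof.
 intros H u Hu. replace (fun n => (B ** K) (u n)) with (fun n => B (K (u n))). apply prec_bop; auto.
 triv.
Qed.
Lemma cpt_compr (K : bop V W) (B : bop U V) : cpt K -> cpt (K ** B).
Proof.
 intros H u Hu. replace (fun n => (K ** B) (u n)) with (fun n => K (B (u n))).
 apply cpt_prec with (nm B); auto. intros; now apply nm_app1.
 triv.
Qed.
End Cpt.
Section Cpt2.
Variable V : CBanach.
(** Without a finite net, points whose images are pairwise more than [eps] apart could be chosen one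
    after another, against precompactness. *)
Lemma cpt_net (W : CBanach) (K : bop V W) eps : cpt K -> 0 < eps ->
 exists l : list W, forall x, nm x <= 1 -> exists y, In y l /\ nm (K x -v y) <= eps.
Proof.
 intros H He. contra Hn.
 have Hs : forall l : list W, exists x, nm x <= 1 /\ forall y, In y l -> eps < nm (K x -v y).
 { intros l. contra Hl. apply Hn. exists l. intros x Hx. contra Hy. apply Hl.
  exists x. split; auto. intros y Iy. apply Rnot_le_lt. intros Hle. apply Hy. exists y; auto. }
 destruct (fun_choice Hs) as [F HF].
 pose (L := fix L n := match n with O => nil | Datatypes.S n => K (F (L n)) :: L n end).
 have HL : forall m n, (n < m)%nat -> In (K (F (L n))) (L m).
 { induction m; intros n Hnm. lia. simpl. destruct (Nat.eq_dec n m). subst; auto. right. apply IHm. lia. }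
 destruct (H (fun n => F (L n)) (fun n => proj1 (HF (L n))) eps (fun n => n) He incr_id) as [q [Hq HQ]].
 specialize (HQ 1%nat 0%nat). destruct (HF (L (q 1%nat))) as [_ B]. specialize (B _ (HL (q 1%nat) (q O) (Hq O))). lra.
Qed.
Lemma cpt_sub (Y : V -> Prop) (HS : vsubspace Y) (HC : vclosed Y) (K : bop V V) (K' : bop (subB HS HC) (subB HS HC)) :
 cpt K -> (forall x, sinc HS HC (K' x) = K (sinc HS HC x)) -> cpt K'.
Proof.
 intros H E u Hu eps p He Hp. have Hn : forall n, nm (sinc HS HC (u n)) <= 1 by auto.
 destruct (H _ Hn eps p He Hp) as [q [Hq HQ]].
 exists q; split; auto. intros i j. rewrite <- sinc_nm, bD, bN, !E. triv.
Qed.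
Lemma cpt_quo (Y : V -> Prop) (HS : vsubspace Y) (HC : vclosed Y) (K : bop V V) (K' : bop (quoB HS HC) (quoB HS HC)) :
 cpt K -> (forall x, K' (quo HS HC x) = quo HS HC (K x)) -> cpt K'.
Proof.
 intros H E u Hu. destruct (fun_choice (fun n => quo_lift (u n) (Rlt_0_1))) as [v Hv].
 replace (fun n => K' (u n)) with (fun n => quo HS HC (K (v n))).
 apply prec_bop. apply cpt_prec with 2; auto. intros n. destruct (Hv n) as [_ B]. specialize (Hu n). lra.
 fext n. destruct (Hv n) as [<- _]. triv.
Qed.
(** The interface to quotients used from here on. The construction is hidden behind an existential,
    and induced operators are described by intertwining identities with the quotient map. *)
Lemma quotient (Y : V -> Prop) : vsubspace Y -> vclosed Y -> exists (E : CBanach) (q : bop V E),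
 (forall y, exists x, q x = y) /\ (forall x, q x = 0v <-> Y x) /\
 (forall (U : CBanach) (f : bop V U), (forall x, Y x -> f x = 0v) -> exists g : bop E U, g ** q = f) /\
 (forall T : bop V V, (forall x, Y x -> Y (T x)) -> exists T' : bop E E, T' ** q = q ** T) /\
 (forall (K : bop V V) (K' : bop E E), cpt K -> K' ** q = q ** K -> cpt K') /\ (forall x, nm (q x) = vdist Y x) /\
 (forall (y : E) eps, 0 < eps -> exists x, q x = y /\ nm x < nm y + eps).
Proof.
 intros HS HC. exists (quoB HS HC), (quo HS HC). split; [|split; [|split; [|split; [|split; [|split]]]]].
 - intros y. destruct (quo_surj y) as [x <-]. exists x; auto.
 - intros x. apply quo_eq0.
 - intros U f Hf. destruct (@quo_factor _ _ HS HC U f Hf) as [g [Hg _]]. exists g. bext x. now rewrite bmA.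
 - intros T HT. destruct (@quo_ind _ _ HS HC T HT) as [g [Hg _]]. exists g. bext x. now rewrite !bmA.
 - intros K K' HK E. apply (cpt_quo HK). intros x. rewrite <- !bmA. now rewrite E.
 - intros x. apply quo_nm.
 - intros y eps He. apply (quo_lift y He).
Qed.
(* Subsequences that are almost constant at each point of a finite net of [k2] are almost constant in norm after composing. *)
Lemma cpt_sandwich (k1 k2 : bop V V) (B : nat -> bop V V) M : cpt k1 -> cpt k2 -> (forall n, nm (B n) <= M) ->
 prec (fun n => k1 ** B n ** k2).
Proof.
 intros H1 H2 HB eps p He Hp. have HM : 0 <= M by (eapply Rle_trans; [apply nm_ge0|apply (HB O)]).
 have Hk := nm_ge0 k1. set (D := 4 * (nm k1 * M + 1)). have HD : 0 < D by (unfold D; nra).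
 destruct (cpt_net H2 (eps := eps / D)) as [l Hl]. triv.
 have Hf : exists q, incr q /\ forall y, In y l -> forall i j, nm (k1 (B (p (q i)) y) -v k1 (B (p (q j)) y)) <= eps / 2.
 { clear Hl. induction l as [|y l IH]. exists (fun n => n). split. apply incr_id. intros y [].
  destruct IH as [q [Hq HQ]].
  have P : prec (fun n => k1 (B n y)).
  { apply cpt_prec with (M * nm y); auto. intros n. le_by nm_app. apply mul_le_r; auto. apply nm_ge0. }
  destruct (P (eps / 2) (fun n => p (q n)) ltac:(lra) (incr_comp Hp Hq)) as [s [Hs HSs]].
  exists (fun n => q (s n)). split. now apply incr_comp. intros y' [<-|Iy] i j. triv. triv. }
 destruct Hf as [q [Hq HQ]]. exists q. split; auto. intros i j. apply nm_le1. intros x Hx.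
 destruct (Hl x Hx) as [y [Iy Hy]]. specialize (HQ y Iy i j).
 have T : forall n, nm (k1 (B n (k2 x -v y))) <= nm k1 * M * (eps / D).
 { intros n. le_by nm_app. rewrite Rmult_assoc. apply mul_le_l; auto.
  le_by nm_app. specialize (HB n). have E := nm_ge0 (B n). assert (E' := nm_ge0 (k2 x -v y)). nra. }
 have Tq : nm k1 * M * (eps / D) <= eps / 4.
 { clear HQ T. set (t := nm k1 * M) in *. replace (t * (eps / D)) with (eps / 4 * (t * (4 / D))) by (field; lra).
  have E : t * (4 / D) <= 1. { apply Rmult_le_reg_r with D; auto. replace (t * (4 / D) * D) with (4 * t) by (field; lra). unfold D. lra. }
  nra. }
 have T1 := T (p (q i)). have T2 := T (p (q j)). bpush.
 replace (k1 (B (p (q i)) (k2 x)) -v k1 (B (p (q j)) (k2 x))) with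
  (k1 (B (p (q i)) y) -v k1 (B (p (q j)) y) +v (k1 (B (p (q i)) (k2 x -v y)) -v k1 (B (p (q j)) (k2 x -v y)))) by (bpush; vring).
 le_by nm_tri. have T3 := nm_sub_le T1 T2. lra.
Qed.
End Cpt2.

(** * Spectral radius of a scalar plus a compact operator *)

Section Low.
Variable V : CBanach.
(** If there were no uniform bound, unit vectors y_n with y_n - z_n A y_n tending to 0 would exist.
    Compactness of K and of the closed bounded parameter set makes them converge along a
    subsequence, to a unit vector solving x = z A x. *)
Lemma LOW (al : C) (K : bop V V) (Zs : C -> Prop) M : cpt K -> (forall z, Zs z -> Cmod z <= M) ->
 (forall (z : nat -> C) l, (forall n, Zs (z n)) -> (forall eps, 0 < eps -> exists N, forall n, (N <= n)%nat -> Cmod (z n - l)%C < eps) -> Zs l) ->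
 (forall z, Zs z -> (1 - z * al)%C <> 0%C) ->
 (forall z x, Zs z -> x = z *v ((al *v bid V +v K) x) -> x = 0v) ->
 exists c, 0 < c /\ forall z x, Zs z -> c * nm x <= nm (x -v z *v ((al *v bid V +v K) x)).
Proof.
 intros HK HM Hcl Hal Hno. set (A := al *v bid V +v K) in *. contra Hn.
 have Hs : forall n, exists zx : C * V, Zs (fst zx) /\ nm (snd zx) = 1 /\ nm (snd zx -v fst zx *v A (snd zx)) < / INR (S n).
 { intros n. contra Hc. apply Hn. exists (/ INR (S n)). split. triv. intros z x Hz.
  apply Rnot_lt_le. intros Hlt. have Hx : 0 < nm x.
  { destruct (Rle_lt_or_eq_dec _ _ (nm_ge0 x)) as [|E]; auto. have D := nm_ge0 (x -v z *v A x). nra. }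
  apply Hc. exists (z, RtoC (/ nm x) *v x). simpl fst; simpl snd. split; auto.
  have Em : Cmod (RtoC (/ nm x)) = / nm x. { rewrite Cmod_R, Rabs_pos_eq; auto. triv. }
  split. rewrite nm_scal, Em. field; lra.
  replace (RtoC (/ nm x) *v x -v z *v A (RtoC (/ nm x) *v x)) with (RtoC (/ nm x) *v (x -v z *v A x)) by (rewrite bZ; vring).
  rewrite nm_scal, Em. apply Rmult_lt_reg_l with (nm x); auto. rewrite <- Rmult_assoc, Rinv_r, Rmult_1_l by lra. lra. }
 destruct (fun_choice Hs) as [zx Hzx]. set (z := fun n => fst (zx n)). set (y := fun n => snd (zx n)).
 destruct (@C_BW z M) as [p [l [Hp Hl]]]. { intros n. apply HM. apply Hzx. }
 have Zl : Zs l. { apply (Hcl (fun n => z (p n))); auto. intros n. apply Hzx. }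
 destruct (@cpt_cv V V K (fun n => y (p n)) 1 HK) as [q [k [Hq Hk]]]. { intros n. unfold y. destruct (Hzx (p n)) as [_ [-> _]]. lra. }
 set (s := fun n => p (q n)). assert (Hs' : incr s) by exact (incr_comp Hp Hq).
 have HD : cv (fun n => y (s n) -v l *v A (y (s n))) 0v.
 { intros eps He. have HA := nm_ge0 A. destruct (small_inv (eps := eps / 2)) as [N1 HN1]. lra.
  destruct (Hl (eps / (2 * (nm A + 1)))) as [N2 HN2]. triv.
  exists (N1 + N2)%nat. intros n Hn'. destruct (Hzx (s n)) as [_ [E1 E2]]. fold (z (s n)) (y (s n)) in E1, E2.
  have S1 := incr_ge Hs' n. have S2 := incr_ge Hq n.
  specialize (HN1 (s n) ltac:(lia)). specialize (HN2 (q n) ltac:(lia)). change (p (q n)) with (s n) in HN2.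
  replace (y (s n) -v l *v A (y (s n)) -v 0v) with ((y (s n) -v z (s n) *v A (y (s n))) +v (z (s n) - l)%C *v A (y (s n))) by vring.
  eapply Rle_lt_trans. apply nm_tri. rewrite nm_scal. have E3 := nm_app A (y (s n)). rewrite E1, Rmult_1_r in E3.
  have E4 := Cmod_ge_0 (z (s n) - l)%C.
  assert (Cmod (z (s n) - l)%C * nm (A (y (s n))) <= eps / 2).
  { le_mid (Cmod (z (s n) - l)%C * (nm A + 1)). nra.
  left. replace (eps / 2) with (eps / (2 * (nm A + 1)) * (nm A + 1)) by (field; lra). nra. }
  lra. }
 (* Since [1 - l * al] is invertible, y is recovered from y - l A y and l K y, which both
    converge. *)
 set (c := (/ (1 - l * al))%C). set (x := c *v (0v +v l *v k)).
 have Hx : cv (fun n => y (s n)) x.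
 { apply cv_ext with (fun n => c *v ((y (s n) -v l *v A (y (s n))) +v l *v K (y (s n)))).
  - intros n. unfold A, c. bpush. match goal with |- ?t = _ => transitivity ((/ (1 - l * al) * (1 - l * al))%C *v y (s n)) end. vring. rewrite Cinv_l by auto. vring.
  - apply cv_scal with (u := fun n => (y (s n) -v l *v A (y (s n))) +v l *v K (y (s n))). apply (@cv_plus V (fun n => y (s n) -v l *v A (y (s n))) (fun n => l *v K (y (s n))) 0v (l *v k)); auto.
  apply cv_scal with (u := fun n => K (y (s n))). triv. }
 have E : x = l *v A x.
 { apply vsub_eq0. apply (cv_unique (u := fun n => y (s n) -v l *v A (y (s n)))); auto.
  apply (@cv_plus V (fun n => y (s n)) (fun n => -v (l *v A (y (s n)))) x (-v (l *v A x))); auto.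
  apply cv_opp with (u := fun n => l *v A (y (s n))). apply cv_scal with (u := fun n => A (y (s n))). apply (@cv_app V V A (fun n => y (s n))); auto. }
 apply Hno in E; auto. assert (1 <= nm x). { apply (cv_nm_ge Hx). exists O. intros n _. destruct (Hzx (s n)) as [_ [E1 _]]. fold (y (s n)) in E1. lra. }
 rewrite E, nm0 in H. lra.
Qed.

Lemma Cmod_lt1_neq (z : C) : Cmod z < 1 -> (1 - z)%C <> 0%C.
Proof. intros H E. assert (E' : z = 1%C). { replace z with (1 - (1 - z))%C by ring. rewrite E. ring. } rewrite E', Cmod_1 in H. lra. Qed.
Lemma ball_closed (M : R) (z : nat -> C) l : (forall n, Cmod (z n) <= M) ->
 (forall eps, 0 < eps -> exists N, forall n, (N <= n)%nat -> Cmod (z n - l)%C < eps) -> Cmod l <= M.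
Proof.
 intros H Hl. apply le_epsilon. intros eps He. destruct (Hl eps He) as [N HN]. specialize (HN N (le_n _)). specialize (H N).
 replace l with (z N + - (z N - l))%C by ring. le_by Cmod_triangle. rewrite Cmod_opp. lra.
Qed.
Lemma pow_le_2 eta n : 0 <= eta -> INR n * eta <= 1/2 -> (1 + eta) ^ n <= 2.
Proof.
 intros He H. le_mid (exp eta ^ n). apply pow_incr. split. lra. apply exp_lin.
 rewrite exp_pow. le_mid (exp (1/2)). apply exp_le; lra.
 have D := exp_le_3. replace 1 with (1/2 + 1/2) in D by lra. rewrite exp_plus in D. nra.
Qed.
Lemma rb_power (A : bop V V) k t : 0 < t -> nm (A ^^ S k) <= t ^ S k -> rb A t.
Proof.
 intros Ht H. have HA := nm_ge0 A. have Hq : 0 <= nm A / t by triv. apply rb_intro. lra. exists ((nm A / t + 1) ^ S k). intros n. have En := Nat.div_mod_eq n (S k). have Hr := Nat.mod_upper_bound n (S k) ltac:(lia). set (q := (n / S k)%nat) in *. set (r := (n mod S k)%nat) in *. clearbody q r. subst n.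
 rewrite bpow_add, pow_add, bpow_mul, pow_mult. le_by nm_comp. have Q1 : nm ((A ^^ S k) ^^ q) <= (t ^ S k) ^ q. { le_by bpow_nm. apply pow_incr. split; auto. apply nm_ge0. }
 have Q2 : nm (A ^^ r) <= (nm A / t + 1) ^ S k * t ^ r. { le_by bpow_nm. le_mid ((nm A / t + 1) ^ r * t ^ r). rewrite <- Rpow_mult_distr. apply pow_incr. split; auto. replace ((nm A / t + 1) * t) with (nm A + t) by (field; lra). lra. apply mul_le_r. triv. apply Rle_pow. lra. lia. }
 replace ((nm A / t + 1) ^ S k * ((t ^ S k) ^ q * t ^ r)) with ((t ^ S k) ^ q * ((nm A / t + 1) ^ S k * t ^ r)) by ring. apply Rmult_le_compat; auto; apply nm_ge0.
Qed.
(** Boundedness below on a closed disc pushes the spectral radius strictly inside. By [LB_sq] the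
    powers of A/r, with r slightly above t, decay like 1/(m+1), and one power with norm at most 1/4
    is enough to lower the bound. *)
Lemma rb_gap (A : bop V V) c t : 0 < c -> 0 < t -> rb A t -> (forall z x, Cmod z <= / t -> c * nm x <= nm (x -v z *v A x)) -> exists s, 0 < s < t /\ rb A s.
Proof.
 (* [K] is the constant of [LB_sq]. The choice of [m] makes the m-th power of A/r at most 1/4, and
    [eta] = 1/(2m) keeps (1+eta)^m at most 2; the factor 1/4 then pays for (1+eta)^(2m). *)
 intros Hc Ht Hrb H. set (K := 2 / c * ((1 + 2 / c) / c)). destruct (INR_unbounded (4 * K)) as [k Hk]. set (m := S k). set (eta := / (2 * INR m)).
 have Hm : 0 < INR m by triv. have Heta : 0 < eta by (apply inv_gt0; lra). have H2 : (1 + eta) ^ m <= 2. { apply pow_le_2. lra. right. unfold eta. field. lra. }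
 set (r := t * (1 + eta)). have Hr : t < r by (unfold r; nra). have Hri := inv_gt0 r ltac:(lra). set (T := RtoC (/ r) *v A).
 have HT : rb T (/ r * t). { replace (/ r) with (Cmod (RtoC (/ r))) at 1 by (rewrite Cmod_R, Rabs_pos_eq; lra). apply rb_scal; auto; lra. }
 destruct (rb_lt1_small (eps := 1) HT) as [N HN]; try lra. { apply Rmult_lt_reg_l with r. lra. rewrite <- Rmult_assoc, Rinv_r; lra. }
 have Q : INR (S m) * nm (T ^^ m) <= K. { apply Rmult_le_reg_l with (/ INR (S m)). triv. rewrite <- Rmult_assoc, Rinv_l, Rmult_1_l by (apply not_0_INR; lia). apply nm_le.
  apply mul_ge0. left. triv. assert (0 < 2 / c) by triv. apply mul_ge0. lra. nra.
  intros x. have D := @LB_sq V T c (N + m + 2)%nat m x Hc. rewrite Rmult_assoc. apply Rmult_le_reg_l with (INR (S m)). triv. rewrite <- (Rmult_assoc (INR (S m))), Rinv_r, Rmult_1_l by (apply not_0_INR; lia). eapply Rle_trans; [|apply D]. nra.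
  - intros z y Hz. unfold T. rewrite bsA, vsA. apply H. rewrite Cmod_mult, Hz, Rmult_1_l, Cmod_R, Rabs_pos_eq by lra. triv. - lia. - left. apply HN. lia. }
 exists (t / (1 + eta)). have Hs : 0 < t / (1 + eta) by triv. split. split; auto. apply Rlt_div_l; nra. apply rb_power with k; auto. fold m.
 have Hp1 : 0 < (1 + eta) ^ m by triv. unfold Rdiv. rewrite Rpow_mult_distr, pow_inv. apply Rle_div_r; auto.
 unfold T in Q. rewrite bpow_scal, nm_scal, cpow_mod, Cmod_R, Rabs_pos_eq, pow_inv in Q by lra. have Er : r ^ m = t ^ m * (1 + eta) ^ m by apply Rpow_mult_distr. have Hrm : 0 < r ^ m by triv.
 set (a := nm (A ^^ m)) in *. have Ha : 0 <= a by apply nm_ge0. set (y := / r ^ m * a) in *. have Ey : a = y * r ^ m by (unfold y; field; lra). have Hy : 0 <= y by nra.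
 have HSm : 4 * K < INR (S m) by (unfold m; rewrite !S_INR; lra). have Hy4 : y <= 1/4 by (apply Rmult_le_reg_l with (INR (S m)); [apply lt_0_INR; lia|lra]). set (p := (1 + eta) ^ m) in *.
 rewrite Ey, Er. have Hpp : 0 <= p * p <= 4 by nra. have Q2 : y * (p * p) <= 1/4 * 4 by nra. nra.
Qed.
(** Absence of eigenvalues gives, through [LOW], a uniform lower bound on the closed disc of radius
    1/rho. The smallest admissible spectral radius bound cannot then be [rho] or more, as [rb_gap]
    would improve it. *)
Lemma rb_compact (al : C) (K : bop V V) rho : cpt K -> Cmod al < rho ->
 (forall lam x, rho <= Cmod lam -> (al *v bid V +v K) x = lam *v x -> x = 0v) ->
 exists r, 0 < r < rho /\ rb (al *v bid V +v K) r.
Proof.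
 intros HK Ha Hno. have Hr : 0 < rho by (assert (D := Cmod_ge_0 al); lra). set (A := al *v bid V +v K) in *.
 destruct (@LOW al K (fun z => Cmod z <= / rho) (/ rho)) as [c [Hc H]]; auto.
 - intros z l. apply ball_closed.
 - intros z Hz. apply Cmod_lt1_neq. rewrite Cmod_mult. have D := Cmod_ge_0 al.
  apply Rle_lt_trans with (/ rho * Cmod al). nra.
  apply Rmult_lt_reg_l with rho; auto. rewrite <- Rmult_assoc, Rinv_r, Rmult_1_l, Rmult_1_r; lra.
 - intros z x Hz E. destruct (Ceq_dec z 0) as [->|Hz0]. rewrite E, vs0l. auto.
  apply (Hno (/ z)%C). rewrite Cmod_inv by auto. rewrite <- (Rinv_inv rho). apply Rinv_le_contravar; auto. now apply Cmod_gt_0.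
  rewrite E at 2. rewrite vsA, Cinv_l by auto. now rewrite vs1.
 (* [- u] is the infimum of the bounds that are at least [rho]. It is itself a bound, because [rb]
    only quantifies over radii strictly above it; the improved bound must fall below [rho]. *)
 - set (P := fun u => exists t, u = - t /\ rho <= t /\ rb A t). destruct (completeness P) as [u [Hu1 Hu2]].
  { exists (- rho). intros v [t [-> [Ht _]]]. lra. } { exists (- (rho + nm A)), (rho + nm A). split; auto. have D := nm_ge0 A. split. lra. apply rb_nmle. lra. }
  have Hu : u <= - rho. { apply Hu2. intros v [t [-> [Ht _]]]. lra. }
  destruct (@rb_gap A c (- u)) as [s [Hs Hrb]]; auto. lra.
  + intros r0 Hr0. contra Hn. assert (Hc' : u <= - r0). { apply Hu2. intros v [t [-> [Ht Hrt]]]. destruct (Rlt_le_dec t r0). exfalso. apply Hn. triv. lra. } lra.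
  + intros z x Hz. apply H. le_by Hz. triv.
  + exists s. split; auto. split. lra. apply Rnot_le_lt. intros Hle. assert (- s <= u). { apply Hu1. exists s. auto. } lra.
Qed.
Lemma rb_eigen (A : bop V V) r k x : rb A r -> 0 <= r < Cmod k -> A x = k *v x -> x = 0v.
Proof.
 intros H Hk E. have Hk0 : k <> 0%C. { intros E0. rewrite E0, Cmod_0 in Hk. lra. }
 assert (E' : forall n, (((/ k)%C *v A) ^^ n) x = x).
 { induction n; sim. triv. rewrite bmA, IHn, bsA, E, vsA, Cinv_l, vs1; auto. }
 have Hr := rb_scal (c := (/ k)%C) (proj1 Hk) H. rewrite Cmod_inv in Hr by auto.
 apply nm_small0. intros eps He. have Hx := nm_ge0 x.
 destruct (rb_lt1_small (eps := eps / (nm x + 1)) Hr) as [N HN].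
 - apply Rmult_lt_reg_l with (Cmod k). lra. rewrite <- Rmult_assoc, Rinv_r, Rmult_1_l, Rmult_1_r; lra.
 - triv.
 - specialize (HN N (le_n _)). rewrite <- (E' N). le_by nm_app.
  le_mid (eps / (nm x + 1) * (nm x + 1)). apply Rmult_le_compat; try apply nm_ge0; lra. right. field. lra.
Qed.

Lemma ker_sub (W : CBanach) (f : bop V W) : vsubspace (fun x => f x = 0v).
Proof. split; [|split]. apply b0. intros x y E1 E2. now rewrite bD, E1, E2, vadd0r. intros c x E. now rewrite bZ, E, vs0r. Qed.
Lemma ker_closed (W : CBanach) (f : bop V W) : vclosed (fun x => f x = 0v).
Proof. intros u l H Hl. apply (cv_unique (u := fun n => f (u n))). now apply cv_app. apply cv_ext with (fun _ => 0v). intros; now rewrite H. apply cv_const. Qed.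

(** Riesz's lemma supplies almost orthogonal unit vectors y_n in the successive subspaces. For m <
    n, K y_n - K y_m equals k_n (y_n - w) with w in the smaller subspace, so the images stay d/2
    apart, against compactness. This is the chain condition that replaces every later appeal to
    finite dimension. *)
Lemma CH (K : bop V V) (Sn : nat -> V -> Prop) (k : nat -> C) d : cpt K -> 0 < d -> (forall n, d <= Cmod (k n)) ->
 (forall n, vsubspace (Sn n)) -> (forall n, vclosed (Sn n)) -> (forall n x, Sn n x -> Sn (S n) x) ->
 (forall n, exists x, Sn (S n) x /\ ~ Sn n x) -> (forall n x, Sn (S n) x -> Sn n (K x -v k n *v x)) -> False.
Proof.
 intros HK Hd Hk Hs Hc Hi Hx Hm.
 have Hy : forall n, exists y, Sn (S n) y /\ nm y <= 1 /\ forall w, Sn n w -> 1/2 <= nm (y -v w).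
 { intros n. destruct (Hx n) as [x [H1 H2]]. destruct (riesz (Hs n) (Hc n) H2) as [c [w [Hw [_ [E D]]]]].
  exists (c *v (x -v w)). split; [|split; auto; lra]. apply (Hs (S n)). apply vsub_minus; auto. }
 destruct (fun_choice Hy) as [y Hyy].
 destruct (HK y (fun n => proj1 (proj2 (Hyy n))) (d / 4) (fun n => n)) as [q [Hq HQ]]. lra. apply incr_id.
 specialize (HQ 1%nat 0%nat). set (n := q 1%nat) in *. set (m := q 0%nat) in *. have Hmn : (m < n)%nat by apply Hq.
 have Him : forall j i x, (i <= j)%nat -> Sn i x -> Sn j x. { induction j; intros i x Hij H. replace 0%nat with i by lia; auto.
  destruct (Nat.eq_dec i (S j)). subst; auto. apply Hi. apply (IHj i); auto. lia. }
 destruct (Hyy n) as [N1 [N2 N3]]. destruct (Hyy m) as [M1 [M2 M3]].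
 have Hkn := Hk n. have Hk0 : k n <> 0%C. { intros E. rewrite E, Cmod_0 in Hkn. lra. }
 set (w := (/ k n)%C *v (K (y m) -v (K (y n) -v k n *v y n))).
 have Hw : Sn n w. { apply (Hs n). apply vsub_minus; auto. apply Him with (S m). lia.
  replace (K (y m)) with ((K (y m) -v k m *v y m) +v k m *v y m) by vring. apply (Hs (S m)). triv. apply (Hs (S m)); auto. }
 specialize (N3 w Hw).
 have E : K (y n) -v K (y m) = k n *v (y n -v w).
 { unfold w. match goal with |- _ = ?t => transitivity ((1 - k n * / k n)%C *v (k n *v y n) +v (k n * / k n)%C *v (K (y n) -v K (y m))) end.
  rewrite Cinv_r by auto. vring. vring. }
 rewrite E, nm_scal in HQ. nra.
Qed.

Fixpoint ppoly (K : bop V V) (ks : list C) : bop V V := match ks with nil => bid V | k :: ks => ppoly K ks ** (K -v k *v bid V) end.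
Lemma ppoly_comm K ks T : comm T K -> comm T (ppoly K ks).
Proof.
 intros H. induction ks; cbn [ppoly]. bring. apply comm_comp; auto. apply comm_add; auto. bring.
Qed.
Lemma ppoly_inv K ks r : rb K r -> (forall k, In k ks -> r < Cmod k) -> exists B, inv_of (ppoly K ks) B /\ forall T, comm T K -> comm T B.
Proof.
 intros H Hks. induction ks as [|k ks IH]; cbn [ppoly]. exists (bid V). split. apply inv_id. intros; apply comm_id.
 destruct IH as [B [H1 H2]]. intros; apply Hks; now right. destruct (neumann_scal H (Hks k (or_introl eq_refl))) as [B' [H1' H2']].
 exists (B' ** B). split. now apply inv_comp. intros T HT. apply comm_comp; auto.
Qed.
Lemma ppoly_cpt K ks : cpt K -> exists c K', ppoly K ks = c *v bid V +v K' /\ cpt K' /\ ((forall k, In k ks -> k <> 0%C) -> c <> 0%C).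
Proof.
 intros HK. induction ks as [|k ks [c [K' [E [H1 H2]]]]]; cbn [ppoly].
 - exists 1%C, 0v. split. bring. split. apply cpt_zero. intros _. apply C1_nz.
 - exists (- (c * k))%C, (c *v K +v K' ** (K -v k *v bid V)). split; [|split].
  + rewrite E. bring.
  + apply cpt_add. now apply cpt_scal. now apply cpt_compr.
  + intros Hk E0. assert (c * k = 0)%C. { replace (c * k)%C with (- - (c * k))%C by ring. rewrite E0. ring. }
  revert H. apply Cmult_neq_0. apply H2. intros; apply Hk; now right. apply Hk. now left.
Qed.
End Low.

(** * Riesz projections of compact operators and limits of spectral radii *)

Section RieszDec.
Variable V : CBanach.
Implicit Types K : bop V V.
Lemma ppoly_S K k ks x : ppoly K (k :: ks) x = ppoly K ks (K x -v k *v x).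
Proof. triv. Qed.
Lemma ppoly_S' K k ks x : ppoly K (k :: ks) x = K (ppoly K ks x) -v k *v ppoly K ks x.
Proof. rewrite ppoly_S, bD, bN, bZ, (comm_app x (ppoly_comm ks (comm_refl K))). auto. Qed.
(** As long as the kernel of the product can be enlarged by a further factor K - k with |k| at least
    d, the number k is an eigenvalue and is appended. The kernels increase strictly, so [CH] stops
    the process. *)
Lemma RD_list K d : cpt K -> 0 < d -> exists ks : list C,
 (forall k, In k ks -> d <= Cmod k /\ exists x, x <> 0v /\ K x = k *v x) /\
 forall k x, d <= Cmod k -> ppoly K ks (K x -v k *v x) = 0v -> ppoly K ks x = 0v.
Proof.
 intros HK Hd. contra Hn.
 set (G := fun ks => forall k, In k ks -> d <= Cmod k /\ exists x, x <> 0v /\ K x = k *v x).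
 have Hs : forall (n : nat) ks, G ks -> exists ks', G ks' /\ (exists k, ks' = k :: ks /\ d <= Cmod k /\ exists x, ppoly K ks' x = 0v /\ ppoly K ks x <> 0v).
 { intros _ ks HG. contra Hc. apply Hn. exists ks. split; auto. intros k x Hk E. contra Hx. apply Hc.
  exists (k :: ks). split.
  - intros k' [<-|Hi]; auto. split; auto. exists (ppoly K ks x). split; auto. apply vsub_eq0. rewrite <- ppoly_S', ppoly_S. triv.
  - exists k. split; auto. split; auto. exists x. triv. }
 destruct (@dep_choice (list C) G (fun _ ks ks' => exists k, ks' = k :: ks /\ d <= Cmod k /\ exists x, ppoly K ks' x = 0v /\ ppoly K ks x <> 0v) nil) as [L [_ [_ HL]]]; auto. intros k [].
 destruct (fun_choice HL) as [k Hk].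
 apply (@CH V K (fun n x => ppoly K (L n) x = 0v) k d); auto.
 - intros n; apply Hk.
 - intros n. apply ker_sub.
 - intros n. apply ker_closed.
 - intros n x Hx. destruct (Hk n) as [-> _]. rewrite ppoly_S', Hx, b0. vring.
 - intros n. destruct (Hk n) as [_ [_ [x Hx]]]. exists x; auto.
 - intros n x. destruct (Hk n) as [-> _]. triv.
Qed.
(** The Riesz projection onto the eigenvalues of modulus at least [d]. On the quotient by the kernel
    of the polynomial no such eigenvalue is left, so [rb_compact] bounds the induced operator by
    some r < d and the polynomial becomes invertible there. *)
Lemma RD K d : cpt K -> 0 < d -> exists (ks : list C) P r,
 (forall k, In k ks -> d <= Cmod k /\ exists x, x <> 0v /\ K x = k *v x) /\
 P ** P = P /\ (forall T, comm T K -> comm T P) /\ ppoly K ks ** P = 0v /\ 0 < r < d /\ rb (K ** (bid V -v P)) r /\ cpt P.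
Proof.
 intros HK Hd. destruct (RD_list HK Hd) as [ks [Hks Hno]].
 set (N := fun x => ppoly K ks x = 0v). have HS : vsubspace N by apply ker_sub. have HC : vclosed N by apply ker_closed.
 destruct (quotient HS HC) as [E [q [Hsj [Hk0 [Hfac [Hind [Hcp _]]]]]]].
 have HT : forall T, comm T K -> exists T' : bop E E, T' ** q = q ** T.
 { intros T H. apply Hind. intros x Hx. unfold N in *. rewrite <- (comm_app x (ppoly_comm ks H)), Hx. bring. }
 destruct (HT K (comm_refl K)) as [K' HK'].
 have Sq : forall (W : CBanach) (f g : bop E W), f ** q = g ** q -> f = g.
 { intros W f g H. bext y. destruct (Hsj y) as [x <-]. rewrite <- !bmA. now rewrite H. }
 have HKx : forall x, K' (q x) = q (K x) by (intros; rewrite <- !bmA; now rewrite HK').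
 assert (HK'c : cpt K') by (apply (Hcp K); auto).
 destruct (@rb_compact E 0%C K' d) as [r [Hr Hrb]]; auto.
 { now rewrite Cmod_0. }
 { intros lam y Hl. destruct (Hsj y) as [x <-]. intros H. rewrite baA, bsA, vs0l, vadd0l, HKx in H.
  apply Hk0. apply (Hno lam); auto. apply Hk0. rewrite bD, bN, bZ, H. vring. }
 replace (0 *v bid E +v K') with K' in Hrb by (bring).
 destruct (ppoly_inv Hrb (ks := ks)) as [B [HB HBc]]. { intros k Hk. destruct (Hks k Hk). lra. }
 destruct (Hfac _ (ppoly K ks)) as [s Es]; auto.
 have Ep : forall l, ppoly K' l ** q = q ** ppoly K l.
 { induction l as [|k l IH]; cbn [ppoly]. bring. rewrite bcA, <- IH, <- !bcA. f_equal.
  bext x. have F := f_equal (fun f => bf f x) HK'. revert F. bpush. now intros ->. }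
 have Eqs : q ** s = ppoly K' ks. { apply Sq. rewrite <- bcA, Es. triv. }
 (* [s] factors the polynomial through the quotient and [B] inverts the polynomial induced on it, so
    [Q] lifts the quotient back into the space: it is the idempotent complementary to the kernel of
    the polynomial. *)
 set (Q := s ** B ** q).
 have HQ : Q ** Q = Q. { unfold Q. rewrite !bcA, <- (bcA (s ** B) q s), Eqs, <- (bcA s B (ppoly K' ks)), (proj2 HB), bc1r. auto. }
 have HQc : forall T, comm T K -> comm T Q.
 { intros T H. destruct (HT T H) as [T' HT']. unfold comm, Q.
  have c1 : comm T' K'. { apply Sq. rewrite <- !bcA, HK', HT', !bcA, HK', HT', <- !bcA. f_equal. triv. }
  have c2 : T ** s = s ** T'. { apply Sq. rewrite <- !bcA, Es, HT', bcA, Es. apply (ppoly_comm ks H). }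
  rewrite !bcA, c2, <- (bcA s T' B), (HBc T' c1), <- !bcA, HT'. auto. }
 have HKn : forall n, (K ** Q) ^^ n ** Q = s ** (B ** K' ^^ n) ** q.
 { have En : forall n, K' ^^ n ** q = q ** K ^^ n. { induction n; sim. bring. now rewrite <- bcA, IHn, bcA, HK', <- bcA. }
  intros n. rewrite bpow_comp by (apply HQc, comm_refl). have F : K ^^ n ** Q = s ** (B ** K' ^^ n) ** q. {
  have cq : Q ** K ^^ n = K ^^ n ** Q by (apply comm_pow, comm_sym, HQc, comm_refl). rewrite <- cq.
  unfold Q. rewrite <- !bcA, En. auto. }
  rewrite <- bcA. replace (Q ^^ n ** Q) with Q. auto. rewrite <- bpow_S. now rewrite bpow_idem. }
 exists ks, (bid V -v Q), r. split; auto. split; [|split; [|split; [|split; [|split]]]]; auto.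
 - replace ((bid V -v Q) ** (bid V -v Q)) with (bid V -v Q -v Q +v Q ** Q) by bring. rewrite HQ. bring.
 - intros T H. apply comm_add. bring. apply comm_opp; auto.
 - replace (ppoly K ks ** (bid V -v Q)) with (ppoly K ks -v ppoly K ks ** Q) by bring.
  unfold Q. rewrite <- Es at 2. rewrite !bcA, <- (bcA s q s), Eqs, <- (bcA s (ppoly K' ks) B), (proj1 HB), bc1r, Es. bring.
 - replace (bid V -v (bid V -v Q)) with Q by bring. intros t Ht. destruct (Hrb t Ht) as [M [HM HMn]].
  exists (nm (bid V) + nm s * nm B * M * nm q * nm K / t + 1).
  have Ht0 : 0 < t by lra. have G : forall n, nm ((K ** Q) ^^ n ** Q) <= nm s * nm B * M * nm q * t ^ n.
  { intros n. rewrite HKn. le_by nm_comp. replace (nm s * nm B * M * nm q * t ^ n) with (nm s * (nm B * (M * t ^ n)) * nm q) by ring.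
  apply mul_le_r. apply nm_ge0. le_by nm_comp. apply mul_le_l. apply nm_ge0.
  le_by nm_comp. apply mul_le_l. apply nm_ge0. auto. }
  have G0 : 0 <= nm s * nm B * M * nm q. { repeat apply mul_ge0; try apply nm_ge0. lra. }
  have G1 : 0 <= nm s * nm B * M * nm q * nm K / t. { apply div_ge0; auto. apply mul_ge0; auto. apply nm_ge0. }
  have G2 := nm_ge0 (bid V). split. lra. intros n. destruct n. sim. lra.
  replace ((K ** Q) ^^ S n) with (K ** ((K ** Q) ^^ n ** Q)).
  + le_by nm_comp. specialize (G n).
  le_mid (nm s * nm B * M * nm q * nm K / t * (t * t ^ n)).
  replace (nm s * nm B * M * nm q * nm K / t * (t * t ^ n)) with (nm K * (nm s * nm B * M * nm q * t ^ n)) by (field; lra).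
  apply mul_le_l; auto. apply nm_ge0. apply mul_le_r. apply mul_ge0. lra. apply pow_le; lra. lra.
  + rewrite bpow_S. have c : comm Q ((K ** Q) ^^ n). { apply comm_pow, comm_comp. apply comm_sym, HQc, comm_refl. triv. }
  assert (c' : comm K ((K ** Q) ^^ n)). { apply comm_pow, comm_comp. triv. apply HQc, comm_refl. }
  rewrite bcA, c', <- bcA. auto.
 - destruct (@ppoly_cpt V K ks HK) as [c [K1 [E1 [E2 E3]]]].
  have c0 : c <> 0%C. { apply E3. intros k Hk E0. destruct (Hks k Hk) as [D _]. rewrite E0, Cmod_0 in D. lra. }
  have F : ppoly K ks ** (bid V -v Q) = 0v.
  { replace (ppoly K ks ** (bid V -v Q)) with (ppoly K ks -v ppoly K ks ** Q) by bring.
  unfold Q. rewrite <- Es at 2. rewrite !bcA, <- (bcA s q s), Eqs, <- (bcA s (ppoly K' ks) B), (proj1 HB), bc1r, Es. bring. }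
  rewrite E1 in F. replace (bid V -v Q) with ((- / c)%C *v (K1 ** (bid V -v Q))). apply cpt_scal, cpt_compr; auto.
  replace (K1 ** (bid V -v Q)) with ((c *v bid V +v K1) ** (bid V -v Q) -v c *v (bid V -v Q)) by bring. rewrite F.
  match goal with |- _ = ?t => transitivity ((/ c * c)%C *v t) end. vring. rewrite Cinv_l by auto. vring.
Qed.
Lemma RD_eigen K P r k x : rb (K ** (bid V -v P)) r -> comm K P -> P ** P = P -> 0 <= r < Cmod k -> K x = k *v x -> P x = x.
Proof.
 intros H Hc HP Hk E. symmetry. apply vsub_eq0. have F : forall y, P (P y) = P y by (intros; rewrite <- bmA; now rewrite HP).
 apply (rb_eigen H Hk). rewrite bmA. transitivity (K (x -v P x)). f_equal. bpush. rewrite F. vring.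
 rewrite bD, bN, (comm_app x Hc), E, bZ. vring.
Qed.
Lemma ppoly_eigen K ks k x : K x = k *v x -> x <> 0v -> ppoly K ks x = 0v -> In k ks.
Proof.
 intros E Hx. induction ks as [|k' ks IH]. rewrite b1A. tauto.
 rewrite ppoly_S, E. replace (k *v x -v k' *v x) with ((k - k')%C *v x) by vring. rewrite bZ. intros H.
 destruct (Ceq_dec k k'). subst; now left. right. apply IH.
 rewrite <- (vs1 (ppoly K ks x)). rewrite <- (Cinv_l (k - k')%C), <- vsA, H, vs0r; auto. now apply Cminus_eq_contra.
Qed.
End RieszDec.
Lemma avoid_list (l : list R) a b : a < b -> exists t, a < t < b /\ ~ In t l.
Proof.
 intros H. have G : exists a' b', a < a' /\ a' < b' /\ b' < b /\ forall t, a' < t < b' -> ~ In t l.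
 { revert a b H. induction l as [|y l IH]; intros a b H. exists ((2*a+b)/3), ((a+2*b)/3). repeat split; try lra. auto.
  destruct (IH a b H) as [a' [b' [H1 [H2 [H3 H4]]]]]. destruct (Rle_lt_dec y ((a'+b')/2)).
  exists ((a'+b')/2), b'. repeat split; try lra. intros t Ht [<-|Hi]. lra. apply (H4 t); auto. lra.
  exists a', ((a'+b')/2). repeat split; try lra. intros t Ht [<-|Hi]. lra. apply (H4 t); auto. lra. }
 destruct G as [a' [b' [H1 [H2 [H3 H4]]]]]. exists ((a'+b')/2). split. lra. apply H4. lra.
Qed.
(** A semicontinuity of the spectral radius at a compact limit. On a circle that avoids the inverses
    of the eigenvalues, the lower bound for the limit passes to nearby terms, and [LB] turns it into
    power bounds independent of the term. *)
Lemma RL V (u : nat -> bop V V) U : cpt U -> cv u U -> (forall i, rb (u i) (1/2)) -> exists r, 0 < r < 1 /\ rb U r.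
Proof.
 intros HU Hu Hr. destruct (RD HU (d := 1/2)) as [ks [P [r [H1 [H2 [H3 [H4 [H5 [H6 _]]]]]]]]]. lra.
 (* [R] > 1 makes 1/R a bound below 1, and [R] < 3/2 keeps R times the radius 1/2 of the terms below
    1. Finitely many moduli are to be avoided. *)
 destruct (@avoid_list (map (fun k => / Cmod k) ks) 1 (3/2)) as [R [HR HRn]]. lra.
 destruct (@LOW V 0%C U (fun z => Cmod z = R) R HU) as [c [Hc HL]].
 - triv.
 - intros z l Hz Hl. apply Rle_antisym. apply ball_closed with z; auto. intros n. rewrite Hz. lra.
  apply le_epsilon. intros eps He. destruct (Hl eps He) as [N HN]. specialize (HN N (le_n _)). rewrite <- (Hz N).
  replace (z N) with (l + (z N - l))%C by ring. le_by Cmod_triangle. lra.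
 - intros z Hz. rewrite Cmult_0_r. replace (1 - 0)%C with (RtoC 1) by ring. apply C1_nz.
 - intros z x Hz E. contra Hx. have z0 : z <> 0%C. { intros E0. rewrite E0, Cmod_0 in Hz. lra. }
  rewrite baA, bsA, vs0l, vadd0l in E. assert (E' : U x = (/ z)%C *v x). { rewrite E at 2. rewrite vsA, Cinv_l, vs1; auto. }
  assert (Hz' : Cmod (/ z)%C = / R) by (now rewrite Cmod_inv, Hz by auto).
  apply HRn. rewrite <- (Rinv_inv R), <- Hz'. apply (in_map (fun k => / Cmod k)). apply (@ppoly_eigen V U ks (/ z)%C x); auto.
  rewrite <- (RD_eigen H6 (H3 U (comm_refl U)) H2 (k := (/ z)%C) (x := x)); auto.
  rewrite <- bmA, H4. triv. rewrite Hz'. split. lra. apply Rlt_trans with (1/2). lra.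
  apply Rmult_lt_reg_r with R. lra. rewrite Rinv_l by lra. lra.
 - have HRi : 0 < / R by triv.
  exists (/ R). split. split; auto. rewrite <- Rinv_1. apply Rinv_lt_contravar; lra.
  apply rb_intro. lra. exists (4 / c). intros m. apply (cv_nm_le (u := fun i => u i ^^ m)).
  { clear - Hu. induction m; sim. apply cv_const. now apply cv_comp. }
  destruct (Hu (c / (2 * R))) as [N0 HN0]. triv. exists N0. intros i Hi.
  have HB : forall z y, Cmod z = 1 -> c / 2 * nm y <= nm (y -v z *v (R *v u i) y).
  { intros z y Hz. specialize (HL (z * R)%C y). rewrite Cmod_mult, Hz, Cmod_R, Rabs_pos_eq, Rmult_1_l in HL by lra.
  specialize (HL eq_refl). rewrite baA, bsA, vs0l, vadd0l in HL.
  have D := nm_rev2 (y -v z *v (R *v u i) y) (y -v (z * R)%C *v U y).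
  replace (y -v z *v (R *v u i) y -v (y -v (z * R)%C *v U y)) with ((- (z * R))%C *v ((u i -v U) y)) in D by (bpush; vring).
  rewrite nm_scal, Cmod_opp, Cmod_mult, Hz, Cmod_R, Rabs_pos_eq, Rmult_1_l in D by lra.
  have D2 := nm_app (u i -v U) y. specialize (HN0 i Hi).
  have D3 : R * nm ((u i -v U) y) <= c / 2 * nm y.
  { le_mid (R * (c / (2 * R) * nm y)). apply mul_le_l. lra. le_by D2. apply mul_le_r. apply nm_ge0. lra.
  right. field. lra. }
  lra. }
  have Hri := rb_scal (c := RtoC R) (a := 1/2) ltac:(lra) (Hr i). rewrite Cmod_R, Rabs_pos_eq in Hri by lra.
  destruct (rb_lt1_small (eps := 1) Hri) as [N HN]; try lra.
  set (N' := (N + m + 1)%nat). specialize (HN N' ltac:(lia)). set (v := R *v u i) in *.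
  have G : nm (v ^^ m) <= 4 / c.
  { have F : forall x, nm (x -v (v ^^ N') x) <= 2 * nm x. { intros x. le_by nm_sub. have D := nm_app (v ^^ N') x. assert (D' := nm_ge0 x). nra. }
  apply nm_le. triv. intros x. have D := @LB V v (c / 2) N' m x ltac:(lra) HB ltac:(unfold N'; lia). specialize (F x).
  apply Rmult_le_reg_l with (c / 2). lra. replace (c / 2 * (4 / c * nm x)) with (2 * nm x) by (field; lra). lra. }
  have G2 : nm (v ^^ m) = R ^ m * nm (u i ^^ m). { unfold v. rewrite bpow_scal, nm_scal, cpow_mod, Cmod_R, Rabs_pos_eq; lra. }
  rewrite G2 in G. rewrite pow_inv. apply Rmult_le_reg_l with (R ^ m). triv.
  replace (R ^ m * (4 / c * / R ^ m)) with (4 / c). lra. field. split. apply pow_nonzero; lra. lra.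
Qed.

(** * Zorn's lemma for subspaces and further facts on precompact sequences *)

Lemma zorn_sub V (R : (V -> Prop) -> Prop) :
 (forall Fm : (V -> Prop) -> Prop, (exists A, Fm A) -> (forall A, Fm A -> vsubspace A /\ R A) ->
  (forall A B, Fm A -> Fm B -> (forall x, A x -> B x) \/ (forall x, B x -> A x)) -> R (fun x => exists A, Fm A /\ A x)) ->
 R (fun x => x = 0v) ->
 exists A, vsubspace A /\ R A /\ forall B, vsubspace B -> R B -> (forall x, A x -> B x) -> forall x, B x -> A x.
Proof.
 intros HF H0. have S0 : vsubspace (fun x : V => x = 0v).
 { split; [|split]; auto. intros x y -> ->. vring. intros c x ->. vring. }
 set (P := fun S : V -> Prop => (forall x, ~ S x) \/ (vsubspace S /\ R S)).
 destruct (@classical_sets.Zorn_bigcup V P) as [A [HA Hm]].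
 - intros Fm HFm Ht. destruct (classic (exists A x, Fm A /\ A x)) as [[A [x [FA Ax]]]|Hn].
  2: { left. intros x [A FA Ax]. apply Hn. exists A, x; auto. }
  right. set (Fm' := fun B => Fm B /\ exists x, B x).
  have E : classical_sets.bigcup Fm (fun X => X) = (fun x => exists B, Fm' B /\ B x).
  { fext y. apply propositional_extensionality. split.
  intros [B FB By]. exists B. split; auto. split; auto. exists y; auto. intros [B [[FB _] By]]. exists B; auto. }
  have Fs : forall B, Fm' B -> vsubspace B /\ R B.
  { intros B [FB [y By]]. destruct (HFm B FB) as [Hb|Hb]; auto. destruct (Hb y By). }
  have Ft : forall B D, Fm' B -> Fm' D -> (forall x, B x -> D x) \/ (forall x, D x -> B x).
  { intros B D [FB _] [FD _]. destruct (Ht B D FB FD); auto. }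
  assert (FA' : Fm' A) by (split; auto; exists x; auto).
  rewrite E. split.
  + split; [|split]. exists A. split; auto. apply (Fs A FA').
  intros y z [B [FB By]] [D [FD Dz]]. destruct (Ft B D FB FD) as [Hi|Hi]. exists D. split; auto. apply (Fs D FD); auto. exists B. split; auto. apply (Fs B FB); auto.
  intros c y [B [FB By]]. exists B. split; auto. apply (Fs B FB); auto.
  + apply HF; auto. exists A; auto.
 - destruct HA as [HA|[HA RA]].
  + exfalso. apply (Hm (fun x : V => x = 0v)). split. intros x Hx. destruct (HA x Hx). intros E. apply (HA 0v). triv. right; auto.
  + exists A. split; auto. split; auto. intros B SB RB HAB x Bx. contra Ax. apply (Hm B). split. triv. intros E. apply Ax. triv. right; auto.
Qed.
Lemma prec_shift V (u : nat -> V) J : prec (fun n => u (n + J)%nat) -> prec u.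
Proof.
 intros H eps p He Hp. have Hge : forall n, (J <= p (n + J))%nat by (intros n; assert (D := incr_ge Hp (n + J)); lia).
 destruct (H eps (fun n => (p (n + J) - J)%nat) He) as [q [Hq HQ]].
 { intros n. have D := Hp (n + J)%nat. have D2 := Hge n. replace (S n + J)%nat with (S (n + J)) by lia. lia. }
 exists (fun n => (q n + J)%nat). split. intros n. specialize (Hq n). lia. intros i j. specialize (HQ i j).
 have D1 := Hge (q i). have D2 := Hge (q j). replace (p (q i + J)%nat) with (p (q i + J) - J + J)%nat by lia.
 replace (p (q j + J)%nat) with (p (q j + J) - J + J)%nat by lia. nra.
Qed.
Lemma prec_approx_ev V (u : nat -> V) : (forall eps, 0 < eps -> exists v J, prec v /\ forall n, (J <= n)%nat -> nm (u n -v v n) <= eps) -> prec u.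
Proof.
 intros H eps p He Hp. destruct (H (eps / 3)) as [v [J [Hv Hc]]]. lra.
 destruct (Hv (eps / 3) (fun n => p (n + J)%nat)) as [q [Hq HQ]]. lra. intros n. apply Hp.
 exists (fun n => (q n + J)%nat). split. intros n. specialize (Hq n). lia. intros i j.
 have A := Hc (p (q i + J)%nat). have B := Hc (p (q j + J)%nat). have D1 := incr_ge Hp (q i + J). have D2 := incr_ge Hp (q j + J).
 specialize (A ltac:(lia)). specialize (B ltac:(lia)). specialize (HQ i j).
 rewrite nm_subC in B. have D := nm_sub_tri (u (p (q i + J)%nat)) (v (p (q i + J)%nat)) (u (p (q j + J)%nat)).
 assert (D' := nm_sub_tri (v (p (q i + J)%nat)) (v (p (q j + J)%nat)) (u (p (q j + J)%nat))). lra.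
Qed.
Lemma prec_pigeon V (A : Type) (l : list A) (a : nat -> A) (g : A -> nat -> V) :
 (forall n, In (a n) l) -> (forall c, In c l -> prec (g c)) -> prec (fun n => g (a n) n).
Proof.
 intros Ha Hg eps p He Hp. destruct (@pigeon A l (fun n => a (p n))) as [c [Hc [s [Hs Es]]]]; auto.
 destruct (Hg c Hc eps (fun n => p (s n)) He (incr_comp Hp Hs)) as [q [Hq HQ]].
 exists (fun n => s (q n)). split. now apply incr_comp. intros i j. rewrite !Es. triv.
Qed.
Lemma list_max (A : Type) (l : list A) (g : A -> R) : (exists a, In a l) -> exists a, In a l /\ forall b, In b l -> g b <= g a.
Proof.
 induction l as [|x l IH]; intros [a Ha]. destruct Ha. destruct l as [|y l].
 - exists x. split. now left. intros b [<-|[]]. lra.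
 - destruct IH as [m [Hm H]]. exists y; now left. destruct (Rle_lt_dec (g m) (g x)).
  exists x. split. now left. intros b [<-|Hb]. lra. specialize (H b Hb). lra.
  exists m. split. now right. intros b [<-|Hb]. lra. auto.
Qed.
Lemma nm_attain (V W : CBanach) (f : bop V W) : exists x, nm x <= 1 /\ nm f / 2 <= nm (f x).
Proof.
 contra H. have D : nm f <= nm f / 2. { apply nm_le1. intros x Hx. apply Rnot_lt_le. intros Hl. apply H. exists x. nra. }
 apply H. exists 0v. rewrite nm0, b0, nm0. lra.
Qed.

Lemma pow_le_mono t n k : 0 <= t <= 1 -> (n <= k)%nat -> t ^ k <= t ^ n.
Proof.
 intros Ht Hnk. replace k with (n + (k - n))%nat by lia. rewrite pow_add.
 assert (0 <= t ^ n) by triv. assert (t ^ (k - n) <= 1). rewrite <- (pow1 (k - n)). triv. nra.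
Qed.
Lemma pow_ge_mono t n k : 1 <= t -> (n <= k)%nat -> t ^ n <= t ^ k.
Proof. intros. apply Rle_pow; auto. Qed.
Lemma pow_small t eps : 0 <= t < 1 -> 0 < eps -> exists m, t ^ m < eps.
Proof.
 intros Ht He. destruct (pow_lt_1_zero t ltac:(rewrite Rabs_pos_eq; lra) eps He) as [m Hm]. exists m. specialize (Hm m (le_n _)).
 rewrite Rabs_pos_eq in Hm; auto. triv.
Qed.

(** * A Berger-Wang theorem for finite families of scalar plus compact operators *)

Section Words.
Variable V : CBanach.
(** The scalar bound [t] plays the role of an essential norm: it is multiplicative along words,
    while everything compact is absorbed in [K]. *)
Definition aff (t : R) (A : bop V V) := exists (b : C) K, A = b *v bid V +v K /\ cpt K /\ Cmod b <= t.
Lemma aff_comp s t A B : aff s A -> aff t B -> aff (s * t) (A ** B).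
Proof.
 intros [a [K [-> [HK Ha]]]] [b [K' [-> [HK' Hb]]]]. exists (a * b)%C, (a *v K' +v K ** (b *v bid V +v K')). split; [|split].
 - bring.
 - apply cpt_add. now apply cpt_scal. now apply cpt_compr.
 - rewrite Cmod_mult. triv.
Qed.
Lemma aff_id : aff 1 (bid V).
Proof. exists 1%C, 0v. split. bring. split. apply cpt_zero. rewrite Cmod_1. lra. Qed.
Fixpoint W (f : nat -> bop V V) (w : list nat) : bop V V := match w with nil => bid V | i :: w => f i ** W f w end.
Lemma W_app f u v : W f (u ++ v) = W f u ** W f v.
Proof. induction u; cbn [W app]. bring. rewrite IHu. bring. Qed.
Definition ok (N : nat) (w : list nat) := forall i, In i w -> (i < N)%nat.
Fixpoint words (N n : nat) : list (list nat) := match n with O => [nil] | S n => flat_map (fun w => map (fun i => i :: w) (seq 0 N)) (words N n) end.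
Lemma wordsP N n w : In w (words N n) <-> ok N w /\ length w = n.
Proof.
 revert w. induction n; intros w; simpl.
 - split. intros [<-|[]]. split; auto. intros i []. intros [_ H]. left. destruct w; auto. discriminate.
 - rewrite in_flat_map. split.
  + intros [v [Hv Hw]]. apply in_map_iff in Hw. destruct Hw as [i [<- Hi]]. apply in_seq in Hi. apply IHn in Hv. destruct Hv as [H1 H2].
  split. intros j [<-|Hj]. lia. auto. simpl; lia.
  + destruct w as [|i w]. intros [_ H]; discriminate. intros [H1 H2]. exists w. split. apply IHn. split. intros j Hj; apply H1; now right. triv.
  apply in_map_iff. exists i. split; auto. apply in_seq. have D := H1 i (or_introl eq_refl). lia.
Qed.
Lemma ok_app N u v : ok N (u ++ v) <-> ok N u /\ ok N v.
Proof. split. intros H; split; intros i Hi; apply H, in_or_app; auto. intros [H1 H2] i Hi. apply in_app_or in Hi. destruct Hi; auto. Qed.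
Lemma ok_split N w m : ok N w -> (m <= length w)%nat -> exists u v, w = u ++ v /\ ok N u /\ ok N v /\ length u = m.
Proof.
 intros H Hm. exists (firstn m w), (skipn m w). rewrite firstn_skipn. split; auto. rewrite <- (firstn_skipn m w) in H. apply ok_app in H.
 destruct H. split; auto. split; auto. rewrite length_firstn. lia.
Qed.
Lemma W_bound f N m : exists M, 0 < M /\ forall w, ok N w -> (length w <= m)%nat -> nm (W f w) <= M.
Proof.
 induction m as [|m [M [HM H]]].
 - exists 1. split. lra. intros w _ Hw. destruct w. apply nm_id. simpl in Hw; lia.
 - destruct (@list_max _ (nil :: words N (S m)) (fun w => nm (W f w))) as [v [_ Hv]]. exists nil; now left.
  exists (M + nm (W f v)). split. have D := nm_ge0 (W f v). lra. intros w Hw Hl.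
  destruct (Nat.eq_dec (length w) (S m)). have D := Hv w. assert (nm (W f w) <= nm (W f v)). apply D. right. apply wordsP; auto. lra.
  specialize (H w Hw ltac:(lia)). have D := nm_ge0 (W f v). lra.
Qed.
Lemma W_aff f N t : 0 <= t -> (forall i, (i < N)%nat -> aff t (f i)) -> forall w, ok N w -> aff (t ^ length w) (W f w).
Proof.
 intros Ht H w. induction w as [|i w IH]; intros Hw; cbn [W length pow]. apply aff_id.
 apply aff_comp. apply H, Hw. now left. apply IH. intros j Hj; apply Hw; now right.
Qed.
Lemma W_inv (f : nat -> bop V V) N (Z : V -> Prop) : (forall i x, (i < N)%nat -> Z x -> Z (f i x)) -> forall w x, ok N w -> Z x -> Z (W f w x).
Proof.
 intros H w x. induction w as [|i w IH]; intros Hw Hx; cbn [W]. triv. rewrite bmA. apply H. apply Hw; now left.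
 apply IH; auto. intros j Hj; apply Hw; now right.
Qed.
Lemma W_aff_choice f N t : 0 <= t < 1 -> (forall i, (i < N)%nat -> aff t (f i)) -> exists (b : list nat -> C) (K : list nat -> bop V V), forall v, ok N v -> W f v = b v *v bid V +v K v /\ cpt (K v) /\ Cmod (b v) <= t ^ length v.
Proof.
 intros Ht Hf.
 have Hc : forall v, exists bK : C * bop V V, ok N v -> W f v = fst bK *v bid V +v snd bK /\ cpt (snd bK) /\ Cmod (fst bK) <= t ^ length v.
 { intros v. destruct (classic (ok N v)) as [Hv|Hv]. destruct (W_aff (proj1 Ht) Hf Hv) as [b [K HbK]]. exists (b, K). auto. exists (RtoC 0, 0v). tauto. }
 destruct (fun_choice Hc) as [bK HbK]. exists (fun v => fst (bK v)), (fun v => snd (bK v)). triv.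
Qed.
(** Cut a prefix a and a suffix c of length m off each long word. Up to an error of order M t^m both
    may be replaced by their compact parts; there are finitely many such pairs, and for each of them
    [cpt_sandwich] makes the products precompact. *)
Lemma W_prec f N t M (w : nat -> list nat) : 0 <= t < 1 -> (forall i, (i < N)%nat -> aff t (f i)) -> (forall v, ok N v -> nm (W f v) <= M) ->
 (forall n, ok N (w n) /\ (n <= length (w n))%nat) -> prec (fun n => W f (w n) : BL V).
Proof.
 intros Ht Hf HM Hw. have HM0 : 0 <= M. { eapply Rle_trans; [apply nm_ge0|apply (HM nil)]. intros i []. }
 destruct (W_aff_choice Ht Hf) as [b [K HE]].
 apply prec_approx_ev. intros eps He.
 destruct (pow_lt_1_zero t ltac:(rewrite Rabs_pos_eq; lra) (eps / (3 * M + 1))) as [m Hm]. triv.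
 specialize (Hm m (le_n _)). have Htm : 0 <= t ^ m <= 1. { split. triv. rewrite <- (pow1 m). triv. }
 rewrite Rabs_pos_eq in Hm by lra.
 have Hs : forall n, exists abc : (list nat * list nat) * list nat, (2 * m <= n)%nat ->
  w n = fst (fst abc) ++ snd abc ++ snd (fst abc) /\ In (fst abc) (list_prod (words N m) (words N m)) /\ ok N (snd abc).
 { intros n. destruct (Nat.le_gt_cases (2 * m) n) as [Hn|Hn]. 2: { exists ((nil, nil), nil). lia. }
  destruct (Hw n) as [H1 H2]. destruct (ok_split (m := m) H1) as [u [v [E [Hu [Hv Lu]]]]]. lia.
  have Lv : (length u + length v = length (w n))%nat by (rewrite E, length_app; lia).
  destruct (ok_split (m := length v - m) Hv) as [v1 [v2 [E' [Hv1 [Hv2 Lv1]]]]]. lia.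
  exists ((u, v2), v1). intros _. rewrite E, E'. split; auto. split; auto. apply in_prod; apply wordsP; auto.
  split; auto. have L2 : (length v = length v1 + length v2)%nat by (rewrite E', length_app; lia). lia. }
 destruct (fun_choice Hs) as [abc Habc].
 set (v := fun n => K (fst (fst (abc n))) ** W f (snd (abc n)) ** K (snd (fst (abc n)))).
 exists v, (2 * m)%nat. split.
 - apply prec_shift with (2 * m)%nat.
  apply (@prec_pigeon (BL V) _ (list_prod (words N m) (words N m)) (fun n => fst (abc (n + 2 * m)%nat)) (fun ac n => K (fst ac) ** W f (snd (abc (n + 2 * m)%nat)) ** K (snd ac))).
  + intros n. apply Habc. lia.
  + intros [a c] Hac. apply in_prod_iff in Hac. destruct Hac as [Ha Hc]. apply wordsP in Ha, Hc.
  apply cpt_sandwich with M; try (apply HE; tauto). intros n. apply HM. apply Habc. lia.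
 - intros n Hn. destruct (Habc n Hn) as [E [Hac Hb]]. unfold v. clear v. destruct (abc n) as [[a c] d]. simpl fst in *; simpl snd in *.
  apply in_prod_iff in Hac. destruct Hac as [Ha Hc]. apply wordsP in Ha, Hc. destruct Ha as [Ha La], Hc as [Hc Lc].
  destruct (HE a Ha) as [Ea [_ Ba]]. destruct (HE c Hc) as [Ec [_ Bc]]. rewrite La in Ba. rewrite Lc in Bc.
  have N1 : nm (W f (d ++ c)) <= M by (apply HM, ok_app; auto). have N2 : nm (W f (a ++ d)) <= M by (apply HM, ok_app; auto).
  replace (W f (w n) -v K a ** W f d ** K c) with (b a *v W f (d ++ c) +v b c *v (W f (a ++ d) -v b a *v W f d)).
  2: { rewrite E, !W_app, Ea, Ec. bring. }
  le_by nm_tri. rewrite !nm_scal. have N4 : nm (W f (a ++ d) -v b a *v W f d) <= 2 * M.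
  { le_by nm_sub. rewrite nm_scal. assert (Cmod (b a) * nm (W f d) <= 1 * M). apply Rmult_le_compat; auto. triv. apply nm_ge0. lra. lra. }
  have N5 : Cmod (b a) * nm (W f (d ++ c)) <= t ^ m * M by (apply Rmult_le_compat; auto; [apply Cmod_ge_0|apply nm_ge0]).
  have N6 : Cmod (b c) * nm (W f (a ++ d) -v b a *v W f d) <= t ^ m * (2 * M) by (apply Rmult_le_compat; auto; [apply Cmod_ge_0|apply nm_ge0]).
  assert (t ^ m * (3 * M + 1) <= eps). { replace eps with (eps / (3 * M + 1) * (3 * M + 1)) at 1 by (field; lra). nra. }
  lra.
Qed.
End Words.
Section BWirr.
Variable V : CBanach.
Variables (f : nat -> bop V V) (N : nat) (t : R).
Hypothesis Ht : 0 <= t < 1.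
Hypothesis Hf : forall i, (i < N)%nat -> aff t (f i).
Hypothesis Hbig : forall n, (0 < n)%nat -> exists w, ok N w /\ length w = n /\ 1/8 <= nm (W f w).

(** In a bounded family, a Koenig argument gives ever longer suffixes whose norms do not vanish. Two
    limits of words U and P with U P = P and P not 0 arise; but U is a compact limit of words of
    spectral radius at most 1/2, so [RL] excludes the eigenvalue 1. *)
Lemma BW_bounded M : (forall w, ok N w -> (0 < length w)%nat -> rb (W f w) (t ^ length w)) -> (forall w, ok N w -> nm (W f w) <= M) -> False.
Proof.
 intros Hrb HM. have HM0 : 0 < M. { destruct (Hbig (n := 1)) as [w [Hw [_ H]]]. lia. specialize (HM w Hw). lra. }
 (* Suffixes that occur in large words of unbounded length: such a suffix has a one-letter extension
    of the same kind, by the pigeonhole principle on the added letter. *)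
 set (good := fun v => ok N v /\ forall n0, exists n u, (n0 <= n)%nat /\ ok N (u ++ v) /\ length u = n /\ 1/8 <= nm (W f (u ++ v))).
 have Hg : forall v, good v -> 1 / (8 * M) <= nm (W f v).
 { intros v [Hv H]. destruct (H O) as [n [u [_ [Hu [_ Hn]]]]]. rewrite W_app in Hn. apply ok_app in Hu. have D := nm_comp (W f u) (W f v).
  specialize (HM u (proj1 Hu)). have D2 := nm_ge0 (W f v). apply Rmult_le_reg_l with M; auto. replace (M * (1 / (8 * M))) with (1/8) by (field; lra). nra. }
 have Hstep : forall (n : nat) v, good v -> exists v', good v' /\ exists i, v' = i :: v.
 { intros _ v [Hv H]. have Hs : forall n, exists ui : list nat * nat, (n <= length (fst ui))%nat /\ ok N (fst ui ++ snd ui :: v) /\ 1/8 <= nm (W f (fst ui ++ snd ui :: v)).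
  { intros n. destruct (H (S n)) as [n' [u [Hn [Hu [Lu Hb]]]]]. destruct (exists_last (l := u)) as [u' [i E]]. intros ->; simpl in *; lia.
  subst u. rewrite <- app_assoc in *. exists (u', i). simpl. rewrite length_app in Lu. simpl in Lu. split. lia. auto. }
  destruct (fun_choice Hs) as [ui Hui].
  destruct (@pigeon nat (seq 0 N) (fun n => snd (ui n))) as [i [Hi [p [Hp Ep]]]].
  { intros n. apply in_seq. destruct (Hui n) as [_ [Ho _]]. apply ok_app in Ho. split. lia. apply Ho. now left. }
  apply in_seq in Hi. exists (i :: v). split; [|exists i; auto]. split. intros j [<-|Hj]. lia. auto.
  intros n0. exists (length (fst (ui (p n0)))), (fst (ui (p n0))). specialize (Ep n0). destruct (Hui (p n0)) as [H1 [H2 H3]]. rewrite Ep in *.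
  have D := incr_ge Hp n0. split. lia. auto. }
 destruct (@dep_choice (list nat) good (fun _ v v' => exists i, v' = i :: v) nil) as [v [_ [Hv Hvs]]]; auto.
 { split. intros i []. intros n0. destruct (Hbig (n := S n0)) as [w [H1 [H2 H3]]]. lia. exists (S n0), w. rewrite app_nil_r. triv. }
 have Hlen : forall n, length (v n) = (n + length (v O))%nat. { induction n; auto. destruct (Hvs n) as [i ->]. simpl. lia. }
 have Happ : forall a b, (a <= b)%nat -> exists u, v b = u ++ v a /\ ok N u /\ length u = (b - a)%nat.
 { intros a b Hab. induction b. exists nil. replace a with O by lia. split; auto. split; auto. intros i [].
  destruct (Nat.eq_dec a (S b)). subst. exists nil. split; auto. split. intros i []. simpl; lia.
  destruct IHb as [u [E [Hu Lu]]]. lia. destruct (Hvs b) as [i Ei]. exists (i :: u). rewrite Ei, E. split; auto. split.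
  have D := proj1 (Hv (S b)). rewrite Ei, E in D. intros j [<-|Hj]. apply D. now left. auto. cbn [length]. lia. }
 have Hv1 : forall n, ok N (v n) /\ (n <= length (v n))%nat by (intros n; split; [apply Hv|rewrite Hlen; lia]).
 destruct (prec_cv (W_prec (w := v) Ht Hf HM Hv1)) as [p [P [Hp HP]]].
 have HPn : 1 / (8 * M) <= nm P. { apply (cv_nm_ge HP). exists O. triv. }
 (* Squares spread the indices, so that passing from one selected suffix to the next adds at least
    [n] letters. *)
 set (s := fun n => p (n * n)%nat).
 have Hsq : incr (fun n => n * n)%nat by (intros n; nia).
 have Hs : forall n, exists u, v (s (S n)) = u ++ v (s n) /\ ok N u /\ (n <= length u)%nat.
 { intros n. destruct (@Happ (s n) (s (S n))) as [u [E [Hu Lu]]]. unfold s. apply incr_le; auto. nia.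
  exists u. split; auto. split; auto. rewrite Lu. unfold s. have D : forall a b, (p a + b <= p (a + b))%nat.
  { intros a b. induction b. replace (a + 0)%nat with a by lia. lia. replace (a + S b)%nat with (S (a + b)) by lia. have D := Hp (a + b)%nat. lia. }
  have D2 := D (n * n)%nat n. have D3 : (p (n * n + n) <= p (S n * S n))%nat by (apply incr_le; auto; nia).
  triv. }
 destruct (fun_choice Hs) as [u Hu].
 have HPs : cv (fun n => W f (v (s n)) : BL V) P by exact (cv_sub Hsq HP).
 destruct (prec_cv (W_prec (w := u) Ht Hf HM (fun n => proj2 (Hu n)))) as [q [U [Hq HU]]].
 (* Both sides are limits of the same words: a suffix prolonged by [u] is the next selected
    suffix. *)
 have EP : U ** P = P.
 { apply (@cv_unique (BL V) (fun n => W f (u (q n)) ** W f (v (s (q n))))).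
  - apply cv_comp. exact HU. apply (cv_sub Hq HPs).
  - apply (@cv_ext (BL V) (fun n => W f (v (s (S (q n)))))). intros n. destruct (Hu (q n)) as [-> _]. apply W_app.
  apply (@cv_sub (BL V) (fun n => W f (v (s n))) P (fun n => S (q n))); auto. intros n. specialize (Hq n). lia. }
 have Hl : forall n, (n <= length (u (q n)))%nat. { intros n. destruct (Hu (q n)) as [_ [_ D]]. have D2 := incr_ge Hq n. lia. }
 have Htn : forall n k, (n <= k)%nat -> t ^ k <= t ^ n. { intros n k Hnk. replace k with (n + (k - n))%nat by lia. rewrite pow_add.
  assert (0 <= t ^ n) by triv. assert (t ^ (k - n) <= 1). rewrite <- (pow1 (k - n)). triv. nra. }
 destruct (fun_choice (fun n => W_aff (proj1 Ht) Hf (proj1 (proj2 (Hu n))))) as [b Hb]. destruct (fun_choice Hb) as [K HK].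
 have HUc : cpt U.
 { apply (@cpt_lim V V (fun n => K (q n))). intros n. apply HK.
  apply (@cv_ext (BL V) (fun n => W f (u (q n)) -v b (q n) *v bid V)). intros n. destruct (HK (q n)) as [E _]. transitivity (b (q n) *v bid V +v K (q n) -v b (q n) *v bid V). rewrite <- E. reflexivity. bring.
  replace U with (U -v 0v : BL V) by vring. apply (@cv_plus (BL V) (fun n => W f (u (q n))) (fun n => -v (b (q n) *v bid V)) U (-v 0v)); auto.
  apply (@cv_opp (BL V) (fun n => b (q n) *v bid V)). intros eps He. destruct (pow_lt_1_zero t ltac:(rewrite Rabs_pos_eq; lra) eps He) as [m Hm].
  exists m. intros n Hn. replace (b (q n) *v bid V -v 0v : BL V) with (b (q n) *v bid V : BL V) by vring. rewrite nm_scal.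
  destruct (HK (q n)) as [_ [_ D]]. specialize (Hm n Hn). rewrite Rabs_pos_eq in Hm by (apply pow_le; lra).
  have D2 := Htn n _ (Hl n). have D3 := nm_id V. have D4 := Cmod_ge_0 (b (q n)). nra. }
 destruct (pow_lt_1_zero t ltac:(rewrite Rabs_pos_eq; lra) (1/2) ltac:(lra)) as [m Hm].
 destruct (@RL V (fun n => W f (u (q (n + m + 1)%nat))) U HUc) as [r [Hr HrU]].
 - apply (@cv_sub (BL V) (fun n => W f (u (q n))) U (fun n => (n + m + 1)%nat)); auto. intros n; lia.
 - intros i. apply rb_le with (t ^ length (u (q (i + m + 1)%nat))).
  + le_by (@Htn m). specialize (Hl (i + m + 1)%nat). lia. specialize (Hm m (le_n _)). apply Rabs_lt_between in Hm. lra.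
  + apply Hrb. apply Hu. specialize (Hl (i + m + 1)%nat). lia.
 - assert (P = 0v). { bext x. rewrite b0A. apply (rb_eigen HrU (k := 1%C)). rewrite Cmod_1. lra.
  rewrite <- bmA, EP, vs1. auto. }
  rewrite H, nm0 in HPn. assert (0 < 1 / (8 * M)) by triv. lra.
Qed.

(** Divided by (1+eta) to the length, the norms tend to 0 because the growth is at most that of
    (1+eta/2) to the length; the maximum is therefore reached among finitely many words. *)
Lemma BW_extremal eta M : 0 < eta -> (forall w, ok N w -> nm (W f w) <= M * (1 + eta / 2) ^ length w) ->
 exists T, ok N T /\ forall w, ok N w -> nm (W f w) * (1 + eta) ^ length T <= nm (W f T) * (1 + eta) ^ length w.
Proof.
 intros He HM. set (g := fun w => nm (W f w) * / (1 + eta) ^ length w).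
 have Hp : forall n, 0 < (1 + eta) ^ n by triv.
 have Hm : exists T, ok N T /\ forall w, ok N w -> g w <= g T.
 { destruct (classic (forall w, ok N w -> g w <= 0)) as [H0|Hn].
  - exists nil. split. intros i []. intros w Hw. specialize (H0 w Hw). unfold g at 2. cbn [length pow]. rewrite Rinv_1. have D := nm_ge0 (W f nil). lra.
  - apply not_all_ex_not in Hn. destruct Hn as [w0 Hn]. apply imply_to_and in Hn. destruct Hn as [Hw0 Hg0]. apply Rnot_le_lt in Hg0.
  have HM0 : 0 <= M. { specialize (HM nil). cbn [length pow] in HM. have D := nm_ge0 (W f nil). have D2 : ok N nil by (intros i []). specialize (HM D2). lra. }
  destruct (pow_lt_1_zero ((1 + eta / 2) / (1 + eta))) with (y := g w0 / (M + 1)) as [n0 Hn0].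
  { rewrite Rabs_pos_eq. apply Rlt_div_l; lra. triv. }
  { triv. }
  set (ws := flat_map (words N) (seq 0 (n0 + length w0 + 1))).
  have Hws : forall w, In w ws <-> ok N w /\ (length w < n0 + length w0 + 1)%nat.
  { intros w. unfold ws. rewrite in_flat_map. split. intros [n [Hn H]]. apply in_seq in Hn. apply wordsP in H. split; [|lia]. tauto.
  intros [H1 H2]. exists (length w). split. apply in_seq. lia. apply wordsP; auto. }
  destruct (@list_max _ ws g) as [T [HT HTm]]. exists w0. apply Hws. split; auto. lia.
  exists T. apply Hws in HT. split. tauto. intros w Hw. destruct (Nat.lt_ge_cases (length w) (n0 + length w0 + 1)). apply HTm. apply Hws; auto.
  le_mid (g w0). 2: { apply HTm. apply Hws. split; auto. lia. }
  specialize (Hn0 (length w) ltac:(lia)). rewrite Rabs_pos_eq in Hn0 by (apply pow_le, div_ge0; lra).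
  le_mid (M * ((1 + eta / 2) / (1 + eta)) ^ length w).
  replace (((1 + eta / 2) / (1 + eta)) ^ length w) with ((1 + eta / 2) ^ length w * / (1 + eta) ^ length w) by (rewrite <- pow_inv, <- Rpow_mult_distr; reflexivity).
  rewrite <- Rmult_assoc. apply mul_le_r. triv. triv.
  have D : ((1 + eta / 2) / (1 + eta)) ^ length w * (M + 1) <= g w0. { replace (g w0) with (g w0 / (M + 1) * (M + 1)) by (field; lra). nra. }
  nra. }
 destruct Hm as [T [HT Hm]]. exists T. split; auto. intros w Hw. specialize (Hm w Hw). unfold g in Hm.
 have D := Hp (length w). have D2 := Hp (length T).
 apply (mul_le_r ((1 + eta) ^ length w * (1 + eta) ^ length T)) in Hm. 2: nra.
 replace (nm (W f w) * / (1 + eta) ^ length w * ((1 + eta) ^ length w * (1 + eta) ^ length T)) with (nm (W f w) * (1 + eta) ^ length T) in Hm by (field; lra).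
 replace (nm (W f T) * / (1 + eta) ^ length T * ((1 + eta) ^ length w * (1 + eta) ^ length T)) with (nm (W f T) * (1 + eta) ^ length w) in Hm by (field; lra). auto.
Qed.
End BWirr.
Section BWirr2.
Variable V : CBanach.
Variables (f : nat -> bop V V) (N : nat) (t : R).
Hypothesis Ht : 0 <= t < 1.
Hypothesis Hf : forall i, (i < N)%nat -> aff t (f i).
Definition winv (A : V -> Prop) := forall i x, (i < N)%nat -> A x -> A (f i x).
(** Modulo the invariant subspace [Z], each block of [n] letters contracts by [c]; the estimate for
    vectors is turned into one for distances by subtracting a nearly nearest point of [Z]. *)
Lemma dist_pow (Z : V -> Prop) n c : vsubspace Z -> winv Z -> 0 <= c -> (forall w x, ok N w -> length w = n -> nm x <= 1 -> vdist Z (W f w x) <= c) ->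
 forall k w v, ok N w -> length w = (n * S k)%nat -> vdist Z (W f w v) <= c ^ S k * nm v.
Proof.
 intros SZ IZ Hc H.
 have Hd1 : forall w v, ok N w -> length w = n -> vdist Z (W f w v) <= c * nm v.
 { intros w v Hw Lw. destruct (Rle_lt_or_eq_dec _ _ (nm_ge0 v)) as [Hv|Hv].
  - have Em : Cmod (RtoC (/ nm v)) = / nm v. { rewrite Cmod_R, Rabs_pos_eq; auto. triv. }
  specialize (H w (RtoC (/ nm v) *v v) Hw Lw). rewrite nm_scal, Em, Rinv_l, bZ, vdist_scal, Em in H by (auto; lra).
  specialize (H ltac:(lra)). apply (mul_le_l (nm v)) in H; [|lra]. rewrite <- Rmult_assoc, Rinv_r, Rmult_1_l in H; lra.
  - symmetry in Hv. apply nm_eq0 in Hv. subst v. rewrite b0, nm0, vdist_in; auto. lra. apply SZ. }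
 have Hd2 : forall w v, ok N w -> length w = n -> vdist Z (W f w v) <= c * vdist Z v.
 { intros w v Hw Lw. apply le_epsilon. intros eps He. destruct (vdist_appr SZ v (eps := eps / (c + 1))) as [z [Hz Hn]]. apply div_gt0; lra.
  have D := Hd1 w (v -v z) Hw Lw. replace (W f w v) with (W f w (v -v z) +v W f w z) by (rewrite bD, bN; vring).
  rewrite vdist_addW; auto. 2: apply (W_inv (N := N)); auto. le_by D. le_mid (c * (vdist Z v + eps / (c + 1))). apply mul_le_l; lra.
  assert (c * (eps / (c + 1)) <= eps). { replace eps with ((c + 1) * (eps / (c + 1))) at 2 by (field; lra). triv. } lra. }
 induction k; intros w v Hw Lw. rewrite pow_1. apply Hd1; auto. lia.
 destruct (ok_split (m := n) Hw) as [u [w' [E [Hu [Hw' Lu]]]]]. nia. rewrite E, W_app, bmA. eapply Rle_trans. apply Hd2; auto.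
 have D := IHk w' v Hw'. rewrite E, length_app in Lw. specialize (D ltac:(nia)). replace (c ^ S (S k)) with (c * c ^ S k) by reflexivity. nra.
Qed.
(** Long words contract strongly modulo [Z] and have a tiny scalar part. What remains is compact, so
    that finitely many net points of finitely many words matter, and directedness lets one member of
    the family approximate them all. *)
Lemma W_net (Fm : (V -> Prop) -> Prop) Z n : (exists A, Fm A) -> (forall A B, Fm A -> Fm B -> exists D, Fm D /\ (forall x, A x -> D x) /\ forall x, B x -> D x) ->
 vsubspace Z -> winv Z -> (forall z eps, Z z -> 0 < eps -> exists A x, Fm A /\ A x /\ nm (z -v x) < eps) -> (0 < n)%nat ->
 (forall w x, ok N w -> length w = n -> nm x <= 1 -> vdist Z (W f w x) <= 1/8) ->
 exists m A, (0 < m)%nat /\ Fm A /\ forall w v, ok N w -> length w = m -> nm v <= 1 -> exists u, A u /\ nm (W f w v -v u) < 1/16.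
Proof.
 intros [A0 HA0] Hch SZ IZ Hap Hn Hd. assert (Hd' := dist_pow SZ IZ (c := 1/8) ltac:(lra) Hd).
 destruct (pow_small (eps := 1/128) Ht) as [k Hk]. lra. set (m := (n * S (S (S k)))%nat).
 have Htm : t ^ m <= 1/128. { le_mid (t ^ k). apply pow_le_mono. lra. nia. lra. }
 have H8 : (1/8) ^ S (S (S k)) <= 1/128. { le_mid ((1/8)^3). apply pow_le_mono. lra. lia. lra. }
 destruct (W_aff_choice Ht Hf) as [b [K HbK]].
 have Hnet : forall l : list V, exists A, Fm A /\ forall v, In v l -> vdist Z v < 4/128 -> exists u, A u /\ nm (v -v u) < 4/128.
 { induction l as [|v l [A [FA HA]]]. exists A0. split; auto. intros v []. destruct (Rlt_dec (vdist Z v) (4/128)) as [Hv|Hv].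
  - destruct (vdist_appr SZ v (eps := 4/128 - vdist Z v)) as [z [Zz Hz]]. lra. destruct (Hap z (4/128 - nm (v -v z)) Zz) as [B [u [FB [Bu Hu]]]]. lra.
  destruct (Hch A B FA FB) as [D [FD [AD BD]]]. exists D. split; auto. intros v' [<-|Hv'] Hd1. exists u. split; auto. have Q := nm_sub_tri v z u. lra. destruct (HA v' Hv' Hd1) as [u' [H1 H2]]. exists u'; auto.
  - exists A. split; auto. intros v' [<-|Hv'] Hd1. lra. auto. }
 have Hwn : forall l, exists A, Fm A /\ forall w, In w l -> ok N w -> length w = m -> forall v, nm v <= 1 -> exists u, A u /\ nm (W f w v -v u) < 1/16.
 { induction l as [|w l [A [FA HA]]]. exists A0. split; auto. intros w []. destruct (classic (ok N w /\ length w = m)) as [[Hw Lw]|Hw].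
  - destruct (HbK w Hw) as [E [HK Hb]]. rewrite Lw in Hb. destruct (cpt_net HK (eps := 1/128)) as [nt Hnt]. lra. destruct (Hnet nt) as [B [FB HB]].
  destruct (Hch A B FA FB) as [D [FD [AD BD]]]. exists D. split; auto. intros w' [<-|Hw'] Hok Hlen v Hv. 2: { destruct (HA w' Hw' Hok Hlen v Hv) as [u [H1 H2]]. exists u; auto. }
  destruct (Hnt v Hv) as [q [Hq Hqn]]. have Hwq : nm (W f w v -v q) <= 2/128.
  { rewrite E. replace ((b w *v bid V +v K w) v -v q) with (b w *v v +v (K w v -v q)) by (bpush; vring). le_by nm_tri. rewrite nm_scal. have Q := Cmod_ge_0 (b w). nra. }
  destruct (HB q Hq) as [u [Hu1 Hu2]]. { have Q := vdist_sub SZ q (W f w v). rewrite nm_subC in Q. have Q2 := Hd' _ w v Hw Lw. have Q3 := nm_ge0 v. nra. }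
  exists u. split; auto. have Q := nm_sub_tri (W f w v) q u. lra.
  - exists A. split; auto. intros w' [<-|Hw'] Hok Hlen v Hv. tauto. eauto. }
 destruct (Hwn (words N m)) as [A [FA HA]]. exists m, A. split. nia. split; auto. intros w v Hw Lw Hv. apply (HA w); auto. apply wordsP; auto.
Qed.
Hypothesis Hgrow : forall eta, 0 < eta -> exists M, forall w, ok N w -> nm (W f w) <= M * (1 + eta) ^ length w.
Hypothesis Hunb : ~ exists M, forall w, ok N w -> nm (W f w) <= M.
(** Nearly extremal words of large norm: they dominate all shorter words, and prolonging them on the
    left hardly increases the norm. *)
Lemma BW_words j : exists T, ok N T /\ (j <= length T)%nat /\ INR (S j) <= nm (W f T) /\
 (forall w, ok N w -> (length w <= length T)%nat -> nm (W f w) <= nm (W f T)) /\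
 (forall s, ok N s -> nm (W f (s ++ T)) <= (1 + / INR (S j)) ^ length s * nm (W f T)).
Proof.
 destruct (W_bound f N j) as [M0 [HM0 HM]]. set (K := M0 + INR (S j)).
 have Hj : 0 < INR (S j) by triv.
 have Hw : exists w0, ok N w0 /\ 2 * K < nm (W f w0).
 { contra H. apply Hunb. exists (2 * K). intros w Hw. apply Rnot_lt_le. intros Hl. apply H. exists w; auto. }
 destruct Hw as [w0 [Hw0 HK]]. have Hl : 0 <= INR (length w0) by triv.
 (* Small against 1/(j+1) for the last estimate, and against the length of [w0] so that (1+eta) to
    that length is at most 2 and the extremal word inherits half the norm of [w0]. *)
 set (eta := Rmin (/ INR (S j)) (/ (2 * (INR (length w0) + 1)))).
 have He : 0 < eta. { apply Rmin_glb_lt; apply inv_gt0; lra. }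
 have H2 : (1 + eta) ^ length w0 <= 2.
 { apply pow_le_2. lra. le_mid ((INR (length w0) + 1) * (/ (2 * (INR (length w0) + 1)))). apply Rmult_le_compat; try lra. apply Rmin_r. right. field. lra. }
 destruct (Hgrow (eta := eta / 2)) as [M HMg]. lra.
 destruct (BW_extremal Ht He HMg) as [T [HT Hext]]. exists T. have Hp : forall n, 1 <= (1 + eta) ^ n. { intros n. apply pow_R1_Rle. lra. }
 have HTK : K < nm (W f T). { specialize (Hext w0 Hw0). have D := Hp (length T). have D1 := nm_ge0 (W f T). nra. }
 have HTa : forall w, ok N w -> nm (W f w) <= nm (W f T) * (1 + eta) ^ length w * / (1 + eta) ^ length T.
 { intros w Hw. specialize (Hext w Hw). have D := Hp (length T). apply Rmult_le_reg_r with ((1 + eta) ^ length T). lra.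
  replace (nm (W f T) * (1 + eta) ^ length w * / (1 + eta) ^ length T * (1 + eta) ^ length T) with (nm (W f T) * (1 + eta) ^ length w) by (field; lra). auto. }
 split; auto. split; [|split; [|split]].
 - destruct (Nat.le_gt_cases j (length T)) as [|Hlt]; auto. specialize (HM T HT ltac:(lia)). unfold K in HTK. lra.
 - unfold K in HTK. lra.
 - intros w Hw Hlw. eapply Rle_trans. apply HTa; auto. have D := Hp (length T). have D2 := pow_ge_mono (t := 1 + eta) ltac:(lra) Hlw.
  rewrite Rmult_assoc. replace (nm (W f T)) with (nm (W f T) * 1) at 2 by ring. apply mul_le_l. apply nm_ge0.
  apply Rmult_le_reg_r with ((1 + eta) ^ length T). lra. rewrite Rmult_assoc, Rinv_l by lra. lra.
 - intros s Hs. le_by HTa. apply ok_app; auto. have D := Hp (length T). rewrite length_app, pow_add.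
  replace (nm (W f T) * ((1 + eta) ^ length s * (1 + eta) ^ length T) * / (1 + eta) ^ length T) with ((1 + eta) ^ length s * nm (W f T)) by (field; lra).
  apply mul_le_r. apply nm_ge0. apply pow_incr. split. lra. assert (eta <= / INR (S j)) by apply Rmin_l. lra.
Qed.
Hypothesis Hmax : forall Z : V -> Prop, vsubspace Z -> vclosed Z -> (forall i x, (i < N)%nat -> Z x -> Z (f i x)) -> (exists x, Z x /\ x <> 0v) ->
 exists n, (0 < n)%nat /\ forall w x, ok N w -> length w = n -> nm x <= 1 -> vdist Z (W f w x) <= 1/8.
(** Normalised images under the words of [BW_words] converge to a nonzero vector with bounded orbit,
    so the vectors of bounded orbit span a nonzero invariant subspace. Modulo its closure words
    become small by [Hmax]; hence the last letters of an extremal word send the unit ball near a set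
    of uniformly bounded orbits, which is too little for its large norm. *)
Lemma BW_unbounded : False.
Proof.
 destruct (fun_choice BW_words) as [T HT]. destruct (fun_choice (fun j => nm_attain (W f (T j)))) as [x Hx].
 set (M := fun j => nm (W f (T j))). have HM : forall j, INR (S j) <= M j by (intros; apply HT).
 have HM0 : forall j, 0 < M j. { intros j. specialize (HM j). assert (0 < INR (S j)) by triv. lra. }
 set (y := fun j => RtoC (/ M j) *v W f (T j) (x j)).
 have Hc : forall j (z : V), nm (RtoC (/ M j) *v z) = / M j * nm z. { intros j z. rewrite nm_scal, Cmod_R, Rabs_pos_eq; auto. triv. }
 have Hcl : forall j (z : V) c, nm z <= M j * c -> nm (RtoC (/ M j) *v z) <= c. { intros j z c Hz. rewrite Hc. specialize (HM0 j). apply Rmult_le_reg_l with (M j); auto. rewrite <- Rmult_assoc, Rinv_r, Rmult_1_l; lra. }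
 destruct (W_aff_choice Ht Hf) as [b [K HbK]].
 (* Split off the first [m] letters: their scalar part is at most t^m, and the remaining word, being
    shorter than the extremal one, sends the normalised vectors into the unit ball, on which the
    compact part acts. *)
 have Hprec : prec y.
 { apply prec_approx_ev. intros eps He. destruct (pow_small Ht He) as [m Hm].
  have Hs : forall j, exists ac : list nat * list nat, (m <= j)%nat -> T j = fst ac ++ snd ac /\ ok N (fst ac) /\ ok N (snd ac) /\ length (fst ac) = m.
  { intros j. destruct (Nat.le_gt_cases m j) as [Hj|Hj]. 2: { exists (nil, nil). lia. } destruct (HT j) as [H1 [H2 _]].
  destruct (ok_split (m := m) H1) as [u [v [E [Hu [Hv L]]]]]. lia. exists (u, v). auto. }
  destruct (fun_choice Hs) as [ac Hac]. set (u := fun j => RtoC (/ M j) *v W f (snd (ac j)) (x j)).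
  have Hu : forall j, (m <= j)%nat -> nm (u j) <= 1.
  { intros j Hj. apply Hcl. destruct (Hac j Hj) as [E [H1 [H2 H3]]]. destruct (HT j) as [_ [_ [_ [Hle _]]]]. rewrite Rmult_1_r. destruct (Hx j) as [Hx1 _].
  eapply Rle_trans. apply nm_app1; auto. apply Hle; auto. rewrite E, length_app. lia. }
  exists (fun j => K (fst (ac j)) (u j)), m. split.
  - apply prec_shift with m. apply (@prec_pigeon V _ (words N m) (fun n => fst (ac (n + m)%nat)) (fun c n => K c (u (n + m)%nat))).
  intros n. destruct (Hac (n + m)%nat ltac:(lia)) as [_ [H1 [_ H2]]]. apply wordsP; auto.
  intros c Hcc. apply wordsP in Hcc. apply (cpt_prec (M := 1)). apply HbK; tauto. intros n. apply Hu. lia.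
  - intros j Hj. destruct (Hac j Hj) as [E [H1 [H2 H3]]]. destruct (HbK _ H1) as [E1 [_ E2]]. rewrite H3 in E2.
  replace (y j -v K (fst (ac j)) (u j)) with (b (fst (ac j)) *v u j).
  rewrite nm_scal. specialize (Hu j Hj). have D := nm_ge0 (u j). have D2 := Cmod_ge_0 (b (fst (ac j))). nra.
  unfold y, u. rewrite E, W_app, E1. bring. }
 destruct (prec_cv Hprec) as [p [z0 [Hp Hz0]]].
 set (Z0 := fun z : V => exists B, forall s, ok N s -> nm (W f s z) <= B).
 have SZ0 : vsubspace Z0.
 { split; [|split]. exists 0. intros s _. rewrite b0, nm0. lra. intros z z' [B HB] [B' HB']. exists (B + B'). intros s Hs. rewrite bD. apply nm_tri_le; auto.
  intros c z [B HB]. exists (Cmod c * B). intros s Hs. rewrite bZ, nm_scal. triv. }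
 (* For a fixed word [s], the factor (1 + 1/(j+1)) to the length of [s] is at most 2 once [j] is
    large; hence the uniform bound 2. *)
 have Hz0Z : Z0 z0.
 { exists 2. intros s Hs. apply (cv_nm_le (u := fun n => W f s (y (p n)))). apply (@cv_app V V (W f s) (fun n => y (p n))); auto.
  destruct (small_inv (eps := 1 / (2 * (INR (length s) + 1)))) as [n0 Hn0]. apply div_gt0. lra. have D := pos_INR (length s). lra.
  exists n0. intros n Hn. have D := incr_ge Hp n. specialize (Hn0 (p n) ltac:(lia)). unfold y. rewrite bZ. apply Hcl. rewrite <- bmA, <- W_app.
  destruct (HT (p n)) as [_ [_ [_ [_ Hb]]]]. specialize (Hb s Hs). destruct (Hx (p n)) as [Hx1 _]. eapply Rle_trans. apply nm_app1; auto.
  le_by Hb. rewrite Rmult_comm. apply mul_le_l. apply nm_ge0. have D4 := inv_S_pos (p n). apply pow_le_2. lra.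
  have D3 := pos_INR (length s). le_mid ((INR (length s) + 1) * (1 / (2 * (INR (length s) + 1)))). apply Rmult_le_compat; lra. right; field; lra. }
 have Hz0n : z0 <> 0v.
 { intros E. have D : 1/2 <= nm z0. { apply (cv_nm_ge Hz0). exists O. intros n _. unfold y. rewrite Hc. destruct (Hx (p n)) as [_ D]. specialize (HM0 (p n)). fold (M (p n)) in D.
  apply Rmult_le_reg_l with (M (p n)); auto. rewrite <- Rmult_assoc, Rinv_r, Rmult_1_l; lra. } rewrite E, nm0 in D. lra. }
 set (Z := vclosure Z0). have SZ : vsubspace Z by now apply vclosure_sub.
 have CZ : vclosed Z by apply vclosure_closed.
 have IZ : forall i z, (i < N)%nat -> Z z -> Z (f i z).
 { intros i z Hi Hz. destruct (vclosure_cv Hz) as [u [Hu Hcu]]. apply cv_vclosure with (fun n => f i (u n)). 2: now apply cv_app.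
  intros n. destruct (Hu n) as [B HB]. exists B. intros s Hs. rewrite <- bmA. replace (W f s ** f i) with (W f (s ++ [i])). apply HB. apply ok_app. split; auto. intros k [<-|[]]; auto.
  rewrite W_app. bring. }
 destruct (Hmax SZ CZ IZ) as [n [Hn Hnd]]. exists z0. split; auto. now apply vclosure_in.
 destruct (@W_net (fun A => exists B, A = fun z => forall s, ok N s -> nm (W f s z) <= B) Z n) as [m [A [Hm [[B ->] HB]]]]; auto. now exists (fun z => forall s, ok N s -> nm (W f s z) <= 0), 0.
 { intros A A' [B ->] [B' ->]. eexists. split. now exists (Rmax B B'). have Q1 := Rmax_l B B'. have Q2 := Rmax_r B B'. split; intros z Hz s Hs; specialize (Hz s Hs); lra. }
 { intros z eps Hz He. destruct (Hz eps He) as [z' [[B HB] Hn']]. exists (fun z => forall s, ok N s -> nm (W f s z) <= B), z'. split; eauto. }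
 (* [B] bounds the orbits met after the last [m] letters; a [j] far beyond it makes [B] negligible
    against the norm [M j], while the error is at most a fraction of [M j] below 1/2. *)
 destruct (INR_unbounded (8 * Rabs B + INR m + 1)) as [j Hj]. have Hjm : (m <= j)%nat. { apply INR_le. have D := Rabs_pos B. lra. }
 destruct (HT j) as [H1 [H2 [H3 [H4 _]]]]. destruct (ok_split (m := length (T j) - m) H1) as [u [w [E [Hu [Hw Lu]]]]]. lia.
 have Lw : length w = m. { have D : (length (T j) = length u + length w)%nat by (rewrite E at 1; apply length_app). lia. }
 destruct (Hx j) as [Hx1 Hx2]. destruct (HB w (x j) Hw Lw Hx1) as [z [Hz2 Hz1]].
 fold (M j) in Hx2. rewrite E, W_app, bmA in Hx2. specialize (Hz2 u Hu).
 replace (W f u (W f w (x j))) with (W f u (W f w (x j) -v z) +v W f u z) in Hx2 by (rewrite bD, bN; vring).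
 have D := nm_tri (W f u (W f w (x j) -v z)) (W f u z). have D2 := nm_app (W f u) (W f w (x j) -v z).
 have D3 : nm (W f u) <= M j by (apply H4; auto; lia). have D4 := nm_ge0 (W f u). have D5 := nm_ge0 (W f w (x j) -v z).
 have D6 : nm (W f u) * nm (W f w (x j) -v z) <= M j * (3/8) by nra.
 have D7 := HM j. rewrite S_INR in D7. have D8 := Rle_abs B. have D9 := pos_INR m. lra.
Qed.
End BWirr2.
Lemma quo_op_nm (V E : CBanach) (q : bop V E) (T : bop V V) (T' : bop E E) :
 (forall (y : E) eps, 0 < eps -> exists x, q x = y /\ nm x < nm y + eps) -> (forall x, nm (q x) <= nm x) ->
 T' ** q = q ** T -> nm T' <= nm T.
Proof.
 intros Hl Hq E0. apply nm_le. apply nm_ge0. intros y. have HT := nm_ge0 T. apply le_epsilon. intros eps He.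
 destruct (Hl y (eps / (nm T + 1))) as [x [<- Hx]]. triv. rewrite <- bmA, E0, bmA.
 le_by Hq. le_by nm_app. le_mid (nm T * (nm (q x) + eps / (nm T + 1))). nra.
 assert (nm T * (eps / (nm T + 1)) <= eps). { replace eps with ((nm T + 1) * (eps / (nm T + 1))) at 2 by (field; lra). triv. }
 lra.
Qed.
Lemma quo_op_pow (V E : CBanach) (q : bop V E) (T : bop V V) (T' : bop E E) n : T' ** q = q ** T -> T' ^^ n ** q = q ** T ^^ n.
Proof. intros H. induction n; sim. bring. now rewrite <- bcA, IHn, bcA, H, <- bcA. Qed.
Lemma vdist_clos V (A : V -> Prop) x : vsubspace A -> vdist (vclosure A) x = vdist A x.
Proof.
 intros SA. have SC := vclosure_sub SA. apply Rle_antisym.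
 - apply vdist_glb; auto. intros w Hw. apply vdist_le; auto. now apply vclosure_in.
 - apply vdist_glb; auto. intros w Hw. apply le_epsilon. intros eps He. destruct (Hw eps He) as [w' [H1 H2]].
  le_by (vdist_le SA x H1). have D := nm_sub_tri x w w'. lra.
Qed.
Lemma bernoulli x n : 0 <= x <= 1 -> 1 - INR n * x <= (1 - x) ^ n.
Proof.
 intros Hx. induction n. simpl. lra. rewrite S_INR. cbn [pow]. have D := pos_INR n. nra.
Qed.
Section BWz.
Variable V : CBanach.
Variables (f : nat -> bop V V) (N : nat) (t : R).
Hypothesis Ht : 0 <= t < 1.
Hypothesis Hf : forall i, (i < N)%nat -> aff t (f i).
(** Large words of every length survive modulo [A]. The threshold is half of the 1/8 used for norms,
    the loss incurred when a norm is tested on one vector of the unit ball. *)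
Definition wbig (A : V -> Prop) := forall n, (0 < n)%nat -> exists w x, ok N w /\ length w = n /\ nm x <= 1 /\ 1/16 <= vdist A (W f w x).
(** The chain condition for Zorn. Were the union to absorb the words of some length, [W_net] would
    bring all images of the unit ball under words of some length within 1/16 of a single member. *)
Lemma wbig_chain (Fm : (V -> Prop) -> Prop) : (exists A, Fm A) -> (forall A, Fm A -> vsubspace A /\ (winv f N A /\ wbig A)) ->
 (forall A B, Fm A -> Fm B -> (forall x, A x -> B x) \/ (forall x, B x -> A x)) -> vsubspace (fun x => exists A, Fm A /\ A x) ->
 winv f N (fun x => exists A, Fm A /\ A x) /\ wbig (fun x => exists A, Fm A /\ A x).
Proof.
 set (U := fun x => exists A, Fm A /\ A x). intros [A0 HA0] HF Hch SU.
 have IU : winv f N U. { intros i x Hi [A [FA Ax]]. exists A. split; auto. apply (HF A FA); auto. }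
 split; auto. contra Hn. apply not_all_ex_not in Hn. destruct Hn as [n Hn]. apply imply_to_and in Hn. destruct Hn as [Hn Hc].
 destruct (@W_net V f N t Ht Hf Fm U n) as [m [A [Hm [FA HA]]]]; auto. now exists A0.
 - intros A B FA FB. destruct (Hch A B FA FB) as [Hi|Hi]; [exists B|exists A]; auto.
 - intros z eps [A [FA Az]] He. exists A, z. rewrite vaddN, nm0. auto.
 - intros w x H1 H2 H3. apply Rnot_lt_le. intros Hl. apply Hc. exists w, x. repeat split; auto. lra.
 - destruct (HF A FA) as [SA [IA BA]]. destruct (BA m Hm) as [w [x [Hw [Lw [Hx Hb]]]]].
  destruct (HA w x Hw Lw Hx) as [u [Hu1 Hu2]]. have D := vdist_le SA (W f w x) Hu1. lra.
Qed.
End BWz.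
(** Suppose that large words exist at every length. Divide by a maximal invariant subspace modulo
    which this persists; in the quotient the words are bounded or unbounded, and the two cases are
    excluded by [BW_bounded] and [BW_unbounded]. *)
Lemma BW0 V (f : nat -> bop V V) N t : 0 <= t < 1 -> (forall i, (i < N)%nat -> aff t (f i)) ->
 (forall w, ok N w -> (0 < length w)%nat -> rb (W f w) (t ^ length w)) ->
 (forall eta, 0 < eta -> exists M, forall w, ok N w -> nm (W f w) <= M * (1 + eta) ^ length w) ->
 exists n, (0 < n)%nat /\ forall w, ok N w -> length w = n -> nm (W f w) < 1/8.
Proof.
 intros Ht Hf Hrb Hgrow. contra Hno.
 have Hbig : forall n, (0 < n)%nat -> exists w, ok N w /\ length w = n /\ 1/8 <= nm (W f w).
 { intros n Hn. contra H. apply Hno. exists n. split; auto. intros w H1 H2. apply Rnot_le_lt. intros Hl. apply H. exists w; auto. }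
 destruct (@zorn_sub V (fun A => vsubspace A -> winv f N A /\ wbig f N A)) as [A [SA [HA Hm]]].
 - intros Fm H1 H2 H3 H4. apply (wbig_chain Ht Hf); auto. intros B FB. destruct (H2 B FB) as [D1 D2]. auto.
 - intros S0. split. intros i x _ ->. apply b0. intros n Hn. destruct (Hbig n Hn) as [w [Hw [Lw Hb]]]. destruct (nm_attain (W f w)) as [x [Hx1 Hx2]].
  exists w, x. split; auto. split; auto. split; auto. apply vdist_glb; auto. intros z ->. replace (W f w x -v 0v) with (W f w x) by vring. lra.
 - specialize (HA SA). destruct HA as [IA BA]. have SC := vclosure_sub SA.
  have CA : vclosed A.
  { have Hc : forall x, vclosure A x -> A x.
  { apply Hm; auto. 2: apply vclosure_in. intros _. split.
  - intros i x Hi Hx. destruct (vclosure_cv Hx) as [u [Hu Hcu]]. apply cv_vclosure with (fun n => f i (u n)). intros n; apply IA; auto. now apply cv_app.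
  - intros n Hn. destruct (BA n Hn) as [w [x [H1 [H2 [H3 H4]]]]]. exists w, x. rewrite vdist_clos; auto. }
  intros u l Hu Hl. apply Hc. apply cv_vclosure with u; auto. }
  destruct (quotient SA CA) as [E [q [Hsj [Hk0 [Hfac [Hind [Hcp [Hqn Hql]]]]]]]].
  have Hq1 : forall x, nm (q x) <= nm x by (intros x; rewrite Hqn; now apply vdist_nm).
  have Hfi : forall i, exists T : bop E E, (i < N)%nat -> T ** q = q ** f i.
  { intros i. destruct (Nat.lt_ge_cases i N) as [Hi|Hi]. destruct (Hind (f i)) as [T HT]. intros x; apply IA; auto. exists T; auto. exists 0v. lia. }
  destruct (fun_choice Hfi) as [g Hg].
  have HW : forall w, ok N w -> W g w ** q = q ** W f w.
  { induction w as [|i w IH]; intros Hw; cbn [W]. bring. rewrite <- bcA, IH, bcA, Hg, <- bcA; auto. apply Hw; now left. intros j Hj; apply Hw; now right. }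
  have HWn : forall w, ok N w -> nm (W g w) <= nm (W f w). { intros w Hw. apply (quo_op_nm Hql Hq1). auto. }
  have Hga : forall i, (i < N)%nat -> aff t (g i).
  { intros i Hi. destruct (Hf i Hi) as [b [K [E1 [HK Hb]]]]. exists b, (g i -v b *v bid E). split. bring. split; auto. apply (Hcp K); auto.
  replace ((g i -v b *v bid E) ** q) with (g i ** q -v b *v q) by bring. rewrite (Hg i Hi), E1. bring. }
  have Hgr : forall w, ok N w -> (0 < length w)%nat -> rb (W g w) (t ^ length w).
  { intros w Hw Lw r Hr. destruct (Hrb w Hw Lw r Hr) as [M [HM HMn]]. exists M. split; auto. intros n. le_to HMn.
  apply (quo_op_nm Hql Hq1). apply quo_op_pow. auto. }
  have Hgg : forall eta, 0 < eta -> exists M, forall w, ok N w -> nm (W g w) <= M * (1 + eta) ^ length w.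
  { intros eta He. destruct (Hgrow eta He) as [M HM]. exists M. intros w Hw. eapply Rle_trans. auto. auto. }
  have Hgb : forall n, (0 < n)%nat -> exists w, ok N w /\ length w = n /\ 1/8 <= nm (W g w).
  (* Doubling the length recovers the threshold: two factors of norm at most 1/8 give at most 1/64,
     less than the 1/16 guaranteed by [wbig]. *)
  { intros n Hn. contra H. destruct (BA (n + n)%nat) as [w [x [Hw [Lw [Hx Hd]]]]]. lia.
  destruct (ok_split (m := n) Hw) as [u [v [E1 [Hu [Hv Lu]]]]]. lia.
  have Lv : length v = n. { rewrite E1, length_app in Lw. lia. }
  have Hs : forall w, ok N w -> length w = n -> nm (W g w) <= 1/8. { intros w' H1 H2. apply Rnot_lt_le. intros Hl. apply H. exists w'. repeat split; auto. lra. }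
  have D : nm (W g w) <= 1/64. { rewrite E1, W_app. le_by nm_comp. have D1 := Hs u Hu Lu. have D2 := Hs v Hv Lv. have D3 := nm_ge0 (W g u). nra. }
  rewrite <- Hqn, <- bmA, <- HW, bmA in Hd by auto. have D2 := nm_app (W g w) (q x). specialize (Hq1 x). have D4 := nm_ge0 (W g w). nra. }
  (* Maximality of [A] enters in the unbounded case only, where words must become small modulo each
     nonzero closed invariant subspace of the quotient. *)
  destruct (classic (exists M, forall w, ok N w -> nm (W g w) <= M)) as [[M HM]|Hunb].
  + apply (@BW_bounded E g N t Ht Hga Hgb M); auto.
  + apply (@BW_unbounded E g N t Ht Hga Hgg Hunb). intros Z SZ CZ IZ [z [Zz Hz]].
  set (Y := fun x => Z (q x)). have SY : vsubspace Y. { unfold Y. split; [|split]. rewrite b0. apply SZ. intros x y Hx Hy. rewrite bD. now apply SZ. intros c x Hx. rewrite bZ. now apply SZ. }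
  have IY : winv f N Y. { intros i x Hi Hx. unfold Y. rewrite <- bmA, <- Hg, bmA by auto. triv. }
  have HnB : ~ wbig f N Y.
  { intros HB. destruct (Hsj z) as [x <-]. apply Hz. apply Hk0. apply (Hm Y); auto. intros y Hy. unfold Y. apply Hk0 in Hy. rewrite Hy. apply SZ. }
  apply not_all_ex_not in HnB. destruct HnB as [n Hn]. apply imply_to_and in Hn. destruct Hn as [Hn Hc]. exists n. split; auto.
  intros w y Hw Lw Hy. destruct (Hql y 1 ltac:(lra)) as [x [<- Hx]].
  have D : vdist Y (W f w (RtoC (1/2) *v x)) < 1/16.
  { apply Rnot_le_lt. intros Hl. apply Hc. exists w, (RtoC (1/2) *v x). split; auto. split; auto. split; auto. rewrite nm_scal, Cmod_R, Rabs_pos_eq; lra. }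
  rewrite bZ, vdist_scal, Cmod_R, Rabs_pos_eq in D by (auto; lra). rewrite <- bmA, HW, bmA by auto.
  le_mid (vdist Y (W f w x)). 2: lra. apply vdist_glb; auto. intros y' Hy'. le_by (vdist_le SZ _ Hy').
  rewrite <- bN, <- bD. triv.
Qed.
Section BW.
Variable V : CBanach.
Lemma W_scal (f : nat -> bop V V) (c : C) w : W (fun i => c *v f i) w = cpow c (length w) *v W f w.
Proof. induction w as [|i w IH]; cbn [W length cpow]. bring. rewrite IH. bring. Qed.
(** Cut a word into blocks of length [n]; the last incomplete block costs a constant, and dividing
    by a power of min(1, r) makes that constant valid also when r < 1. *)
Lemma W_growth (f : nat -> bop V V) N n r : (0 < n)%nat -> 0 < r -> (forall w, ok N w -> length w = n -> nm (W f w) <= r ^ n) ->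
 exists M, forall w, ok N w -> nm (W f w) <= M * r ^ length w.
Proof.
 intros Hn Hr H. destruct (W_bound f N n) as [M0 [HM0 HM]]. set (s := Rmin 1 r). have Hs : 0 < s <= 1. { split. apply Rmin_glb_lt; lra. apply Rmin_l. }
 set (mu := s ^ n). have Hmu : 0 < mu by (apply pow_lt; lra).
 have Hc : forall k w, (length w <= k)%nat -> ok N w -> nm (W f w) <= M0 / mu * r ^ length w.
 { induction k; intros w Hk Hw.
  - destruct w; [|simpl in Hk; lia]. le_mid M0. apply HM; auto; simpl; lia. rewrite Rmult_1_r. apply Rle_div_r; auto.
  assert (mu <= 1). { rewrite <- (pow1 n). apply pow_incr; lra. } nra.
  - destruct (Nat.le_gt_cases n (length w)) as [Hl|Hl].
  + destruct (ok_split (m := n) Hw Hl) as [u [v [E [Hu [Hv Lu]]]]]. have L : (length w = n + length v)%nat by (rewrite E, length_app; lia).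
  rewrite E at 1. rewrite W_app, L, pow_add. le_by nm_comp. have D2 := IHk v ltac:(lia) Hv.
  replace (M0 / mu * (r ^ n * r ^ length v)) with (r ^ n * (M0 / mu * r ^ length v)) by ring. apply Rmult_le_compat; auto; apply nm_ge0.
  + le_mid M0. apply HM; auto; lia. replace (M0 / mu * r ^ length w) with (M0 * (r ^ length w / mu)) by (field; lra).
  have D : 1 <= r ^ length w / mu. { apply Rle_div_r; auto. rewrite Rmult_1_l. le_mid (s ^ length w). apply pow_le_mono. lra. lia. apply pow_incr. split. lra. apply Rmin_r. }
  nra. }
 exists (M0 / mu). intros w Hw. apply (Hc (length w)); auto.
Qed.
(** If the optimal growth rate rho were at least [kap], dividing by rho would turn the scalar bound
    into c0/rho < 1, and [BW0] would produce a rate smaller than rho. So some rate is at most [kap],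
    and [renorm] applies to the rescaled family. *)
Theorem BW (f : nat -> bop V V) N c0 kap : 0 <= c0 < kap -> (forall i, (i < N)%nat -> aff c0 (f i)) ->
 (forall w, ok N w -> (0 < length w)%nat -> rb (W f w) (c0 ^ length w)) ->
 exists Nn M, isnm Nn M /\ forall i x, (i < N)%nat -> Nn (f i x) <= kap * Nn x.
Proof.
 intros Hc Hf Hrb. set (S0 := fun r => 0 < r /\ exists M, forall w, ok N w -> nm (W f w) <= M * r ^ length w).
 destruct (classic (exists r, S0 r /\ r <= kap)) as [[r [[Hr [M HM]] Hrk]]|Hno].
 - have Er : Cmod (RtoC (/ r)) = / r. { rewrite Cmod_R, Rabs_pos_eq; auto. triv. }
  have Hri := inv_gt0 _ Hr.
  destruct (@renorm V (fun g => exists i, (i < N)%nat /\ g = RtoC (/ r) *v f i) (Rabs M + 1)) as [Nn [HN HNf]].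
  + have D := Rabs_pos M. lra.
  + intros w Hw. have Hv : exists v, ok N v /\ w = W (fun i => RtoC (/ r) *v f i) v.
  { induction Hw as [|g w [i [Hi ->]] _ [v [Hv ->]]]. exists nil. split; auto. intros i []. exists (i :: v). split; auto. intros j [<-|Hj]; auto. }
  destruct Hv as [v [Hv ->]]. rewrite W_scal, nm_scal, cpow_mod, Er, pow_inv. le_mid (/ r ^ length v * (M * r ^ length v)).
  apply mul_le_l; auto. left; apply inv_gt0, pow_lt; auto. replace (/ r ^ length v * (M * r ^ length v)) with M by (field; apply pow_nonzero; lra).
  have D := Rle_abs M. lra.
  + exists Nn, (Rabs M + 1). split; auto. intros i x Hi. specialize (HNf _ (ex_intro _ i (conj Hi eq_refl)) x).
  have D := isnm_ge0 x HN. destruct HN as [_ [_ [_ Hsc]]]. have E : f i x = r *v (RtoC (/ r) *v f i) x.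
  { rewrite bsA, vsA, <- RtoC_mult, Rinv_r by lra. vring. }
  rewrite E. le_by Hsc. rewrite Cmod_R, Rabs_pos_eq by lra. nra.
 - exfalso. destruct (@inf_exists S0) as [rho [Hlow Happ]].
  { destruct (W_bound f N 1) as [M1 [HM1 HM]]. exists M1. split; auto. apply (W_growth (n := 1)); auto. intros w Hw Lw. rewrite pow_1. apply HM; auto; lia. }
  { intros r [Hr _]. lra. }
  have Hrho : kap <= rho. { apply le_epsilon. intros eps He. destruct (Happ eps He) as [r [Hr Hlt]]. apply Rnot_lt_le. intros Hl. apply Hno. exists r. split; auto. lra. }
  have Hr0 : 0 < rho by lra. have Hri := inv_gt0 _ Hr0.
  have Er : Cmod (RtoC (/ rho)) = / rho. { rewrite Cmod_R, Rabs_pos_eq; auto. lra. }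
  set (g := fun i => RtoC (/ rho) *v f i). set (t := c0 / rho).
  have Ht : 0 <= t < 1. { split. apply div_ge0; lra. apply Rlt_div_l; lra. }
  have Hgn : forall w, nm (W f w) = rho ^ length w * nm (W g w).
  { intros w. unfold g. rewrite W_scal, nm_scal, cpow_mod, Er, pow_inv. field. apply pow_nonzero; lra. }
  destruct (@BW0 V g N t Ht) as [n [Hn Hs]].
  + intros i Hi. destruct (Hf i Hi) as [b [K [E [HK Hb]]]]. exists (RtoC (/ rho) * b)%C, (RtoC (/ rho) *v K). split. unfold g. rewrite E. bring.
  split. now apply cpt_scal. rewrite Cmod_mult, Er. rewrite Rmult_comm. apply mul_le_r; lra.
  + intros w Hw Lw. unfold g. rewrite W_scal. replace (t ^ length w) with (Cmod (cpow (RtoC (/ rho)) (length w)) * c0 ^ length w).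
  apply rb_scal. apply pow_le; lra. auto. rewrite cpow_mod, Er, <- Rpow_mult_distr. f_equal. unfold t. nra.
  + intros eta He. destruct (Happ (rho * eta)) as [r [[Hr [M HM]] Hlt]]. nra. exists (Rabs M). intros w Hw.
  apply Rmult_le_reg_l with (rho ^ length w). apply pow_lt; auto. rewrite <- Hgn. eapply Rle_trans. apply HM; auto.
  replace (rho ^ length w * (Rabs M * (1 + eta) ^ length w)) with (Rabs M * (rho * (1 + eta)) ^ length w) by (rewrite Rpow_mult_distr; ring).
  have D : r ^ length w <= (rho * (1 + eta)) ^ length w by triv.
  have D2 : 0 <= r ^ length w by triv. have D3 := Rle_abs M. have D4 := Rabs_pos M.
  nra.
  (* By Bernoulli's inequality (1-x)^n is at least 1/8, so the smallness at length [n] is a growth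
     rate rho (1-x) < rho. *)
  + set (x := 7 / 8 / INR n). have HIn : 1 <= INR n. { change 1 with (INR 1). apply le_INR. lia. }
  have Hx : 0 <= x <= 7/8. { split. apply div_ge0; lra. apply Rle_div_l. lra. nra. }
  have Hb := bernoulli (x := x) n ltac:(lra). replace (1 - INR n * x) with (1/8) in Hb by (unfold x; field; lra).
  have HS : S0 (rho * (1 - x)). { assert (0 < rho * (1 - x)) by nra. split; auto. apply (W_growth (n := n)); auto.
  intros w Hw Lw. rewrite Hgn, Lw, Rpow_mult_distr. apply mul_le_l. apply pow_le; lra. specialize (Hs w Hw Lw). lra. }
  specialize (Hlow _ HS). assert (0 < x). { apply div_gt0; lra. } nra.
Qed.
End BW.

(** * The group generated by exponentials and a Lomonosov argument *)

Lemma aff1_pow V (K : bop V V) n : cpt K -> exists K', (bid V +v K) ^^ n = bid V +v K' /\ cpt K'.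
Proof.
 intros HK. induction n as [|n [K' [E H]]]; sim. exists 0v. split. bring. apply cpt_zero.
 exists (K' +v K ** (bid V +v K')). split. rewrite E. bring. apply cpt_add; auto. now apply cpt_compr.
Qed.
Lemma bexp_cpt V (t : bop V V) : cpt t -> cpt (bexp t -v bid V).
Proof.
 intros Ht. destruct (fun_choice (fun k => aff1_pow (2 ^ k) (cpt_scal (RtoC (/ p2 k)) Ht))) as [K HK].
 apply (@cpt_lim V V K). intros n; apply HK. apply (@cv_ext (BL V) (fun k => ea k t -v bid V)).
 intros k. destruct (HK k) as [E _]. unfold ea. rewrite E. bring.
 apply (@cv_plus (BL V) (fun k => ea k t) (fun _ => -v bid V)). apply bexpP. apply (@cv_const (BL V)).
Qed.
Definition irreducible V (LL : bop V V -> Prop) := forall Y : V -> Prop, vsubspace Y -> vclosed Y -> (forall t x, LL t -> Y x -> Y (t x)) -> (forall x, Y x -> x = 0v) \/ (forall x, Y x).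
Section Grp.
Variable V : CBanach.
Variable LL : bop V V -> Prop.
Hypothesis HLc : forall t, LL t -> cpt t.
Hypothesis HLs : forall (c : C) t, LL t -> LL (c *v t).
Hypothesis irr : irreducible LL.
Inductive G : bop V V -> Prop := Gid : G (bid V) | Gexp t g : LL t -> G g -> G (bexp t ** g).
Lemma G_comp g h : G g -> G h -> G (g ** h).
Proof. intros Hg Hh. induction Hg. now rewrite bc1l. rewrite <- bcA. now constructor. Qed.
Lemma G_exp t : LL t -> G (bexp t).
Proof. intros H. rewrite <- (bc1r (bexp t)). constructor; auto. constructor. Qed.
Lemma LL_opp t : LL t -> LL (-v t).
Proof. rewrite voppE. auto. Qed.
Lemma G_inv g : G g -> exists gi, G gi /\ inv_of g gi.
Proof.
 intros Hg. induction Hg as [|t g Ht Hg [gi [H1 H2]]]. exists (bid V). split. constructor. apply inv_id.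
 exists (gi ** bexp (-v t)). split. apply G_comp; auto. apply G_exp. now apply LL_opp. apply inv_comp; auto. apply bexp_inv.
Qed.
Lemma G_cpt g : G g -> cpt (g -v bid V).
Proof.
 intros Hg. induction Hg as [|t g Ht Hg IH]. replace (bid V -v bid V) with (0v : bop V V) by bring. apply cpt_zero.
 replace (bexp t ** g -v bid V) with ((bexp t -v bid V) ** g +v (g -v bid V)) by bring. apply cpt_add; auto. apply cpt_compr, bexp_cpt; auto.
Qed.
(** The norm closure of the scalar multiples of group elements: a closed semigroup, in which limits
    of normalised powers stay. *)
Definition SS (T : bop V V) := forall eps, 0 < eps -> exists (c : C) g, G g /\ nm (T -v c *v g) < eps.
Lemma SS_G g : G g -> SS g.
Proof. intros Hg eps He. exists 1%C, g. split; auto. replace (g -v 1 *v g : BL V) with (0v : BL V) by vring. rewrite nm0; auto. Qed.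
Lemma SS_scal (c : C) T : SS T -> SS (c *v T).
Proof.
 intros H eps He. destruct (H (eps / (Cmod c + 1))) as [d [g [Hg Hn]]]. apply div_gt0; auto. assert (D := Cmod_ge_0 c); lra.
 exists (c * d)%C, g. split; auto. replace (c *v T -v (c * d) *v g : BL V) with (c *v (T -v d *v g) : BL V) by vring. rewrite nm_scal.
 have D := Cmod_ge_0 c. apply Rle_lt_trans with ((Cmod c) * (eps / (Cmod c + 1))). nra.
 replace eps with ((Cmod c + 1) * (eps / (Cmod c + 1))) at 2 by (field; lra). apply Rmult_lt_compat_r. triv. lra.
Qed.
Lemma SS_lim (u : nat -> bop V V) T : (forall n, SS (u n)) -> cv u T -> SS T.
Proof.
 intros H Hc eps He. destruct (Hc (eps / 2)) as [n Hn]. lra. specialize (Hn n (le_n _)). destruct (H n (eps / 2)) as [c [g [Hg Hcg]]]. lra.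
 exists c, g. split; auto. have D := nm_sub_tri T (u n) (c *v g). rewrite nm_subC in Hn. lra.
Qed.
Lemma SS_cv T : SS T -> exists (c : nat -> C) g, (forall n, G (g n)) /\ cv (fun n => c n *v g n : BL V) T.
Proof.
 intros H. have Hs : forall n, exists cg : C * bop V V, G (snd cg) /\ nm (T -v fst cg *v snd cg) < / INR (S n).
 { intros n. destruct (H _ (inv_S_pos n)) as [c [g Hcg]]. exists (c, g). auto. }
 destruct (fun_choice Hs) as [cg Hcg]. exists (fun n => fst (cg n)), (fun n => snd (cg n)). split. intros n; apply Hcg.
 intros eps He. destruct (small_inv He) as [N HN]. exists N. intros n Hn. rewrite nm_subC. eapply Rlt_trans. apply Hcg. triv.
Qed.
Lemma SS_comp A B : SS A -> SS B -> SS (A ** B).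
Proof.
 intros HA HB. destruct (SS_cv HA) as [c [g [Hg Hc]]]. destruct (SS_cv HB) as [d [h [Hh Hd]]].
 apply (@SS_lim (fun n => (c n *v g n) ** (d n *v h n))). 2: now apply cv_comp.
 intros n. replace ((c n *v g n) ** (d n *v h n)) with ((c n * d n)%C *v (g n ** h n)) by bring. apply SS_scal, SS_G, G_comp; auto.
Qed.
Lemma SS_pow A n : SS A -> SS (A ^^ n).
Proof. intros H. induction n; sim. apply SS_G; constructor. now apply SS_comp. Qed.
Lemma bexp_deriv t (s : R) : 0 < s <= 1 -> nm (RtoC (/ s) *v (bexp (s *v t) -v bid V) -v t) <= s * (nm t * nm t * exp (nm t)).
Proof.
 intros Hs. have D := bexp_lin (s *v t). have Es : nm (s *v t) = s * nm t by (rewrite nm_scal, Cmod_R, Rabs_pos_eq; lra). rewrite Es in D.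
 have Hsi : 0 < / s by triv.
 replace (RtoC (/ s) *v (bexp (s *v t) -v bid V) -v t) with (RtoC (/ s) *v (bexp (s *v t) -v bid V -v s *v t) : BL V).
 2: { transitivity (RtoC (/ s) *v (bexp (s *v t) -v bid V) -v (RtoC (/ s) * RtoC s)%C *v t : BL V). vring. rewrite <- RtoC_mult, Rinv_l by lra. vring. }
 rewrite nm_scal, Cmod_R, Rabs_pos_eq by lra. apply Rmult_le_reg_l with s. lra. rewrite <- Rmult_assoc, Rinv_r, Rmult_1_l by lra.
 le_by D. have T := nm_ge0 t. assert (exp (s * nm t) <= exp (nm t)) by (apply exp_le; nra).
 replace (s * (s * (nm t * nm t * exp (nm t)))) with (s * nm t * (s * nm t) * exp (nm t)) by ring. triv.
Qed.
Lemma irr_dense (S : V -> Prop) x : x <> 0v -> S x -> (forall t z, LL t -> S z -> vclosure (vspan S) (t z)) -> forall y, vclosure (vspan S) y.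
Proof.
 intros Hx Sx Ht. have SC := vclosure_sub (vspan_sub S). have CC := @vclosure_closed V (vspan S). destruct (irr SC CC) as [H|H]; auto.
 - intros t z Lt Hz. apply (vclosure_min (W := vspan S) (W' := fun z => vclosure (vspan S) (t z))); auto.
  + apply vspan_min; auto. split; [|split]. rewrite b0. apply SC. intros a b Ha Hb. rewrite bD. now apply SC. intros c a Ha. rewrite bZ. now apply SC.
  + intros u l Hu Hl. apply (CC (fun n => t (u n))); auto. now apply cv_app.
 - destruct Hx. now apply H, vclosure_in, vspan_in.
Qed.
(** Stability of [H] under short exponentials suffices: the difference quotient of exp(s t) h x at s
    = 0 puts t h x into the closed span, which is therefore invariant. [theoremV] needs this for a
    set that is not a semigroup. *)
Lemma dense (H : bop V V -> Prop) x : H (bid V) -> (forall h t, H h -> LL t -> exists d, 0 < d /\ forall s, 0 < s < d -> H (bexp (s *v t) ** h)) ->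
 x <> 0v -> forall y, vclosure (vspan (fun z => exists h, H h /\ z = h x)) y.
Proof.
 intros H1 Hs Hx. apply (irr_dense Hx). exists (bid V). auto.
 intros t z Ht [h [Hh ->]] eps He. destruct (Hs h t Hh Ht) as [d [Hd Hds]]. set (M := nm t * nm t * exp (nm t) * nm (h x)).
  have HM : 0 <= M. { have D := nm_ge0 t. have D2 := nm_ge0 (h x). have D3 := exp_pos (nm t). repeat apply mul_ge0; lra. }
  set (s := Rmin (Rmin 1 (d / 2)) (eps / (M + 1) / 2)).
  have He2 : 0 < eps / (M + 1) by triv.
  have Hs0 : 0 < s by (unfold s; repeat apply Rmin_glb_lt; lra). have Hs1 : s <= 1 by (eapply Rle_trans; [apply Rmin_l|apply Rmin_l]).
  have Hs2 : s <= d / 2 by (eapply Rle_trans; [apply Rmin_l|apply Rmin_r]). have Hs3 : s <= eps / (M + 1) / 2 by apply Rmin_r.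
  exists (RtoC (/ s) *v (bexp (s *v t) -v bid V) (h x)). split.
  + apply (vspan_sub (V := V)). rewrite baA, boA. apply vsub_minus. apply vspan_sub. apply vspan_in. exists (bexp (s *v t) ** h). split. apply Hds; lra. now rewrite bmA.
  apply vspan_in. exists h. triv.
  + rewrite nm_subC. replace (RtoC (/ s) *v (bexp (s *v t) -v bid V) (h x) -v t (h x)) with ((RtoC (/ s) *v (bexp (s *v t) -v bid V) -v t) (h x)) by (bpush; vring).
  eapply Rle_lt_trans. apply nm_app. apply Rle_lt_trans with (s * M). unfold M. rewrite <- Rmult_assoc. apply mul_le_r. apply nm_ge0. apply bexp_deriv; lra.
  apply Rle_lt_trans with (eps / (M + 1) / 2 * M). apply mul_le_r; auto. 
  assert (eps / (M + 1) * (M + 1) = eps) by (field; lra). nra.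
Qed.
Lemma G_dense x : x <> 0v -> forall y, vclosure (vspan (fun z => exists h, G h /\ z = h x)) y.
Proof. apply dense. constructor. intros h t Hh Ht. exists 1. split. lra. intros s _. constructor; auto. Qed.
Lemma G_dense_op x y eps : x <> 0v -> 0 < eps -> exists c, @vspan (BL V) G c /\ nm (c x -v y) < eps.
Proof.
 intros Hx He. destruct (G_dense Hx y He) as [z [Hz Hn]].
 have Hc : exists c, @vspan (BL V) G c /\ z = c x.
 { revert z Hz Hn. have Hq : forall z, vspan (fun z => exists h, G h /\ z = h x) z -> exists c, @vspan (BL V) G c /\ z = c x.
  apply vspan_min.
  - have D := vspan_sub (V := BL V) G. split; [|split]. exists 0v. split. apply D. triv.
  intros a b [c [Hc ->]] [d [Hd ->]]. exists (c +v d). split. now apply D. triv.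
  intros k a [c [Hc ->]]. exists (k *v c). split. now apply D. triv.
  - intros z [h [Hh ->]]. exists h. split; auto. now apply (@vspan_in (BL V)).
  - triv. }
 destruct Hc as [c [Hc ->]]. exists c. split; auto. now rewrite nm_subC.
Qed.
Lemma G_nz (T : bop V V) x : T <> 0v -> x <> 0v -> exists h, G h /\ T (h x) <> 0v.
Proof.
 intros HT Hx. contra Hn. apply HT. bext y. rewrite b0A.
 apply (vclosure_min (W := vspan (fun z => exists h, G h /\ z = h x)) (W' := fun z => T z = 0v)). 3: now apply G_dense.
 apply vspan_min. apply ker_sub. intros z [h [Hh ->]]. contra Hc. apply Hn. exists h; auto. apply ker_closed.
Qed.
Definition snm (N : V -> R) := (forall x y, N (x +v y) <= N x + N y) /\ (forall (c : C) x, N (c *v x) <= Cmod c * N x).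
Lemma isnm_snm N M : isnm N M -> snm N.
Proof. intros [_ [_ [H1 H2]]]. split; auto. Qed.
(** The list and the constant are fixed before the norm [N] is. In [step1] the norm is built only
    after the constant is known. *)
Lemma span_bound (c : bop V V) : @vspan (BL V) G c -> exists (l : list (bop V V)) gam, 0 <= gam /\ (forall g, In g l -> G g) /\
 forall N, snm N -> (forall x, 0 <= N x) -> (forall g x, In g l -> N (g x) <= 2 * N x) -> forall x, N (c x) <= gam * N x.
Proof.
 revert c. apply vspan_min.
 - split; [|split].
  + exists nil, 0. split. lra. split. intros g []. intros N HN HN0 _ x. rewrite b0A. replace (0v : V) with (0%C *v (0v : V)) by apply vs0l. le_by HN. rewrite Cmod_0. lra.
  + intros a b [l [ga [H1 [H2 H3]]]] [l' [gb [H1' [H2' H3']]]]. exists (l ++ l'), (ga + gb). split. lra. split.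
  intros g Hg. apply in_app_or in Hg. destruct Hg; auto. intros N HN HN0 Hl x. rewrite baA. le_by HN.
  rewrite Rmult_plus_distr_r. apply Rplus_le_compat. apply H3; auto. intros; apply Hl, in_or_app; auto. apply H3'; auto. intros; apply Hl, in_or_app; auto.
  + intros c a [l [ga [H1 [H2 H3]]]]. have D := Cmod_ge_0 c. exists l, (Cmod c * ga). split. nra. split; auto. intros N HN HN0 Hl x. rewrite bsA.
  le_by HN. rewrite Rmult_assoc. triv.
 - intros g Hg. exists [g], 2. split. lra. split. intros h [<-|[]]; auto. intros N HN HN0 Hl x. apply Hl. now left.
Qed.
Lemma G_rb1 : (forall (g : bop V V) nu x, G g -> g x = nu *v x -> 1 < Cmod nu -> x = 0v) -> forall g, G g -> rb g 1.
Proof.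
 intros Hno g Hg r Hr. have Eg : 1%C *v bid V +v (g -v bid V) = g by bring.
 destruct (@rb_compact V 1%C (g -v bid V) r (G_cpt Hg)) as [r' [Hr' H]]. rewrite Cmod_1; lra.
 intros lam x Hl E. rewrite Eg in E. apply (Hno g lam); auto. lra. rewrite Eg in H. apply H. lra.
Qed.
(** Otherwise all group elements have spectral radius at most 1, and [BW] makes any finite set of
    them at most 2 in a suitable norm. Lomonosov's argument gives finitely many c in the span of the
    group such that some c a returns each point of a ball to the ball. The operator a is replaced by
    an average of exponentials with large parameter, tiny in the suitable norm, so iteration drives
    a point of the ball to 0, which the ball avoids. *)
Lemma step1 a : LL a -> a <> 0v -> exists g nu x, G g /\ x <> 0v /\ g x = nu *v x /\ 1 < Cmod nu.
Proof.
 intros La Ha. contra Hno.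
 have Hrb : forall g, G g -> rb g 1.
 { apply G_rb1. intros g nu x Hg E Hnu. contra Hx. apply Hno. exists g, nu, x; auto. }
 have Hx1 : exists x1, a x1 <> 0v. { contra H. apply Ha. bext x. rewrite b0A. contra Hx. apply H. exists x; auto. }
 destruct Hx1 as [x1 Hx1]. have Hax : 0 < nm (a x1). { destruct (Rle_lt_or_eq_dec _ _ (nm_ge0 (a x1))) as [|E]; auto. exfalso. apply Hx1, nm_eq0; auto. }
 (* Normalised so that a x0 has norm |a| + 1: then x0 has norm above 1, and [a] sends the unit ball
    around x0 outside the open unit ball around 0. *)
 have Hna := nm_ge0 a. set (x0 := RtoC ((nm a + 1) / nm (a x1)) *v x1).
 have Hax0 : nm (a x0) = nm a + 1. { unfold x0. rewrite bZ, nm_scal, Cmod_R, Rabs_pos_eq. field; lra. triv. }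
 have Hx0 : 1 < nm x0. { have D := nm_app a x0. nra. }
 set (B := fun b => nm (b -v x0) <= 1). have HB1 : forall b, B b -> nm b <= nm x0 + 1.
 { intros b Hb. unfold B in Hb. have D := nm_rev b x0. lra. }
 have HB2 : forall b, B b -> 1 <= nm (a b).
 { intros b Hb. have D := nm_rev (a x0) (a b). rewrite nm_subC, <- bN, <- bD in D. have D2 := nm_app a (b -v x0).
  assert (nm a * nm (b -v x0) <= nm a * 1) by triv. lra. }
 have Hca := HLc La.
 (* A uniform bound on the returning operators: otherwise images a b_n would converge to some y not
    0, for which one fixed c already works. *)
 have Hn0 : exists n0, 0 < n0 /\ forall b, B b -> exists c, @vspan (BL V) G c /\ nm c <= n0 /\ nm (c (a b) -v x0) < 1/4.
 { contra H. have Hs : forall n, exists b, B b /\ forall c, @vspan (BL V) G c -> nm c <= INR (S n) -> 1/4 <= nm (c (a b) -v x0).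
  { intros n. contra Hc. apply H. exists (INR (S n)). split. triv. intros b Hb. contra Hd. apply Hc. exists b. split; auto.
  intros c H1 H2. apply Rnot_lt_le. intros H3. apply Hd. exists c; auto. }
  destruct (fun_choice Hs) as [b Hb]. destruct (@cpt_cv V V a b (nm x0 + 1) Hca) as [p [y [Hp Hy]]]. intros n; apply HB1, Hb.
  have Hy1 : 1 <= nm y. { apply (cv_nm_ge Hy). exists O. intros; apply HB2, Hb. }
  destruct (@G_dense_op y x0 (1/8)) as [c [Hc Hcy]]. intros E. rewrite E, nm0 in Hy1. lra. lra.
  destruct (cv_app c Hy (eps := 1/8)) as [N HN]. lra. destruct (INR_unbounded (nm c)) as [k Hk].
  set (n := (N + k)%nat). specialize (HN n ltac:(unfold n; lia)). destruct (Hb (p n)) as [_ H2].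
  have Hkn : (k <= S (p n))%nat by (assert (D := incr_ge Hp n); unfold n in *; lia). apply le_INR in Hkn.
  specialize (H2 c Hc ltac:(lra)). have D := nm_sub_tri (c (a (b (p n)))) (c y) x0. lra. }
 destruct Hn0 as [n0 [Hn0 Hc]].
 set (rad := 1 / (16 * n0 * (nm x0 + 1))). have Hrad : 0 < rad. { apply div_gt0. lra. nra. }
 have Hcl : exists cl : list (bop V V), (forall c, In c cl -> @vspan (BL V) G c /\ nm c <= n0) /\ forall b, B b -> exists c, In c cl /\ nm (c (a b) -v x0) <= 1/2.
 { destruct (cpt_net Hca Hrad) as [nt Hnt].
  assert (Hnt' : forall b, B b -> exists y, In y nt /\ nm (a b -v RtoC (nm x0 + 1) *v y) <= 1 / (16 * n0)).
  { intros b Hb. have Er : Cmod (RtoC (nm x0 + 1)) = nm x0 + 1 by (rewrite Cmod_R, Rabs_pos_eq; lra).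
  have Eri : Cmod (RtoC (/ (nm x0 + 1))) = / (nm x0 + 1). { rewrite Cmod_R, Rabs_pos_eq; auto. triv. }
  destruct (Hnt (RtoC (/ (nm x0 + 1)) *v b)) as [y [Hy Hyn]].
  { rewrite nm_scal, Eri. apply Rmult_le_reg_l with (nm x0 + 1). lra. rewrite <- Rmult_assoc, Rinv_r, Rmult_1_l, Rmult_1_r by lra. auto. }
  exists y. split; auto. replace (a b -v RtoC (nm x0 + 1) *v y) with (RtoC (nm x0 + 1) *v (a (RtoC (/ (nm x0 + 1)) *v b) -v y)).
  2: { rewrite bZ. transitivity ((RtoC (nm x0 + 1) * RtoC (/ (nm x0 + 1)))%C *v a b -v RtoC (nm x0 + 1) *v y). vring. rewrite <- RtoC_mult, Rinv_r by lra. vring. }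
  rewrite nm_scal, Er. le_mid ((nm x0 + 1) * rad). nra. right. unfold rad. field. lra. }
  clear Hnt. have Hl : forall l : list V, exists cl : list (bop V V), (forall c, In c cl -> @vspan (BL V) G c /\ nm c <= n0) /\
  forall y b, In y l -> B b -> nm (a b -v RtoC (nm x0 + 1) *v y) <= 1 / (16 * n0) -> exists c, In c cl /\ nm (c (a b) -v x0) <= 1/2.
  { induction l as [|y l [cl [H1 H2]]]. exists nil. split. intros c []. intros y b [].
  destruct (classic (exists b, B b /\ nm (a b -v RtoC (nm x0 + 1) *v y) <= 1 / (16 * n0))) as [[b [Hb Hby]]|Hn].
  - destruct (Hc b Hb) as [c [G1 [G2 G3]]]. exists (c :: cl). split. intros d [<-|Hd]; auto.
  intros y' b' [<-|Hy'] Hb' Hd. exists c. split. now left.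
  have D := nm_sub_tri (a b') (RtoC (nm x0 + 1) *v y) (a b). rewrite (nm_subC (RtoC (nm x0 + 1) *v y)) in D.
  have D2 := nm_app c (a b' -v a b). have D3 : nm c * nm (a b' -v a b) <= n0 * (2 / (16 * n0)). { apply Rmult_le_compat; try apply nm_ge0; auto. lra. }
  replace (n0 * (2 / (16 * n0))) with (1/8) in D3 by (field; lra). have D4 := nm_sub_tri (c (a b')) (c (a b)) x0. rewrite <- bN, <- bD in D4 at 1. rewrite bD, bN in D4. rewrite bD, bN in D2. lra.
  destruct (H2 y' b' Hy' Hb' Hd) as [d [Hd1 Hd2]]. exists d. split; auto. now right.
  - exists cl. split; auto. intros y' b' [<-|Hy'] Hb' Hd. exfalso. apply Hn. exists b'; auto. eauto. }
  destruct (Hl nt) as [cl [H1 H2]]. exists cl. split; auto. intros b Hb. destruct (Hnt' b Hb) as [y [Hy Hyn]]. eauto. }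
 destruct Hcl as [cl [Hcl1 Hcl2]].
 have Hgam : exists (l : list (bop V V)) gam, 0 <= gam /\ (forall g, In g l -> G g) /\
  forall N, snm N -> (forall x, 0 <= N x) -> (forall g x, In g l -> N (g x) <= 2 * N x) -> forall c x, In c cl -> N (c x) <= gam * N x.
 { clear Hcl2. induction cl as [|c cl IH]. exists nil, 0. split. lra. split. intros g []. intros N _ _ _ c x [].
  destruct IH as [l [ga [H1 [H2 H3]]]]. intros; apply Hcl1; now right. destruct (span_bound (proj1 (Hcl1 c (or_introl eq_refl)))) as [l' [gb [H1' [H2' H3']]]].
  exists (l ++ l'), (ga + gb). split. lra. split. intros g Hg. apply in_app_or in Hg. destruct Hg; auto. intros N HN HN0 HlN d x [<-|Hd]; have D := HN0 x.
  assert (N (c x) <= gb * N x). apply H3'; auto. intros; apply HlN, in_or_app; auto. nra.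
  assert (N (d x) <= ga * N x). apply H3; auto. intros; apply HlN, in_or_app; auto. nra. }
 destruct Hgam as [l [gam [Hgam0 [HlG HlN]]]].
 (* The average with parameter [R0] is at most 2/R0 in the suitable norm, and the returning
    operators at most [gam]; their product contracts by 1/2. *)
 set (R0 := 4 * (gam + 1)). destruct (@bexp_extract V a R0 (1 / (2 * n0 * (nm x0 + 1)))) as [N0 [HN0 HK']]. unfold R0; lra. apply div_gt0. lra. nra.
 set (ex := fun k => bexp ((RtoC R0 * cpow (rou N0) k)%C *v a)). set (co := fun k => cpow (cpow (rou N0) k) (N0 - 1)).
 set (K' := RtoC (/ (INR N0 * R0)) *v vsum N0 (fun k => co k *v ex k) : bop V V) in *.
 set (fl := l ++ map ex (seq 0 N0)). have HflG : forall g, In g fl -> G g.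
 { intros g Hg. apply in_app_or in Hg. destruct Hg as [Hg|Hg]; auto. apply in_map_iff in Hg. destruct Hg as [k [<- _]]. apply G_exp. auto. }
 set (f := fun i => nth i fl (bid V)). have HfG : forall i, G (f i). { intros i. unfold f. destruct (nth_in_or_default i fl (bid V)) as [Hi|Hi]; auto. rewrite Hi. constructor. }
 destruct (@BW V f (length fl) 1 2) as [Nn [M [HN HNf]]]. lra.
 { intros i _. exists 1%C, (f i -v bid V). split. bring. split. apply G_cpt; auto. rewrite Cmod_1. lra. }
 { intros w _ _. rewrite pow1. apply Hrb. induction w; cbn [W]. constructor. apply G_comp; auto. }
 have HNl : forall g x, In g fl -> Nn (g x) <= 2 * Nn x. { intros g x Hg. destruct (In_nth fl g (bid V) Hg) as [i [Hi <-]]. apply (HNf i x Hi). }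
 have Hs := isnm_snm HN. have HNp := fun x => isnm_ge0 x HN.
 have HNR : 0 < INR N0 by triv. have HR0 : 0 < R0 by (unfold R0; lra).
 have HNK : forall x, Nn (K' x) <= 2 / R0 * Nn x.
 { intros x. unfold K'. rewrite bsA. le_by Hs. rewrite Cmod_R, Rabs_pos_eq by (left; apply inv_gt0, Rmult_lt_0_compat; auto).
  have D : Nn ((vsum N0 (fun k => co k *v ex k) : bop V V) x) <= INR N0 * (2 * Nn x).
  { rewrite vsum_app2. have Hq : forall n, (n <= N0)%nat -> Nn (vsum n (fun k => (co k *v ex k) x)) <= INR n * (2 * Nn x).
  { induction n; intros Hn; cbn [vsum]. rewrite Rmult_0_l. replace (0v : V) with (0%C *v (0v : V)) by apply vs0l. le_by Hs. rewrite Cmod_0. lra.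
  le_by Hs. rewrite S_INR. have D := IHn ltac:(lia). have D2 : Nn ((co n *v ex n) x) <= 2 * Nn x.
  { rewrite bsA. le_by Hs. unfold co. rewrite !cpow_mod, rou_mod, !pow1, Rmult_1_l. apply HNl. apply in_or_app. right. apply in_map. apply in_seq. lia. }
  lra. }
  triv. }
  le_mid (/ (INR N0 * R0) * (INR N0 * (2 * Nn x))). apply mul_le_l; auto. triv. right. field. lra. }
 (* Replacing [a] by the average moves c a b by at most 1/2, and c a b lies within 1/2 of x0, so the
    ball is kept. *)
 have Hstep : forall b, B b -> exists b', B b' /\ Nn b' <= 1/2 * Nn b.
 { intros b Hb. destruct (Hcl2 b Hb) as [c [Hci Hcn]]. exists (c (K' b)). split.
  - unfold B. have D := nm_sub_tri (c (K' b)) (c (a b)) x0. replace (c (K' b) -v c (a b)) with (c ((K' -v a) b)) in D by (bpush; auto).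
  have D2 := nm_app c ((K' -v a) b). have D3 := nm_app (K' -v a) b. specialize (HB1 b Hb). destruct (Hcl1 c Hci) as [_ Hcn0].
  have D4 : nm (K' -v a) * nm b <= 1 / (2 * n0 * (nm x0 + 1)) * (nm x0 + 1) by (apply Rmult_le_compat; auto; apply nm_ge0).
  replace (1 / (2 * n0 * (nm x0 + 1)) * (nm x0 + 1)) with (1 / (2 * n0)) in D4 by (field; lra).
  have D5 : nm c * nm ((K' -v a) b) <= n0 * (1 / (2 * n0)) by (apply Rmult_le_compat; try apply nm_ge0; auto; lra).
  replace (n0 * (1 / (2 * n0))) with (1/2) in D5 by (field; lra). lra.
  - have D : Nn (c (K' b)) <= gam * Nn (K' b). apply HlN; auto. intros; apply HNl, in_or_app; auto.
  specialize (HNK b). have D2 := HNp b. assert (gam * Nn (K' b) <= gam * (2 / R0 * Nn b)) by nra.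
  assert (gam * (2 / R0 * Nn b) <= 1/2 * Nn b). { replace (gam * (2 / R0 * Nn b)) with (gam / (gam + 1) * (1/2 * Nn b)) by (unfold R0; field; lra).
  assert (gam / (gam + 1) <= 1) by (apply Rle_div_l; lra). nra. }
  lra. }
 destruct (@dep_choice V B (fun _ b b' => Nn b' <= 1/2 * Nn b) x0) as [b [Eb [Hb Hbs]]].
 { unfold B. rewrite vaddN, nm0. lra. } { triv. }
 have Hbn : forall n, Nn (b n) <= (1/2)^n * Nn x0. { induction n; cbn [pow]. rewrite Eb. lra. specialize (Hbs n). lra. }
 destruct (@pow_half_small (Nn x0) (nm x0 - 1)) as [n Hn]. lra. specialize (Hn n (le_n _)). specialize (Hbn n).
 have D := proj1 (proj1 (proj2 HN) (b n)). have D2 := nm_rev x0 (b n). rewrite nm_subC in D2. specialize (Hb n). unfold B in Hb. lra.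
Qed.
End Grp.
Lemma cv_RC V (c : nat -> R) (u : nat -> V) M : (forall n, nm (u n) <= M) -> (forall eps, 0 < eps -> exists N, forall n, (N <= n)%nat -> Rabs (c n) < eps) -> cv (fun n => RtoC (c n) *v u n) 0v.
Proof.
 intros HM Hc eps He. have HM0 : 0 <= M by (eapply Rle_trans; [apply nm_ge0|apply (HM O)]). destruct (Hc (eps / (M + 1))) as [N HN]. triv.
 exists N. intros n Hn. specialize (HN n Hn). replace (RtoC (c n) *v u n -v 0v) with (RtoC (c n) *v u n) by vring. rewrite nm_scal, Cmod_R.
 specialize (HM n). have D2 := Rabs_pos (c n). apply Rle_lt_trans with (Rabs (c n) * (M + 1)). nra.
 replace eps with (eps / (M + 1) * (M + 1)) by (field; lra). nra.
Qed.
Lemma nm_RC V (c : R) (x : V) : 0 <= c -> nm (c *v x) = c * nm x.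
Proof. intros. rewrite nm_scal, Cmod_R, Rabs_pos_eq; auto. Qed.
Lemma bop_neq0 (V W : CBanach) (T : bop V W) : T <> 0v -> exists x, T x <> 0v.
Proof. intros H. contra Hn. apply H. bext x. rewrite b0A. contra Hx. apply Hn. exists x; auto. Qed.
Lemma nm_pos V (x : V) : x <> 0v -> 0 < nm x.
Proof. intros H. destruct (Rle_lt_or_eq_dec _ _ (nm_ge0 x)) as [|E]; auto. destruct H. apply nm_eq0; auto. Qed.
Lemma idem_rb V (P : bop V V) : P ** P = P -> rb P 1.
Proof.
 intros H. apply rb_intro. lra. exists (nm (bid V) + nm P). intros n. rewrite pow1, Rmult_1_r. destruct n. sim. have D := nm_ge0 P. lra.
 rewrite bpow_idem by auto. have D := nm_ge0 (bid V). lra.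
Qed.
Lemma idem_compl V (P : bop V V) : P ** P = P -> (bid V -v P) ** (bid V -v P) = bid V -v P.
Proof. intros H. bstep (bid V -v P -v P +v P ** P). rewrite H. bring. Qed.

(** * Compact elements of the closed semigroup, minimal ranges and idempotents *)

Section Step2.
Variable V : CBanach.
Variable LL : bop V V -> Prop.
Hypothesis HLc : forall t, LL t -> cpt t.
Hypothesis HLs : forall (c : C) t, LL t -> LL (c *v t).
Hypothesis irr : irreducible LL.
Notation G := (G LL). Notation SS := (SS LL).

(** The part of g away from its Riesz projection grows more slowly than |nu|^n, so the powers of g
    divided by the norms of g^n P are asymptotically those of g^n P, which lie between two compact
    factors and accumulate at a nonzero limit. *)
Lemma SS_compact g nu x : G g -> x <> 0v -> g x = nu *v x -> 1 < Cmod nu ->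
 exists T P, SS T /\ T <> 0v /\ cpt P /\ T ** P = T.
Proof.
 intros Hg Hx E Hnu. set (K := g -v bid V). have HK : cpt K by apply (G_cpt HLc Hg). set (d := (Cmod nu - 1) / 2).
 destruct (RD HK (d := d)) as [ks [P [r [_ [HP [HPc [_ [Hr [Hrb HPk]]]]]]]]]. unfold d; lra.
 have Hd : r < Cmod (nu - 1)%C. { have D := Cmod_triangle (nu - 1) 1. replace (nu - 1 + 1)%C with nu in D by ring. rewrite Cmod_1 in D. unfold d in Hr; lra. }
 have Px : P x = x. { apply (RD_eigen Hrb (HPc K (comm_refl K)) HP (k := (nu - 1)%C)). lra. unfold K. bpush. rewrite E. vring. }
 have cgP : comm g P. { apply HPc. apply comm_add. triv. bring. }
 set (A := g ** (bid V -v P)). have HA : rb A (1 + r).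
 { replace A with ((bid V -v P) +v K ** (bid V -v P)) by (unfold A, K; bring). apply rb_add; try lra; auto.
  - have c : comm (bid V -v P) K. { apply comm_sym, comm_add. bring. apply comm_opp, HPc, comm_refl. }
  apply comm_comp; auto. triv.
  - apply idem_rb, idem_compl; auto. }
 set (rho := (1 + r + Cmod nu) / 2). destruct (HA rho) as [C0 [HC0 HAn]]. unfold rho, d in *; lra.
 set (M := fun n => nm (g ^^ n ** P)).
 have Hgn : forall n, (g ^^ n) x = cpow nu n *v x. { induction n; sim. bring. rewrite bmA, IHn, bZ, E. vring. }
 have Hxp := nm_pos Hx.
 have HM : forall n, Cmod nu ^ n <= M n. { intros n. apply Rmult_le_reg_r with (nm x); auto. rewrite <- cpow_mod, <- nm_scal, <- Hgn. rewrite <- Px at 1. rewrite <- bmA. apply nm_app. }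
 have HM0 : forall n, 0 < M n. { intros n. assert (0 < Cmod nu ^ n) by triv. specialize (HM n). lra. }
 have HMi : forall n, 0 < / M n by triv.
 have HAg : forall n, g ^^ S n = g ^^ S n ** P +v A ^^ S n.
 { intros n. unfold A. rewrite bpow_comp. rewrite (bpow_idem n (idem_compl HP)). bring. apply comm_add. bring. apply comm_opp; auto. }
 set (U := fun n => RtoC (/ M (S n)) *v (g ^^ S n ** P) : bop V V).
 have HU1 : forall n, nm (U n) = 1. { intros n. unfold U. rewrite nm_RC by (left; auto). apply Rinv_l. apply Rgt_not_eq, HM0. }
 have Hpr : prec (fun n => U n : BL V).
 { replace (fun n => U n : BL V) with (fun n => P ** U n ** P : BL V). apply cpt_sandwich with 1; auto. intros n. rewrite HU1; lra.
  fext n. unfold U. have c : P ** g ^^ S n = g ^^ S n ** P by (apply comm_pow, comm_sym; auto).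
  replace (P ** (RtoC (/ M (S n)) *v (g ^^ S n ** P)) ** P) with (RtoC (/ M (S n)) *v ((P ** g ^^ S n) ** (P ** P))) by bring. rewrite HP, c, <- bcA, HP. auto. }
 destruct (prec_cv Hpr) as [p [T [Hp HT]]]. exists T, P.
 have HTn : 1 <= nm T. { apply (cv_nm_ge HT). exists O. intros n _. rewrite HU1. lra. }
 split; [|split; [|split]]; auto.
 - apply (@SS_lim _ _ (fun n => RtoC (/ M (S (p n))) *v g ^^ S (p n))). intros n. apply SS_scal, SS_pow, SS_G; auto.
  apply (@cv_ext (BL V) (fun n => U (p n) +v RtoC (/ M (S (p n)) * rho ^ S (p n)) *v (RtoC (/ rho ^ S (p n)) *v A ^^ S (p n)))).
  { intros n. rewrite (HAg (p n)). unfold U. rewrite vsA, <- RtoC_mult. replace (/ M (S (p n)) * rho ^ S (p n) * / rho ^ S (p n)) with (/ M (S (p n))). bring.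
  field. split. apply pow_nonzero. unfold rho; lra. apply Rgt_not_eq, HM0. }
  replace T with (T +v 0v : BL V) by vring. apply (@cv_plus (BL V) (fun n => U (p n)) (fun n => RtoC (/ M (S (p n)) * rho ^ S (p n)) *v (RtoC (/ rho ^ S (p n)) *v A ^^ S (p n))) T 0v); auto.
  have Hrho : 0 < rho by (unfold rho; lra).
  apply (@cv_RC (BL V) (fun n => / M (S (p n)) * rho ^ S (p n)) (fun n => RtoC (/ rho ^ S (p n)) *v A ^^ S (p n)) C0).
  + intros n. have Hq : 0 < rho ^ S (p n) by triv. rewrite nm_RC by (left; apply inv_gt0; auto). apply Rmult_le_reg_l with (rho ^ S (p n)); auto.
  rewrite <- Rmult_assoc, Rinv_r, Rmult_1_l by lra. rewrite Rmult_comm. triv.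
  + intros eps He. destruct (pow_lt_1_zero (rho / Cmod nu)) with (y := eps) as [N HN]; auto. rewrite Rabs_pos_eq. apply Rlt_div_l. lra. unfold rho, d in *; lra. triv.
  exists N. intros n Hn. have D := incr_ge Hp n. specialize (HN (S (p n)) ltac:(lia)). rewrite Rabs_pos_eq in HN by (apply pow_le, div_ge0; lra).
  rewrite Rabs_pos_eq. 2: { triv. } eapply Rle_lt_trans. 2: apply HN.
  replace ((rho / Cmod nu) ^ S (p n)) with (/ Cmod nu ^ S (p n) * rho ^ S (p n)). apply mul_le_r. triv. apply Rinv_le_contravar. triv. apply HM.
  unfold Rdiv. rewrite Rpow_mult_distr, pow_inv. ring.
 - intros E0. rewrite E0, nm0 in HTn. lra.
 - apply (@cv_unique (BL V) (fun n => U (p n) ** P)). apply cv_comp; auto. apply cv_const. apply (@cv_ext (BL V) (fun n => U (p n))); auto.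
  intros n. unfold U. replace ((RtoC (/ M (S (p n))) *v (g ^^ S (p n) ** P)) ** P) with (RtoC (/ M (S (p n))) *v (g ^^ S (p n) ** (P ** P))) by bring. now rewrite HP.
Qed.
(** Finite dimension is expressed by precompactness of bounded sequences, and minimality by the
    alternative that an element of the semigroup kills [R0] or is injective on it. *)
Definition minR (R0 : V -> Prop) := vsubspace R0 /\ vclosed R0 /\ (forall u M, (forall n, R0 (u n)) -> (forall n, nm (u n) <= M) -> prec u) /\
 (forall X, SS X -> (exists y, R0 y /\ X y <> 0v) -> forall y, R0 y -> X y = 0v -> y = 0v).
(** As long as some product X T is nonzero with a larger kernel, T is replaced by it. Since T P = T,
    P - 1 maps the whole space into each kernel, and [CH] for the compact [P] forbids an infinite
    increase. *)
Lemma max_ker T0 P : SS T0 -> T0 <> 0v -> cpt P -> T0 ** P = T0 ->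
 exists T, SS T /\ T <> 0v /\ T ** P = T /\ forall X, SS X -> X ** T <> 0v -> forall x, X (T x) = 0v -> T x = 0v.
Proof.
 intros HS H0 HP HT0. contra Hn. set (Q := fun T => SS T /\ T <> 0v /\ T ** P = T).
 destruct (@dep_choice (bop V V) Q (fun _ T T' => exists X, T' = X ** T /\ exists x, X (T x) = 0v /\ T x <> 0v) T0) as [T [_ [HT HTs]]].
 - split; auto.
 - intros _ T [H1 [H2 H3]]. contra Hc. apply Hn. exists T. split; auto. split; auto. split; auto. intros X HX HXT x Hx. contra Hx0. apply Hc.
  exists (X ** T). split. split. apply SS_comp; auto. split; auto. now rewrite <- bcA, H3. exists X. split; auto. exists x; auto.
 - apply (@CH V P (fun n x => T n x = 0v) (fun _ => RtoC 1) 1); auto; try lra.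
  + intros _. rewrite Cmod_1. lra.
  + intros n; apply ker_sub.
  + intros n; apply ker_closed.
  + intros n x Hx. destruct (HTs n) as [X [-> _]]. rewrite bmA, Hx. bring.
  + intros n. destruct (HTs n) as [X [-> [x [H1 H2]]]]. exists x. triv.
  + intros n x _. destruct (HT n) as [_ [_ H3]]. rewrite vs1, bD, bN, <- bmA, H3. vring.
Qed.
(** T = T P with P compact makes P the identity modulo the kernel of T; vectors at distance 1/2 from
    the kernel with images tending to 0 would have a limit in the kernel. *)
Lemma ran_bound (T : bop V V) P : cpt P -> T ** P = T -> exists c, 0 < c /\ forall x, exists x', T x' = T x /\ nm x' <= c * nm (T x).
Proof.
 intros HP HT. contra Hn.
 have TP : forall x, T (P x) = T x by (intros; rewrite <- bmA; now rewrite HT).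
 set (Kr := fun x => T x = 0v). have SK := ker_sub T. have CK := ker_closed (f := T). fold Kr in SK, CK.
 have Hs : forall n, exists x, 1/2 <= vdist Kr x /\ nm x <= 1 /\ nm (T x) < / INR (S n).
 { intros n. contra Hc. apply Hn. have HI : 0 < INR (S n) by triv. exists (2 * INR (S n)). split. lra. intros x.
  destruct (classic (Kr x)) as [Kx|Kx]. exists 0v. rewrite b0, Kx, nm0. split; auto. lra.
  have Hd := vdist_pos SK CK Kx. destruct (vdist_appr SK x Hd) as [w [Hw Hwn]]. exists (x -v w).
  have E : T (x -v w) = T x. { rewrite bD, bN. rewrite Hw. vring. } split; auto.
  apply Rnot_lt_le. intros Hl. apply Hc. have Hdw := vdist_le SK x Hw. have Hp : 0 < / nm (x -v w) by triv.
  exists (RtoC (/ nm (x -v w)) *v (x -v w)). rewrite vdist_scal, Cmod_R, Rabs_pos_eq by (auto; lra). rewrite bZ, E, !nm_RC by lra.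
  have Ed : vdist Kr (x -v w) = vdist Kr x by (apply vdist_addW; auto; apply vsub_opp; auto). rewrite Ed. split; [|split].
  - apply Rmult_le_reg_l with (nm (x -v w)). lra. rewrite <- Rmult_assoc, Rinv_r; lra.
  - rewrite Rinv_l; lra.
  - apply Rmult_lt_reg_l with (nm (x -v w)). lra. rewrite <- Rmult_assoc, Rinv_r, Rmult_1_l by lra. apply Rmult_lt_reg_r with (INR (S n)); auto. rewrite Rmult_assoc, Rinv_l; lra. }
 destruct (fun_choice Hs) as [x Hx]. destruct (@cpt_cv V V P x 1 HP) as [p [z [Hp Hz]]]. intros n; apply Hx.
 have Kz : Kr z.
 { apply (cv_unique (u := fun n => T (P (x (p n))))). now apply (@cv_app V V T (fun n => P (x (p n)))). apply cv_ext with (fun n => T (x (p n))). intros; now rewrite TP.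
  intros eps He. destruct (small_inv He) as [N HN]. exists N. intros n Hnn. replace (T (x (p n)) -v 0v) with (T (x (p n))) by vring. eapply Rlt_trans. apply Hx. apply HN. have D := incr_ge Hp n. lia. }
 destruct (Hz (1/4)) as [N HN]. lra. specialize (HN N (le_n _)). destruct (Hx (p N)) as [H1 _]. have D := vdist_le SK (P (x (p N))) Kz.
 have Ed : vdist Kr (P (x (p N))) = vdist Kr (x (p N)).
 { replace (P (x (p N))) with (x (p N) +v (P (x (p N)) -v x (p N))) by vring. apply vdist_addW; auto. unfold Kr. rewrite bD, bN, TP. vring. }
 lra.
Qed.
Lemma minR_ran T P : SS T -> cpt P -> T ** P = T -> (forall X, SS X -> X ** T <> 0v -> forall x, X (T x) = 0v -> T x = 0v) -> minR (fun y => exists x, y = T x).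
Proof.
 intros HS HP HT Hm. destruct (ran_bound HP HT) as [c [Hc Hb]]. have HTc : cpt T by (rewrite <- HT; now apply cpt_compl).
 have Hlift : forall u : nat -> V, (forall n, exists x, u n = T x) -> forall M, (forall n, nm (u n) <= M) -> exists x, (forall n, u n = T (x n)) /\ forall n, nm (x n) <= c * M.
 { intros u Hu M HM. destruct (fun_choice Hu) as [x Hx]. destruct (fun_choice (fun n => Hb (x n))) as [x' Hx']. exists x'. split. intros n. destruct (Hx' n) as [-> _]. auto.
  intros n. destruct (Hx' n) as [_ D]. rewrite <- Hx in D. specialize (HM n). nra. }
 split; [|split; [|split]].
 - split; [|split]. exists 0v. bring. intros x y [a ->] [b ->]. exists (a +v b). bring. intros k x [a ->]. exists (k *v a). bring.
 - intros u l Hu Hl. destruct (cv_bounded Hl) as [M [HM0 HM]]. destruct (Hlift u Hu M HM) as [x [Hx Hxn]].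
  destruct (@cpt_cv V V P x (c * M) HP Hxn) as [p [z [Hp Hz]]]. exists z. apply (cv_unique (u := fun n => u (p n))). now apply cv_sub.
  apply cv_ext with (fun n => T (P (x (p n)))). intros n. rewrite <- bmA, HT, Hx. auto. now apply (@cv_app V V T (fun n => P (x (p n)))).
 - intros u M Hu HM. destruct (Hlift u Hu M HM) as [x [Hx Hxn]]. replace u with (fun n => T (x n)). apply cpt_prec with (c * M); auto. apply functional_extensionality. auto.
 - intros X HX [y [[a ->] Hy]] z [b ->] Hz. apply (Hm X); auto. intros E. apply Hy. rewrite <- bmA, E. triv.
Qed.
Lemma minR_low R0 (X : bop V V) : minR R0 -> (forall y, R0 y -> X y = 0v -> y = 0v) -> exists c, 0 < c /\ forall y, R0 y -> c * nm y <= nm (X y).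
Proof.
 intros [SR [CR [PR _]]] Hk. contra Hn.
 have Hs : forall n, exists y, R0 y /\ nm y = 1 /\ nm (X y) < / INR (S n).
 { intros n. contra Hc. apply Hn. exists (/ INR (S n)). split. triv. intros y Hy. apply Rnot_lt_le. intros Hl. apply Hc.
  destruct (classic (y = 0v)) as [->|Hy0]. rewrite b0, nm0 in Hl. lra. have Hp := nm_pos Hy0. have Hpi := inv_gt0 _ Hp.
  exists (RtoC (/ nm y) *v y). split. now apply SR. rewrite bZ, !nm_RC by lra. split. rewrite Rinv_l; lra.
  apply Rmult_lt_reg_l with (nm y); auto. rewrite <- Rmult_assoc, Rinv_r, Rmult_1_l by lra. lra. }
 destruct (fun_choice Hs) as [y Hy]. destruct (@prec_cv V y) as [p [z [Hp Hz]]]. apply (PR y 1). intros; apply Hy. intros n. destruct (Hy n) as [_ [-> _]]. lra.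
 have Rz : R0 z. { apply (CR (fun n => y (p n))); auto. intros; apply Hy. }
 have Xz : X z = 0v. { apply (cv_unique (u := fun n => X (y (p n)))). now apply (@cv_app V V X (fun n => y (p n))).
  intros eps He. destruct (small_inv He) as [N HN]. exists N. intros n Hnn. replace (X (y (p n)) -v 0v) with (X (y (p n))) by vring. eapply Rlt_trans. apply Hy. apply HN. have D := incr_ge Hp n. lia. }
 have D : 1 <= nm z. { apply (cv_nm_ge Hz). exists O. intros n _. destruct (Hy (p n)) as [_ [-> _]]. lra. }
 rewrite (Hk z Rz Xz), nm0 in D. lra.
Qed.
(** An idempotent as in a compact semigroup. Normalised powers U of A converge along a subsequence
    to some S0 not 0, the quotient powers joining consecutive ones converge to e, and e S0 = S0.
    Injectivity of S0 on the minimal range forces e to be the identity there. *)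
Lemma idem R0 A P2 : minR R0 -> SS A -> cpt P2 -> A ** P2 = A -> (forall x, R0 (A x)) -> (forall y, R0 y -> exists x, y = A x) -> (exists y, R0 y /\ A y <> 0v) ->
 exists e, SS e /\ e ** e = e /\ (forall x, R0 (e x)) /\ (forall y, R0 y -> e y = y) /\ (forall x, A x = 0v -> e x = 0v).
Proof.
 intros HR HA HP HAP HAR HRA [y0 [Ry0 Ay0]]. destruct HR as [SR [CR [PR Hmin]]].
 have HAi : forall y, R0 y -> A y = 0v -> y = 0v. { apply Hmin; auto. exists y0; auto. }
 destruct (minR_low (R0 := R0) (X := A)) as [c [Hc HcA]]; auto. split; auto.
 have HAc : cpt A by (rewrite <- HAP; now apply cpt_compl).
 have HRn : forall n x, R0 ((A ^^ S n) x) by (intros n x; sim; rewrite bmA; auto).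
 have Hlow : forall n, c * nm (A ^^ S n) <= nm (A ^^ S (S n)).
 { intros n. apply Rmult_le_reg_l with (/ c). triv. rewrite <- Rmult_assoc, Rinv_l, Rmult_1_l by lra. apply nm_le.
  apply mul_ge0. triv. apply nm_ge0. intros x. apply Rmult_le_reg_l with c; auto. rewrite <- !Rmult_assoc, Rinv_r, Rmult_1_l by lra.
  le_by HcA. triv. rewrite <- bpow_app_S. apply nm_app. }
 have HNp : forall n, 0 < nm (A ^^ S n).
 { induction n. apply nm_pos. rewrite bpow_1. intros E. apply Ay0. rewrite E. triv. specialize (Hlow n). nra. }
 (* A power of exponent at least 2 has the form A (...) P2 with compact outer factors, and the low
    bound on [R0] controls the middle factor by the whole. *)
 have Hpr : forall (a : nat -> R) (k : nat -> nat) M, (forall i, 0 <= a i) -> (forall i, nm (RtoC (a i) *v A ^^ S (S (k i))) <= M) -> prec (fun i => RtoC (a i) *v A ^^ S (S (k i)) : BL V).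
 { intros a k M Ha HM. replace (fun i => RtoC (a i) *v A ^^ S (S (k i)) : BL V) with (fun i => A ** (RtoC (a i) *v A ^^ S (k i)) ** P2 : BL V).
  apply cpt_sandwich with (M / c); auto. intros i. specialize (HM i). rewrite nm_RC in * by auto. apply Rmult_le_reg_l with c; auto. replace (c * (M / c)) with M by (field; lra).
  specialize (Hlow (k i)). specialize (Ha i). assert (a i * (c * nm (A ^^ S (k i))) <= a i * nm (A ^^ S (S (k i)))) by nra. lra.
  fext i. replace (A ** (RtoC (a i) *v A ^^ S (k i)) ** P2) with (RtoC (a i) *v (A ** A ^^ S (k i) ** P2)) by bring. f_equal.
  rewrite (bpow_S A (k i)), <- !bcA, HAP. rewrite <- bpow_S. triv. }
 have Hnv : forall (a : nat -> R) (k : nat -> nat) S', (forall i, 0 <= a i) -> cv (fun i => RtoC (a i) *v A ^^ S (k i) : BL V) S' -> S' <> 0v -> exists y, R0 y /\ S' y <> 0v.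
 { intros a k S' Ha HS' Hn0. have Hx : S' ** A <> 0v.
  { intros E. have D : c * nm S' <= nm (S' ** A).
  { apply le_epsilon. intros eps He. destruct (HS' (eps / (2 * c))) as [N1 H1]. triv.
  have HS2 : cv (fun i => (RtoC (a i) *v A ^^ S (k i)) ** A : BL V) (S' ** A) by (apply cv_comp; auto; apply cv_const).
  destruct (HS2 (eps / 2)) as [N2 H2]. lra. set (i := (N1 + N2)%nat). specialize (H1 i ltac:(unfold i; lia)). specialize (H2 i ltac:(unfold i; lia)).
  have D1 := nm_rev S' (RtoC (a i) *v A ^^ S (k i)). rewrite nm_subC in D1. have D2 := nm_rev ((RtoC (a i) *v A ^^ S (k i)) ** A) (S' ** A).
  have D3 : c * nm (RtoC (a i) *v A ^^ S (k i)) <= nm ((RtoC (a i) *v A ^^ S (k i)) ** A).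
  { replace ((RtoC (a i) *v A ^^ S (k i)) ** A) with (RtoC (a i) *v (A ^^ S (k i) ** A)) by bring. rewrite <- bpow_S, !nm_RC by auto. specialize (Hlow (k i)). specialize (Ha i).
  nra. }
  have D4 : c * nm S' <= c * (nm (RtoC (a i) *v A ^^ S (k i)) + eps / (2 * c)) by nra.
  replace (c * (nm (RtoC (a i) *v A ^^ S (k i)) + eps / (2 * c))) with (c * nm (RtoC (a i) *v A ^^ S (k i)) + eps / 2) in D4 by (field; lra). lra. }
  rewrite E, nm0 in D. have D2 := nm_pos Hn0. nra. }
  destruct (bop_neq0 Hx) as [x Hx']. rewrite bmA in Hx'. exists (A x). auto. }
 set (U := fun n => RtoC (/ nm (A ^^ S (S n))) *v A ^^ S (S n) : bop V V).
 have HUi : forall n, 0 <= / nm (A ^^ S (S n)) by triv.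
 have HU1 : forall n, nm (U n) = 1. { intros n. unfold U. rewrite nm_RC by auto. apply Rinv_l. apply Rgt_not_eq, HNp. }
 have HUp : prec (fun n => U n : BL V). { apply (Hpr (fun n => / nm (A ^^ S (S n))) (fun n => n) 1); auto. intros n. change (nm (U n) <= 1). rewrite HU1. lra. }
 destruct (prec_cv HUp) as [p0 [S0 [Hp0 HS00]]]. set (p := fun i => p0 (2 * i)%nat).
 have Hp2 : forall i, (p i + 2 <= p (S i))%nat. { intros i. unfold p. replace (2 * S i)%nat with (S (S (2 * i))) by lia. have D1 := Hp0 (2 * i)%nat. have D2 := Hp0 (S (2 * i)). lia. }
 have HS0 : cv (fun i => U (p i) : BL V) S0. { apply (@cv_sub (BL V) (fun n => U (p0 n)) S0 (fun i => (2 * i)%nat)); auto. intros i; lia. }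
 clearbody p. clear HS00 Hp0.
 have S0n : S0 <> 0v. { intros E. have D : 1 <= nm S0. apply (cv_nm_ge HS0). exists O. intros; rewrite HU1; lra. rewrite E, nm0 in D. lra. }
 have S0S : SS S0. { apply (@SS_lim _ _ (fun i => U (p i))); auto. intros i. apply SS_scal, SS_pow; auto. }
 have S0R : forall x, R0 (S0 x). { intros x. apply (CR (fun i => U (p i) x)). intros i. unfold U. rewrite bsA. apply SR, HRn. apply cv_app2; auto. }
 have S0i : forall y, R0 y -> S0 y = 0v -> y = 0v. { apply Hmin; auto. apply (Hnv (fun i => / nm (A ^^ S (S (p i)))) (fun i => S (p i))); auto. }
 (* [U] carries exponents p + 2 and [Vi] exponents m + 2, hence the 2 subtracted; the gaps of [p]
    were made at least 2 so that the truncated subtraction is exact. *)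
 set (m := fun i => (p (S i) - p i - 2)%nat). set (a := fun i => nm (A ^^ S (S (p i))) * / nm (A ^^ S (S (p (S i))))).
 have Ha : forall i, 0 <= a i by (intros i; apply mul_ge0; auto; apply nm_ge0).
 set (Vi := fun i => RtoC (a i) *v A ^^ S (S (m i)) : bop V V).
 have HVU : forall i, Vi i ** U (p i) = U (p (S i)).
 { intros i. unfold Vi, U. replace ((RtoC (a i) *v A ^^ S (S (m i))) ** (RtoC (/ nm (A ^^ S (S (p i)))) *v A ^^ S (S (p i)))) with ((RtoC (a i) * RtoC (/ nm (A ^^ S (S (p i)))))%C *v (A ^^ S (S (m i)) ** A ^^ S (S (p i)))) by bring.
  rewrite <- bpow_add, <- RtoC_mult. replace (S (S (m i)) + S (S (p i)))%nat with (S (S (p (S i)))) by (unfold m; specialize (Hp2 i); lia).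
  f_equal. f_equal. unfold a. field. split; apply Rgt_not_eq, HNp. }
 (* If the quotient powers were unbounded, their normalisations would have a nonzero limit V' with
    V' S0 = 0, although V' is injective on the minimal range. *)
 have HVb : exists M, forall i, nm (Vi i) <= M.
 { contra Hnb. have Hq : forall k N : nat, exists n, (N <= n)%nat /\ INR (S k) <= nm (Vi n).
  { intros k N. contra Hcc. apply Hnb. have Hf : forall N', exists M, forall i, (i < N')%nat -> nm (Vi i) <= M.
  { induction N' as [|N' [M HM]]. exists 0. intros; lia. exists (Rmax M (nm (Vi N'))). intros i Hi. destruct (Nat.eq_dec i N'). subst. apply Rmax_r. le_by HM. lia. apply Rmax_l. }
  destruct (Hf N) as [M HM]. exists (Rmax M (INR (S k))). intros i. destruct (Nat.lt_ge_cases i N). eapply Rle_trans. auto. apply Rmax_l.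
  le_to Rmax_r. apply Rnot_lt_le. intros Hl. apply Hcc. exists i. split; auto. lra. }
  destruct (sub_pred Hq) as [q [Hq1 Hq2]].
  have Hvp : forall k, 0 < nm (Vi (q k)). { intros k. specialize (Hq2 k). assert (0 < INR (S k)) by triv. lra. }
  set (b := fun k => / nm (Vi (q k)) * a (q k)). have Hb : forall k, 0 <= b k. { intros k. apply mul_ge0; auto. triv. }
  have Eb : forall k, RtoC (b k) *v A ^^ S (S (m (q k))) = RtoC (/ nm (Vi (q k))) *v Vi (q k) :> bop V V. { intros k. unfold Vi at 2. rewrite vsA, <- RtoC_mult. triv. }
  have Hb1 : forall k, nm (RtoC (b k) *v A ^^ S (S (m (q k)))) = 1. { intros k. rewrite Eb, nm_RC by (left; apply inv_gt0; auto). apply Rinv_l. apply Rgt_not_eq, Hvp. }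
  destruct (@prec_cv (BL V) (fun k => RtoC (b k) *v A ^^ S (S (m (q k))))) as [s [V' [Hs HV']]]. apply (Hpr b (fun k => m (q k)) 1); auto. intros k; rewrite Hb1; lra.
  assert (V'n : V' <> 0v). { intros E. have D : 1 <= nm V'. apply (cv_nm_ge HV'). exists O. intros n _. rewrite Hb1; lra. rewrite E, nm0 in D. lra. }
  assert (V'i : forall y, R0 y -> V' y = 0v -> y = 0v).
  { apply Hmin. apply (@SS_lim _ _ (fun k => RtoC (b (s k)) *v A ^^ S (S (m (q (s k)))))); auto. intros k. apply SS_scal, SS_pow; auto.
  apply (Hnv (fun k => b (s k)) (fun k => S (m (q (s k))))); auto. }
  have E0 : V' ** S0 = 0v.
  { apply (@cv_unique (BL V) (fun k => (RtoC (b (s k)) *v A ^^ S (S (m (q (s k))))) ** U (p (q (s k))))).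
  - apply cv_comp; auto. apply (@cv_sub (BL V) (fun i => U (p i)) S0 (fun k => q (s k))); auto. now apply incr_comp.
  - apply (@cv_ext (BL V) (fun k => RtoC (/ nm (Vi (q (s k)))) *v U (p (S (q (s k)))))).
  intros k. rewrite Eb. rewrite <- HVU. bring.
  apply (@cv_RC (BL V) (fun k => / nm (Vi (q (s k)))) (fun k => U (p (S (q (s k))))) 1). intros k; rewrite HU1; lra.
  intros eps He. destruct (small_inv He) as [N HN]. exists N. intros n Hn. rewrite Rabs_pos_eq by (left; apply inv_gt0; auto).
  eapply Rle_lt_trans. apply Rinv_le_contravar. 2: apply (Hq2 (s n)). triv. apply HN. have D := incr_ge Hs n. lia. }
  destruct (bop_neq0 S0n) as [x Hx]. apply Hx. apply V'i; auto. rewrite <- bmA, E0. triv. }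
 destruct HVb as [M HM]. destruct (prec_cv (Hpr a m M Ha HM)) as [q [e [Hq He]]].
 have HeS : SS e. { apply (@SS_lim _ _ (fun i => Vi (q i))); auto. intros i. apply SS_scal, SS_pow; auto. }
 have EeS : e ** S0 = S0.
 { apply (@cv_unique (BL V) (fun k => Vi (q k) ** U (p (q k)))). apply cv_comp; auto. apply (@cv_sub (BL V) (fun i => U (p i)) S0 q); auto.
  apply (@cv_ext (BL V) (fun k => U (p (S (q k))))). intros k. triv. apply (@cv_sub (BL V) (fun i => U (p i)) S0 (fun k => S (q k))); auto. intros n. specialize (Hq n). lia. }
 have ceA : comm e A. { apply comm_sym. apply (@comm_lim _ A (fun i => Vi (q i))); auto. intros i. apply comm_scal, comm_pow, comm_refl. }
 have ceS : comm e S0. { apply (@comm_lim _ e (fun i => U (p i))); auto. intros i. apply comm_scal, comm_pow; auto. }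
 have HeR : forall x, R0 (e x). { intros x. apply (CR (fun i => Vi (q i) x)). intros i. unfold Vi. rewrite bsA. apply SR, HRn. apply (@cv_app2 V V (fun i => Vi (q i))); auto. }
 have Hey : forall y, R0 y -> e y = y.
 { intros y Hy. apply vsub_eq0. apply S0i. apply vsub_minus; auto. rewrite bD, bN, (comm_app y (comm_sym ceS)), <- bmA, EeS. vring. }
 exists e. split; auto. split. bext x. rewrite bmA. auto. split; auto. split; auto.
 intros x Hx. apply (cv_unique (u := fun i => Vi (q i) x)). apply (@cv_app2 V V (fun i => Vi (q i))); auto. apply cv_ext with (fun _ => 0v). intros i. unfold Vi. rewrite bsA, bpow_S, bmA, Hx, b0, vs0r. auto. apply cv_const.
Qed.
End Step2.

(** * Scalar corners and a rank-one idempotent *)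

Definition line V (v z : V) := exists c : C, z = c *v v.
Lemma line_sub V (v : V) : vsubspace (line v).
Proof.
 split; [|split]. exists 0%C. vring. intros x y [c ->] [d ->]. exists (c + d)%C. vring. intros c x [d ->]. exists (c * d)%C. vring.
Qed.
Lemma line_closed V (v : V) : v <> 0v -> vclosed (line v).
Proof.
 intros Hv u l Hu Hl. destruct (fun_choice Hu) as [c Hc]. destruct (cv_bounded Hl) as [M [HM0 HM]]. have Hp := nm_pos Hv.
 destruct (@C_BW c (M / nm v)) as [p [d [Hp1 Hd]]].
 { intros n. apply Rle_div_r; auto. rewrite <- nm_scal, <- Hc. auto. }
 exists d. apply (cv_unique (u := fun n => u (p n))). now apply cv_sub. apply cv_ext with (fun n => c (p n) *v v). intros; now rewrite Hc.
 intros eps He. destruct (Hd (eps / nm v)) as [N HN]. triv. exists N. intros n Hn. specialize (HN n Hn).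
 replace (c (p n) *v v -v d *v v) with ((c (p n) - d)%C *v v) by vring. rewrite nm_scal. apply Rlt_div_r in HN; auto.
Qed.
Lemma exp_le_1p x : 0 <= x -> x * exp (2 * x) <= exp (3 * x) - 1.
Proof.
 intros Hx. replace (3 * x) with (2 * x + x) by ring. rewrite exp_plus. have D := exp_lin x. have D2 := exp_ge1 (c := 2 * x) ltac:(lra). nra.
Qed.
Section ClaimX.
Variable V : CBanach.
Variable LL : bop V V -> Prop.
Hypothesis HLc : forall t, LL t -> cpt t.
Hypothesis HLs : forall (c : C) t, LL t -> LL (c *v t).
Hypothesis irr : irreducible LL.
Notation G := (G LL). Notation SS := (SS LL).
Lemma bexp_fix (Y : bop V V) v : Y v = 0v -> bexp Y v = v.
Proof.
 intros H. apply (cv_unique (u := fun k => ea k Y v)). apply cv_app2, bexpP. apply cv_ext with (fun _ => v). 2: apply cv_const.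
 intros k. unfold ea. generalize (2 ^ k)%nat. induction n; sim. triv. rewrite bmA, <- IHn. bpush. rewrite H. vring.
Qed.
(* [bexp (s Y) e] is a limit of powers of scalar multiples of [e (bexp (s t / 2^k)) e]. *)
Lemma corner_exp e t (la : C) s : SS e -> e ** e = e -> LL t -> SS (bexp (s *v (e ** t ** e -v la *v e)) ** e).
Proof.
 intros HeS He Ht. set (X := e ** t ** e). set (Y := X -v la *v e).
 have eX : e ** X = X by (unfold X; now rewrite !bcA, He).
 set (sg := fun k => (s * RtoC (/ p2 k))%C). set (d := fun k => Cmod s * / p2 k).
 have Hsg : forall k, Cmod (sg k) = d k. { intros k. unfold sg, d. now rewrite Cmod_mult, inv_p2_mod. }
 have Hp2 : forall k, 1 <= p2 k. { intros k. apply pow_R1_Rle. lra. }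
 have Hd : forall k, 0 <= d k <= Cmod s. { intros k. have D := Cmod_ge_0 s. unfold d. specialize (Hp2 k). split. apply mul_ge0; auto. left; apply inv_gt0; lra.
  replace (Cmod s) with (Cmod s * 1) at 2 by ring. apply mul_le_l; auto. rewrite <- Rinv_1. triv. }
 set (B := fun k => (1 - sg k * la)%C *v (e ** bexp (sg k *v t) ** e)).
 have HBS : forall k, SS (B k). { intros k. apply SS_scal. apply SS_comp; auto. apply SS_comp; auto. apply SS_G, G_exp; auto. }
 set (C1 := Cmod la * nm X + (1 + Cmod s * Cmod la) * (nm e * (nm t * nm t * exp (Cmod s * nm t)) * nm e)).
 have Ht0 := nm_ge0 t. have He0 := nm_ge0 e. have HX0 := nm_ge0 X. have Hl0 := Cmod_ge_0 la. have Hs0 := Cmod_ge_0 s. have HY0 := nm_ge0 Y.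
 have HE0 := exp_pos (Cmod s * nm t).
 have HC1 : 0 <= C1. { apply Rplus_le_le_0_compat. apply mul_ge0; auto. triv. }
 have HB : forall k, nm (B k -v e -v sg k *v Y) <= d k * d k * C1.
 { intros k. set (E := bexp (sg k *v t) -v bid V -v sg k *v t). specialize (Hd k).
  replace (B k -v e -v sg k *v Y) with ((- (sg k * sg k * la))%C *v X +v (1 - sg k * la)%C *v (e ** E ** e)).
  2: { unfold B. have Eb : bexp (sg k *v t) = E +v bid V +v sg k *v t by (unfold E; bring). rewrite Eb.
  have Ee : e ** (E +v bid V +v sg k *v t) ** e = e ** E ** e +v e ** e +v sg k *v X by bring. rewrite Ee, He. unfold Y. bring. }
  le_by nm_tri. rewrite !nm_scal, Cmod_opp, !Cmod_mult, Hsg.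
  have HE : nm E <= d k * d k * (nm t * nm t * exp (Cmod s * nm t)).
  { le_by bexp_lin. rewrite nm_scal, Hsg. replace (d k * d k * (nm t * nm t * exp (Cmod s * nm t))) with (d k * nm t * (d k * nm t) * exp (Cmod s * nm t)) by ring.
  apply mul_le_l. apply mul_ge0; apply mul_ge0; lra. apply exp_le. nra. }
  have HEe : nm (e ** E ** e) <= d k * d k * (nm e * (nm t * nm t * exp (Cmod s * nm t)) * nm e).
  { le_by nm_comp. eapply Rle_trans. apply mul_le_r; auto. apply nm_comp.
  nra. }
  have H1 : Cmod (1 - sg k * la)%C <= 1 + Cmod s * Cmod la. { le_by Cmod_triangle. rewrite Cmod_1, Cmod_opp, Cmod_mult, Hsg. nra. }
  have H2 : Cmod (1 - sg k * la)%C * nm (e ** E ** e) <= (1 + Cmod s * Cmod la) * (d k * d k * (nm e * (nm t * nm t * exp (Cmod s * nm t)) * nm e)).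
  { apply Rmult_le_compat; auto. apply Cmod_ge_0. apply nm_ge0. }
  unfold C1. lra. }
 set (c := Cmod s * (nm Y + Cmod s * C1)).
 have Hc0 : 0 <= c. { apply mul_ge0; auto. nra. }
 set (D := fun k => (bid V -v e) +v B k).
 have HeB : forall k, e ** B k = B k. { intros k. unfold B. bstep ((1 - sg k * la)%C *v (e ** e ** bexp (sg k *v t) ** e)). now rewrite He. }
 have HBe : forall k, B k ** e = B k. { intros k. bstep ((1 - sg k * la)%C *v (e ** bexp (sg k *v t) ** (e ** e))). now rewrite He. }
 have HDn : forall k n, D k ^^ S n ** e = B k ^^ S n.
 { intros k n. induction n. rewrite !bpow_1. bstep (e -v e ** e +v B k ** e). rewrite He, HBe. bring.
  rewrite (bpow_S (D k)). rewrite <- bcA. have De : D k ** e = e ** B k. { bstep (e -v e ** e +v B k ** e). rewrite He, HBe, HeB. bring. }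
  rewrite De, bcA, IHn, <- bpow_S. auto. }
 apply (@SS_lim _ _ (fun k => B k ^^ (2 ^ k))). { intros k. apply SS_pow; auto. }
 apply (@cv_ext (BL V) (fun k => D k ^^ (2 ^ k) ** e)).
 { intros k. have Hk : (0 < 2 ^ k)%nat by (assert (Q := Nat.pow_nonzero 2 k); lia). destruct (2 ^ k)%nat. lia. triv. }
 apply cv_comp. 2: apply (@cv_const (BL V)).
 apply (@cv_half (BL V) (fun k => D k ^^ (2 ^ k)) (fun k => ea k (s *v Y)) _ (exp c * (Cmod s * Cmod s * C1))). 2: apply bexpP.
 intros k. specialize (Hp2 k). have Hpi : 0 < / p2 k by triv. specialize (HB k). have Hdk := Hd k.
 have Elin : RtoC (/ p2 k) *v (s *v Y) = sg k *v Y by (unfold sg; vring).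
 have Hc2 : d k * nm Y <= / p2 k * c. { unfold c, d. assert (0 <= / p2 k * Cmod s * (Cmod s * C1)). repeat apply mul_ge0; lra. lra. }
 apply pow_close2; auto.
 - unfold D. replace (bid V -v e +v B k) with (bid V +v (sg k *v Y +v (B k -v e -v sg k *v Y))) by bring.
  le_by nm_tri. have N1 := nm_id V. have N2 := nm_tri (sg k *v Y) (B k -v e -v sg k *v Y). rewrite nm_scal, Hsg in N2.
  le_to exp_lin. assert (d k * d k * C1 <= / p2 k * Cmod s * (Cmod s * C1)). { replace (/ p2 k * Cmod s * (Cmod s * C1)) with (Cmod s * / p2 k * Cmod s * C1) by ring. apply mul_le_r; auto. apply mul_le_l. apply mul_ge0; lra. lra. }
  unfold c. unfold d in N2 at 1. lra.
 - rewrite Elin. le_by lin_nm. rewrite Hsg. apply exp_le; auto.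
 - rewrite Elin. unfold D. replace (bid V -v e +v B k -v (bid V +v sg k *v Y)) with (B k -v e -v sg k *v Y) by bring. le_by HB. right. unfold d. ring.
Qed.
(** X = e t e has an eigenvector v in [R0]. With Y = X - la e, the entire family exp(s Y) e lies in
    the semigroup and fixes v. Unboundedness would give a nonzero limit killing v, against
    minimality; so the family is bounded and Y = 0, as in Liouville's theorem. *)
Lemma corner_scalar R0 e t : minR LL R0 -> SS e -> e ** e = e -> (forall x, R0 (e x)) -> (forall y, R0 y -> e y = y) -> e <> 0v -> LL t ->
 exists chi : C, forall x, e (t (e x)) = chi *v e x.
Proof.
 intros HR HeS He HeR Hey Hn Ht. assert (HR' := HR). destruct HR' as [SR [CR [PR Hmin]]].
 have Hec : cpt e. { intros u Hu. apply (PR (fun n => e (u n)) (nm e)). intros; apply HeR. intros n. now apply nm_app1. }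
 set (X := e ** t ** e). have HXc : cpt X by (unfold X; now apply cpt_compl).
 have HXR : forall x, R0 (X x). { intros x. unfold X. rewrite !bmA. triv. }
 destruct (bop_neq0 Hn) as [w0 Hw0].
 have Hev : exists (la : C) v, R0 v /\ v <> 0v /\ X v = la *v v.
 (* Without eigenvectors in [R0], X is bounded below there, while a compact operator without nonzero
    eigenvalues has arbitrarily small spectral radius. *)
 { contra Hne. have Hk : forall y, R0 y -> X y = 0v -> y = 0v.
  { intros y Hy Hy0. contra Hyn. apply Hne. exists 0%C, y. rewrite vs0l. auto. }
  destruct (minR_low (R0 := R0) (X := X) HR Hk) as [c [Hc HcX]].
  have Hlow : forall n, c ^ n * nm (e w0) <= nm ((X ^^ n) (e w0)) /\ R0 ((X ^^ n) (e w0)).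
  { induction n as [|n [I1 I2]]; sim. rewrite b1A. split; auto. lra. rewrite bmA. split; auto. specialize (HcX _ I2). nra. }
  destruct (@rb_compact V 0%C X (c / 2) HXc) as [r [Hr Hrb]]. rewrite Cmod_0; lra.
  { intros lam x Hl E. rewrite baA, bsA, vs0l, vadd0l in E. contra Hx. apply Hne. exists lam, x. split; auto.
  have Hl0 : lam <> 0%C. { intros E0. rewrite E0, Cmod_0 in Hl. lra. }
  replace x with ((/ lam)%C *v X x). apply SR; auto. rewrite E, vsA, Cinv_l, vs1; auto. }
  replace (0 *v bid V +v X) with X in Hrb by bring. destruct (Hrb (c / 2)) as [M [HM HMn]]. lra. have Hwp := nm_pos Hw0.
  destruct (@pow_half_small (M * 1) 1) as [n Hh]. lra. specialize (Hh n (le_n _)). destruct (Hlow n) as [L1 _]. have D := nm_app (X ^^ n) (e w0). specialize (HMn n).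
  have Hcn : 0 < c ^ n by triv. have E2 : (c / 2) ^ n = c ^ n * (1/2)^n. { rewrite <- Rpow_mult_distr. f_equal. lra. } rewrite E2 in HMn.
  have D2 : nm (X ^^ n) * nm (e w0) <= M * (c ^ n * (1 / 2) ^ n) * nm (e w0) by nra.
  have D3 : c ^ n * nm (e w0) * 1 <= c ^ n * nm (e w0) * (M * 1 * (1/2)^n) by lra.
  assert (0 < c ^ n * nm (e w0)) by nra. nra. }
 destruct Hev as [la [v [Rv [Hv0 Hv]]]]. set (Y := X -v la *v e).
 have Yv : Y v = 0v. { unfold Y. bpush. rewrite Hv, (Hey v Rv). vring. }
 have Ye : Y ** e = Y. { bstep (e ** t ** (e ** e) -v la *v (e ** e)). now rewrite He. }
 have eY : e ** Y = Y. { unfold Y, X. bstep (e ** e ** t ** e -v la *v (e ** e)). now rewrite He. }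
 set (Z := fun s => bexp (s *v Y) ** e). have HZS : forall s, SS (Z s) by (intros s; exact (corner_exp la s HeS He Ht)).
 have HZb : exists M, forall s, nm (Z s) <= M.
 { contra Hnb. have Hs : forall n, exists s, INR (S n) <= nm (Z s).
  { intros n. contra Hc. apply Hnb. exists (INR (S n)). intros s. apply Rnot_lt_le. intros Hl. apply Hc. exists s. lra. }
  destruct (fun_choice Hs) as [s Hsn]. set (a := fun n => / nm (Z (s n))).
  have HZp : forall n, 0 < nm (Z (s n)). { intros n. specialize (Hsn n). assert (0 < INR (S n)) by triv. lra. }
  have Ha : forall n, 0 <= a n by (intros n; left; apply inv_gt0; auto).
  have H1 : forall n, nm (RtoC (a n) *v Z (s n)) = 1. { intros n. rewrite nm_RC by auto. apply Rinv_l. apply Rgt_not_eq, HZp. }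
  have eZ : forall z, e ** Z z ** e = Z z.
  { intros z. unfold Z. have c1 : e ** (z *v Y) = (z *v Y) ** e. { bstep (z *v (e ** Y)). rewrite eY. rewrite <- Ye at 1. bring. }
  rewrite bcA, (bexp_intertw c1), <- !bcA, !He. auto. }
  have Hp : prec (fun n => RtoC (a n) *v Z (s n) : BL V).
  { replace (fun n => RtoC (a n) *v Z (s n) : BL V) with (fun n => e ** (RtoC (a n) *v Z (s n)) ** e : BL V). apply cpt_sandwich with 1; auto. intros n; rewrite H1; lra.
  fext n. bstep (RtoC (a n) *v (e ** Z (s n) ** e) : BL V). now rewrite eZ. }
  destruct (prec_cv Hp) as [p [Zl [Hp1 HZl]]].
  have Zln : Zl <> 0v. { intros E. have D : 1 <= nm Zl. apply (cv_nm_ge HZl). exists O. intros; rewrite H1; lra. rewrite E, nm0 in D. lra. }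
  have Zle : Zl ** e = Zl. { apply (@cv_unique (BL V) (fun n => (RtoC (a (p n)) *v Z (s (p n))) ** e)). apply cv_comp; auto. apply cv_const. apply (@cv_ext (BL V) (fun n => RtoC (a (p n)) *v Z (s (p n)))); auto.
  intros n. transitivity (RtoC (a (p n)) *v (bexp (s (p n) *v Y) ** (e ** e)) : BL V). now rewrite He. bring. }
  apply Hv0. apply (Hmin Zl); auto.
  - apply (@SS_lim _ _ (fun n => RtoC (a (p n)) *v Z (s (p n)))); auto. intros n. apply SS_scal; auto.
  - destruct (bop_neq0 Zln) as [x Hx]. exists (e x). split; auto. rewrite <- bmA, Zle. auto.
  - apply (cv_unique (u := fun n => (RtoC (a (p n)) *v Z (s (p n))) v)). apply (@cv_app2 V V (fun n => RtoC (a (p n)) *v Z (s (p n)))); auto.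
  apply (cv_ext (u := fun n => RtoC (a (p n)) *v v)). { intros n. rewrite bsA. f_equal. unfold Z. rewrite bmA, (Hey v Rv), bexp_fix; auto. rewrite bsA, Yv. vring. }
  apply (@cv_RC V (fun n => a (p n)) (fun _ => v) (nm v)). intros; lra. intros eps He'. destruct (small_inv He') as [N HN]. exists N. intros n Hnn. rewrite Rabs_pos_eq by auto.
  eapply Rle_lt_trans. apply Rinv_le_contravar. 2: apply Hsn. triv. apply HN. have D := incr_ge Hp1 n. lia. }
 destruct HZb as [M HM]. have HM0 : 0 <= M by (eapply Rle_trans; [apply nm_ge0|apply (HM 0%C)]).
 have HY0 : Y = 0v :> BL V.
 (* The linear coefficient of a function bounded by M on the circle of radius R1 is at most M/R1;
    [R1] is chosen to make this at most eps/2. *)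
 { apply nm_small0. intros eps Heps. set (R1 := 2 * (M + 1) / eps). have HR1 : 0 < R1 by (apply div_gt0; lra). have He0 := nm_ge0 e.
  destruct (@bexp_extract V Y R1 (eps / (2 * (nm e + 1)))) as [N [HN HE]]; auto. triv. have HNp : 0 < INR N by triv.
  match type of HE with nm (?T -v Y) <= _ => set (T0 := T) in * end.
  have HTe : nm (T0 ** e) <= / (INR N * R1) * (INR N * M).
  { unfold T0. match goal with |- nm ((?k *v vsum N ?f) ** e) <= _ => replace ((k *v vsum N f) ** e) with (k *v vsum N (fun j => cpow (cpow (rou N) j) (N - 1) *v Z (RtoC R1 * cpow (rou N) j)%C) : BL V) end.
  rewrite nm_RC by (left; apply inv_gt0, Rmult_lt_0_compat; auto). apply mul_le_l. triv.
  apply vsum_nm. intros j Hj. rewrite nm_scal, !cpow_mod, rou_mod, !pow1, Rmult_1_l. apply HM.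
  bext x. rewrite bmA, !bsA, !vsum_app2. triv. }
  replace (/ (INR N * R1) * (INR N * M)) with (M / R1) in HTe by (field; lra).
  have HMR : M / R1 <= eps / 2. { unfold R1. replace (M / (2 * (M + 1) / eps)) with (eps / 2 * (M / (M + 1))) by (field; lra). assert (M / (M + 1) <= 1) by (apply Rle_div_l; lra). nra. }
  replace Y with (T0 ** e -v (T0 -v Y) ** e : BL V) by (transitivity (Y ** e : BL V); [bring|auto]).
  le_by nm_sub. have D := nm_comp (T0 -v Y) e. have D2 : nm (T0 -v Y) * nm e <= eps / (2 * (nm e + 1)) * (nm e + 1) by (apply Rmult_le_compat; try apply nm_ge0; lra).
  replace (eps / (2 * (nm e + 1)) * (nm e + 1)) with (eps / 2) in D2 by (field; lra). lra. }
 exists la. intros x. apply vsub_eq0. transitivity (Y x). bpush. auto. rewrite HY0. triv.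
Qed.

Lemma exp_near (e t : bop V V) x eps : 0 < eps -> exists d, 0 < d <= 1 /\ forall s, 0 < s < d -> nm (e (bexp (s *v t) x) -v e x) < eps.
Proof.
 intros He. have He0 := nm_ge0 e. have Ht0 := nm_ge0 t. have Hx0 := nm_ge0 x. have HE := exp_pos (2 * nm t). set (K := nm e * (nm t * exp (2 * nm t) * nm x)). have HK : 0 <= K by (unfold K; pos).
 exists (Rmin 1 (eps / (K + 1))). split. split. apply Rmin_glb_lt; pos. apply Rmin_l. intros s [Hs Hsd]. have H1 := Rmin_l 1 (eps / (K + 1)). have H2 := Rmin_r 1 (eps / (K + 1)).
 rewrite <- bN, <- bD. replace (bexp (s *v t) x -v x) with ((bexp (s *v t) -v bid V) x) by (bpush; auto). apply Rle_lt_trans with (s * K).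
 - le_by nm_app. unfold K. rewrite <- Rmult_assoc, (Rmult_comm s), Rmult_assoc. apply mul_le_l; auto. le_by nm_app. rewrite <- Rmult_assoc. apply mul_le_r; auto.
  le_by bexp_close1. rewrite nm_RC, Rmult_assoc by lra. apply mul_le_l. lra. apply mul_le_l; auto. apply exp_le. nra.
 - apply Rle_lt_trans with (s * (K + 1)). nra. apply Rlt_div_r; lra.
Qed.
Lemma near_neq0 (x y : V) : nm (x -v y) < nm y -> x <> 0v.
Proof. intros H E. rewrite E, nm_subC in H. replace (y -v 0v) with y in H by vring. lra. Qed.
(** Differentiating the proportionality of A(exp(s t) x) and e(exp(s t) x) at s = 0. The
    proportionality factor need not be differentiable; its boundedness suffices, since all other
    terms already lie on the line. *)
Lemma line_deriv (e A t : bop V V) x d : e x <> 0v -> line (e x) (A x) -> line (e x) (e (t x)) -> 0 < d <= 1 ->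
 (forall s, 0 < s < d -> line (e (bexp (s *v t) x)) (A (bexp (s *v t) x)) /\ nm (e (bexp (s *v t) x) -v e x) < nm (e x) / 2) -> line (e x) (A (t x)).
Proof.
 intros Hn HA Ht Hd H. have Hp := nm_pos Hn. have SL := line_sub (e x). set (L := line (e x)) in *. apply (vdist0_in SL (line_closed Hn)).
 have He0 := nm_ge0 e. have HA0 := nm_ge0 A. have Hx0 := nm_ge0 x. have Ht0 := nm_ge0 t. have HE := exp_pos (nm t). have HE2 := exp_pos (2 * nm t).
 set (M := nm t * nm t * exp (nm t) * nm x). have HM : 0 <= M by (unfold M; pos). set (k0 := nm A * ((nm t * exp (2 * nm t) + 1) * nm x) / (nm (e x) / 2)).
 have Hk0 : 0 <= k0 by (unfold k0; pos).
 set (K := (k0 * nm e + nm A) * M). have HK : 0 <= K by (unfold K; pos). apply Rle_antisym. 2: now apply vdist_ge0. apply le_epsilon. intros eps Heps.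
 set (s := Rmin d (eps / (K + 1)) / 2). have H1 := Rmin_l d (eps / (K + 1)). have H2 := Rmin_r d (eps / (K + 1)). have Hq : 0 < eps / (K + 1) by pos. have H3 : 0 < Rmin d (eps / (K + 1)) by (apply Rmin_glb_lt; lra).
 have Hs : 0 < s < d by (unfold s; lra). destruct (H s Hs) as [[k Hk] Hc]. set (F := bexp (s *v t)) in *. set (Er := RtoC (/ s) *v (F -v bid V) -v t).
 have HEr : nm (Er x) <= s * M. { le_by nm_app. unfold M. rewrite <- Rmult_assoc. apply mul_le_r; auto. apply bexp_deriv; lra. }
 have HF : nm (F x) <= (nm t * exp (2 * nm t) + 1) * nm x.
 { le_by nm_app. apply mul_le_r; auto. replace F with (F -v bid V +v bid V) by bring. le_by nm_tri. apply Rplus_le_compat. 2: apply nm_id. le_by bexp_close1. rewrite nm_RC by lra. apply Rmult_le_compat; try pos. nra. apply exp_le; nra. }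
 have Hkk : Cmod k <= k0. { apply Rle_div_r. lra. le_mid (nm (A (F x))). rewrite Hk, nm_scal. apply mul_le_l. apply Cmod_ge_0. have Q := nm_rev (e x) (e (F x)). rewrite nm_subC in Q. lra. le_by nm_app. apply mul_le_l; auto. }
 (* The approximant on the line is what remains of the difference quotient when the second-order
    error [Er] is left out. *)
 destruct HA as [a Ha]. destruct Ht as [b Hb]. le_by (vdist_le SL (A (t x)) (w := ((k - a) * RtoC (/ s) + k * b)%C *v e x)). now exists ((k - a) * RtoC (/ s) + k * b)%C.
 replace (A (t x) -v ((k - a) * RtoC (/ s) + k * b)%C *v e x) with (k *v e (Er x) -v A (Er x)).
 2: { unfold Er. bpush. rewrite Hk, Ha, Hb. vring. }
 le_by nm_sub. rewrite nm_scal. have Q1 := nm_app e (Er x). have Q2 := nm_app A (Er x).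
 have Q3 : Cmod k * nm (e (Er x)) <= k0 * (nm e * (s * M)). { apply Rmult_le_compat; auto. apply Cmod_ge_0. apply nm_ge0. le_by Q1. apply mul_le_l; auto. }
 have Q4 : nm A * nm (Er x) <= nm A * (s * M) by (apply mul_le_l; auto). have Q5 : s < eps / (K + 1) by (unfold s; lra). apply Rlt_div_r in Q5; [|lra]. unfold K in Q5. lra.
Qed.
Lemma words_dense x : x <> 0v -> forall y, vclosure (vspan (fun z => exists p, Wd LL p /\ z = p x)) y.
Proof.
 intros Hx. apply (irr_dense irr Hx). exists (bid V). split; auto. constructor.
 intros t z Ht [p [Hp ->]]. apply vclosure_in, vspan_in. exists (t ** p). split. now constructor. now rewrite bmA.
Qed.
(** Take an idempotent e onto a minimal range and v in it. Corners being scalar, e t h v is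
    proportional to e h v for h in the group; by differentiation, e sends all words in the algebra
    applied to v into the line of v, and these vectors span a dense subspace. *)
Theorem rank_one a0 : LL a0 -> a0 <> 0v -> exists e v, SS e /\ e ** e = e /\ v <> 0v /\ e v = v /\ forall x, line v (e x).
Proof.
 intros La Ha0. destruct (step1 HLc HLs irr La Ha0) as [g [nu [x0 [Hg [Hx0 [E0 Hnu]]]]]].
 destruct (SS_compact HLc Hg Hx0 E0 Hnu) as [T0 [P [HT0 [HT0n [HP HTP0]]]]]. destruct (max_ker HT0 HT0n HP HTP0) as [T [HT [HTn [HTP Hmax]]]].
 set (R0 := fun y => exists x, y = T x). have HR : minR LL R0 by (apply (minR_ran HT HP HTP Hmax)). assert (HR' := HR). destruct HR' as [SR [CR [PR Hmin]]].
 destruct (bop_neq0 HTn) as [x1 Hx1]. destruct (G_nz HLs irr HTn Hx1) as [h [Hh Hhx]]. destruct (G_inv HLs Hh) as [hi [Hhi [Hi1 Hi2]]].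
 (* T itself may vanish on its range; a group element [h] with T h T not 0 repairs this without
    changing the range. *)
 destruct (@idem V LL R0 (T ** h) (hi ** P ** h)) as [e [HeS [He [HeR [Hey _]]]]]; auto.
 { apply SS_comp; auto. now apply SS_G. } { apply cpt_compr, cpt_compl; auto. } { rewrite !bcA, <- (bcA T h hi), Hi1, bc1r, HTP. auto. }
 { intros x. exists (h x). now rewrite bmA. } { intros y [x ->]. exists (hi x). rewrite bmA, <- (bmA h hi), Hi1. auto. }
 { exists (T x1). split. exists x1; auto. now rewrite bmA. }
 set (v := T x1). have Rv : R0 v by (exists x1; auto). have ev : e v = v by auto. have Hv : v <> 0v by auto.
 have Hec : cpt e. { intros u Hu. apply (PR (fun n => e (u n)) (nm e)). intros; apply HeR. intros n. now apply nm_app1. }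
 exists e, v. split; auto. split; auto. split; auto. split; auto. clear h Hh Hhx hi Hhi Hi1 Hi2.
 (* The idempotent [e'] onto [h R0] has the same kernel as [e], so that [e t h v] and [e h v] are the images under [e] of [e' t e' h v] and [h v]. *)
 have Hchi : forall h t, G h -> e (h v) <> 0v -> LL t -> line (e (h v)) (e (t (h v))).
 { intros h t Hh Hehv Ht. destruct (G_inv HLs Hh) as [hi [Hhi HI]].
  have Hhi1 : forall x, hi (h x) = x by (intros; apply (inv_app x HI)). have Hhi2 : forall x, h (hi x) = x by (intros; apply (inv_app2 x HI)).
  set (R1 := fun y => R0 (hi y)).
  have HR1 : minR LL R1.
  { split; [|split; [|split]].
  - unfold R1. split; [|split]. rewrite b0; apply SR. intros x y Hx Hy. rewrite bD. now apply SR. intros c x Hx. rewrite bZ. now apply SR.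
  - intros u l Hu Hl. apply (CR (fun n => hi (u n))); auto. now apply cv_app.
  - intros u M Hu HM. replace u with (fun n => h (hi (u n))). apply prec_bop. apply (PR _ (nm hi * M)); auto. intros n. le_by nm_app. apply mul_le_l; auto. apply nm_ge0. apply functional_extensionality; auto.
  - intros X HX [y [Ry Hy]] z Rz Hz. rewrite <- (Hhi2 z), (Hmin (X ** h)) with (y := hi z); auto. apply b0. apply SS_comp; auto. now apply SS_G. exists (hi y). split; auto. all: now rewrite bmA, Hhi2. }
  have R1hv : R1 (h v) by (unfold R1; now rewrite Hhi1).
  destruct (@idem V LL R1 (h ** e) e) as [e' [HeS' [He' [HeR' [Hey' Hek]]]]]; auto.
  { apply SS_comp; auto; now apply SS_G. } { rewrite <- bcA, He; auto. } { intros x. unfold R1. rewrite bmA, Hhi1. auto. } { intros y Hy. exists (hi y). rewrite bmA, (Hey _ Hy), Hhi2; auto. }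
  { exists (h v). split; auto. rewrite bmA. intros E. apply Hehv. rewrite <- (Hhi1 (e (h v))), E. apply b0. }
  assert (Hen' : e' <> 0v). { intros E. apply Hehv. rewrite <- (Hey' _ R1hv), E, b0A. apply b0. }
  assert (e'e : forall x, e' (e x) = e' x). { intros x. apply vsub_eq0. rewrite <- bN, <- bD. apply Hek. rewrite bmA, bD, bN, <- bmA, He, vaddN. apply b0. }
  assert (ee' : forall x, e (e' x) = e x).
  { intros x. symmetry. apply vsub_eq0. rewrite <- bN, <- bD. apply (Hmin e'); auto. destruct (bop_neq0 Hen') as [w Hw]. exists (e w). split; auto. now rewrite e'e.
  rewrite e'e, bD, bN, <- (bmA e' e'), He'. apply vaddN. }
  destruct (corner_scalar HR1 HeS' He' HeR' Hey' Hen' Ht) as [chi Hch]. exists chi.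
  rewrite <- (ee' (t (h v))). rewrite <- (Hey' _ R1hv) at 1. now rewrite Hch, bZ, ee'. }
 (* The induction absorbs the letters into [A] one by one, each letter being obtained as a
    derivative along the group by [line_deriv]; this is why [A] and [h] are general. *)
 have HW : forall p, Wd LL p -> forall A : bop V V, (forall h, G h -> e (h v) <> 0v -> line (e (h v)) (A (h v))) -> forall h, G h -> e (h v) <> 0v -> line (e (h v)) ((A ** p) (h v)).
 { intros p Hp. induction Hp as [|t p Ht Hp IH]; intros A HA h Hh Hn. rewrite bc1r. auto. rewrite bcA. apply IH; auto. clear h Hh Hn. intros h Hh Hn. rewrite bmA.
  have Hn2 : 0 < nm (e (h v)) / 2. { have Q := nm_pos Hn. lra. } destruct (exp_near e t (h v) Hn2) as [d [Hd Hds]]. apply (line_deriv (d := d) Hn (HA h Hh Hn) (Hchi h t Hh Hn Ht) Hd).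
  intros s Hs. specialize (Hds s Hs). split; [|lra]. rewrite <- (bmA _ h). apply HA. constructor; auto. rewrite bmA. apply near_neq0 with (e (h v)). lra. }
 have SL := line_sub v. intros x. apply (vclosure_min (W := vspan (fun z => exists p, Wd LL p /\ z = p v)) (W' := fun z => line v (e z))).
 - apply vspan_min. { split; [|split]. rewrite b0. apply SL. intros a b Ha Hb'. rewrite bD. now apply SL. intros c a Ha. rewrite bZ. now apply SL. }
  intros z [p [Hp ->]]. have Q := HW p Hp e (fun h _ _ => ex_intro _ (RtoC 1) (eq_sym (vs1 _))) (bid V) (Gid _). rewrite b1A, ev, bmA in Q. auto.
 - intros u l Hu Hl. apply (line_closed Hv (u := fun n => e (u n))); auto. now apply cv_app.
 - apply words_dense; auto.
Qed.
End ClaimX.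

(** * Newton iteration towards idempotents and polynomial spectral filters *)

Section Newton.
Variable V : CBanach.
Implicit Types Q T A : bop V V.
(** The new norm is the supremum of N(B^j x)/rho^j. Operators commuting with B keep their bounds, so
    the construction can be repeated for a second operator. *)
Lemma rb_renorm_comm (N : V -> R) M B a rho : isnm N M -> rb B a -> a < rho -> 0 < rho -> exists N' M', isnm N' M' /\ (forall x, N' (B x) <= rho * N' x) /\
 forall A c, comm A B -> 0 <= c -> (forall x, N (A x) <= c * N x) -> forall x, N' (A x) <= c * N' x.
Proof.
 intros HN HB Ha Hr. destruct (HB rho Ha) as [C0 [HC0 HBn]]. destruct HN as [HM [HN1 [HN2 HN3]]].
 set (E := fun x r => exists j, r = N ((B ^^ j) x) * / rho ^ j). have Hrn : forall j, 0 < / rho ^ j by triv.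
 have Hbd : forall x j, N ((B ^^ j) x) * / rho ^ j <= M * C0 * nm x.
 { intros x j. have D1 := proj2 (HN1 ((B ^^ j) x)). have D2 := nm_app (B ^^ j) x. specialize (HBn j). have Hx := nm_ge0 x.
  have D3 : nm (B ^^ j) * nm x <= C0 * rho ^ j * nm x by nra. have D4 : M * nm ((B ^^ j) x) <= M * (C0 * rho ^ j * nm x) by nra.
  replace (M * C0 * nm x) with (M * (C0 * rho ^ j * nm x) * / rho ^ j) by (field; apply pow_nonzero; lra). triv. }
 have Hex : forall x, exists l, is_lub (E x) l.
 { intros x. destruct (completeness (E x)) as [l Hl]. exists (M * C0 * nm x). intros r [j ->]. auto. exists (N ((B ^^ 0) x) * / rho ^ 0), O. auto. exists l; auto. }
 destruct (fun_choice Hex) as [N' HN'].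
 have Hub : forall x j, N ((B ^^ j) x) <= rho ^ j * N' x. { intros x j. apply Rmult_le_reg_r with (/ rho ^ j); auto. replace (rho ^ j * N' x * / rho ^ j) with (N' x) by (field; apply pow_nonzero; lra). apply (HN' x). exists j; auto. }
 have Hle : forall x b, (forall j, N ((B ^^ j) x) <= rho ^ j * b) -> N' x <= b.
 { intros x b Hb. apply (HN' x). intros r [j ->]. apply Rmult_le_reg_l with (rho ^ j). triv. rewrite (Rmult_comm (N _)), <- Rmult_assoc, Rinv_r, Rmult_1_l. auto. apply pow_nonzero; lra. }
 exists N', (M * C0). split; [|split].
 - split. nra. split; [|split].
  + intros x. split. le_mid (N x). apply HN1. have D := Hub x O. rewrite b1A in D. lra. apply (HN' x). intros r [j ->]. auto.
  + intros x y. apply Hle. intros j. rewrite bD. le_by HN2. have D1 := Hub x j. have D2 := Hub y j. lra.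
  + intros c x. apply Hle. intros j. rewrite bZ. le_by HN3. have D2 := Cmod_ge_0 c. assert (Cmod c * N ((B ^^ j) x) <= Cmod c * (rho ^ j * N' x)) by triv. lra.
 - intros x. apply Hle. intros j. have D := Hub x (S j). rewrite bpow_S, bmA in D. cbn [pow] in D. lra.
 - intros A c Hc Hc0 HA x. apply Hle. intros j. rewrite <- (comm_app x (comm_pow j Hc)). le_by HA.
  assert (c * N ((B ^^ j) x) <= c * (rho ^ j * N' x)) by triv. lra.
Qed.
(** Iterates of q -> 3 q^2 - 2 q^3, for which 0 and 1 are superattracting fixed points exchanged by
    q -> 1 - q. In the limit they act as a spectral projection, and being polynomials they preserve
    every subspace invariant under [Q]. *)
Fixpoint nw (l : nat) Q := match l with O => Q | S l => 3 *v (nw l Q ** nw l Q) -v 2 *v (nw l Q ** nw l Q ** nw l Q) end.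
Lemma nw_compl l Q : nw l (bid V -v Q) = bid V -v nw l Q.
Proof. induction l; cbn [nw]; auto. rewrite IHl. bring. Qed.
Lemma nw_comm l Q T : comm T Q -> comm T (nw l Q).
Proof. intros H. induction l; cbn [nw]; auto. apply comm_add. apply comm_scal, comm_comp; auto. apply comm_opp, comm_scal, comm_comp; auto. apply comm_comp; auto. Qed.
Lemma nw_inv (Y : V -> Prop) l Q : vsubspace Y -> (forall y, Y y -> Y (Q y)) -> forall y, Y y -> Y (nw l Q y).
Proof.
 intros SY H. induction l; cbn [nw]; auto. intros y Hy. rewrite baA, boA, !bsA, !bmA. apply vsub_minus; auto; apply SY; auto.
Qed.
Lemma snm_sub (N : V -> R) x y : snm N -> N (x -v y) <= N x + N y.
Proof. intros [H1 H2]. le_by H1. rewrite voppE. have D := H2 (-1)%C y. rewrite Cmod_R, Rabs_left in D by lra. lra. Qed.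
Lemma nw_small (N : V -> R) M (Y : V -> Prop) Q : isnm N M -> vsubspace Y -> (forall y, Y y -> Y (Q y)) -> (forall y, Y y -> N (Q y) <= 1/8 * N y) ->
 forall y, Y y -> cv (fun l => nw l Q y) 0v.
Proof.
 intros HN SY HQ HNQ y Hy. have Hs := isnm_snm HN.
 have H : forall l y, Y y -> N (nw l Q y) <= 1/8 * (1/2)^l * N y.
 { clear y Hy. induction l; intros y Hy; cbn [nw]. rewrite pow_O, Rmult_1_r. auto.
  set (q := nw l Q) in *. set (r := 1/8 * (1/2)^l) in *. have Hr : 0 <= r <= 1/8. { unfold r. have Q1 : 0 <= (1/2)^l by triv. have Q2 : (1/2)^l <= 1^l by triv. rewrite pow1 in Q2. lra. }
  have Yq : forall y, Y y -> Y (q y) by (intros; apply nw_inv; auto).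
  rewrite baA, boA, !bsA, !bmA. eapply Rle_trans. apply snm_sub; auto.
  have D1 := IHl y Hy. have D2 := IHl _ (Yq _ Hy). have D3 := IHl _ (Yq _ (Yq _ Hy)). have D0 := isnm_ge0 y HN.
  have E2 : N (q (q y)) <= r * (r * N y) by nra.
  have E3 : N (q (q (q y))) <= r * (r * (r * N y)) by nra.
  have F1 := proj2 Hs (RtoC 3) (q (q y)). have F2 := proj2 Hs (RtoC 2) (q (q (q y))). rewrite Cmod_R, Rabs_pos_eq in F1, F2 by lra.
  replace (1 / 8 * (1 / 2) ^ S l) with (r / 2) by (unfold r; cbn [pow]; field). set (z := N y) in *. assert (r * z <= 1/8 * z) by nra.
  nra. }
 apply cv_le with (fun l => N y * (1/2)^l).
 - intros l. replace (nw l Q y -v 0v) with (nw l Q y) by vring. le_by (proj1 (proj2 HN)). specialize (H l y Hy). have D0 := isnm_ge0 y HN.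
  assert (0 <= (1/2)^l * N y). apply mul_ge0; auto. apply pow_le; lra. lra.
 - intros eps He. apply pow_half_small; auto.
Qed.
(** Vanishing at 0 to order 2^l: iterates of a nilpotent operator are 0 from some index on. *)
Lemma nw_factor l T : exists Y, (forall X, comm X T -> comm X Y) /\ nw l T = Y ** T ^^ (2 ^ l).
Proof.
 induction l as [|l [Y [HY E]]]; cbn [nw]. exists (bid V). split. intros; apply comm_id. rewrite bpow_1, bc1l. auto.
 have cT : comm (T ^^ (2 ^ l)) Y by (apply HY, comm_sym, comm_pow, comm_refl).
 exists ((3 *v bid V -v 2 *v nw l T) ** Y ** Y). split.
 - intros X HX. apply comm_comp; auto. apply comm_comp; auto. apply comm_add. apply comm_scal, comm_id. apply comm_opp, comm_scal, nw_comm; auto.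
 - replace (2 ^ S l)%nat with (2 ^ l + 2 ^ l)%nat by (simpl; lia). rewrite bpow_add.
  have E2 : nw l T ** nw l T = Y ** Y ** (T ^^ (2 ^ l) ** T ^^ (2 ^ l)). { rewrite E. rewrite !bcA. f_equal. rewrite <- !bcA. f_equal. apply cT. }
  bstep ((3 *v bid V -v 2 *v nw l T) ** (nw l T ** nw l T)). rewrite E2, !bcA. auto.
Qed.
(** The product of the factors 1 - T/k, equal to 1 at T = 0 and to 0 at T = k. *)
Fixpoint qp T (ks : list C) : bop V V := match ks with nil => bid V | k :: ks => qp T ks ** (bid V -v (/ k)%C *v T) end.
Lemma qp_comm T ks X : comm X T -> comm X (qp T ks).
Proof. intros H. induction ks; cbn [qp]. bring. apply comm_comp; auto. apply comm_add. bring. apply comm_opp, comm_scal; auto. Qed.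
Lemma qp_S T k ks x : qp T (k :: ks) x = qp T ks (x -v (/ k)%C *v T x).
Proof. triv. Qed.
Lemma qp_div T ks : exists Z, (forall X, comm X T -> comm X Z) /\ bid V -v qp T ks = T ** Z.
Proof.
 induction ks as [|k ks [Z [H E]]]; cbn [qp]. exists 0v. split. intros; apply comm_zero. bring.
 exists (Z +v (/ k)%C *v qp T ks). split. intros X HX. apply comm_add; auto. apply comm_scal, qp_comm; auto.
 bstep (bid V -v qp T ks +v (/ k)%C *v (qp T ks ** T)). rewrite E. rewrite <- (qp_comm ks (comm_refl T)). bring.
Qed.
Section Est.
Variables (N : V -> R) (M : R) (Y : V -> Prop).
Hypothesis HN : isnm N M.
Hypothesis SY : vsubspace Y.
Lemma nsub_le x y a b : N x <= a -> N y <= b -> N (x -v y) <= a + b.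
Proof. intros. have D := snm_sub x y (isnm_snm HN). lra. Qed.
Lemma nscal_le (c : C) x a : N x <= a -> N (c *v x) <= Cmod c * a.
Proof. intros. le_by HN. triv. Qed.
Lemma qp_near T ks tau : 0 <= tau -> (forall y, Y y -> Y (T y)) -> (forall k y, In k ks -> Y y -> N ((/ k)%C *v T y) <= tau * N y) ->
 forall y, Y y -> N (y -v qp T ks y) <= ((1 + tau) ^ length ks - 1) * N y.
Proof.
 intros Ht HT. induction ks as [|k ks IH]; intros HNT y Hy.
 - cbn [qp length pow]. rewrite b1A. replace (y -v y) with (0%C *v y) by (rewrite vs0l; symmetry; apply vaddN). le_by HN. rewrite Cmod_0. lra.
 - rewrite qp_S. cbn [length pow]. set (y' := y -v (/ k)%C *v T y). assert (Yy' : Y y'). { apply vsub_minus; auto. apply SY; auto. }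
  have D := IH (fun k' z Hk => HNT k' z (or_intror Hk)) y' Yy'. have D1 := HNT k y (or_introl eq_refl) Hy.
  have D2 : N y' <= (1 + tau) * N y. { unfold y'. have Q := nsub_le (Rle_refl (N y)) D1. lra. }
  replace (y -v qp T ks y') with ((/ k)%C *v T y -v (qp T ks y' -v y')) by (unfold y'; vring).
  have D3 : N (qp T ks y' -v y') <= ((1 + tau) ^ length ks - 1) * N y'. { replace (qp T ks y' -v y') with ((-1)%C *v (y' -v qp T ks y')) by vring. le_by HN. rewrite Cmod_R, Rabs_left by lra. lra. }
  have Q := nsub_le D1 D3. assert (1 <= (1 + tau) ^ length ks) by (apply pow_R1_Rle; lra).
  nra.
Qed.
(** A telescoping comparison of the two products: if that of [A] vanishes, that of a nearby [T] is
    small. *)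
Lemma qp_far T A ks b eta w : 0 <= b -> 0 <= eta -> 0 < w -> (forall y, Y y -> Y (T y)) -> (forall y, Y y -> Y (A y)) -> (forall y, Y y -> N (T y) <= b * N y) -> (forall y, Y y -> N (A y) <= b * N y) ->
 (forall y, Y y -> N (T y -v A y) <= eta * N y) -> (forall k, In k ks -> w <= Cmod k) ->
 forall y, Y y -> N (qp T ks y -v qp A ks y) <= INR (length ks) * (1 + b / w) ^ length ks * (eta / w) * N y.
Proof.
 intros Hb He Hw HT HA HNT HNA HTA Hks. have Hbw : 0 <= b / w by triv. have Hew : 0 <= eta / w by triv.
 have Hk : forall k z c, w <= Cmod k -> 0 <= c -> N z <= c -> N ((/ k)%C *v z) <= c / w.
 { intros k z c Hkw Hc Hz. have k0 : k <> 0%C. { intros E. rewrite E, Cmod_0 in Hkw. lra. } le_by nscal_le. apply Hz. rewrite Cmod_inv by auto. rewrite Rmult_comm. apply mul_le_l; auto. triv. }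
 have Hpos : forall y, 0 <= N y by (intros; apply (isnm_ge0 y HN)).
 have HqA : forall l, (forall k, In k l -> w <= Cmod k) -> forall y, Y y -> N (qp A l y) <= (1 + b / w) ^ length l * N y.
 { induction l as [|k l IH]; intros Hl y Hy. cbn [qp length pow]. rewrite b1A. lra. rewrite qp_S. cbn [length pow]. le_by IH. intros; apply Hl; now right. apply vsub_minus; auto. apply SY; auto.
  have D := @nsub_le y ((/ k)%C *v A y) (N y) (b * N y / w) ltac:(lra) ltac:(apply Hk; auto; [apply Hl; now left|apply mul_ge0; auto]).
  assert (0 <= (1 + b / w) ^ length l) by triv. nra. }
 induction ks as [|k ks IH]; intros y Hy.
 - cbn [qp length]. simpl INR. rewrite b1A. replace (y -v y) with (0%C *v y) by (rewrite vs0l; symmetry; apply vaddN). le_by HN. rewrite Cmod_0. lra.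
 - rewrite !qp_S. cbn [length]. rewrite S_INR. cbn [pow]. set (y' := y -v (/ k)%C *v T y). assert (Yy' : Y y'). { apply vsub_minus; auto. apply SY; auto. }
  assert (Hks' : forall k, In k ks -> w <= Cmod k) by (intros; apply Hks; now right). have Hkw : w <= Cmod k by (apply Hks; now left).
  have D1 := IH Hks' y' Yy'.
  have D2 : N y' <= (1 + b / w) * N y. { have D := @nsub_le y ((/ k)%C *v T y) (N y) (b * N y / w) ltac:(lra) ltac:(apply Hk; auto; apply mul_ge0; auto). unfold y'. lra. }
  set (z := (/ k)%C *v (T y -v A y)). have Yz : Y z. { apply SY. apply vsub_minus; auto. }
  have D3 : N z <= eta * N y / w. { apply Hk; auto. triv. }
  replace (qp T ks y' -v qp A ks (y -v (/ k)%C *v A y)) with ((qp T ks y' -v qp A ks y') -v qp A ks z).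
  2: { unfold z, y'. bring. }
  have D4 := HqA ks Hks' z Yz. have D5 := nsub_le D1 D4. le_by D5. set (B := (1 + b / w) ^ length ks) in *. have HB : 0 <= B by (apply pow_le; lra). have HIn := pos_INR (length ks).
  have HC : 0 <= INR (length ks) * B * (eta / w) by triv.
  have E1 : INR (length ks) * B * (eta / w) * N y' <= INR (length ks) * B * (eta / w) * ((1 + b / w) * N y) by nra.
  have E2 : B * N z <= B * (eta * N y / w) by nra. specialize (Hpos y).
  have E3 : 0 <= B * (eta / w) * (b / w) * N y by triv. lra.
Qed.
Lemma pow_near T A b eta m : 1 <= b -> 0 <= eta -> (forall y, Y y -> Y (T y)) -> (forall y, Y y -> Y (A y)) -> (forall y, Y y -> N (T y) <= b * N y) -> (forall y, Y y -> N (A y) <= b * N y) ->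
 (forall y, Y y -> N (T y -v A y) <= eta * N y) ->
 forall y, Y y -> Y ((T ^^ m) y) /\ Y ((A ^^ m) y) /\ N ((T ^^ m) y) <= b ^ m * N y /\ N ((A ^^ m) y) <= b ^ m * N y /\ N ((T ^^ m) y -v (A ^^ m) y) <= INR m * b ^ m * eta * N y.
Proof.
 intros Hb He HT HA HNT HNA HTA y Hy. have Hpos := isnm_ge0 y HN.
 induction m as [|m [I1 [I2 [I3 [I4 I5]]]]]; sim.
 - rewrite b1A. simpl INR. repeat split; auto; try lra. replace (y -v y) with (0%C *v y) by (rewrite vs0l; symmetry; apply vaddN). le_by HN. rewrite Cmod_0. lra.
 - rewrite !bmA, S_INR. have J : Y ((T ^^ m) y -v (A ^^ m) y) by (apply vsub_minus; auto). have J1 := HNT _ J. have J2 := HTA _ I2. rewrite bD, bN in J1.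
  have Hbm : 0 < b ^ m by triv.
  have T1 : b * N ((T ^^ m) y) <= b * (b ^ m * N y) by nra. have T2 : b * N ((A ^^ m) y) <= b * (b ^ m * N y) by nra.
  have T3 := HNT _ I1. have T4 := HNA _ I2. repeat split; auto; try lra.
  replace (T ((T ^^ m) y) -v A ((A ^^ m) y)) with ((T ((T ^^ m) y) -v T ((A ^^ m) y)) +v (T ((A ^^ m) y) -v A ((A ^^ m) y))) by vring.
  le_by HN. have K1 : b * N ((T ^^ m) y -v (A ^^ m) y) <= b * (INR m * b ^ m * eta * N y) by nra.
  have K2 : eta * N ((A ^^ m) y) <= eta * (b ^ m * N y) by nra.
  have K3 : 0 <= (b - 1) * (b ^ m * eta * N y) by triv. lra.
Qed.
End Est.
Lemma pow_div A (k : C) m : exists D, (forall X, comm X A -> comm X D) /\ A ^^ m -v cpow k m *v bid V = D ** (A -v k *v bid V).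
Proof.
 induction m as [|m [D [H E]]]; sim. exists 0v. split. intros; apply comm_zero. bring.
 exists (A ** D +v cpow k m *v bid V). split. intros X HX. apply comm_add. apply comm_comp; auto. bring.
 bstep (A ** (A ^^ m -v cpow k m *v bid V) +v cpow k m *v (A -v k *v bid V)). rewrite E. bring.
Qed.
Lemma qp_ppoly A (ks : list C) m : (forall k, In k ks -> k <> 0%C) -> exists D, qp (A ^^ m) (map (fun k => cpow k m) ks) = D ** ppoly A ks.
Proof.
 intros Hk. induction ks as [|k ks IH]; cbn [qp ppoly map]. exists (bid V). bring.
 destruct IH as [D E]. intros; apply Hk; now right. destruct (pow_div A k m) as [D' [H' E']]. rewrite E.
 have k0 : cpow k m <> 0%C. { intros E0. have k1 : k <> 0%C by (apply Hk; now left). apply Cmod_gt_0 in k1. have F := cpow_mod k m. rewrite E0, Cmod_0 in F. assert (0 < Cmod k ^ m) by triv. lra. }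
 exists (D ** ((- / cpow k m)%C *v D')).
 have F : bid V -v (/ cpow k m)%C *v A ^^ m = (- / cpow k m)%C *v D' ** (A -v k *v bid V).
 { transitivity ((- / cpow k m)%C *v (A ^^ m -v cpow k m *v bid V)). transitivity ((/ cpow k m * cpow k m)%C *v bid V -v (/ cpow k m)%C *v A ^^ m). rewrite Cinv_l, vs1; auto. bring. rewrite E'. bring. }
 rewrite F. have c : comm (ppoly A ks) D'. { apply H', comm_sym, ppoly_comm, comm_refl. }
 bstep ((- / cpow k m)%C *v (D ** (ppoly A ks ** D') ** (A -v k *v bid V))). rewrite c. bring.
Qed.
End Newton.
Lemma pow_near1 tau n : 0 <= tau -> INR n * tau <= 1/16 -> (1 + tau) ^ n - 1 <= 1/8.
Proof.
 intros Ht H. assert ((1 + tau) ^ n <= exp (INR n * tau)). { rewrite <- exp_pow. apply pow_incr. split. lra. apply exp_lin. }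
 have D : exp (1/16) * (1 - 1/16) <= 1. { have D := exp_lin (- (1/16)). have D2 : exp (1/16) * exp (- (1/16)) = 1 by (rewrite <- exp_plus; replace (1/16 + - (1/16)) with 0 by ring; apply exp_0). nra. }
 assert (exp (INR n * tau) <= exp (1/16)) by (apply exp_le; lra). lra.
Qed.
Ltac cmr := repeat first [assumption | apply comm_refl | apply comm_id | apply comm_opp | apply comm_scal | apply comm_add | apply comm_comp | apply comm_pow | match goal with H : forall A B, In A _ -> In B _ -> comm A B |- _ => apply H; simpl; tauto end].
Ltac cm := cmr; try (apply comm_sym; cmr); auto.
(** A filter for Om = U T' + U' T - 2 on the range of Pi, where T is close to 1 and Om is therefore
    close to U + U' - 2. On the range of F the polynomial annihilating U + U' - 2 makes the filter
    small, and on the complement Om has spectral radius below om, so the filter is close to 1. The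
    Newton iterates drive these values to 0 and 1. The closeness [eps] and the exponent [m] depend
    only on the eigenvalues and the bound [a]. *)
Lemma BLK (ks : list C) om om' a : 0 < om' < om -> 1 <= a -> (forall k, In k ks -> om <= Cmod k) -> exists m eps, (0 < m)%nat /\ 0 < eps /\
 forall (Z : CBanach) (U U' T T' F Pi Om : bop Z Z) r1 r, nm U <= a -> nm U' <= a -> nm T' <= a -> T' ** T = bid Z ->
 Om = U ** T' +v U' ** T -v 2 *v bid Z -> F ** F = F -> Pi ** Pi = Pi ->
 (forall A B, In A [U; U'; T; T'; F; Pi] -> In B [U; U'; T; T'; F; Pi] -> comm A B) ->
 rb ((U +v U' -v 2 *v bid Z) ** (bid Z -v F)) r1 -> r1 < om' -> rb ((T -v bid Z) ** Pi) r -> r < eps ->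
 ppoly (U +v U' -v 2 *v bid Z) ks ** F = 0v ->
 forall x, cv (fun l => nw l (qp (Om ^^ m) (map (fun k => cpow k m) ks)) (F (Pi x))) 0v /\
  cv (fun l => nw l (bid Z -v qp (Om ^^ m) (map (fun k => cpow k m) ks)) (Pi x -v F (Pi x))) 0v.
Proof.
 intros Hom Ha Hks. set (n := length ks). set (om2 := (om + om') / 2).
 have Ho2 : 0 < om2 < om by (unfold om2; lra).
 (* Raising to the m-th power separates the scales: (om2/om)^m is so small that all factors of the
    filter together stay within 1/8 of 1. *)
 destruct (pow_small (t := om2 / om) (eps := 1 / (16 * (INR n + 1)))) as [m0 Hm0]. { split. apply div_ge0; lra. apply Rlt_div_l; lra. } { have D := pos_INR n. apply div_gt0; lra. }
 set (m := S m0). set (tau := (om2 / om) ^ m). have Hq : 0 <= om2 / om <= 1. { split. apply div_ge0; lra. apply Rle_div_l; lra. }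
 have Htau : 0 <= tau /\ INR n * tau <= 1/16. { unfold tau. split. apply pow_le; lra. have D := pos_INR n. have D2 : (om2 / om) ^ m <= 1 / (16 * (INR n + 1)). { le_mid ((om2 / om) ^ m0). apply pow_le_mono. lra. unfold m; lia. lra. }
  le_mid ((INR n + 1) * (1 / (16 * (INR n + 1)))). apply Rmult_le_compat; try lra. apply pow_le; lra. right. field. lra. }
 have Hm : (0 < m)%nat by (unfold m; lia). clearbody m.
 set (b := 2 * a + 2 + om). have Hb : 1 <= b by (unfold b; lra). have Hbm : 0 < b ^ m by (apply pow_lt; lra). have Hwm : 0 < om ^ m by (apply pow_lt; lra).
 set (C1 := INR n * (1 + b ^ m / om ^ m) ^ n * (INR m * b ^ m / om ^ m)).
 have Hbw : 0 <= b ^ m / om ^ m by (apply div_ge0; lra).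
 have HC1 : 0 <= C1. { unfold C1. have D := pos_INR n. have D2 := pos_INR m. apply mul_ge0. apply mul_ge0; auto. apply pow_le; lra. apply div_ge0; auto. apply mul_ge0; lra. }
 set (eta := Rmin (Rmin ((om - om') / 2) om) (1 / (8 * (C1 + 1)))).
 have Heta : 0 < eta. { unfold eta. repeat apply Rmin_glb_lt; try lra. apply div_gt0; lra. }
 have He1 : eta <= (om - om') / 2 by (eapply Rle_trans; [apply Rmin_l|apply Rmin_l]). have He2 : eta <= om by (eapply Rle_trans; [apply Rmin_l|apply Rmin_r]).
 have He3 : C1 * eta <= 1/8. { le_mid ((C1 + 1) * (1 / (8 * (C1 + 1)))). apply Rmult_le_compat; try lra. apply Rmin_r. right; field; lra. }
 set (eps := eta / (a * a + a)). have Haa : 0 < a * a + a by nra. have Heps : 0 < eps by (apply div_gt0; lra).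
 exists m, eps. split; auto. split; auto.
 intros Z U U' T T' F Pi Om r1 r HU HU' HT' HTT EOm HF HPi Hc Hr1 Hr1' Hr Hre Hpp x.
 have d15 : comm Pi F by cm.
 have HN0 : isnm nm 1 (V := Z). { split. lra. split; [|split]. intros y. split; lra. intros; apply nm_tri. intros c y. rewrite nm_scal. lra. }
 set (A := U +v U' -v 2 *v bid Z) in *.
 destruct (@rb_renorm_comm Z nm 1 (A ** (bid Z -v F)) r1 om' HN0 Hr1 Hr1') as [N1 [M1 [HN1 [HB1 HA1]]]]. lra.
 destruct (@rb_renorm_comm Z N1 M1 ((T -v bid Z) ** Pi) r eps HN1 Hr Hre) as [N [M [HN [HB2 HA2]]]]. lra.
 have Hnm : forall B : bop Z Z, nm B <= a -> forall y : Z, nm (B y) <= a * nm y. { intros B HB y. le_by nm_app. apply mul_le_r; auto. apply nm_ge0. }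
 have NU : forall y, N (U y) <= a * N y. { apply HA2; try lra. cm. apply HA1; try lra. unfold A; cm. auto. }
 assert (NU' : forall y, N (U' y) <= a * N y). { apply HA2; try lra. cm. apply HA1; try lra. unfold A; cm. auto. }
 assert (NT' : forall y, N (T' y) <= a * N y). { apply HA2; try lra. cm. apply HA1; try lra. unfold A; cm. auto. }
 have NB1 : forall y, N ((A ** (bid Z -v F)) y) <= om' * N y. { apply HA2; try lra. apply comm_sym. unfold A; cmr; apply comm_sym; cmr. auto. }
 have Hpos : forall y, 0 <= N y by (intros; apply (isnm_ge0 y HN)). have Hsn := isnm_snm HN.
 have NA : forall y, N (A y) <= (2 * a + 2) * N y.
 { intros y. unfold A. rewrite !baA, boA, bsA, b1A. eapply Rle_trans. apply snm_sub; auto. have D := proj1 Hsn (U y) (U' y). have D2 := proj2 Hsn (RtoC 2) y. rewrite Cmod_R, Rabs_pos_eq in D2 by lra. specialize (NU y). specialize (NU' y). lra. }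
 set (Yp := fun y => Pi y = y).
 (* As T' T = 1, Om - A equals (U' - U T') (T - 1), of size at most (a + a^2) eps on the range of
    Pi; this explains the value of [eps]. *)
 have NX : forall y, Yp y -> N (Om y -v A y) <= eta * N y.
 { intros y Hy. have E1 : (T -v bid Z) y = ((T -v bid Z) ** Pi) y by (rewrite bmA, Hy; auto). have D := HB2 y. rewrite <- E1 in D. set (z := (T -v bid Z) y) in *.
  have E2 : Om y -v A y = U' z -v U (T' z).
  { rewrite EOm. unfold A, z. bpush. have F1 : T' (T y) = y by (rewrite <- bmA, HTT; auto). rewrite F1. vring. }
  rewrite E2. eapply Rle_trans. apply snm_sub; auto. have D1 := NU' z. have D2 := NU (T' z). have D3 := NT' z. assert (a * N (T' z) <= a * (a * N z)) by (apply mul_le_l; lra).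
  assert ((a * a + a) * N z <= (a * a + a) * (eps * N y)) by (apply mul_le_l; lra). replace ((a * a + a) * (eps * N y)) with (eta * N y) in H0 by (unfold eps; field; lra). lra. }
 have cOP : comm Pi Om by (rewrite EOm; cm). have cOF : comm F Om by (rewrite EOm; cm). have cAP : comm Pi A by (unfold A; cm). have cAF : comm F A by (unfold A; cm).
 set (Q := qp (Om ^^ m) (map (fun k => cpow k m) ks)). have cQP : comm Pi Q by (apply qp_comm, comm_pow; auto). have cQF : comm F Q by (apply qp_comm, comm_pow; auto).
 have Hk0 : forall k, In k ks -> k <> 0%C. { intros k Hk E. specialize (Hks k Hk). rewrite E, Cmod_0 in Hks. lra. }
 have Hfix : forall (B D : bop Z Z) y, comm B D -> B y = y -> B (D y) = D y. { intros B D y Hcm Hy. rewrite (comm_app y Hcm), Hy. auto. }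
 have Hfix0 : forall (B D : bop Z Z) y, comm B D -> B y = 0v -> B (D y) = 0v. { intros B D y Hcm Hy. rewrite (comm_app y Hcm), Hy. apply b0. }
 have HPP : Pi (Pi x) = Pi x by (rewrite <- bmA, HPi; auto). have HFF : forall y, F (F y) = F y by (intros; rewrite <- bmA, HF; auto).
 have SP : vsubspace Yp. { unfold Yp. split; [|split]. apply b0. intros y z Hy Hz. rewrite bD, Hy, Hz; auto. intros c y Hy. rewrite bZ, Hy; auto. }
 split.
 - set (Y := fun y => Yp y /\ F y = y).
  have SYf : vsubspace Y. { unfold Y. split; [|split]. split. apply SP. apply b0. intros y z [Hy1 Hy2] [Hz1 Hz2]. split. now apply SP. rewrite bD, Hy2, Hz2; auto. intros c y [Hy1 Hy2]. split. now apply SP. rewrite bZ, Hy2; auto. }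
  have YOm : forall y, Y y -> Y (Om y) by (intros y [H1 H2]; split; [apply Hfix; auto|apply Hfix; auto]).
  have YA : forall y, Y y -> Y (A y) by (intros y [H1 H2]; split; [apply Hfix; auto|apply Hfix; auto]).
  have NOm : forall y, Y y -> N (Om y) <= b * N y.
  { intros y [Hy _]. replace (Om y) with ((Om y -v A y) +v A y) by vring. le_by Hsn. specialize (NX y Hy). specialize (NA y). specialize (Hpos y). assert (eta * N y <= om * N y) by (apply mul_le_r; lra). unfold b. lra. }
  have NAb : forall y, Y y -> N (A y) <= b * N y. { intros y _. specialize (NA y). specialize (Hpos y). unfold b. assert (0 <= om * N y) by (apply mul_ge0; lra). lra. }
  have Hpn := @pow_near Z N M Y HN SYf Om A b eta m Hb (Rlt_le _ _ Heta) YOm YA NOm NAb (fun y Hy => NX y (proj1 Hy)).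
  apply (nw_small HN SYf).
  + intros y [H1 H2]. split; apply Hfix; auto.
  + intros y Hy. replace (Q y) with (Q y -v qp (A ^^ m) (map (fun k => cpow k m) ks) y).
  eapply Rle_trans. apply (@qp_far Z N M Y HN SYf (Om ^^ m) (A ^^ m) (map (fun k => cpow k m) ks) (b ^ m) (INR m * b ^ m * eta) (om ^ m)); auto; try lra.
  * apply mul_ge0; try lra. apply mul_ge0; try lra. apply pos_INR.
  * intros z Hz; apply Hpn; auto. * intros z Hz; apply Hpn; auto. * intros z Hz; apply Hpn; auto. * intros z Hz; apply Hpn; auto. * intros z Hz; apply Hpn; auto.
  * intros k Hk. apply in_map_iff in Hk. destruct Hk as [k' [<- Hk']]. rewrite cpow_mod. apply pow_incr. split. lra. auto.
  * rewrite length_map. fold n. apply mul_le_r; auto. le_to He3. right. unfold C1. field. lra.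
  * destruct (qp_ppoly A m Hk0) as [D ED]. rewrite ED, bmA. destruct Hy as [_ Hy]. rewrite <- Hy at 2. rewrite <- (bmA (ppoly A ks) F), Hpp, b0A, b0. vring.
  + split. unfold Yp. rewrite (comm_app _ d15), HPP. auto. apply HFF.
 - set (Y := fun y => Yp y /\ F y = 0v).
  have SYn : vsubspace Y. { unfold Y. split; [|split]. split. apply SP. apply b0. intros y z [Hy1 Hy2] [Hz1 Hz2]. split. now apply SP. rewrite bD, Hy2, Hz2; apply vadd0r. intros c y [Hy1 Hy2]. split. now apply SP. rewrite bZ, Hy2; apply vs0r. }
  have YOm : forall y, Y y -> Y (Om y) by (intros y [H1 H2]; split; [apply Hfix; auto|apply Hfix0; auto]).
  have NOm : forall y, Y y -> N (Om y) <= om2 * N y.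
  { intros y [Hy HFy]. replace (Om y) with ((Om y -v A y) +v A y) by vring. le_by Hsn. specialize (NX y Hy). specialize (NB1 y). rewrite bmA, baA, boA, b1A, HFy in NB1. replace (y -v 0v) with y in NB1 by vring. specialize (Hpos y).
  assert (eta * N y <= (om - om') / 2 * N y) by (apply mul_le_r; lra). unfold om2. lra. }
  have NOmm : forall j y, Y y -> Y ((Om ^^ j) y) /\ N ((Om ^^ j) y) <= om2 ^ j * N y.
  { induction j; intros y Hy; sim. rewrite b1A. split; auto. lra. rewrite bmA. destruct (IHj y Hy) as [I1 I2]. split; auto. specialize (NOm _ I1). assert (om2 * N ((Om ^^ j) y) <= om2 * (om2 ^ j * N y)) by (apply mul_le_l; lra). lra. }
  apply (nw_small HN SYn).
  + intros y [H1 H2]. have E : (bid Z -v Q) y = y -v Q y by (bpush; auto). rewrite E. split. apply vsub_minus; auto. apply Hfix; auto. rewrite bD, bN, (Hfix0 F Q y), H2; auto. apply vaddN.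
  + intros y Hy. have E : (bid Z -v Q) y = y -v Q y by (bpush; auto). rewrite E. eapply Rle_trans. apply (@qp_near Z N M Y HN SYn (Om ^^ m) (map (fun k => cpow k m) ks) tau); auto. lra.
  * intros z Hz. apply NOmm; auto.
  * intros k z Hk Hz. apply in_map_iff in Hk. destruct Hk as [k' [<- Hk']]. specialize (Hks k' Hk'). destruct (NOmm m z Hz) as [_ D]. le_by (nscal_le HN _ D).
  have Hkp : om ^ m <= Cmod k' ^ m by (apply pow_incr; split; lra). have k0 : cpow k' m <> 0%C. { intros E0. rewrite <- cpow_mod, E0, Cmod_0 in Hkp. lra. }
  rewrite Cmod_inv, cpow_mod by auto. unfold tau, Rdiv. rewrite Rpow_mult_distr, pow_inv, <- Rmult_assoc. apply mul_le_r; auto. rewrite Rmult_comm. apply mul_le_l. apply pow_le; lra. apply Rinv_le_contravar; auto.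
  * rewrite length_map. apply mul_le_r; auto. apply pow_near1; [lra | fold n; lra].
  + split. unfold Yp. rewrite bD, bN, (comm_app _ d15), HPP. auto. rewrite bD, bN, HFF. apply vaddN.
Qed.

(** * Left and right multiplication operators *)

Section LR.
Variable V : CBanach.
Definition Lm (A : bop V V) : bop (BL V) (BL V).
Proof.
 refine (@Bop (BL V) (BL V) (fun y => A ** y) _). split; [|split]; intros. bring. bring.
 exists (nm A). intros y. apply nm_comp.
Defined.
Definition Rm (A : bop V V) : bop (BL V) (BL V).
Proof.
 refine (@Bop (BL V) (BL V) (fun y => y ** A) _). split; [|split]; intros. bring. bring.
 exists (nm A). intros y. rewrite Rmult_comm. apply nm_comp.
Defined.
Lemma LmE A y : Lm A y = A ** y. Proof. triv. Qed.
Lemma RmE A y : Rm A y = y ** A. Proof. triv. Qed.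
Opaque Lm Rm.
Ltac lr := apply bop_ext; intros ?y; rewrite ?bmA, ?LmE, ?RmE.
Lemma LR_comm A B : comm (Lm A) (Rm B). Proof. lr. bring. Qed.
Lemma LL_comm A B : comm A B -> comm (Lm A) (Lm B). Proof. intros H. lr. now rewrite !bcA, H. Qed.
Lemma RR_comm A B : comm A B -> comm (Rm A) (Rm B). Proof. intros H. lr. now rewrite <- !bcA, H. Qed.
Lemma Lm_nm A : nm (Lm A) <= nm A. Proof. apply nm_le. apply nm_ge0. intros y. rewrite LmE. apply nm_comp. Qed.
Lemma Rm_nm A : nm (Rm A) <= nm A. Proof. apply nm_le. apply nm_ge0. intros y. rewrite RmE, Rmult_comm. apply nm_comp. Qed.
Lemma Lm_comp A B : Lm (A ** B) = Lm A ** Lm B. Proof. lr. bring. Qed.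
Lemma Rm_comp A B : Rm (A ** B) = Rm B ** Rm A. Proof. lr. bring. Qed.
Lemma Lm_lin (c : C) A B : Lm (A +v c *v B) = Lm A +v c *v Lm B. Proof. lr. bring. Qed.
Lemma Rm_lin (c : C) A B : Rm (A +v c *v B) = Rm A +v c *v Rm B. Proof. lr. bring. Qed.
Lemma Lm_id : Lm (bid V) = bid (BL V). Proof. lr. bring. Qed.
Lemma Rm_id : Rm (bid V) = bid (BL V). Proof. lr. bring. Qed.
Lemma Lm_pow A n : Lm A ^^ n = Lm (A ^^ n). Proof. induction n; sim. now rewrite Lm_id. now rewrite IHn, Lm_comp. Qed.
Lemma Rm_pow A n : Rm A ^^ n = Rm (A ^^ n). Proof. induction n. now sim; rewrite Rm_id. rewrite (bpow_S A). sim. now rewrite IHn, Rm_comp. Qed.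
Lemma Lm_rb A r : rb A r -> rb (Lm A) r.
Proof. intros H t Ht. destruct (H t Ht) as [M [HM HMn]]. exists M. split; auto. intros n. rewrite Lm_pow. le_by Lm_nm. auto. Qed.
Lemma Rm_rb A r : rb A r -> rb (Rm A) r.
Proof. intros H t Ht. destruct (H t Ht) as [M [HM HMn]]. exists M. split; auto. intros n. rewrite Rm_pow. le_by Rm_nm. auto. Qed.
Lemma Lm_ppoly A ks : ppoly (Lm A) ks = Lm (ppoly A ks).
Proof. induction ks as [|k ks IH]; cbn [ppoly]. now rewrite Lm_id. rewrite IH, Lm_comp. f_equal. rewrite <- Lm_id. bstep (Lm A +v (- k)%C *v Lm (bid V)). rewrite <- Lm_lin. f_equal. bring. Qed.
Lemma Rm_ppoly A ks : ppoly (Rm A) ks = Rm (ppoly A ks).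
Proof.
 induction ks as [|k ks IH]; cbn [ppoly]. now rewrite Rm_id. rewrite IH.
 have E : Rm A -v k *v bid (BL V) = Rm (A -v k *v bid V). { rewrite <- Rm_id. bstep (Rm A +v (- k)%C *v Rm (bid V)). rewrite <- Rm_lin. f_equal. bring. }
 rewrite E, <- Rm_comp. f_equal. apply ppoly_comm. bring.
Qed.
Lemma LmRm_cpt k1 k2 : cpt k1 -> cpt k2 -> cpt (Lm k1 ** Rm k2).
Proof.
 intros H1 H2 u Hu. replace (fun n => (Lm k1 ** Rm k2) (u n)) with (fun n => k1 ** (u n : bop V V) ** k2 : BL V). now apply cpt_sandwich with 1.
 fext n. bring.
Qed.
(** The eigenvalue 1 of conjugation, carried by the corner to be kept, is separated from the others,
    which a polynomial can cancel. *)
Lemma ppoly_split (T : bop V V) ks : exists (ks1 : list C) M, (forall k, In k ks1 -> k <> 1%C) /\ ppoly T ks = (T -v bid V) ^^ M ** ppoly T ks1.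
Proof.
 induction ks as [|k ks [ks1 [M [H E]]]]. exists nil, O. split. intros k []. now rewrite bc1l.
 destruct (Ceq_dec k 1) as [->|Hk].
 - exists ks1, (S M). split; auto. cbn [ppoly]. rewrite E. sim. have c : comm (T -v bid V) ((T -v bid V) ^^ M ** ppoly T ks1).
  { apply comm_comp. apply comm_pow, comm_refl. apply ppoly_comm, comm_sym, comm_add. apply comm_refl. apply comm_opp, comm_id. }
  rewrite <- (bcA (T -v bid V)). rewrite c. f_equal. bring.
 - exists (k :: ks1), M. split. intros k' [<-|Hk']; auto. cbn [ppoly]. rewrite E. now rewrite bcA.
Qed.
End LR.
Ltac lr := apply bop_ext; intros ?y; rewrite ?bmA, ?LmE, ?RmE.
Lemma idem_small V (J : bop V V) a : J ** J = J -> rb J a -> a < 1 -> J = 0v.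
Proof.
 intros HJ Hr Ha. apply (@nm_small0 (BL V)). intros eps He. destruct (rb_lt1_small Hr Ha He) as [N HN]. specialize (HN (S N) ltac:(lia)). rewrite bpow_idem in HN; auto. lra.
Qed.
Lemma comm_m1 V (A X : bop V V) : comm A X -> comm (A -v bid V) X.
Proof. intros H. apply comm_sym, comm_add. now apply comm_sym. bring. Qed.
Lemma comm_idsub V (A X : bop V V) : comm X A -> comm X (bid V -v A).
Proof. intros H. apply comm_add. bring. now apply comm_opp. Qed.

(** * Corners of a conjugation-invariant space of quasinilpotent operators *)

Section S3.
Variable V : CBanach.
Variable M : bop V V -> Prop.
Hypothesis SM : @vsubspace (BL V) M.
Hypothesis CM : @vclosed (BL V) M.
Hypothesis QM : forall y, M y -> rb y 0.
Variables (g gi p : bop V V) (mu : C).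
Hypothesis Hinv : inv_of g gi.
Hypothesis Hg : cpt (g -v bid V).
Hypothesis HMg : forall y, M y -> M (g ** y ** gi) /\ M (gi ** y ** g).
Hypothesis Hp : p ** p = p.
Hypothesis Hp0 : p <> 0v.
Hypothesis Hcp : comm g p.
Hypothesis Hmu : g ** p = mu *v p.
Hypothesis Hmu0 : mu <> 0%C.
Hypothesis Hmu1 : mu <> 1%C.
Variable B : bop V V.
Hypothesis HB : (g -v mu *v bid V) ** B = bid V -v p.
Hypothesis HBc : comm g B.
Hypothesis Hrk : forall y, exists c : C, p ** y ** p = c *v p.
Notation ID := (bid V).
(** Conjugation Th by g has eigenvalue 1 on the corner p x p. Polynomials in Th and its inverse, and
    their limits, keep M. They are used to cancel, from the row p x, everything except this corner,
    by filtering Om = Th + Th^(-1) - 2 around 0. *)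
Lemma row_free x : M x -> exists x', M x' /\ exists c : C, c <> 0%C /\ p ** x' = c *v (p ** x ** p).
Proof.
 intros Mx. destruct Hinv as [Hi1 Hi2]. set (K := g -v ID) in *. set (W := g +v gi -v 2 *v ID).
 have cggi : comm g gi by (unfold comm; now rewrite Hi1, Hi2). have cgip : comm gi p by (apply comm_sym, (inv_comm Hinv), comm_sym; auto).
 have Hgip : gi ** p = (/ mu)%C *v p.
 { transitivity ((/ mu)%C *v (gi ** (mu *v p))). transitivity ((/ mu * mu)%C *v (gi ** p)). rewrite Cinv_l, vs1; auto. bring. rewrite <- Hmu, bcA, Hi2, bc1l. auto. }
 have HWc : cpt W. { replace W with (K -v gi ** K). apply cpt_minus; auto. now apply cpt_compl. unfold W, K. bstep (g -v ID -v gi ** g +v gi). rewrite Hi2. bring. }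
 (* The eigenvalue of W = g + g^(-1) - 2 on [p]. It equals (mu-1)^2/mu, which is nonzero exactly
    because mu is not 1; the projection F catches it, whence F p = p. *)
 set (w := (mu + / mu - 2)%C). have Hw : w <> 0%C.
 { have E : w = ((mu - 1) * (mu - 1) * / mu)%C by (unfold w; field; auto). rewrite E. repeat apply Cmult_neq_0. now apply Cminus_eq_contra. now apply Cminus_eq_contra. intros E'. apply C1_nz. rewrite <- (Cinv_r mu), E' by auto. ring. }
 have HWp : W ** p = w *v p. { unfold W. bstep (g ** p +v gi ** p -v 2 *v p). rewrite Hmu, Hgip. unfold w. bring. }
 set (om := Cmod w). have Hom : 0 < om by now apply Cmod_gt_0.
 destruct (RD HWc Hom) as [ks [F [r [Hks [HF [HFc [HFp [Hr [Hrb _]]]]]]]]].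
 have cgW : comm g W by (unfold W; cm). have cgiW : comm gi W by (unfold W; cm). have cpW : comm p W by (unfold W; cm; apply comm_sym; auto).
 have cgF := HFc _ cgW. have cgiF := HFc _ cgiW. have cpF := HFc _ cpW.
 have HFpp : F ** p = p. { bext z. rewrite bmA. apply (RD_eigen Hrb (HFc W (comm_refl W)) HF (k := w)). fold om; lra. rewrite <- bmA, HWp. bring. }
 set (a := nm g + nm gi + 1). have Hg0 := nm_ge0 g. have Hgi0 := nm_ge0 gi.
 destruct (@BLK ks om ((r + om) / 2) a) as [m [eps [Hm [Heps Hblk]]]]. lra. unfold a; lra. intros k Hk. apply Hks; auto.
 assert (Hmu1' : 0 < Cmod (mu - 1)%C) by (apply Cmod_gt_0; now apply Cminus_eq_contra).
 destruct (@RD V K (Rmin eps (Cmod (mu - 1)%C)) Hg) as [_ [P [r2 [_ [HP [HPc [_ [Hr2 [Hrb2 HPk]]]]]]]]]. apply Rmin_glb_lt; auto.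
 have Hr2a : r2 < eps by (eapply Rlt_le_trans; [apply Hr2|apply Rmin_l]). have Hr2b : r2 < Cmod (mu - 1)%C by (eapply Rlt_le_trans; [apply Hr2|apply Rmin_r]).
 have cgP : comm g P by (apply HPc; unfold K; cm). have cgiP : comm gi P by (apply HPc; unfold K; cm). have cFP : comm F P by (apply HPc; unfold K; apply comm_add; [apply comm_sym; auto|cm]). have cpP : comm p P by (apply HPc; unfold K; apply comm_add; [apply comm_sym; auto|cm]).
 have HPp : P ** p = p. { bext z. rewrite bmA. apply (RD_eigen Hrb2 (HPc K (comm_refl K)) HP (k := (mu - 1)%C)). lra. rewrite <- bmA. unfold K. bstep ((g ** p -v p) z). rewrite Hmu. bring. }
 set (Th := Lm g ** Rm gi). set (Thi := Lm gi ** Rm g). set (Om := Th +v Thi -v 2 *v bid (BL V)).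
 have ThE : forall y, Th y = g ** y ** gi by (intros; unfold Th; now rewrite bmA, LmE, RmE, bcA). have ThiE : forall y, Thi y = gi ** y ** g by (intros; unfold Thi; now rewrite bmA, LmE, RmE, bcA).
 have TT : Th ** Thi = bid (BL V). { bext y. rewrite bmA, ThE, ThiE, b1A. rewrite !bcA, Hi1, bc1l, <- bcA, Hi1, bc1r. auto. }
 have TT2 : Thi ** Th = bid (BL V). { bext y. rewrite bmA, ThE, ThiE, b1A. rewrite !bcA, Hi2, bc1l, <- bcA, Hi2, bc1r. auto. }
 have cTT : comm Th Thi by (unfold comm; now rewrite TT, TT2).
 set (PP := Lm P ** Rm P). have PPE : forall y, PP y = P ** y ** P by (intros; unfold PP; now rewrite bmA, LmE, RmE, bcA).
 have HPP : PP ** PP = PP. { bext y. rewrite bmA, !PPE. rewrite !bcA, HP, <- bcA, HP. auto. }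
 have cTP : comm Th PP. { unfold comm. bext y. rewrite !bmA, ThE, PPE, PPE, ThE, !bcA, cgP, <- !bcA. do 3 f_equal. symmetry. apply cgiP. }
 have cTiP : comm Thi PP. { unfold comm. bext y. rewrite !bmA, ThiE, PPE, PPE, ThiE, !bcA, cgiP, <- !bcA. do 3 f_equal. symmetry. apply cgP. }
 (* On the corner P B(V) P, conjugation is compact with bounded inverse. The part of the corner
    outside its Riesz projection is the range of an idempotent of spectral radius below 1, hence 0,
    so a polynomial annihilates conjugation there. *)
 have Hann : exists ks0, forall y, ppoly Th ks0 (PP y) = 0v.
 { set (C0 := Th ** PP). set (C1 := Thi ** PP). have HC0 : cpt C0.
  { replace C0 with (Lm (g ** P) ** Rm (P ** gi)). apply LmRm_cpt. apply cpt_compl, HPk. apply cpt_compr, HPk. unfold C0. bext y. rewrite !bmA, ThE, PPE, LmE, RmE, !bcA. auto. }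
  have cCP0 : comm C0 PP by (apply comm_sym, comm_comp; [exact (comm_sym cTP)|apply comm_refl]).
  have cC : comm C0 C1 by (apply comm_comp; [apply comm_sym, comm_comp; [exact (comm_sym cTT)|exact cTiP]|exact cCP0]). have HCC : C0 ** C1 = PP. { unfold C0, C1. bstep (Th ** (PP ** Thi) ** PP). rewrite <- cTiP. bstep (Th ** Thi ** (PP ** PP)). now rewrite TT, HPP, bc1l. }
  have cCP := comm_sym cCP0. have Hc1 := nm_ge0 C1.
  destruct (@RD (BL V) C0 (/ (nm C1 + 1)) HC0) as [ks0 [Pi0 [r0 [_ [HPi [HPic [HPip [Hr0 [Hrb0 _]]]]]]]]]. apply inv_gt0; lra.
  set (J := PP ** (bid (BL V) -v Pi0)). have cPi := HPic _ cCP.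
  have HJ : J ** J = J. { unfold J. bstep (PP ** ((bid (BL V) -v Pi0) ** PP) ** (bid (BL V) -v Pi0)). have c := comm_sym (comm_idsub cPi). rewrite c, bcA, HPP, <- bcA, idem_compl; auto. }
  have EJ : J = C0 ** (bid (BL V) -v Pi0) ** C1. { have c := comm_idsub (HPic _ (comm_sym cC)). rewrite <- bcA, <- c, bcA, HCC. auto. }
  have J0 : J = 0v. { apply (@idem_small (BL V) J (r0 * nm C1)); auto. rewrite EJ. apply rb_comp; auto; try lra. 2: apply rb_nm. exact (comm_sym (comm_comp (comm_sym cC) (comm_idsub (HPic _ (comm_sym cC))))).
  apply Rle_lt_trans with (/ (nm C1 + 1) * nm C1). apply mul_le_r; lra. apply Rmult_lt_reg_l with (nm C1 + 1). lra. rewrite <- Rmult_assoc, Rinv_r; lra. }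
  exists ks0. have Hres : forall l y, ppoly C0 l (PP y) = ppoly Th l (PP y).
  { induction l as [|k l IH]; intros y; auto. rewrite !ppoly_S. have E : C0 (PP y) = Th (PP y) by (unfold C0; rewrite <- !bmA, <- bcA, HPP; auto). rewrite E. replace (Th (PP y) -v k *v PP y) with (PP (Th y -v k *v y)). auto. rewrite bD, bN, bZ, (comm_app y (comm_sym cTP)). auto. }
  intros y. rewrite <- Hres. have E : PP y = Pi0 (PP y). { apply vsub_eq0. transitivity (J y). unfold J. rewrite bmA, baA, boA, b1A, !bD, bN, (comm_app y cPi). auto. now rewrite J0, b0A. }
  rewrite E, <- bmA, HPip. apply b0A. }
 (* The eigenvalues other than 1 are cancelled beforehand by a polynomial in Th, which replaces x by
    [x1]. *)
 destruct Hann as [ks0 Hann]. destruct (ppoly_split Th ks0) as [ks1 [M0 [Hks1 Esp]]]. set (x1 := ppoly Th ks1 x).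
 have MTh : forall y, M y -> M (Th y) by (intros; rewrite ThE; now apply HMg). have MThi : forall y, M y -> M (Thi y) by (intros; rewrite ThiE; now apply HMg).
 have Mx1 : M x1. { unfold x1. clear Hks1 Esp. revert x Mx x1. induction ks1 as [|k l IH]; intros x Mx x1; unfold x1. cbn [ppoly]. now rewrite b1A. rewrite ppoly_S. apply IH. apply vsub_minus; auto. now apply SM; auto. }
 set (y := PP x1 : BL V). have Hy : ((Th -v bid (BL V)) ^^ S M0) y = 0v.
 { sim. rewrite bmA. unfold y, x1. rewrite (comm_app x (ppoly_comm ks1 (comm_sym cTP))). rewrite <- (bmA ((Th -v bid (BL V)) ^^ M0)), <- Esp, Hann. apply b0. }
 set (Q := qp (Om ^^ m) (map (fun k => cpow k m) ks)). set (IZ := bid (BL V)).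
 have cThOm : comm Th Om by (apply comm_add; [apply comm_add; [apply comm_refl|exact cTT]|apply comm_opp, comm_scal, comm_id]).
 (* On the corner Th - 1 is nilpotent on y and divides 1 - Q, so the iterates of 1 - Q vanish on y
    from some index on. *)
 have Hcv0 : cv (fun l => nw l (IZ -v Q) y) 0v.
 { destruct (qp_div (Om ^^ m) (map (fun k => cpow k m) ks)) as [Z1 [HZ1 EZ1]]. fold Q IZ in EZ1.
  have EOm : Om = (Th -v IZ) ** (IZ -v Thi). { symmetry. unfold IZ. bstep (Th -v Th ** Thi -v bid (BL V) +v Thi). rewrite TT. unfold Om. bring. }
  set (T1 := Th -v IZ) in *. change ((T1 ^^ S M0) y = 0v) in Hy. have cT : comm T1 (IZ -v Thi) by exact (comm_idsub (comm_m1 cTT)). have cT1 : comm T1 Z1 by exact (HZ1 _ (comm_pow m (comm_m1 cThOm))).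
  destruct m as [|m']; [lia|]. set (X := (IZ -v Thi) ** Om ^^ m' ** Z1). have cTX : comm T1 X. { unfold X. apply comm_comp; [apply comm_comp; [exact cT|exact (comm_pow m' (comm_m1 cThOm))]|exact cT1]. }
  have EQ : IZ -v Q = T1 ** X. { rewrite EZ1. sim. rewrite EOm at 1. unfold X. now rewrite !bcA. }
  intros e He. exists (S M0). intros l Hl. destruct (nw_factor l (IZ -v Q)) as [Y0 [_ EY]]. rewrite EY, bmA, EQ, bpow_comp by auto.
  have H2l : (S M0 <= 2 ^ l)%nat. { have D := Nat.pow_gt_lin_r 2 l. lia. }
  have cXT : comm (X ^^ (2 ^ l)) (T1 ^^ (2 ^ l)) by (apply comm_pow, comm_sym, comm_pow; auto). rewrite <- cXT, bmA.
  replace (2 ^ l)%nat with ((2 ^ l - S M0) + S M0)%nat at 2 by lia. rewrite bpow_add, bmA, Hy, !b0, vaddN, nm0. auto. }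
 have Hlim : forall z w0, cv (fun l => nw l (IZ -v Q) z) w0 -> cv (fun l => nw l Q z) (z -v w0).
 { intros z w0 H. apply (@cv_ext (BL V) (fun l => z -v nw l (IZ -v Q) z)). intros l. rewrite nw_compl. unfold IZ. bpush. vring.
  apply (@cv_plus (BL V) (fun _ => z) (fun l => -v nw l (IZ -v Q) z)). apply cv_const. now apply (@cv_opp (BL V)). }
 set (yr := Rm (ID -v P) x1 : BL V).
 have EW : Lm g +v Lm gi -v 2 *v bid (BL V) = Lm W. { unfold W. rewrite <- Lm_id. bstep (Lm g +v 1%C *v Lm gi +v (- RtoC 2)%C *v Lm ID). rewrite <- !Lm_lin. f_equal. bring. }
 have EWr : Rm g +v Rm gi -v 2 *v bid (BL V) = Rm W. { unfold W. rewrite <- Rm_id. bstep (Rm g +v 1%C *v Rm gi +v (- RtoC 2)%C *v Rm ID). rewrite <- !Rm_lin. f_equal. bring. }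
 have L1 : forall A, bid (BL V) -v Lm A = Lm (ID -v A). { intros A. rewrite <- Lm_id. bstep (Lm ID +v (-1)%C *v Lm A). rewrite <- Lm_lin. f_equal. bring. }
 have R1 : forall A, bid (BL V) -v Rm A = Rm (ID -v A). { intros A. rewrite <- Rm_id. bstep (Rm ID +v (-1)%C *v Rm A). rewrite <- Rm_lin. f_equal. bring. }
 assert (cgiP' := comm_idsub cgiP). assert (cgP' := comm_idsub cgP). assert (cFP' := comm_idsub cFP).
 have Eg1 : Lm g -v bid (BL V) = Lm K. { unfold K. rewrite <- Lm_id. bstep (Lm g +v (-1)%C *v Lm ID). rewrite <- Lm_lin. f_equal. bring. }
 have Eg2 : Rm g -v bid (BL V) = Rm K. { unfold K. rewrite <- Rm_id. bstep (Rm g +v (-1)%C *v Rm ID). rewrite <- Rm_lin. f_equal. bring. }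
 have cKP : (ID -v P) ** K = K ** (ID -v P) by exact (comm_sym (comm_idsub (comm_m1 cgP))).
 have HaL : nm (Lm g) <= a /\ nm (Lm gi) <= a /\ nm (Rm g) <= a /\ nm (Rm gi) <= a. { have D1 := Lm_nm g. have D2 := Lm_nm gi. have D3 := Rm_nm g. have D4 := Rm_nm gi. unfold a. lra. }
 destruct HaL as [HaL1 [HaL2 [HaR1 HaR2]]].
 have Hright := Hblk (BL V) (Lm g) (Lm gi) (Rm g) (Rm gi) (Lm F) (Rm (ID -v P)) Om r r2 HaL1 HaL2 HaR2.
 have Hleft := Hblk (BL V) (Rm g) (Rm gi) (Lm g) (Lm gi) (Rm F) (Lm (ID -v P)) Om r r2 HaR1 HaR2 HaL2. clear Hblk.
 have Hcc : forall A D, In A [g; gi; F; ID -v P] -> In D [g; gi; F; ID -v P] -> comm A D.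
 { intros A D HA HD. simpl in HA, HD. destruct HA as [<-|[<-|[<-|[<-|[]]]]]; destruct HD as [<-|[<-|[<-|[<-|[]]]]]; auto; try apply comm_refl; apply comm_sym; auto. }
 rewrite EW, L1, Eg2, <- (Lm_comp W (ID -v F)), <- (Rm_comp (ID -v P) K), cKP, Lm_ppoly, <- (Lm_comp (ppoly W ks) F), HFp in Hright.
 rewrite EWr, R1, Eg1, <- (Rm_comp (ID -v F) W), <- (Lm_comp K (ID -v P)), Rm_ppoly, <- (Rm_comp F (ppoly W ks)) in Hleft.
 have Hrc : forall x, cv (fun l => nw l Q (Lm F (Rm (ID -v P) x))) 0v /\ cv (fun l => nw l (IZ -v Q) (Rm (ID -v P) x -v Lm F (Rm (ID -v P) x))) 0v.
 { apply Hright; clear Hright Hleft; auto.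
  - rewrite <- Rm_comp, Hi1. apply Rm_id.
  - now rewrite <- Lm_comp, HF.
  - now rewrite <- Rm_comp, idem_compl.
  - intros A D HA HD. simpl in HA, HD. repeat (destruct HA as [<-|HA]); try destruct HA; repeat (destruct HD as [<-|HD]); try destruct HD; first [apply LR_comm | apply comm_sym, LR_comm | apply LL_comm, Hcc; simpl; auto 6 | apply RR_comm, Hcc; simpl; auto 6].
  - now apply Lm_rb.
  - lra.
  - apply Rm_rb; auto.
  - bext z. now rewrite LmE, b0A; bring. }
 have Hlc : forall x, cv (fun l => nw l Q (Rm F (Lm (ID -v P) x))) 0v /\ cv (fun l => nw l (IZ -v Q) (Lm (ID -v P) x -v Rm F (Lm (ID -v P) x))) 0v.
 { have cWF : W ** (ID -v F) = (ID -v F) ** W by exact (comm_idsub (HFc W (comm_refl W))).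
  have E0 : F ** ppoly W ks = 0v by (rewrite <- HFp; symmetry; apply (comm_sym (ppoly_comm ks (comm_sym (HFc W (comm_refl W)))))).
  apply Hleft; clear Hright Hleft; auto.
  - rewrite <- Lm_comp, Hi2. apply Lm_id.
  - unfold Om, Th, Thi. rewrite (LR_comm g gi), (LR_comm gi g). bring.
  - now rewrite <- Rm_comp, HF.
  - now rewrite <- Lm_comp, idem_compl.
  - intros A D HA HD. simpl in HA, HD. repeat (destruct HA as [<-|HA]); try destruct HA; repeat (destruct HD as [<-|HD]); try destruct HD; first [apply LR_comm | apply comm_sym, LR_comm | apply LL_comm, Hcc; simpl; auto 6 | apply RR_comm, Hcc; simpl; auto 6].
  - apply Rm_rb. now rewrite <- cWF.
  - lra.
  - apply Lm_rb; auto.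
  - rewrite E0. bext z. now rewrite RmE, b0A; bring. }
 (* x1 is split into its P-corner, the part x1 (1-P) and the part (1-P) x1 P. In the last two, one
    of the multiplications is nearly the identity and [BLK] computes the limit of the iterates: only
    the parts cut off by F on the other side vanish. *)
 set (yl := Lm (ID -v P) (Rm P x1) : BL V). set (x' := y +v (yr -v Lm F yr) +v (yl -v Rm F yl)).
 have Edec : x1 = y +v (Lm F yr +v (yr -v Lm F yr)) +v (Rm F yl +v (yl -v Rm F yl)).
 { transitivity (y +v yr +v yl : BL V). unfold y, yr, yl. rewrite PPE, LmE, !RmE. bring. vring. }
 have Hcvx : cv (fun l => nw l Q x1) x'.
 { apply (@cv_ext (BL V) (fun l => nw l Q y +v (nw l Q (Lm F yr) +v nw l Q (yr -v Lm F yr)) +v (nw l Q (Rm F yl) +v nw l Q (yl -v Rm F yl)))).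
  { intros l. rewrite Edec. rewrite !(bD (nw l Q)). auto. }
  replace x' with ((y -v 0v) +v (0v +v (yr -v Lm F yr -v 0v)) +v (0v +v (yl -v Rm F yl -v 0v)) : BL V) by (unfold x'; vring).
  exact (@cv_plus (BL V) _ _ _ _ (@cv_plus (BL V) _ _ _ _ (Hlim _ _ Hcv0) (@cv_plus (BL V) _ _ _ _ (proj1 (Hrc x1)) (Hlim _ _ (proj2 (Hrc x1)))))
  (@cv_plus (BL V) _ _ _ _ (proj1 (Hlc (Rm P x1))) (Hlim _ _ (proj2 (Hlc (Rm P x1)))))). }
 assert (Mx' : M x').
 { apply (CM (u := fun l => nw l Q x1)); auto. intros l. have MOm : forall z, M z -> M (Om z). { intros z Hz. unfold Om. rewrite !baA, boA, bsA, b1A. destruct SM as [_ [SM1 SM2]]. apply vsub_minus; [auto|apply SM1; auto|apply SM2; auto]. }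
  have MOmm : forall j z, M z -> M ((Om ^^ j) z) by (induction j; intros z Hz; sim; [now rewrite b1A|rewrite bmA; auto]).
  have MQ : forall l' z, M z -> M (qp (Om ^^ m) l' z).
  { destruct SM as [_ [SM1 SM2]]. induction l' as [|k l' IH]; intros z Hz. cbn [qp]. now rewrite b1A. rewrite qp_S. apply IH. apply vsub_minus; [exact SM|exact Hz|apply SM2; auto]. }
  apply nw_inv; [exact SM|intros; apply MQ; auto|exact Mx1]. }
 have pP1 : p ** (ID -v P) = 0v. { bstep (p -v p ** P). rewrite cpP, HPp. apply vaddN. }
 have pF : p ** F = p by (rewrite cpF; auto).
 have Epx : p ** x' = p ** y.
 { unfold x', yl. rewrite !LmE, !RmE. bstep (p ** y +v (p ** yr -v p ** F ** yr) +v (p ** (ID -v P) ** (x1 ** P) -v p ** (ID -v P) ** (x1 ** P) ** F)). rewrite pF, pP1. bring. }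
 have Hrow : forall u, p ** Th u = (p ** u) ** (mu *v gi). { intros u. rewrite ThE, !bcA, <- Hcp, Hmu. bring. }
 set (E1 := (g -v mu *v ID) ** gi). set (E2 := g ** B). have cE : comm E1 E2 by exact (comm_sym (comm_comp (comm_add (comm_sym (comm_comp (comm_refl g) HBc)) (comm_opp (comm_scal mu (comm_id _)))) (comm_sym (comm_comp (comm_sym cggi) (comm_sym (inv_comm Hinv (comm_sym HBc))))))).
 have HEE : E1 ** E2 = ID -v p. { unfold E1, E2. rewrite bcA, <- (bcA _ gi g), Hi2, bc1r. auto. }
 have HrowE : forall n u, p ** ((Th -v bid (BL V)) ^^ n) u = cpow (-1) n *v ((p ** u) ** E1 ^^ n).
 { induction n; intros u; sim. rewrite b1A, bc1r, vs1. auto. rewrite bmA. transitivity (p ** Th (((Th -v bid (BL V)) ^^ n) u) -v p ** ((Th -v bid (BL V)) ^^ n) u). bpush. bring.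
  rewrite Hrow, IHn. have EE : E1 = ID -v mu *v gi. { unfold E1. bstep (g ** gi -v mu *v gi). now rewrite Hi1. } change (E1 ** E1 ^^ n) with (E1 ^^ S n). rewrite (bpow_S E1 n), (bcA (p ** u)). set (X := p ** u ** E1 ^^ n). rewrite EE. bring. }
 (* On the row p y, Th - 1 acts up to sign as right multiplication by [E1] = 1 - mu g^(-1), which is
    invertible off p with inverse [E2]; nilpotency therefore leaves only p y p. *)
 have Ekill : p ** y ** (ID -v p) = 0v.
 { have H0 := HrowE (S M0) y. rewrite Hy in H0. have H1 : (p ** y) ** E1 ^^ S M0 = 0v.
  { transitivity (cpow (-1) (S M0) *v (cpow (-1) (S M0) *v ((p ** y) ** E1 ^^ S M0))). rewrite vsA, <- cpow_cmul. replace (-1 * -1)%C with (RtoC 1) by ring. now rewrite cpow_1, vs1. rewrite <- H0. bring. }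
  transitivity ((p ** y) ** E1 ^^ S M0 ** E2 ^^ S M0). rewrite <- (bcA _ (E1 ^^ S M0)), <- bpow_comp, HEE, bpow_idem by (auto; apply idem_compl; auto). auto. rewrite H1. bring. }
 have Ep : p ** x' = p ** x1 ** p. { rewrite Epx. bstep (p ** y ** p +v p ** y ** (ID -v p)). rewrite Ekill. unfold y. rewrite PPE, !bcA, cpP, HPp, <- !bcA, HPp. bring. }
 exists x'. split; auto.
 (* Conjugation fixes the corner, since g gives mu on the left and g^(-1) gives 1/mu on the right;
    each factor Th - k thus contributes 1 - k, which is not 0. *)
 have Hf1 : forall l : list C, (forall k, In k l -> k <> 1%C) -> forall u : BL V, exists c : C, c <> 0%C /\ p ** (ppoly Th l u) ** p = c *v (p ** u ** p).
 { induction l as [|k l IH]; intros Hl u. exists 1%C. cbn [ppoly]. rewrite b1A, vs1. split; auto. apply C1_nz.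
  destruct (IH (fun k' Hk' => Hl k' (or_intror Hk')) (Th u -v k *v u)) as [c [Hc0 Hc]]. exists (c * (1 - k))%C. split. apply Cmult_neq_0; auto. apply Cminus_eq_contra. intros Ek. apply (Hl k). now left. auto.
  rewrite ppoly_S, Hc. bstep (c *v ((p ** Th u) ** p -v k *v (p ** u ** p))). rewrite Hrow. bstep (c *v (mu *v ((p ** u) ** (gi ** p)) -v k *v (p ** u ** p))). rewrite Hgip.
  bstep (c *v ((mu * / mu)%C *v (p ** u ** p) -v k *v (p ** u ** p))). rewrite Cinv_r by auto. bring. }
 destruct (Hf1 ks1 Hks1 x) as [c [Hc0 Hc]]. exists c. split; auto. rewrite Ep. exact Hc.
Qed.
(** If p x p = chi p with chi not 0, a multiple u of the element of [row_free] satisfies p u = p,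
    hence p u^n = p for all n, which is impossible for a quasinilpotent u. *)
Theorem corner_zero x : M x -> p ** x ** p = 0v.
Proof.
 intros Mx. destruct (row_free Mx) as [x' [Mx' [c [Hc0 Hc]]]]. destruct (Hrk x) as [chi Hchi]. rewrite Hchi in Hc |- *.
 destruct (Ceq_dec (c * chi) 0) as [E|E].
 - have chi0 : chi = 0%C. { contra Hn. apply (Cmult_neq_0 c chi); auto. } rewrite chi0. vring.
 - exfalso. apply Hp0. set (z := (c * chi)%C) in *. have Hpz : p ** ((/ z)%C *v x') = p. { bstep ((/ z)%C *v (p ** x')). rewrite Hc. bstep ((/ z * (c * chi))%C *v p). rewrite Cinv_l, vs1; auto. }
  have Hn : forall n, p ** ((/ z)%C *v x') ^^ n = p. { induction n; sim. bring. now rewrite bcA, Hpz. }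
  have Hr := rb_scal (c := (/ z)%C) (Rle_refl 0) (QM Mx'). rewrite Rmult_0_r in Hr. apply (@nm_small0 (BL V)). intros eps He. have P0 := nm_ge0 p.
  destruct (rb_lt1_small (eps := eps / (nm p + 1)) Hr) as [N HN]. lra. triv. specialize (HN N (le_n _)). rewrite <- (Hn N).
  le_by nm_comp. le_mid ((nm p + 1) * (eps / (nm p + 1))). apply Rmult_le_compat; try apply nm_ge0; lra. right; field; lra.
Qed.
End S3.
(** The defect u^2 - u is squared at each step up to a bounded factor, so the iterates converge
    geometrically to an idempotent; as polynomials in u they keep its commutant. *)
Lemma newton_idem V (u : bop V V) d0 b : nm (u ** u -v u) <= d0 -> nm u + 1 <= b -> 2 * d0 * (1 + 2 * b) <= 1 -> d0 <= 1/8 ->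
 exists p, p ** p = p /\ (forall T, comm T u -> comm T p) /\ nm (p -v u) <= 2 * d0 * (1 + 2 * b).
Proof.
 intros Hd Hb H1 H8. have Hd0 : 0 <= d0 by (eapply Rle_trans; [apply nm_ge0|apply Hd]). have Hu := nm_ge0 u.
 set (D := fun l => nw l u ** nw l u -v nw l u : bop V V).
 have Estep : forall l, nw (S l) u -v nw l u = D l ** (bid V -v 2 *v nw l u) by (intros; unfold D; cbn [nw]; bring).
 have ED : forall l, D (S l) = D l ** D l ** (4 *v D l -v 3 *v bid V) by (intros; unfold D; cbn [nw]; bring).
 have Hl : forall l, nm (D l) <= d0 * (1/2)^l /\ nm (nw l u -v u) <= 2 * d0 * (1 + 2 * b) * (1 - (1/2)^l).
 { induction l as [|l [I1 I2]]. rewrite pow_O, vaddN, nm0. unfold D; cbn [nw]. split; lra.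
  have Hh : 0 < (1/2)^l <= 1. { split. triv. have Q := pow_incr (1/2) 1 l. rewrite pow1 in Q. nra. } cbn [pow]. have HD := nm_ge0 (D l).
  have Hq : nm (nw l u) <= b. { have Q := nm_rev (nw l u) u. nra. }
  split.
  - rewrite ED. have Q1 := nm_comp (D l ** D l) (4 *v D l -v 3 *v bid V). have Q2 := nm_comp (D l) (D l). have Q3 := nm_sub (4 *v D l) (3 *v bid V). rewrite !nm_RC in Q3 by lra. have Q4 := nm_id V.
  assert (nm (D l) <= 1/8) by nra. have Q5 : nm (D l) * nm (D l) <= 1/8 * nm (D l) by nra.
  have Q7 : nm (D l ** D l) * nm (4 *v D l -v 3 *v bid V) <= 1/8 * nm (D l) * 4 by (apply Rmult_le_compat; try apply nm_ge0; lra). lra.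
  - replace (nw (S l) u -v u) with ((nw (S l) u -v nw l u) +v (nw l u -v u) : BL V) by vring. le_by nm_tri. rewrite Estep. have Q1 := nm_comp (D l) (bid V -v 2 *v nw l u).
  have Q3 := nm_sub (bid V) (2 *v nw l u). rewrite nm_RC in Q3 by lra. have Q4 := nm_id V. nra. }
 have Hgeo : forall l, nm (nw (S l) u -v nw l u) <= d0 * (1 + 2 * b) * (1/2)^l.
 { intros l. rewrite Estep. destruct (Hl l) as [I1 I2]. have Q1 := nm_comp (D l) (bid V -v 2 *v nw l u). have Q3 := nm_sub (bid V) (2 *v nw l u). rewrite nm_RC in Q3 by lra. have Q4 := nm_id V.
  have Hh : 0 < (1/2)^l by triv. have Hq : nm (nw l u) <= b. { have Q := nm_rev (nw l u) u. assert (0 <= 2 * d0 * (1 + 2 * b)) by nra. nra. }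
  have Q7 : nm (D l) * nm (bid V -v 2 *v nw l u) <= d0 * (1/2)^l * (1 + 2 * b) by (apply Rmult_le_compat; try apply nm_ge0; lra). lra. }
 destruct (cv_cauchy (geo_cauchy Hgeo)) as [p Hp]. exists p. split; [|split].
 - apply (@vsub_eq0 (BL V)). apply (@cv_unique (BL V) D). { apply (@cv_plus (BL V) (fun l => nw l u ** nw l u) (fun l => -v nw l u)). now apply cv_comp. now apply (@cv_opp (BL V)). }
  apply cv_le with (fun l => d0 * (1/2)^l). intros l. replace (D l -v 0v) with (D l : BL V) by vring. exact (proj1 (Hl l)). intros eps He. apply pow_half_small; auto.
 - intros T HT. apply (@comm_lim _ T (fun l => nw l u)); auto. intros l. apply nw_comm; auto.
 - apply (@cv_nm_le (BL V) (fun l => nw l u -v u)). { apply (@cv_plus (BL V) (fun l => nw l u) (fun _ => -v u)); auto. apply cv_const. }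
  exists O. intros l _. destruct (Hl l) as [_ I2]. have Hh : 0 < (1/2)^l by triv. assert (0 <= 2 * d0 * (1 + 2 * b)) by nra. nra.
Qed.
Lemma line_cpt V (f : bop V V) w : (forall x, line w (f x)) -> cpt f.
Proof.
 intros Hf. destruct (classic (w = 0v)) as [->|Hw].
 - replace f with (0v : bop V V). apply cpt_zero. bext x. destruct (Hf x) as [c ->]. bring.
 - intros u Hu. apply cv_prec. intros p Hp. have Hwp := nm_pos Hw. destruct (fun_choice Hf) as [c Hc].
  destruct (@C_BW (fun n => c (u (p n))) (nm f / nm w)) as [q [d [Hq Hd]]]. { intros n. apply Rle_div_r; auto. rewrite <- nm_scal, <- Hc. now apply nm_app1. }
  exists q, (d *v w). split; auto. intros eps He. destruct (Hd (eps / nm w)) as [N HN]. triv. exists N. intros n Hn. specialize (HN n Hn).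
  rewrite Hc. replace (c (u (p (q n))) *v w -v d *v w) with ((c (u (p (q n))) - d)%C *v w) by vring. rewrite nm_scal. apply Rlt_div_r in HN; auto.
Qed.
(** Apply [RL] after rescaling by 1/r, for each r > 0. *)
Lemma nil_lim V (u : nat -> bop V V) U : cpt U -> cv u U -> (forall i, rb (u i) 0) -> rb U 0.
Proof.
 intros HU Hu H r Hr. have Hi := inv_gt0 _ Hr. destruct (@RL V (fun i => RtoC (/ r) *v u i) (RtoC (/ r) *v U)) as [s [Hs Hrb]].
 - now apply cpt_scal. - now apply (@cv_scal (BL V)). - intros i. apply rb_le with 0. lra. replace 0 with (Cmod (RtoC (/ r)) * 0) by ring. apply rb_scal; auto. lra.
 - destruct (Hrb 1) as [M [HM HMn]]. lra. exists M. split; auto. intros n. specialize (HMn n). rewrite bpow_scal, nm_scal, cpow_mod, Cmod_R, Rabs_pos_eq, pow1, pow_inv, Rmult_1_r in HMn by lra.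
  have Hp : 0 < r ^ n by triv. apply Rmult_le_reg_l with (/ r ^ n). triv. replace (/ r ^ n * (M * r ^ n)) with M by (field; lra). auto.
Qed.
Lemma bexp_Lm V (t : bop V V) : bexp (Lm t) = Lm (bexp t).
Proof.
 apply (@cv_unique (BL (BL V)) (fun k => ea k (Lm t))). apply bexpP. apply (@cv_ext (BL (BL V)) (fun k => Lm (ea k t))).
 intros k. unfold ea. rewrite <- Lm_pow, Lm_lin, Lm_id. auto.
 intros eps He. destruct (@bexpP V t eps He) as [N HN]. exists N. intros n Hn. eapply Rle_lt_trans. 2: apply (HN n Hn).
 replace (Lm (ea n t) -v Lm (bexp t)) with (Lm (ea n t -v bexp t)). apply Lm_nm. transitivity (Lm (ea n t +v (-1)%C *v bexp t)). f_equal. bring. rewrite Lm_lin. bring.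
Qed.
Lemma bexp_Rm V (t : bop V V) : bexp (Rm t) = Rm (bexp t).
Proof.
 apply (@cv_unique (BL (BL V)) (fun k => ea k (Rm t))). apply bexpP. apply (@cv_ext (BL (BL V)) (fun k => Rm (ea k t))).
 intros k. unfold ea. rewrite <- Rm_pow, Rm_lin, Rm_id. auto.
 intros eps He. destruct (@bexpP V t eps He) as [N HN]. exists N. intros n Hn. eapply Rle_lt_trans. 2: apply (HN n Hn).
 replace (Rm (ea n t) -v Rm (bexp t)) with (Rm (ea n t -v bexp t)). apply Rm_nm. transitivity (Rm (ea n t +v (-1)%C *v bexp t)). f_equal. bring. rewrite Rm_lin. bring.
Qed.

(** * Irreducible Lie algebras of compact operators have no nonzero quasinilpotent ideals *)

Section ThmV.
Variable V : CBanach.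
Variables LL JJ : bop V V -> Prop.
Hypothesis HLc : forall t, LL t -> cpt t.
Hypothesis HLs : forall (c : C) t, LL t -> LL (c *v t).
Hypothesis irr : irreducible LL.
Hypothesis SJ : @vsubspace (BL V) JJ.
Hypothesis HJL : forall x, JJ x -> LL x.
Hypothesis HJq : forall x, JJ x -> rb x 0.
Hypothesis HJi : forall t x, LL t -> JJ x -> JJ (t ** x -v x ** t).
Notation G := (G LL). Notation SS := (SS LL).
Definition JC := @vclosure (BL V) JJ.
Lemma JC_sub : @vsubspace (BL V) JC. Proof. now apply vclosure_sub. Qed.
Lemma JC_q x : JC x -> rb x 0.
Proof.
 intros H. destruct (vclosure_cv H) as [u [Hu Hc]]. apply (nil_lim (u := u)); auto. apply (cpt_lim (u := u)); auto.
Qed.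
(** Conjugation by exp t is the exponential of y -> t y - y t, which preserves the closed ideal. *)
Lemma JC_exp t y : LL t -> JC y -> JC (bexp t ** y ** bexp (-v t)).
Proof.
 intros Ht Hy. have E : bexp (Lm t +v (-1)%C *v Rm t) y = bexp t ** y ** bexp (-v t).
 { rewrite bexp_add by (apply comm_scal, LR_comm). replace ((-1)%C *v Rm t) with (Rm (-v t)). rewrite bexp_Lm, bexp_Rm, bmA, LmE, RmE. bring.
  transitivity (Rm (0v +v (-1)%C *v t)). f_equal. bring. rewrite Rm_lin. have E0 : Rm (0v : bop V V) = 0v. { bext z. rewrite RmE. bring. } rewrite E0. bring. }
 rewrite <- E. apply (@bexp_sub (BL V) JC). apply JC_sub. apply vclosure_closed. 2: auto.
 intros z Hz. replace ((Lm t +v (-1)%C *v Rm t) z) with (t ** z -v z ** t). destruct (vclosure_cv Hz) as [u [Hu Hc]].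
 apply (@cv_vclosure (BL V) JJ (fun n => t ** u n -v u n ** t)); auto. apply (@cv_plus (BL V) (fun n => t ** u n) (fun n => -v (u n ** t))). apply cv_comp; auto; apply cv_const. apply (@cv_opp (BL V)), cv_comp; auto; apply cv_const.
 rewrite baA, bsA, LmE, RmE. bring.
Qed.
Lemma G_Ad g : G g -> exists gi, inv_of g gi /\ forall y, JC y -> JC (g ** y ** gi) /\ JC (gi ** y ** g).
Proof.
 intros Hg. induction Hg as [|t g Ht Hg [gi [H1 H2]]]. exists (bid V). split. apply inv_id. intros y Hy. triv.
 exists (gi ** bexp (-v t)). split. apply inv_comp; auto. apply bexp_inv. intros y Hy. split.
 - replace (bexp t ** g ** y ** (gi ** bexp (-v t))) with (bexp t ** (g ** y ** gi) ** bexp (-v t)) by bring. exact (JC_exp Ht (proj1 (H2 y Hy))).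
 - replace (gi ** bexp (-v t) ** y ** (bexp t ** g)) with (gi ** (bexp (-v t) ** y ** bexp (-v (-v t))) ** g). refine (proj2 (H2 _ (JC_exp _ Hy))). exact (LL_opp HLs Ht). replace (-v (-v t)) with t by bring. bring.
Qed.
(** Approximate e by a multiple u of a group element g and correct u to an exact idempotent p, which
    has rank one and commutes with g. Then g p = mu p with mu isolated in g, [corner_zero] gives p x
    p = 0, and e x e is arbitrarily close to it. *)
Lemma corner_SS e v x : SS e -> e ** e = e -> v <> 0v -> e v = v -> (forall y, line v (e y)) -> JC x -> e ** x ** e = 0v.
Proof.
 intros HeS He Hv ev Hel Hx. have He0 := nm_ge0 e. have Hx0 := nm_ge0 x. apply (@nm_small0 (BL V)). intros eps Heps.
 set (b := nm e + 3). set (C0 := 2 * (2 * nm e + 3) * (1 + 2 * b) + 1). have HC0 : 1 <= C0. { unfold C0, b. assert (0 <= (2 * nm e + 3) * (1 + 2 * (nm e + 3))) by (apply mul_ge0; lra). lra. }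
 (* Small enough for the Newton iteration starting at u, for p to remain within 1/32 of e and of u,
    and for the final error to be at most [eps]. *)
 set (dl := Rmin (1 / (16 * C0 * (nm e + 2))) (eps / (C0 * (2 * nm e + 2) * (nm x + 1)))).
 have Hdl : 0 < dl. { unfold dl. apply Rmin_glb_lt; apply div_gt0; try lra; repeat apply Rmult_lt_0_compat; lra. }
 have Hd1 : dl * C0 * (nm e + 2) <= 1/16. { le_mid (1 / (16 * C0 * (nm e + 2)) * (C0 * (nm e + 2))). rewrite Rmult_assoc. apply mul_le_r. apply mul_ge0; lra. apply Rmin_l. right; field; lra. }
 have Hd2 : dl * (C0 * (2 * nm e + 2) * (nm x + 1)) <= eps. { le_mid (eps / (C0 * (2 * nm e + 2) * (nm x + 1)) * (C0 * (2 * nm e + 2) * (nm x + 1))). apply mul_le_r. repeat apply mul_ge0; lra. apply Rmin_r. right; field; lra. }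
 have HdC : dl * C0 <= 1/32 by nra. have Hdl1 : dl <= 1/32 by nra.
 destruct (HeS dl Hdl) as [c [g [Hg Hcg]]]. set (u := c *v g) in *. rewrite nm_subC in Hcg. have Hu : nm u <= nm e + 1 by (assert (Q := nm_rev u e); lra).
 have Hdd : nm (u ** u -v u) <= dl * (2 * nm e + 3).
 { replace (u ** u -v u) with (u ** (u -v e) +v (u -v e) ** e -v (u -v e)) by (transitivity (u ** u -v e ** e -v u +v e); [bring|rewrite He; bring]).
  have Q1 := nm_comp u (u -v e). have Q2 := nm_comp (u -v e) e. have Q3 := nm_sub (u ** (u -v e) +v (u -v e) ** e) (u -v e). have Q4 := nm_tri (u ** (u -v e)) ((u -v e) ** e).
  have Q5 : nm u * nm (u -v e) <= (nm e + 1) * dl by (apply Rmult_le_compat; try apply nm_ge0; lra). have Q6 : nm (u -v e) * nm e <= dl * nm e by (apply mul_le_r; lra). lra. }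
 have H3 : 2 * (dl * (2 * nm e + 3)) * (1 + 2 * b) <= dl * (C0 - 1) by (unfold C0; lra).
 destruct (@newton_idem V u (dl * (2 * nm e + 3)) b Hdd) as [p [Hp [Hpc Hpu]]]. unfold b; lra. lra. unfold b in H3. nra.
 have Hpe : nm (p -v e) <= dl * C0. { have Q := nm_sub_tri p u e. lra. } assert (Hpu' : nm (p -v u) <= 1/32) by lra. have Hp0 := nm_ge0 p.
 have Hpn : nm p <= nm e + 1 by (assert (Q := nm_rev p e); lra).
 have He1 : 1 <= nm e. { have Q := nm_app e v. rewrite ev in Q. have Q2 := nm_pos Hv. nra. }
 have Hpp : nm (p -v e) * nm p <= 1/16. { le_to Hd1. apply Rmult_le_compat; try apply nm_ge0; lra. }
 have Hpnz : p <> 0v. { intros E. rewrite E in Hpe. rewrite nm_subC in Hpe. replace (e -v 0v) with (e : BL V) in Hpe by vring. lra. }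
 (* Close idempotents have the same rank: the distance from p y to the line of p v is contracted by
    a factor at most 1/2 on replacing e by p, hence is 0. *)
 have Hpl : forall y, line (p v) (p y).
 { destruct (classic (p v = 0v)) as [Hpv|Hpv].
  - exfalso. apply Hpnz. have Epe : p ** e = 0v. { bext z. rewrite bmA. destruct (Hel z) as [k ->]. rewrite bZ, Hpv, b0A, vs0r. auto. }
  apply (@idem_small V p (nm (p -v e) * nm p)); auto. have E : p = p ** (p -v e). { transitivity (p ** p -v p ** e). rewrite Hp, Epe. bring. bring. } apply rb_nmle. rewrite E at 1. rewrite Rmult_comm. apply nm_comp. lra.
  - have SL := line_sub (p v). have CL := line_closed Hpv. set (L := line (p v)) in *. set (th := nm p * nm (p -v e)). have Hth : 0 <= th <= 1/2. { unfold th. have Q := nm_ge0 (p -v e). split. apply mul_ge0; auto. lra. }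
  intros y. apply vdist0_in; auto. set (dd := vdist L (p y)). have Hdd0 : 0 <= dd by (apply vdist_ge0; auto). apply Rle_antisym; auto. apply le_epsilon. intros e0 He0'.
  have Hc1 : dd <= th * (dd + e0).
  { destruct (vdist_appr SL (p y) He0') as [w [[k Hk] Hwn]]. fold dd in Hwn. set (z := p y -v w) in *. have pz : p z = z. { unfold z. rewrite Hk, bD, bN, bZ, <- !(bmA p p), Hp. auto. }
  have Ez : dd = vdist L (p ((p -v e) z)).
  { destruct (Hel z) as [k' Hk']. replace (p y) with (p ((p -v e) z) +v (k' *v p v +v k *v p v)). unfold dd. replace (p y) with (p ((p -v e) z) +v (k' *v p v +v k *v p v)). apply vdist_addW; auto. exists (k' + k)%C. vring.
  all: rewrite baA, boA, pz, Hk', bD, bN, bZ, pz; unfold z; rewrite Hk; vring. }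
  rewrite Ez. eapply Rle_trans. apply vdist_nm; auto. le_by nm_app. have Q := nm_app (p -v e) z. unfold th. rewrite Rmult_assoc. apply mul_le_l; auto. le_by Q. apply mul_le_l; [apply nm_ge0|lra]. }
  nra. }
 have Hpv : p v <> 0v. { intros E. apply Hpnz. bext y. destruct (Hpl y) as [k ->]. now rewrite E, vs0r, b0A. }
 have Hrk : forall y, exists k : C, p ** y ** p = k *v p.
 { intros y. destruct (Hpl (y (p v))) as [k Hk]. exists k. bext z. rewrite bsA, !bmA. destruct (Hpl z) as [k' ->]. rewrite !bZ, Hk. vring. }
 have cgp : comm g p. { apply Hpc. apply comm_scal, comm_refl. }
 have Hmu : exists mu : C, g ** p = mu *v p. { destruct (Hrk g) as [k Hk]. exists k. rewrite <- Hk, <- cgp, <- bcA, Hp. auto. }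
 destruct Hmu as [mu Hmu]. destruct (G_Ad Hg) as [gi [Hgi HAd]].
 have Hmu0 : mu <> 0%C. { intros E. apply Hpv. rewrite E, vs0l in Hmu. rewrite <- (inv_app (p v) Hgi), <- (bmA g p), Hmu, b0A. apply b0. }
 set (ka := (c * mu)%C). have Hup : u ** p = ka *v p. { unfold u, ka. bstep (c *v (g ** p)). rewrite Hmu. bring. }
 have Hka : 3/4 <= Cmod ka.
 { have Q : nm ((p -v u) ** p) <= 1/32 * nm p by (apply nm_comp_le; auto; lra). have E : (p -v u) ** p = (1 - ka)%C *v p. { bstep (p ** p -v u ** p). rewrite Hp, Hup. bring. } rewrite E, nm_scal in Q.
  have Q2 : Cmod (1 - ka)%C <= 1/32. { apply Rmult_le_reg_r with (nm p); auto. now apply nm_pos. } have Q3 := Cmod_triangle (1 - ka) ka. replace (1 - ka + ka)%C with (RtoC 1) in Q3 by ring. rewrite Cmod_1 in Q3. lra. }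
 (* Off p the operator u is smaller than [ka], so u - ka is invertible there by the Neumann series;
    this yields [B]. *)
 set (D := u ** (bid V -v p)). have HD : nm D < Cmod ka.
 { have E : D = (u -v p) ** (bid V -v p). { unfold D. bstep (u ** (bid V -v p) -v p +v p). rewrite <- Hp at 3. bring. } rewrite E. eapply Rle_lt_trans. apply nm_comp. have Q := nm_sub (bid V) p. have Q2 := nm_id V. rewrite nm_subC in Hpu. 
  have Q3 : nm (u -v p) * nm (bid V -v p) <= dl * C0 * (nm e + 2) by (apply Rmult_le_compat; try apply nm_ge0; lra). lra. }
 destruct (neumann_scal (@rb_nm V D) HD) as [B0 [[HB1 HB2] HBc]].
 have cup : comm u p. { apply Hpc, comm_refl. } have cpD : comm p D by (apply comm_comp; [apply comm_sym; exact cup|exact (comm_idsub (comm_refl p))]).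
 have cgD : comm g D by (apply comm_comp; [apply comm_scal, comm_refl|exact (comm_idsub cgp)]).
 set (B := c *v ((bid V -v p) ** B0)).
 have HB : (g -v mu *v bid V) ** B = bid V -v p.
 { unfold B. transitivity ((u -v ka *v bid V) ** (bid V -v p) ** B0). unfold u, ka. bring.
  have E : (u -v ka *v bid V) ** (bid V -v p) = (D -v ka *v bid V) ** (bid V -v p). { unfold D. bstep (u ** (bid V -v p) -v ka *v (bid V -v p)). rewrite <- (idem_compl Hp) at 1. bring. }
  rewrite E, <- bcA. have cc : B0 ** (bid V -v p) = (bid V -v p) ** B0 by (exact (comm_idsub (comm_sym (HBc _ cpD)))). rewrite <- cc, bcA, HB1, bc1l. auto. }
 have cgB : comm g B by (apply comm_scal, comm_comp; [exact (comm_idsub cgp)|apply HBc, cgD]).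
 have Hpxp : p ** x ** p = 0v.
 { destruct (Ceq_dec mu 1) as [E1|E1].
  (* When mu = 1, 1 - p = (g - 1) B is compact, and so is the identity. Then 2 g is an admissible
     group element with eigenvalue 2, and conjugation by it is the same. *)
  - have Hid : cpt (bid V). { replace (bid V) with (p +v (bid V -v p)) by bring. apply cpt_add. apply (line_cpt Hpl). rewrite <- HB, E1. apply cpt_compr. replace (g -v 1 *v bid V) with (g -v bid V) by bring. apply (G_cpt HLc Hg). }
  have H2 : (/ RtoC 2 * RtoC 2)%C = RtoC 1 by (rewrite <- RtoC_inv, <- RtoC_mult, Rinv_l by lra; auto). assert (H2' : (RtoC 2 * / RtoC 2)%C = RtoC 1) by (rewrite Cmult_comm; auto).
  apply (@corner_zero V JC JC_sub (@vclosure_closed (BL V) JJ) JC_q (2 *v g) ((/ RtoC 2)%C *v gi) p (RtoC 2 * mu)%C) with (B := (/ RtoC 2)%C *v B); auto.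
  + apply inv_scal; auto. intros E. apply RtoC_inj in E. lra.
  + rewrite <- (bc1r (2 *v g -v bid V)). now apply cpt_compl.
  + intros y Hy. replace ((2 *v g) ** y ** (/ 2 *v gi)) with ((RtoC 2 * / RtoC 2)%C *v (g ** y ** gi)) by bring. replace ((/ 2 *v gi) ** y ** (2 *v g)) with ((RtoC 2 * / RtoC 2)%C *v (gi ** y ** g)) by bring. rewrite H2', !vs1. auto.
  + now apply comm_sym, comm_scal, comm_sym. + bstep (2 *v (g ** p)). rewrite Hmu. bring.
  + apply Cmult_neq_0; auto. intros E. apply RtoC_inj in E. lra. + rewrite E1, Cmult_1_r. intros E. apply RtoC_inj in E. lra.
  + bstep ((/ RtoC 2 * RtoC 2)%C *v ((g -v mu *v bid V) ** B)). rewrite H2, vs1. auto.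
  + apply comm_scal, comm_sym, comm_scal, comm_sym; auto.
  - apply (@corner_zero V JC JC_sub (@vclosure_closed (BL V) JJ) JC_q g gi p mu) with (B := B); auto. apply (G_cpt HLc Hg). }
 replace (e ** x ** e) with ((e -v p) ** x ** e +v p ** x ** (e -v p) : BL V). 2: { bstep (e ** x ** e -v p ** x ** p). rewrite Hpxp. bring. }
 le_by nm_tri. rewrite nm_subC in Hpe. have Q1 : nm ((e -v p) ** x ** e) <= dl * C0 * nm x * nm e by (repeat apply nm_comp_le; auto; lra). have Q2 : nm (p ** x ** (e -v p)) <= (nm e + 1) * nm x * (dl * C0) by (repeat apply nm_comp_le; auto; lra).
 assert (0 <= dl * C0 * (2 * nm e + 2)) by (repeat apply mul_ge0; lra). nra.
Qed.
(** All rank-one idempotents of the closed semigroup have zero corners. Moving e by the group turns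
    e y e = 0 into e y h v = 0 for enough h, then e y = 0, and finally x = 0. *)
Theorem theoremV x : JJ x -> x = 0v.
Proof.
 intros Jx. contra Hx. destruct (rank_one HLc HLs irr (HJL Jx) Hx) as [e [v [HeS [He [Hv [ev Hel]]]]]].
 have JCx : forall y, JJ y -> JC y by (intros; now apply vclosure_in).
 (* h e divided by [chi] is again a rank-one idempotent of the semigroup, and it fixes h v. *)
 have H0 : forall y h, JC y -> G h -> e (h v) <> 0v -> e (y (h v)) = 0v.
 { intros y h Hy Hh Hehv. destruct (Hel (h v)) as [chi Hchi]. have chi0 : chi <> 0%C. { intros E. apply Hehv. rewrite Hchi, E. apply vs0l. }
  have Ehe : e ** h ** e = chi *v e. { bext w. rewrite bsA, !bmA. destruct (Hel w) as [k ->]. rewrite !bZ, Hchi. vring. }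
  destruct (G_inv HLs Hh) as [hi [_ Hhi]]. have hv : h v <> 0v. { intros E. apply Hehv. rewrite E. apply b0. }
  have F : ((/ chi)%C *v (h ** e)) ** y ** ((/ chi)%C *v (h ** e)) = 0v.
  { apply (@corner_SS _ (h v)); auto. apply SS_scal, SS_comp; auto. now apply SS_G. bstep ((/ chi * / chi)%C *v (h ** (e ** h ** e))). rewrite Ehe. bstep ((/ chi * (/ chi * chi))%C *v (h ** e)). rewrite Cinv_l, Cmult_1_r; auto.
  rewrite bsA, bmA, Hchi, bZ, vsA, Cinv_l, vs1; auto. intros w. destruct (Hel w) as [k Hk]. exists (/ chi * k)%C. rewrite bsA, bmA, Hk, bZ, vsA. auto. }
  have F2 : (/ chi)%C *v h (e (y (h v))) = 0v.
  { transitivity ((((/ chi)%C *v (h ** e)) ** y ** ((/ chi)%C *v (h ** e))) (h v)). 2: rewrite F; apply b0A.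
  rewrite !bmA. replace (((/ chi)%C *v (h ** e)) (h v)) with (h v). now rewrite bsA, bmA. rewrite bsA, bmA, Hchi, bZ, vsA, Cinv_l, vs1; auto. }
  have F3 : h (e (y (h v))) = 0v. { rewrite <- (vs1 (h (e (y (h v))))), <- (Cinv_r _ chi0), <- vsA, F2. apply vs0r. }
  rewrite <- (inv_app (e (y (h v))) Hhi), F3. apply b0. }
 (* The condition e h v not 0 is open, so it survives short exponentials; this is what [dense]
    requires of the set of such h. *)
 have Hop : forall h t, (G h /\ e (h v) <> 0v) -> LL t -> exists d, 0 < d /\ forall s, 0 < s < d -> G (bexp (s *v t) ** h) /\ e ((bexp (s *v t) ** h) v) <> 0v.
 { intros h t [Hh Hn] Ht. destruct (exp_near e t (h v) (nm_pos Hn)) as [d [[Hd _] Hds]]. exists d. split; auto. intros s Hs. split. exact (Gexp (HLs _ Ht) Hh). rewrite bmA. exact (near_neq0 (Hds s Hs)). }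
 have H1 : forall y, JC y -> e ** y = 0v.
 { intros y Hy. bext z. rewrite b0A. have Hz := @dense _ LL irr (fun h => G h /\ e (h v) <> 0v) v (conj (Gid _) (fun E => Hv (eq_trans (eq_sym ev) E))) Hop Hv z.
  have CK := @ker_closed _ _ (e ** y). destruct (vclosure_cv Hz) as [w [Hw Hcw]]. apply (CK w z); auto. intros n. apply (@vspan_min _ _ (fun x => (e ** y) x = 0v) (ker_sub (e ** y))) with (2 := Hw n). intros z' [h [[Hh Hn] ->]]. rewrite bmA. exact (H0 y h Hy Hh Hn). }
 destruct (classic (forall z, x z = 0v)) as [E|E]. apply Hx. bext z. rewrite E, b0A. auto.
 apply not_all_ex_not in E. destruct E as [z Hz]. have He0 : e <> 0v. { intros E. apply Hv. rewrite <- ev, E. apply b0A. }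
 (* With y the conjugate h x h^(-1), e y = 0 reads e h x = 0; some h contradicts this unless x
    vanishes. *)
 destruct (G_nz HLs irr He0 Hz) as [h [Hh Hn]]. destruct (G_Ad Hh) as [hi [Hhi HAd]]. apply Hn. have Q := H1 _ (proj1 (HAd _ (JCx _ Jx))).
 transitivity ((e ** (h ** x ** hi)) (h z)). rewrite !bmA, (inv_app z Hhi). auto. rewrite Q. apply b0A.
Qed.
End ThmV.

(** * The trace on a space with compact identity *)

Section Trace.
Variables (E : CBanach) (N : bop E E).
Hypothesis Hid : cpt (bid E).
Hypothesis HN : rb N 0.
Notation pr := (E * (E -> C))%type.
Fixpoint lsum (g : pr -> C) (B : list pr) : C := match B with nil => RtoC 0 | p :: B => (g p + lsum g B)%C end.
Lemma lsum_ext g h (B : list pr) : (forall p, In p B -> g p = h p) -> lsum g B = lsum h B.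
Proof. induction B; intros H; cbn; auto. rewrite IHB, H; auto. now left. intros; apply H; now right. Qed.
Lemma lsum_add g h (B : list pr) : lsum (fun p => g p + h p)%C B = (lsum g B + lsum h B)%C.
Proof. induction B; cbn. ring. rewrite IHB. ring. Qed.
Lemma lsum_mul c g (B : list pr) : lsum (fun p => c * g p)%C B = (c * lsum g B)%C.
Proof. induction B; cbn. ring. rewrite IHB. ring. Qed.
Lemma lsum_swap (g : pr -> pr -> C) (B B' : list pr) : lsum (fun p => lsum (g p) B') B = lsum (fun q => lsum (fun p => g p q) B) B'.
Proof.
 induction B as [|p B IH]; cbn. induction B'; cbn; auto. rewrite <- IHB'. ring.
 rewrite IH. symmetry. apply (lsum_add (fun q => g p q) (fun q => lsum (fun p => g p q) B)).
Qed.
Fixpoint rs (B : list pr) (x : E) : E := match B with nil => 0v | p :: B => snd p x *v fst p +v rs B x end.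
(** A basis of [Y] with its coordinate functionals, linear on [Y] only, in which N has zero
    diagonal. Only the expansion of vectors and the diagonal values are recorded, which is all that
    a trace needs. *)
Definition adp (Y : E -> Prop) (B : list pr) := (vsubspace Y /\ vclosed Y /\ forall x, Y x -> Y (N x)) /\
 (forall p, In p B -> (forall x y, Y x -> Y y -> snd p (x +v y) = (snd p x + snd p y)%C) /\ (forall (c : C) x, Y x -> snd p (c *v x) = (c * snd p x)%C) /\
  Y (fst p) /\ snd p (fst p) = RtoC 1 /\ snd p (N (fst p)) = RtoC 0) /\ forall x, Y x -> x = rs B x.
(* The identity is compact, so a quasinilpotent operator on a nonzero quotient, not being bounded below, has a kernel. *)
Lemma flag_step Y : vsubspace Y -> vclosed Y -> (forall x, Y x -> Y (N x)) -> ~ (forall x, Y x) -> exists w, ~ Y w /\ Y (N w).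
Proof.
 intros SY CY NY HY. destruct (quotient SY CY) as [Q [q [Hsj [Hk0 [_ [Hind [Hcp [Hqn Hql]]]]]]]]. destruct (Hind N NY) as [N' HN'].
 apply not_all_ex_not in HY. destruct HY as [u Hu]. contra Hno.
 destruct (@LOW Q (RtoC 0) (bid Q +v N') (fun z => z = RtoC 1) 1) as [c [Hc HL]].
 - apply cpt_add. apply (Hcp (bid E)); auto. bring. apply Hcp with N; auto. rewrite <- (bc1r N). now apply cpt_compl.
 - intros z ->. rewrite Cmod_1. lra.
 - intros z l Hz Hl. contra Hn. have P0 : 0 < Cmod (1 - l)%C. { apply Cmod_gt_0. intros E1. apply Hn. replace l with (1 - (1 - l))%C by ring. rewrite E1. ring. }
  destruct (Hl _ P0) as [n Hn']. specialize (Hn' n (le_n n)). rewrite Hz in Hn'. lra.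
 - intros z ->. replace (1 - 1 * 0)%C with (RtoC 1) by ring. intros H. apply RtoC_inj in H. lra.
 - intros z x -> Ex. destruct (Hsj x) as [w <-]. apply Hk0. contra Hw. apply Hno. exists w. split; auto. apply Hk0. rewrite <- bmA, <- HN', bmA.
  replace (N' (q w)) with ((1 *v ((0 *v bid Q +v (bid Q +v N')) (q w))) -v q w). rewrite <- Ex. vring. rewrite !baA, bsA, b1A. vring.
 - assert (HL' : forall n, c ^ n * nm (q u) <= nm (N' ^^ n) * nm (q u)).
  { intros n. le_to nm_app. induction n; sim. rewrite b1A. lra. rewrite bmA. specialize (HL (RtoC 1) ((N' ^^ n) (q u)) eq_refl).
  replace ((N' ^^ n) (q u) -v 1 *v ((0 *v bid Q +v (bid Q +v N')) ((N' ^^ n) (q u)))) with (-v N' ((N' ^^ n) (q u))) in HL. rewrite nm_opp in HL. le_to HL. rewrite Rmult_assoc. apply mul_le_l; lra. rewrite !baA, bsA, b1A. vring. }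
  have Hpu : 0 < nm (q u). { apply nm_pos. intros E0. apply Hu. now apply Hk0. }
  destruct (HN (r := c / 2)) as [M [HM HMn]]. lra. destruct (@pow_half_small 1 (/ (M + 1))) as [n Hn]. apply inv_gt0; lra. specialize (Hn n (le_n n)). specialize (HL' n). specialize (HMn n).
  have Q1 : nm (N' ^^ n) <= nm (N ^^ n). { apply (quo_op_nm Hql). intros z. rewrite Hqn. now apply vdist_nm. apply quo_op_pow. auto. }
  apply Rmult_le_reg_r in HL'; auto. replace (c / 2) with (c * (1/2)) in HMn by field. rewrite Rpow_mult_distr in HMn. have Hcn : 0 < c ^ n by (apply pow_lt; auto).
  assert (1 * (1/2)^n * (M + 1) < 1). { apply Rmult_lt_reg_r with (/ (M + 1)). apply inv_gt0; lra. rewrite Rmult_assoc, Rinv_r by lra. lra. }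
  assert (0 < (1/2)^n) by (apply pow_lt; lra). nra.
Qed.
(** A new vector w with N w in Y adds one coordinate; the old functionals are extended by first
    subtracting the component along w. The diagonal entry of N at w is 0 because N w has no such
    component. *)
Lemma adp_ext Y B w : adp Y B -> ~ Y w -> Y (N w) -> exists B', adp (fun x => exists c, Y (x -v c *v w)) B'.
Proof.
 intros [[SY [CY NY]] [HB HY]] Hw HNw. destruct SY as [Y0 [Ya Ys]]. set (Y' := fun x => exists c, Y (x -v c *v w)).
 have Yu : forall x (c d : C), Y (x -v c *v w) -> Y (x -v d *v w) -> c = d.
 { intros x c d H1 H2. contra Hn. apply Hw. replace w with ((/ (d - c))%C *v ((x -v c *v w) +v (-1)%C *v (x -v d *v w))). auto.
  transitivity ((/ (d - c) * (d - c))%C *v w). vring. rewrite Cinv_l. vring. apply Cminus_eq_contra; auto. }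
 destruct (@fun_choice E C (fun x c => Y' x -> Y (x -v c *v w))) as [cc Hcc]. { intros x. destruct (classic (Y' x)) as [[c H]|H]. now exists c. exists (RtoC 0); tauto. }
 have YY : forall x, Y x -> Y' x. { intros x Hx. exists (RtoC 0). replace (x -v 0%C *v w) with x by vring. auto. }
 have c0 : forall x, Y x -> cc x = RtoC 0. { intros x Hx. apply (Yu x). apply Hcc; auto. replace (x -v 0%C *v w) with x by vring. auto. }
 have ca : forall x y, Y' x -> Y' y -> cc (x +v y) = (cc x + cc y)%C.
 { intros x y Hx Hy. assert (Y ((x +v y) -v (cc x + cc y)%C *v w)). { replace ((x +v y) -v (cc x + cc y)%C *v w) with ((x -v cc x *v w) +v (y -v cc y *v w)) by vring. auto. } apply (Yu (x +v y)); auto. apply Hcc. eexists; eauto. }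
 have cs : forall (c : C) x, Y' x -> cc (c *v x) = (c * cc x)%C.
 { intros c x Hx. assert (Y (c *v x -v (c * cc x)%C *v w)). { replace (c *v x -v (c * cc x)%C *v w) with (c *v (x -v cc x *v w)) by vring. auto. } apply (Yu (c *v x)); auto. apply Hcc. eexists; eauto. }
 have cw : cc w = RtoC 1. { assert (Y (w -v 1 *v w)). { replace (w -v 1 *v w) with (0v : E) by vring. auto. } apply (Yu w); auto. apply Hcc. eexists; eauto. }
 exists ((w, cc) :: map (fun p => (fst p, fun x => snd p (x -v cc x *v w))) B). split; [split; [|split]|split].
 - split; [|split]. auto. intros x y [c Hx] [d Hy]. exists (c + d)%C. replace ((x +v y) -v (c + d)%C *v w) with ((x -v c *v w) +v (y -v d *v w)) by vring. auto.
  intros c x [d Hx]. exists (c * d)%C. replace (c *v x -v (c * d)%C *v w) with (c *v (x -v d *v w)) by vring. auto.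
 - have SY : vsubspace Y by (split; auto). destruct (quotient SY CY) as [Q [q [_ [Hk0 _]]]]. have Hqw : q w <> 0v by (intros H; now apply Hw, Hk0).
  intros u l Hu Hl. destruct (@line_closed Q (q w) Hqw (fun n => q (u n)) (q l)) as [c Hc]. intros n. destruct (Hu n) as [c Hc]. exists c. apply vsub_eq0. rewrite <- bZ, <- bN, <- bD. now apply Hk0.
  now apply cv_app. exists c. apply Hk0. rewrite bD, bN, bZ, Hc. vring.
 - intros x [c Hx]. exists (RtoC 0). replace (N x -v 0%C *v w) with (N (x -v c *v w) +v c *v N w). auto. rewrite bD, bN, bZ. vring.
 - intros p [<-|Hp]; cbn [fst snd]. repeat split; auto. exists (RtoC 1). replace (w -v 1 *v w) with (0v : E) by vring. auto.
  apply in_map_iff in Hp. destruct Hp as [p' [<- Hp]]. cbn [fst snd]. destruct (HB p' Hp) as [H1 [H2 [H3 [H4 H5]]]]. repeat split; auto.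
  + intros x y Hx Hy. rewrite ca by auto. rewrite <- H1 by auto. f_equal. vring. + intros c x Hx. rewrite cs by auto. rewrite <- H2 by auto. f_equal. vring.
  + rewrite c0 by auto. replace (fst p' -v 0%C *v w) with (fst p') by vring. auto. + rewrite c0 by auto. replace (N (fst p') -v 0%C *v w) with (N (fst p')) by vring. auto.
 - intros x Hx. cbn [rs map fst snd]. transitivity (cc x *v w +v (x -v cc x *v w)). vring. f_equal. rewrite (HY _ (Hcc x Hx)) at 1. clear. induction B; cbn; auto. now rewrite IHB.
Qed.
(** Vectors are adjoined one at a time by [flag_step]; [CH] for the compact identity excludes an
    infinite chain. *)
Lemma adp_full : exists B, adp (fun _ => True) B.
Proof.
 contra Hno. destruct (@dep_choice (E -> Prop) (fun Y => exists B, adp Y B) (fun _ Y Y' => exists w, ~ Y w /\ Y' = fun x => exists c, Y (x -v c *v w)) (fun x => x = 0v)) as [Yn [_ [Hn HR]]].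
 - exists nil. split; [split; [|split]|split]. split; [|split]; intros; subst; vring. intros u l Hu Hl. apply (@cv_unique E u); auto. apply (@cv_ext E (fun _ => 0v)). intros; symmetry; auto. apply cv_const. intros x ->. apply b0. intros p []. auto.
 - intros _ Y [B HB]. have HY : ~ forall x, Y x. { intros HY. apply Hno. exists B. replace (fun _ : E => True) with Y. auto. fext x. apply propositional_extensionality. firstorder. }
  destruct (proj1 HB) as [SY [CY NY]]. destruct (flag_step SY CY NY HY) as [w [Hw1 Hw2]]. destruct (adp_ext HB Hw1 Hw2) as [B' HB']. exists (fun x => exists c, Y (x -v c *v w)). split. now exists B'. now exists w.
 - apply (@CH E (bid E) Yn (fun _ => RtoC 1) 1 Hid). lra. intros; rewrite Cmod_1; lra. 1,2: intros n; destruct (Hn n) as [B [HB _]]; apply HB.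
  + intros n x Hx. destruct (HR n) as [w [_ ->]]. exists (RtoC 0). replace (x -v 0%C *v w) with x by vring. auto.
  + intros n. destruct (HR n) as [w [Hw ->]]. exists w. split; auto. exists (RtoC 1). replace (w -v 1 *v w) with (0v : E) by vring. destruct (Hn n) as [B [HB _]]. apply HB.
  + intros n x _. rewrite b1A. replace (x -v 1 *v x) with (0v : E) by vring. destruct (Hn n) as [B [HB _]]. apply HB.
Qed.
Definition comspan := @vspan (BL E) (fun T => exists A B : bop E E, T = A ** B -v B ** A).
(** In an adapted basis N has trace 0 and the identity has the dimension as trace, while
    combinations of commutators have trace 0. So k times the dimension is 0, and k = 0 unless the
    space is trivial. *)
Lemma trace_zero (k : C) : comspan (k *v bid E +v N) -> rb (k *v bid E +v N) 0.
Proof.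
 intros H. destruct adp_full as [B [_ [HB HY]]]. set (tr := fun A : bop E E => lsum (fun p => snd p (A (fst p))) B).
 have Hadd : forall A A' : bop E E, tr (A +v A') = (tr A + tr A')%C. { intros A A'. unfold tr. rewrite <- lsum_add. apply lsum_ext. intros p Hp. rewrite baA. now apply HB. }
 have Hsc : forall (c : C) (A : bop E E), tr (c *v A) = (c * tr A)%C. { intros c A. unfold tr. rewrite <- lsum_mul. apply lsum_ext. intros p Hp. rewrite bsA. now apply HB. }
 have Hexp : forall p (A : bop E E) x, In p B -> snd p (A x) = lsum (fun q => snd q x * snd p (A (fst q)))%C B.
 { intros p A x Hp. rewrite (HY x I) at 1. destruct (HB p Hp) as [H1 [H2 _]]. generalize B. intros B'. induction B' as [|q B' IH]; cbn.
  rewrite b0. replace (0v : E) with ((RtoC 0) *v (0v : E)) by vring. rewrite H2 by auto. ring. rewrite bD, bZ, H1, H2, IH; auto. }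
 have Hc : forall A A', tr (A ** A') = tr (A' ** A).
 { intros A A'. unfold tr. transitivity (lsum (fun p => lsum (fun q => snd q (A' (fst p)) * snd p (A (fst q)))%C B) B). apply lsum_ext. intros p Hp. rewrite bmA. auto.
  rewrite lsum_swap. apply lsum_ext. intros p Hp. rewrite bmA. rewrite (Hexp p A') by auto. apply lsum_ext. intros q Hq. ring. }
 have T0 : tr (k *v bid E +v N) = RtoC 0.
 { refine (@vspan_min (BL E) _ (fun T => tr T = RtoC 0) _ _ _ H). split; [|split].
  - replace (0v : BL E) with (0 *v (0v : BL E)) by vring. rewrite Hsc. ring. - intros x y Hx Hy. rewrite Hadd, Hx, Hy. ring. - intros c x Hx. rewrite Hsc, Hx. ring.
  - intros T [A [A' ->]]. replace (A ** A' -v A' ** A) with (A ** A' +v (-1)%C *v (A' ** A)) by bring. rewrite Hadd, Hsc, Hc. ring. }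
 have T1 : tr N = RtoC 0. { unfold tr. rewrite (@lsum_ext _ (fun p => 0 * 1)%C). rewrite lsum_mul. ring. intros p Hp. replace (0 * 1)%C with (RtoC 0) by ring. now apply HB. }
 have T2 : tr (bid E) = RtoC (INR (length B)).
 { unfold tr. clear - HB. induction B as [|p B' IH]. auto. cbn [lsum length]. rewrite S_INR, RtoC_plus. rewrite IH. 2: intros; apply HB; now right. rewrite b1A. destruct (HB p (or_introl eq_refl)) as [_ [_ [_ [-> _]]]]. ring. }
 rewrite Hadd, Hsc, T1, T2 in T0. destruct B as [|p B'].
 - replace (k *v bid E +v N) with (0v : bop E E). apply rb_nmle. rewrite nm0; lra. bext x. rewrite (HY _ I). symmetry. rewrite (HY _ I). auto.
 - assert (k = RtoC 0). { contra Hk. have Q : (k * RtoC (INR (length (p :: B'))))%C = RtoC 0 by (rewrite <- T0; ring). revert Q. apply Cmult_neq_0; auto. intros E1. apply RtoC_inj in E1. cbn [length] in E1. rewrite S_INR in E1. have Q := pos_INR (length B'). lra. }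
  subst k. replace (0 *v bid E +v N) with N by bring. auto.
Qed.
End Trace.
Fixpoint adn V (x : bop V V) n (z : bop V V) : bop V V := match n with O => z | S n => x ** adn x n z -v adn x n z ** x end.

(** * Engel ideals in irreducible Lie algebras of compact operators *)

Section Engel.
Variables (E : CBanach) (LL : bop E E -> Prop).
Hypothesis HLc : forall t, LL t -> cpt t.
Hypothesis HLs : @vsubspace (BL E) LL.
Hypothesis irr : irreducible LL.
(** The Engel condition in pointwise form: the constant may depend on z, which is all that the
    images under representations provide. *)
Definition esmall (x : bop E E) := forall z, LL z -> forall d, 0 < d -> exists M, 0 <= M /\ forall n, nm (adn x n z) <= M * d ^ n.
(* The vectors on which the powers of [x - k] decay superexponentially form an invariant subspace, which the Riesz projection complementary to the eigenvalues of modulus at least [|k|] kills. *)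
Lemma eig_dense x (k : C) v : cpt x -> esmall x -> k <> 0%C -> v <> 0v -> x v = k *v v -> cpt (bid E) /\ forall u, x u = 0v -> u = 0v.
Proof.
 intros Hx Hs Hk Hv Ev. set (A := x -v k *v bid E). set (G := fun u => forall d, 0 < d -> exists M, 0 <= M /\ forall n, nm ((A ^^ n) u) <= M * d ^ n).
 have SG : vsubspace G. { split; [|split].
  - intros d Hd. exists 0. split. lra. intros n. rewrite b0, nm0. lra.
  - intros a b Ha Hb d Hd. destruct (Ha d Hd) as [M [HM H1]]. destruct (Hb d Hd) as [M' [HM' H2]]. exists (M + M'). split. lra. intros n. rewrite bD. le_by nm_tri. specialize (H1 n). specialize (H2 n). lra.
  - intros c a Ha d Hd. destruct (Ha d Hd) as [M [HM H1]]. exists (Cmod c * M). split. apply mul_ge0; auto; apply Cmod_ge_0. intros n. rewrite bZ, nm_scal, Rmult_assoc. apply mul_le_l; auto; apply Cmod_ge_0. }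
 have IG : forall z u, LL z -> G u -> G (z u).
 { intros z u Hz Hu d Hd. destruct (Hs z Hz (d/2)) as [M [HM H1]]. lra. destruct (Hu (d/2)) as [M' [HM' H2]]. lra. exists (M * M'). split. now apply mul_ge0.
  have H : forall n j i, nm ((A ^^ n) (adn x j z ((A ^^ i) u))) <= M * M' * (2 ^ n * (d/2) ^ (n + j + i)).
  { induction n; intros j i.
  - cbn [bpow]. rewrite b1A. le_by nm_app. rewrite pow_O, Rmult_1_l, Nat.add_0_l, pow_add. replace (M * M' * ((d/2)^j * (d/2)^i)) with (M * (d/2)^j * (M' * (d/2)^i)) by ring. apply Rmult_le_compat; try apply nm_ge0; auto.
  - rewrite bpow_S, bmA. replace (A (adn x j z ((A ^^ i) u))) with (adn x (S j) z ((A ^^ i) u) +v adn x j z ((A ^^ S i) u)).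
  + rewrite bD. le_by nm_tri. have I1 := IHn (S j) i. have I2 := IHn j (S i). replace (n + S j + i)%nat with (S (n + j + i)) in I1 by lia. replace (n + j + S i)%nat with (S (n + j + i)) in I2 by lia. replace (S n + j + i)%nat with (S (n + j + i)) by lia. cbn [pow] in *. lra.
  + cbn [adn bpow]. rewrite bmA. set (y := (A ^^ i) u). unfold A. rewrite !baA, !boA, !bmA, !bsA, !b1A, bD, bN, bZ. vring. }
  intros n. have Q := H n O O. cbn [adn bpow] in Q. rewrite b1A, !Nat.add_0_r in Q. rewrite <- Rpow_mult_distr in Q. replace (2 * (d/2)) with d in Q by field. auto. }
 have Gv : G v. { intros d Hd. exists (nm v). split. apply nm_ge0. intros n. have Av : A v = 0v. { unfold A. rewrite baA, boA, bsA, b1A, Ev. vring. }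
  destruct n. cbn [bpow pow]. rewrite b1A. lra. rewrite bpow_S, bmA, Av, b0, nm0. apply mul_ge0. apply nm_ge0. apply pow_le; lra. }
 destruct (irr (vclosure_sub SG) (@vclosure_closed E G)) as [H|H]. { intros t y Ht Hy. destruct (vclosure_cv Hy) as [w [Hw Hc]]. apply (cv_vclosure (u := fun n => t (w n))). intros n. now apply IG. now apply cv_app. } { exfalso. apply Hv, H. now apply vclosure_in. }
 have Hkm : 0 < Cmod k by now apply Cmod_gt_0. destruct (RD Hx Hkm) as [ks [P [r [Hks [HP [HPc [HpP [Hr [Hrb HcP]]]]]]]]]. set (Q := bid E -v P).
 destruct (neumann_scal Hrb (proj2 Hr)) as [B0 [[HB1 HB2] HBc]]. fold Q in HB1, HB2, HBc.
 have HQ2 : Q ** Q = Q by now apply idem_compl. have cxQ : x ** Q = Q ** x. { unfold Q. bstep (x -v x ** P). rewrite (HPc x (comm_refl x)). bring. }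
 have HAQ : A ** Q = (x ** Q -v k *v bid E) ** Q. { unfold A. transitivity (x ** (Q ** Q) -v k *v Q). rewrite HQ2. bring. bring. }
 have cAQ : comm A Q. { unfold comm, A. bstep (x ** Q -v k *v Q). rewrite cxQ. bring. }
 have HBA : forall n, (B0 ^^ n) ** Q ** (A ^^ n) = Q.
 { induction n. cbn [bpow]. bring. rewrite bpow_S. cbn [bpow]. bstep (B0 ^^ n ** (B0 ** (Q ** A)) ** A ^^ n). rewrite <- cAQ, HAQ, (bcA B0), HB2, bc1l. auto. }
 have HGQ : forall u, G u -> Q u = 0v.
 { intros u Hu. have Hb := nm_ge0 B0. destruct (Hu (/ (2 * (nm B0 + 1)))) as [M [HM HMn]]. apply inv_gt0; lra. apply nm_small0. intros eps He. destruct (@pow_half_small (nm Q * M) eps He) as [n Hn]. specialize (Hn n (le_n n)). left. eapply Rle_lt_trans. 2: apply Hn.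
  have E1 : Q u = (B0 ^^ n) (Q ((A ^^ n) u)). { rewrite <- (HBA n) at 1. now rewrite !bmA. } rewrite E1. le_by nm_app. have Q1 := nm_app Q ((A ^^ n) u). have Q2 := bpow_nm B0 n. specialize (HMn n).
  have Q3 : nm (B0 ^^ n) <= (nm B0 + 1) ^ n. { le_by Q2. apply pow_incr. lra. } have QQ := nm_ge0 Q.
  le_mid ((nm B0 + 1) ^ n * (nm Q * (M * (/ (2 * (nm B0 + 1)))^n))). apply Rmult_le_compat; try apply nm_ge0; auto. le_by Q1. now apply mul_le_l.
  right. replace (1/2) with ((nm B0 + 1) * / (2 * (nm B0 + 1))) by (field; lra). rewrite Rpow_mult_distr. ring. }
 have HP1 : P = bid E. { symmetry. apply (@vsub_eq0 (BL E)). bext y. fold Q. rewrite b0A. destruct (vclosure_cv (H y)) as [w [Hw Hc]]. apply (@ker_closed _ _ Q w y); auto. }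
 split. rewrite <- HP1. auto. intros u Hu. contra Hn. have Hin : In (RtoC 0) ks. { apply (@ppoly_eigen _ x ks 0%C u); auto. rewrite Hu. vring. rewrite <- (b1A u) at 1. rewrite <- HP1, <- bmA, HpP. apply b0A. }
 destruct (Hks _ Hin) as [Q1 _]. rewrite Cmod_0 in Q1. lra.
Qed.
Lemma cpt_rb0 (x : bop E E) : cpt x -> (forall (k : C) v, k <> 0%C -> x v = k *v v -> v = 0v) -> rb x 0.
Proof.
 intros Hx H r Hr. destruct (@rb_compact E (RtoC 0) x r Hx) as [s [Hs Hrb]]. rewrite Cmod_0; auto. intros lam v Hl Ev. apply (H lam). intros E0. rewrite E0, Cmod_0 in Hl. lra. rewrite <- Ev, baA, bsA, b1A. vring.
 replace (0 *v bid E +v x) with x in Hrb by bring. apply Hrb. lra.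
Qed.
(** With a nonzero eigenvalue k, [eig_dense] makes the identity compact. It also shows that x - k,
    which has a kernel, has no nonzero eigenvalue. So x = k + y with y quasinilpotent, and the trace
    decides. *)
Lemma engel_comspan_rb x : cpt x -> esmall x -> comspan x -> rb x 0.
Proof.
 intros Hx Hs Hc. contra Hn. have H : exists (k : C) v, k <> 0%C /\ v <> 0v /\ x v = k *v v. { contra H. apply Hn, cpt_rb0; auto. intros k v Hk Ev. contra Hv. apply H. now exists k, v. }
 destruct H as [k [v [Hk [Hv Ev]]]]. destruct (eig_dense Hx Hs Hk Hv Ev) as [Hid _]. set (y := x -v k *v bid E). have Hy : cpt y by (apply cpt_minus; [auto|now apply cpt_scal]).
 have Had : forall n z, adn y n z = adn x n z. { intros n z. induction n; auto. cbn [adn]. rewrite IHn. unfold y. bring. }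
 have Hys : esmall y. { intros z Hz d Hd. destruct (Hs z Hz d Hd) as [M HM]. exists M. split. apply HM. intros n. rewrite Had. apply HM. }
 have Yv : y v = 0v. { unfold y. rewrite baA, boA, bsA, b1A, Ev. vring. }
 have Hrb : rb y 0. { apply cpt_rb0; auto. intros m w Hm Ew. contra Hw. destruct (eig_dense Hy Hys Hm Hw Ew) as [_ H]. now apply Hv, H. }
 apply Hn. have Ex : x = k *v bid E +v y by (unfold y; bring). rewrite Ex in *. now apply trace_zero.
Qed.
(** The members of the ideal that are combinations of commutators again form an ideal,
    quasinilpotent by [engel_comspan_rb] and hence zero by [theoremV]; it contains every bracket
    with the ideal. *)
Theorem engel_ideal_central (JJ : bop E E -> Prop) : @vsubspace (BL E) JJ -> (forall x, JJ x -> LL x) -> (forall t x, LL t -> JJ x -> JJ (t ** x -v x ** t)) ->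
 (forall x, JJ x -> esmall x) -> forall t x, LL t -> JJ x -> t ** x -v x ** t = 0v.
Proof.
 intros SJ JL HJ Hs t x Ht Hx. destruct HLs as [_ [_ HLs']]. destruct SJ as [J1 [J2 J3]]. have SC := @vspan_sub (BL E) (fun T => exists A B : bop E E, T = A ** B -v B ** A). fold (@comspan E) in SC. destruct SC as [C1 [C2 C3]].
 have Hcm : forall A B : bop E E, comspan (A ** B -v B ** A). { intros A B. replace (A ** B -v B ** A) with (1 *v (A ** B -v B ** A) +v 0v : BL E) by vring. constructor. now exists A, B. constructor. }
 apply (@theoremV E LL (fun z => JJ z /\ comspan z)); auto.
 - split; [|split]. split; auto. intros a b [A1 A2] [B1 B2]. split; auto. intros c a [A1 A2]; split; auto.
 - intros z [Z1 _]. auto. - intros z [Z1 Z2]. apply engel_comspan_rb; auto. - intros s z Hs' [Z1 Z2]. split; auto.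
Qed.
End Engel.

(** * Riesz projections preserve closed invariant subspaces *)

Section RieszInv.
Variables (X : CBanach) (w P Q : bop X X) (r d : R) (Y : X -> Prop).
Hypothesis (HQ : Q ** Q = Q) (cQ : w ** Q = Q ** w) (Hrb : rb (w ** Q) r) (Hr : r < d).
Hypothesis (SY : vsubspace Y) (CY : vclosed Y) (wY : forall x, Y x -> Y (w x)).
(** On the range of Q the powers of w/k tend to 0, and u - (w/k)^n u lies in Y as a combination of
    images of w u - k u; in the limit u lies in Y. *)
Lemma resolvent_inv (k : C) u : d <= Cmod k -> 0 < d -> Q u = u -> Y (w u -v k *v u) -> Y u.
Proof.
 intros Hk Hd Hu Hy. have Hk0 : k <> 0%C by (intros E; rewrite E, Cmod_0 in Hk; lra). set (T := (/ k)%C *v (w ** Q)). destruct SY as [_ [Sa Ss]].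
 have HT : forall n, Q ((T ^^ n) u) = (T ^^ n) u /\ Y (u -v (T ^^ n) u).
 { induction n as [|n [I1 I2]]. cbn [bpow]. rewrite b1A, vaddN. split; auto. apply SY.
  have E : (T ^^ S n) u = (/ k)%C *v w ((T ^^ n) u). { rewrite bpow_app_S. unfold T at 1. now rewrite bsA, bmA, I1. } rewrite E. split.
  - rewrite bZ, <- bmA, <- cQ, bmA, I1. auto.
  - replace (u -v (/ k)%C *v w ((T ^^ n) u)) with ((-1 * / k)%C *v (w u -v k *v u) +v (/ k)%C *v w (u -v (T ^^ n) u)). apply Sa; apply Ss; auto. rewrite bD, bN. transitivity ((/ k * k)%C *v u -v (/ k)%C *v w ((T ^^ n) u)). vring. rewrite Cinv_l; auto. now rewrite vs1. }
 apply (CY (u := fun n => u -v (T ^^ n) u)). intros n. apply HT. intros eps He. have Hkp := proj1 (Cmod_gt_0 k) Hk0.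
 have Hrt : rb T (/ Cmod k * Rmax r 0). { unfold T. rewrite <- Cmod_inv by auto. apply rb_scal. apply Rmax_r. eapply rb_le. 2: apply Hrb. apply Rmax_l. }
 destruct (rb_lt1_small (eps := eps / (nm u + 1)) Hrt) as [N HN]. { apply Rmult_lt_reg_l with (Cmod k); auto. rewrite <- Rmult_assoc, Rinv_r, Rmult_1_l, Rmult_1_r by lra. apply Rmax_lub_lt; lra. } { apply div_gt0; auto. assert (H := nm_ge0 u); lra. }
 exists N. intros n Hn. specialize (HN n Hn). replace (u -v (T ^^ n) u -v u) with (-v (T ^^ n) u) by vring. rewrite nm_opp. have H := nm_ge0 u. have HA := nm_app (T ^^ n) u. apply Rlt_div_r in HN. 2: lra. have H2 := nm_ge0 (T ^^ n). lra.
Qed.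
(** The annihilating polynomial takes the same value, in Y, at y and at Q y. Its factors are removed
    one by one by [resolvent_inv], so Q y and then P y lie in Y. *)
Lemma riesz_proj_inv ks y : 0 < d -> (forall k, In k ks -> d <= Cmod k) -> P = bid X -v Q -> ppoly w ks ** P = 0v -> Y y -> Y (P y).
Proof.
 intros Hd Hks -> HP Hy. rewrite baA, boA, b1A. apply vsub_minus; auto.
 have E : ppoly w ks (Q y) = ppoly w ks y. { symmetry. apply vsub_eq0. rewrite <- bN, <- bD. rewrite <- (b0A X y), <- HP, bmA, baA, boA, b1A. auto. }
 have H1 : Y (ppoly w ks (Q y)). { rewrite E. clear - SY wY Hy. revert y Hy. induction ks; intros y Hy. cbn [ppoly]. now rewrite b1A. rewrite ppoly_S. apply IHks. apply vsub_minus; auto. now apply SY. }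
 have H2 : Q (Q y) = Q y by (rewrite <- bmA; now rewrite HQ). revert H1 H2. generalize (Q y). clear E HP. induction ks as [|k ks IH]; intros u H1 H2. cbn [ppoly] in H1. now rewrite b1A in H1.
 rewrite ppoly_S in H1. apply (resolvent_inv (k := k)); auto. apply Hks; now left. apply IH; auto. intros; apply Hks; now right. rewrite bD, bN, bZ, <- bmA, <- cQ, bmA, H2. auto.
Qed.
End RieszInv.
Definition Esolv (X : CBanach) (L0 : bop X X -> Prop) := forall I : bop X X -> Prop, @vsubspace (BL X) I -> (forall x, I x -> L0 x) -> (forall a x, L0 a -> I x -> I (a ** x -v x ** a)) ->
 (forall u x, (forall n, I (u n)) -> L0 x -> cv u x -> I x) -> (exists x, L0 x /\ ~ I x) ->
 exists J : bop X X -> Prop, @vsubspace (BL X) J /\ (forall x, J x -> L0 x) /\ (forall a x, L0 a -> J x -> J (a ** x -v x ** a)) /\ (exists x, J x /\ ~ I x) /\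
  forall x z d, J x -> J z -> 0 < d -> exists M, 0 <= M /\ forall n, exists i, I i /\ nm (adn x n z -v i) <= M * d ^ n.

(** * Irreducible representations, and words that contain a commutator *)

Section Rep.
Variables (X : CBanach) (L0 : bop X X -> Prop).
Hypothesis HL0 : @vsubspace (BL X) L0.
Hypothesis HLb : forall S T, L0 S -> L0 T -> L0 (S ** T -v T ** S).
Hypothesis HLc : forall T, L0 T -> cpt T.
(** A map of raw operators constrained on [L0] only, which avoids a subtype for the algebra. *)
Record isrep (E : CBanach) (rho : bop X X -> bop E E) : Prop := {
 rep_add : forall S T, L0 S -> L0 T -> rho (S +v T) = rho S +v rho T;
 rep_scal : forall (c : C) T, L0 T -> rho (c *v T) = c *v rho T;
 rep_br : forall S T, L0 S -> L0 T -> rho (S ** T -v T ** S) = rho S ** rho T -v rho T ** rho S;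
 rep_nm : forall T, L0 T -> nm (rho T) <= nm T;
 rep_cpt : forall T, L0 T -> cpt (rho T);
 rep_irr : forall Y : E -> Prop, vsubspace Y -> vclosed Y -> (forall t x, L0 t -> Y x -> Y (rho t x)) -> (forall x, Y x -> x = 0v) \/ (forall x, Y x) }.
(** Inside the closed invariant subspace generated by v, divide by a maximal invariant subspace
    whose closure avoids v. The chain condition behind Zorn's lemma is not automatic for closures
    and is a hypothesis; the relations between [S], [i] and [q] record how v and the operators pass
    to the quotient. *)
Lemma irr_subquotient v (Hv : v <> 0v) (R : (X -> Prop) -> Prop) :
 (forall A, R A <-> (forall t x, L0 t -> A x -> A (t x)) /\ ~ vclosure A v) ->
 (forall Fm : (X -> Prop) -> Prop, (exists A, Fm A) -> (forall A, Fm A -> vsubspace A /\ R A) ->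
  (forall A B, Fm A -> Fm B -> (forall x, A x -> B x) \/ (forall x, B x -> A x)) -> ~ vclosure (fun x => exists A, Fm A /\ A x) v) ->
 exists (E : CBanach) (rho : bop X X -> bop E E) (S : CBanach) (i : bop S X) (q : bop S E) s0, isrep rho /\ (forall s s', i s = i s' -> s = s') /\ i s0 = v /\ q s0 <> 0v /\
  forall T, L0 T -> exists TS : bop S S, i ** TS = T ** i /\ rho T ** q = q ** TS.
Proof.
 intros HR Hch. set (inv := fun A : X -> Prop => forall t x, L0 t -> A x -> A (t x)).
 set (V := fun x => forall A, vsubspace A -> vclosed A -> inv A -> A v -> A x).
 have SV : vsubspace V. { split; [|split]. intros A HA _ _ _; apply HA. intros x y Hx Hy A HA HC HI Av. apply HA; [apply Hx|apply Hy]; auto. intros c x Hx A HA HC HI Av. apply HA, Hx; auto. }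
 have CV : vclosed V. { intros u l Hu Hl A HA HC HI Av. apply (HC u); auto. intros n; apply Hu; auto. }
 have IV : inv V. { intros t x Ht Hx A HA HC HI Av. apply HI, Hx; auto. }
 have vV : V v by (intros A _ _ _ Av; auto).
 destruct (@zorn_sub X (fun A => (forall x, A x -> V x) /\ R A)) as [A [SA [[AV RA] Amax]]].
 - intros Fm HF HA Hc. split. intros x [B [HB Bx]]. apply (HA B HB); auto. apply HR. split. intros t x Ht [B [HB Bx]]. exists B. split; auto. destruct (HA B HB) as [_ [_ HB2]]. apply HR in HB2. now apply HB2. apply Hch; auto. intros B HB. destruct (HA B HB) as [? [? ?]]. auto.
 - split. intros x ->. apply SV. apply HR. split. intros t x _ ->. apply b0. intros H. destruct (vclosure_cv H) as [u [Hu Hl]]. apply Hv. apply (@cv_unique X u); auto. apply (@cv_ext X (fun _ => 0v)). intros n. now rewrite Hu. apply cv_const.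
 - apply HR in RA. destruct RA as [IA vA]. have CA : vclosed A.
  { have H : forall x, vclosure A x -> A x. { apply Amax. now apply vclosure_sub. split. intros x Hx. apply (@vclosure_min X A V); auto. apply HR. split. intros t x Ht Hx. destruct (vclosure_cv Hx) as [u [Hu Hl]]. apply (cv_vclosure (u := fun n => t (u n))). intros; now apply IA. now apply cv_app.
  intros H. apply vA. apply (@vclosure_min X (vclosure A) (vclosure A)) in H; auto. apply vclosure_closed. intros x; apply vclosure_in. }
  intros u l Hu Hl. apply H. now apply (cv_vclosure (u := u)). }
  set (S := subB SV CV). set (i := sinc SV CV : bop S X). set (AS := fun s : S => A (i s)).
  have iinj : forall s s', i s = i s' -> s = s' by apply sinc_inj. have inm : forall s, nm (i s) = nm s by apply sinc_nm. have iin : forall s, V (i s) by apply sinc_in. have isj : forall x, V x -> exists s, i s = x by apply sinc_surj.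
  have SS : vsubspace AS. { unfold AS. split; [|split]. rewrite b0; apply SA. intros x y; rewrite bD; apply SA. intros c x; rewrite bZ; apply SA. }
  have CS : vclosed AS. { intros u l Hu Hl. apply (CA (fun n => i (u n))); auto. }
  destruct (quotient SS CS) as [E [q [Hsj [Hk0 [_ [Hind [Hcp [Hqn Hql]]]]]]]].
  set (Rl := fun T (T' : bop E E) => exists TS : bop S S, i ** TS = T ** i /\ T' ** q = q ** TS /\ nm TS <= nm T).
  have HRl : forall T, L0 T -> exists T', Rl T T'.
  { intros T HT. destruct (@sub_lift X V SV CV S (T ** i)) as [TS [H1 H2]]. intros s. rewrite bmA. apply IV; auto. fold i in H1.
  destruct (Hind TS) as [T' HT']. intros s Hs. unfold AS. rewrite H1, bmA. now apply IA. exists T', TS. split; [|split]; auto. bext s. rewrite bmA. apply H1.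
  apply nm_le. apply nm_ge0. intros s. le_mid (nm (i (TS s))). right; symmetry; apply inm. rewrite H1, bmA. le_by nm_app. right. f_equal. }
  have Hun : forall T T1 T2, Rl T T1 -> Rl T T2 -> T1 = T2.
  { intros T T1 T2 [S1 [H1 [H2 _]]] [S2 [H3 [H4 _]]]. assert (S1 = S2). { bext s. apply iinj. rewrite <- !bmA. now rewrite H1, H3. } subst S2. bext y. destruct (Hsj y) as [s <-]. rewrite <- !bmA. now rewrite H2, H4. }
  destruct (@fun_choice (bop X X) (bop E E) (fun T T' => L0 T -> Rl T T')) as [rho Hrho]. { intros T. destruct (classic (L0 T)) as [H|H]. destruct (HRl T H) as [T' HT']. now exists T'. exists 0v. tauto. }
  have Hmk : forall T T' (TS : bop S S), L0 T -> i ** TS = T ** i -> T' ** q = q ** TS -> rho T = T'.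
  { intros T T' TS HT H1 H2. destruct (Hrho T HT) as [S2 [H3 [H4 _]]]. assert (TS = S2). { bext s. apply iinj. rewrite <- !bmA. now rewrite H1, H3. } subst S2. bext y. destruct (Hsj y) as [s <-]. rewrite <- !bmA. now rewrite H2, H4. }
  destruct (isj v vV) as [s0 Hs0]. destruct HL0 as [L00 [L0a L0s]].
  exists E, rho, S, i, q, s0. split; [|split; [exact iinj|split; [exact Hs0|split]]].
  2: { intros H. apply Hk0 in H. unfold AS in H. rewrite Hs0 in H. apply vA. now apply vclosure_in. }
  2: { intros T HT. destruct (Hrho T HT) as [TS [H1 [H2 _]]]. now exists TS. }
  constructor.
  + intros T U HT HU. destruct (Hrho T HT) as [S1 [H1 [H2 _]]]. destruct (Hrho U HU) as [S2 [H3 [H4 _]]]. apply Hmk with (S1 +v S2); auto. bstep (i ** S1 +v i ** S2). rewrite H1, H3. bring. bstep (rho T ** q +v rho U ** q). rewrite H2, H4. bring.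
  + intros c T HT. destruct (Hrho T HT) as [S1 [H1 [H2 _]]]. apply Hmk with (c *v S1); auto. bstep (c *v (i ** S1)). rewrite H1. bring. bstep (c *v (rho T ** q)). rewrite H2. bring.
  + intros T U HT HU. destruct (Hrho T HT) as [S1 [H1 [H2 _]]]. destruct (Hrho U HU) as [S2 [H3 [H4 _]]]. apply Hmk with (S1 ** S2 -v S2 ** S1); auto.
  bstep ((i ** S1) ** S2 -v (i ** S2) ** S1). rewrite H1, H3. bstep (T ** (i ** S2) -v U ** (i ** S1)). rewrite H1, H3. bring.
  bstep (rho T ** (rho U ** q) -v rho U ** (rho T ** q)). rewrite H2, H4. bstep ((rho T ** q) ** S2 -v (rho U ** q) ** S1). rewrite H2, H4. bring.
  + intros T HT. destruct (Hrho T HT) as [S1 [H1 [H2 H3]]]. le_to H3. apply (quo_op_nm Hql); auto. intros s. rewrite Hqn. now apply vdist_nm.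
  + intros T HT. destruct (Hrho T HT) as [S1 [H1 [H2 H3]]]. apply Hcp with S1; auto. apply (@cpt_sub X V SV CV T). auto. intros s. exact (f_equal (fun f => bf f s) H1).
  (* The preimage of a nonzero closed invariant subspace is strictly larger than [A]; by maximality
     it contains v, and then everything that v generates. *)
  + intros Y SY CY IY. destruct (classic (forall x, Y x -> x = 0v)) as [H|H]. now left. right. apply not_all_ex_not in H. destruct H as [e He]. apply imply_to_and in He. destruct He as [Ye He].
  set (B := fun x => exists s, i s = x /\ Y (q s)).
  have SB : vsubspace B. { split; [|split]. exists 0v. rewrite !b0. split; auto. apply SY. intros x y [s [<- Hs]] [s' [<- Hs']]. exists (s +v s'). rewrite !bD. split; auto. now apply SY. intros c x [s [<- Hs]]. exists (c *v s). rewrite !bZ. split; auto. now apply SY. }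
  have BI : inv B. { intros t x Ht [s [<- Hs]]. destruct (Hrho t Ht) as [S1 [H1 [H2 _]]]. exists (S1 s). rewrite <- !bmA. rewrite H1, <- H2, !bmA. split; auto. }
  have BC : vclosed B. { intros u l Hu Hl. destruct (fun_choice Hu) as [s Hs]. have Vl : V l. { apply (CV u); auto. intros n. destruct (Hs n) as [<- _]. apply iin. } destruct (isj l Vl) as [s' Hs']. exists s'. split; auto. apply (CY (fun n => q (s n))). intros; apply Hs. apply cv_app. intros eps Hep. destruct (Hl eps Hep) as [N HN]. exists N. intros n Hn. specialize (HN n Hn). rewrite <- inm, bD, bN, Hs'. destruct (Hs n) as [-> _]. auto. }
  have Bv : B v. { contra Hn. destruct (Hsj e) as [s Es]. apply He. rewrite <- Es. apply Hk0. apply (Amax B); auto. split. intros x [s' [<- _]]. apply iin. apply HR. split; auto. intros H. apply Hn. apply (@vclosure_min X B B); auto. intros x Ax. destruct (isj x (AV x Ax)) as [s' Hs']. exists s'. split; auto. have Z : q s' = 0v. { apply Hk0. unfold AS. now rewrite Hs'. } rewrite Z. apply SY. exists s. rewrite Es. auto. }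
  intros y. destruct (Hsj y) as [s <-]. have Bs : B (i s). { apply (iin s); auto. } destruct Bs as [s' [E1 Ys]]. apply iinj in E1. now rewrite E1 in Ys.
Qed.

Lemma rep_minus E (rho : bop X X -> bop E E) S T : isrep rho -> L0 S -> L0 T -> rho (S -v T) = rho S -v rho T.
Proof.
 intros H HS HT. destruct HL0 as [_ [_ Hs]]. replace (S -v T) with (S +v (-1)%C *v T) by bring. rewrite (rep_add H), (rep_scal H); auto. bring.
Qed.
Lemma adn_in x z n : L0 x -> L0 z -> L0 (adn x n z).
Proof. intros Hx Hz. induction n; auto. now apply HLb. Qed.
Lemma adn_rep E (rho : bop X X -> bop E E) x z n : isrep rho -> L0 x -> L0 z -> rho (adn x n z) = adn (rho x) n (rho z).
Proof. intros H Hx Hz. induction n; auto. cbn [adn]. rewrite (rep_br H), IHn; auto. now apply adn_in. Qed.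
Lemma adn_S V (x z : bop V V) n : adn x (S n) z = adn x n (x ** z -v z ** x).
Proof. induction n; auto. cbn [adn] in *. now rewrite IHn. Qed.
Definition central x := L0 x /\ forall E (rho : bop X X -> bop E E), isrep rho -> forall y, L0 y -> rho x ** rho y -v rho y ** rho x = 0v.
Lemma central_sub : @vsubspace (BL X) central.
Proof.
 destruct HL0 as [L00 [La Ls]]. split; [|split].
 - split; auto. intros E rho H y Hy. replace (0v : BL X) with (0 *v (0v : BL X)) by vring. rewrite (rep_scal H) by auto. bring.
 - intros a b [A1 A2] [B1 B2]. split; auto. intros E rho H y Hy. rewrite (rep_add H) by auto. bstep ((rho a ** rho y -v rho y ** rho a) +v (rho b ** rho y -v rho y ** rho b)). rewrite (A2 _ _ H y Hy), (B2 _ _ H y Hy). vring.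
 - intros c a [A1 A2]. split; auto. intros E rho H y Hy. rewrite (rep_scal H) by auto. bstep (c *v (rho a ** rho y -v rho y ** rho a)). rewrite (A2 _ _ H y Hy). apply (vs0r (BL E)).
Qed.
Lemma central_ideal a x : L0 a -> central x -> central (a ** x -v x ** a).
Proof.
 intros Ha [H1 H2]. split; auto. intros E rho H y Hy. rewrite (rep_br H) by auto. replace (rho a ** rho x -v rho x ** rho a) with (0v : bop E E). bring. replace (rho a ** rho x -v rho x ** rho a) with (-v (rho x ** rho a -v rho a ** rho x)) by bring. rewrite (H2 _ _ H a Ha). vring.
Qed.
Lemma central_closed (u : nat -> bop X X) x : (forall n, central (u n)) -> L0 x -> cv u x -> central x.
Proof.
 intros Hu Hx Hc. split; auto. intros E rho H y Hy.
 have Hr : cv (fun n => rho (u n)) (rho x). { intros eps He. destruct (Hc eps He) as [N HN]. exists N. intros n Hn. eapply Rle_lt_trans. 2: apply (HN n Hn). destruct (Hu n) as [H1 _]. rewrite <- (rep_minus H H1 Hx). apply (rep_nm H). apply vsub_minus; auto. }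
 apply (@cv_unique (BL E) (fun n => rho (u n) ** rho y -v rho y ** rho (u n))).
 - apply (@cv_plus (BL E) (fun n => rho (u n) ** rho y) (fun n => -v (rho y ** rho (u n)))). apply cv_comp; auto; apply cv_const. apply (@cv_opp (BL E)), cv_comp; auto; apply cv_const.
 - apply (@cv_ext (BL E) (fun _ => 0v)). intros n. symmetry. now apply Hu. apply cv_const.
Qed.
Hypothesis HES : Esolv L0.
(** Otherwise E-solvability applies to the ideal [central] and yields a larger J whose elements are
    Engel modulo [central]. Their images are [esmall], so [engel_ideal_central] makes J central. *)
Lemma all_central x : L0 x -> central x.
Proof.
 intros Hx. contra Hn. destruct (@HES central central_sub) as [J [SJ [JL [JI [[y [Jy Hy]] Hd]]]]].
 { intros z Hz; apply Hz. } { apply central_ideal. } { apply central_closed. } { now exists x. }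
 apply Hy. split; auto. intros E rho H t Ht. destruct HL0 as [L00 [La Ls]]. destruct SJ as [J0 [Ja Js]]. set (LL := fun T => exists S, L0 S /\ T = rho S).
 replace (rho y ** rho t -v rho t ** rho y) with (-v (rho t ** rho y -v rho y ** rho t)) by bring. rewrite (@engel_ideal_central E LL) with (JJ := fun T => exists S, J S /\ T = rho S); try vring.
 - intros T [S [HS ->]]. now apply (rep_cpt H).
 - split; [|split]. exists 0v. split; auto. replace (0v : BL X) with (0 *v (0v : BL X)) by vring. rewrite (rep_scal H) by auto. vring.
  intros a b [S [HS ->]] [T [HT ->]]. exists (S +v T). rewrite (rep_add H); auto. intros c a [S [HS ->]]. exists (c *v S). rewrite (rep_scal H); auto.
 - intros Y SY CY IY. apply (rep_irr H SY CY). intros s z Hs. apply IY. now exists s.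
 - split; [|split]. exists 0v. split; auto. replace (0v : BL X) with (0 *v (0v : BL X)) by vring. rewrite (rep_scal H) by auto. vring.
  intros a b [S [HS ->]] [T [HT ->]]. exists (S +v T). rewrite (rep_add H); auto. intros c a [S [HS ->]]. exists (c *v S). rewrite (rep_scal H); auto.
 - intros T [S [HS ->]]. exists S. auto.
 - intros a b [S [HS ->]] [T [HT ->]]. exists (S ** T -v T ** S). rewrite (rep_br H); auto.
 - intros T [S [HS ->]] T' [z [Hz ->]] d Hd0. have HSz : J (S ** z -v z ** S). { replace (S ** z -v z ** S) with ((-1)%C *v (z ** S -v S ** z)) by bring. auto. }
  destruct (Hd S _ d HS HSz Hd0) as [M [HM HMn]]. assert (HS' := JL S HS). set (C0 := nm (rho z) + nm (rho S ** rho z -v rho z ** rho S) / d). have N0 := nm_ge0 (rho S). have N1 := nm_ge0 (rho z). have N2 := nm_ge0 (rho S ** rho z -v rho z ** rho S).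
  have HC1 : 0 <= nm (rho S ** rho z -v rho z ** rho S) / d by (apply div_ge0; auto). have HC2 : 0 <= 2 * nm (rho S) * M / (d * d) by (apply div_ge0; [repeat apply mul_ge0; lra|nra]).
  exists (C0 + 2 * nm (rho S) * M / (d * d)). split. unfold C0. lra. intros [|[|n]].
  + cbn [adn pow]. unfold C0. lra. + cbn [adn pow]. le_mid (nm (rho S ** rho z -v rho z ** rho S) / d * (d * 1)). right; field; lra. apply mul_le_r. lra. unfold C0. lra.
  (* The first bracket brings z into J, the next n approach a central i, and the last one
     annihilates the image of i. The two extra brackets account for the division by d^2. *)
  + destruct (HMn n) as [i [[Hi1 Hi2] Hin]]. rewrite adn_S. rewrite <- (rep_br H) by auto. cbn [adn]. rewrite <- (adn_rep n H HS') by auto. set (w := adn S n (S ** z -v z ** S)) in *. have Hw : L0 w by (apply adn_in; auto).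
  have Hwi : nm (rho w -v rho i) <= M * d ^ n. { rewrite <- (rep_minus H Hw Hi1). le_to Hin. apply (rep_nm H). apply vsub_minus; auto. }
  replace (rho S ** rho w -v rho w ** rho S) with (rho S ** (rho w -v rho i) -v (rho w -v rho i) ** rho S). 2: { bstep ((rho S ** rho w -v rho w ** rho S) +v (rho i ** rho S -v rho S ** rho i)). rewrite (Hi2 _ _ H S HS'). vring. }
  le_by nm_sub. have Q1 := nm_comp (rho S) (rho w -v rho i). have Q2 := nm_comp (rho w -v rho i) (rho S). have Q3 : nm (rho S) * nm (rho w -v rho i) <= nm (rho S) * (M * d ^ n) by (apply mul_le_l; auto).
  le_mid (2 * nm (rho S) * M / (d * d) * (d ^ Datatypes.S (Datatypes.S n))). cbn [pow]. replace (2 * nm (rho S) * M / (d * d) * (d * (d * d ^ n))) with (2 * (nm (rho S) * (M * d ^ n))) by (field; lra). lra. apply mul_le_r. apply pow_le; lra. unfold C0. lra.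
 - now exists t. - now exists y.
Qed.
Lemma W_cpt_in (f : nat -> bop X X) w j : (forall i, cpt (f i)) -> In j w -> cpt (W f w).
Proof. intros Hf. destruct w as [|i w]; intros []; cbn [W]; now apply cpt_compr. Qed.
(** An eigenvector v of the compact word, with nonzero eigenvalue, survives in an irreducible
    subquotient by [irr_subquotient]. There commutators act as 0, hence so does the word. *)
Lemma word_quasinilpotent (f : nat -> bop X X) a b j w : (forall i, L0 (f i)) -> L0 a -> L0 b -> (exists c : C, f j = c *v (a ** b -v b ** a)) -> In j w -> rb (W f w) 0.
Proof.
 intros Hf Ha Hb [c Hc] Hj. set (K := W f w). have HK : cpt K. { apply W_cpt_in with j; auto. } apply cpt_rb0; auto. intros lam v Hl Ev. contra Hv.
 have Hlp := proj1 (Cmod_gt_0 lam) Hl. destruct (RD HK Hlp) as [ks [P [r [Hks [HP [HPc [HpP [Hr [Hrb HcP]]]]]]]]]. have cKP := HPc K (comm_refl K).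
 set (Q := bid X -v P) in *. have HQ : Q ** Q = Q by now apply idem_compl. have EP : P = bid X -v Q by (unfold Q; bring).
 have cKQ : K ** Q = Q ** K by exact (comm_idsub cKP). have Pv : P v = v by exact (RD_eigen Hrb cKP HP (conj (Rlt_le _ _ (proj1 Hr)) (proj2 Hr)) Ev).
 have WI : forall (A : X -> Prop) l x, (forall t x, L0 t -> A x -> A (t x)) -> A x -> A (W f l x). { intros A l x HA Hx. induction l; cbn [W]. now rewrite b1A. rewrite bmA. auto. }
 have Hcl : forall A, vsubspace A -> (forall t x, L0 t -> A x -> A (t x)) -> forall x, vclosure A x -> vclosure A (P x).
 { intros A SA IA x Hx. apply (@riesz_proj_inv X K P Q r (Cmod lam) (vclosure A) HQ cKQ Hrb (proj2 Hr) (vclosure_sub SA) (@vclosure_closed X A)) with (ks := ks); auto.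
  - intros y Hy. destruct (vclosure_cv Hy) as [u [Hu Hl']]. apply (cv_vclosure (u := fun n => K (u n))). intros n. now apply WI. now apply cv_app. - intros k Hk. now apply Hks. }
 destruct (@irr_subquotient v Hv (fun A => (forall t x, L0 t -> A x -> A (t x)) /\ ~ vclosure A v)) as [E [rho [S [i [q [s0 [Hrep [Hi [Hs0 [Hq HT]]]]]]]]]].
 - tauto.
 (* The Riesz projection P is compact, preserves the closures of invariant subspaces and fixes v. By
    [CH], the P-fixed parts of these closures along the chain are all contained in that of one
    member, whose closure would therefore contain v. *)
 - intros Fm HF HA Hch Hcv.
  have HB : exists A, Fm A /\ forall B x, Fm B -> vclosure B x -> P x = x -> vclosure A x.
  { contra Hno. destruct HF as [A0 HA0]. destruct (@dep_choice (X -> Prop) Fm (fun _ A B => (forall x, A x -> B x) /\ exists x, vclosure B x /\ P x = x /\ ~ vclosure A x) A0 HA0) as [An [_ [Hn HR]]].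
  - intros _ A FA. contra H. apply Hno. exists A. split; auto. intros B x FB HBx Px. contra Hx. apply H. exists B. split; auto. split. 2: now exists x. destruct (Hch A B FA FB) as [H1|H1]; auto. exfalso. apply Hx. apply (@vclosure_min X B (vclosure A)); auto. intros y Hy. now apply vclosure_in, H1. apply vclosure_closed.
  - have Sn : forall n, vsubspace (An n) by (intros n; now apply HA).
  apply (@CH X P (fun n x => vclosure (An n) x /\ P x = x) (fun _ => RtoC 1) 1 HcP). lra. intros; rewrite Cmod_1; lra.
  + intros n. have S1 := vclosure_sub (Sn n). split; [|split]. split. apply S1. apply b0. intros x y [H1 H2] [H3 H4]. split. now apply S1. now rewrite bD, H2, H4. intros k x [H1 H2]. split. now apply S1. now rewrite bZ, H2.
  + intros n u l Hu Hl'. split. apply (vclosure_closed (u := u)); auto. intros m; apply Hu. apply (@cv_unique X u); auto. apply (@cv_ext X (fun m => P (u m))). intros m; apply Hu. now apply cv_app.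
  + intros n x [H1 H2]. split; auto. apply (@vclosure_min X (An n) (vclosure (An (S n)))); auto. intros y Hy. apply vclosure_in. now apply HR. apply vclosure_closed.
  + intros n. destruct (HR n) as [_ [x [H1 [H2 H3]]]]. exists x. split; auto. tauto.
  + intros n x [H1 H2]. rewrite H2. replace (x -v 1 *v x) with (0v : X) by vring. split. apply (vclosure_sub (Sn n)). apply b0. }
  destruct HB as [A [FA HB]]. destruct (HA A FA) as [SA [IA HvA]]. apply HvA. destruct (vclosure_cv Hcv) as [y [Hy Hl']]. apply (@vclosure_closed X A (fun n => P (y n))). 2: { rewrite <- Pv. now apply cv_app. }
  intros n. destruct (Hy n) as [B [FB By]]. destruct (HA B FB) as [SB [IB _]]. apply (HB B); auto. apply Hcl; auto. now apply vclosure_in. rewrite <- bmA. now rewrite HP.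
 (* The word upstairs induces the word in the representing operators, so the image of v is an
    eigenvector of the latter. *)
 - have HW : forall l s, exists s', i s' = W f l (i s) /\ q s' = W (fun k => rho (f k)) l (q s).
  { induction l as [|k l IH]; intros s; cbn [W]. exists s. now rewrite !b1A. destruct (IH s) as [s' [H1 H2]]. destruct (HT (f k) (Hf k)) as [TS [H3 H4]]. exists (TS s'). rewrite !bmA, <- H1, <- H2, <- !bmA. now rewrite H3, H4. }
  destruct (HW w s0) as [s' [H1 H2]]. have E1 : s' = lam *v s0. { apply Hi. rewrite bZ, H1, Hs0. exact Ev. }
  have Hc0 : rho (f j) = 0v. { rewrite Hc, (rep_scal Hrep), (rep_br Hrep) by auto. rewrite (proj2 (all_central Ha) _ _ Hrep b Hb). apply (vs0r (BL E)). }
  have HW0 : W (fun k => rho (f k)) w = 0v. { clear - Hj Hc0. induction w as [|k l IH]. destruct Hj. cbn [W]. destruct Hj as [->|Hj]. rewrite Hc0. bring. rewrite IH by auto. bring. }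
  apply Hq. rewrite HW0, b0A, E1, bZ in H2. rewrite <- (vs1 (q s0)), <- (Cinv_l lam), <- vsA, H2 by auto. apply vs0r.
Qed.
End Rep.

(** * Powers of a sum estimated in two norms *)

Section Words.
Variables (Z : CBanach) (A G : bop Z Z).
(* The sum of the products of [n] factors [A] or [G], exactly [j] of which are [G]. *)
Fixpoint wsum n j : bop Z Z := match n with O => match j with O => bid Z | _ => 0v end | S n => A ** wsum n j +v match j with O => 0v | S j => G ** wsum n j end end.
Lemma wsum_zero n : forall j, (n < j)%nat -> wsum n j = 0v.
Proof. induction n; intros [|j] Hj; try lia; cbn [wsum]; auto. rewrite !IHn by lia. bring. Qed.
Lemma wsum_total n : forall J, (n < J)%nat -> @vsum (BL Z) J (wsum n) = (A +v G) ^^ n.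
Proof.
 have H : forall n J, @vsum (BL Z) (S J) (wsum (S n)) = A ** @vsum (BL Z) (S J) (wsum n) +v G ** @vsum (BL Z) J (wsum n).
 { intros m. induction J. cbn [vsum wsum]. bring. cbn [vsum] in *. rewrite IHJ. cbn [wsum]. bring. }
 induction n; intros J HJ. induction J as [|[|J] IH]. lia. cbn [vsum wsum bpow]. bring. cbn [vsum] in *. rewrite IH by lia. cbn [wsum bpow]. bring.
 destruct J as [|J]. lia. rewrite H, !IHn by lia. cbn [bpow]. bring.
Qed.
(** [B x t] reads: the size of x is at most t. This covers a norm restricted to the elements of a
    subspace as well as a bound for another norm, so that one estimate serves for both. *)
Definition cone (B : Z -> R -> Prop) := B 0v 0 /\ (forall x t u, B x t -> t <= u -> B x u) /\ (forall x y t u, B x t -> B y u -> B (x +v y) (t + u)).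
Lemma wsum_bound B s g x t : cone B -> 0 <= s -> 0 <= g -> 0 <= t -> (forall x t, B x t -> B (A x) (s * t)) -> (forall x t, B x t -> B (G x) (g * t)) -> B x t ->
 forall n j, (j <= n)%nat -> B (wsum n j x) (2 ^ n * (s ^ (n - j) * g ^ j) * t).
Proof.
 intros [B0 [Bm Ba]] Hs Hg Ht HA HG Hx. induction n as [|n IH]; intros j Hj.
 - replace j with O by lia. cbn [wsum pow Nat.sub]. rewrite b1A. eapply Bm. apply Hx. lra.
 - have HP : forall i j, 0 <= 2 ^ n * (s ^ i * g ^ j) * t by (intros; repeat apply mul_ge0; auto; apply pow_le; lra). cbn [wsum]. rewrite baA, bmA. destruct j as [|j].
  + eapply Bm. apply Ba. apply HA, IH. lia. rewrite b0A. apply B0. rewrite !Nat.sub_0_r. cbn [pow]. have Q := HP (S n) O. cbn [pow] in Q. lra.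
  + rewrite bmA. have Q := HP (n - j)%nat (S j). replace (S n - S j)%nat with (n - j)%nat by lia. destruct (Nat.eq_dec j n) as [->|Hn].
  * rewrite wsum_zero, b0A, b0 by lia. eapply Bm. apply Ba. apply B0. apply HG, IH. lia. cbn [pow] in *. lra.
  * eapply Bm. apply Ba. apply HA, IH. lia. apply HG, IH. lia. replace (n - j)%nat with (S (n - S j)) in * by lia. cbn [pow] in *. lra.
Qed.
Lemma wsum_power (B B' : Z -> R -> Prop) s g h h' mu C0 x t t' : cone B -> cone B' -> 0 <= s <= g -> 0 <= h' <= h -> 0 <= t -> 0 <= t' -> 0 <= C0 -> s * g <= mu -> h * h' <= mu ->
 (forall x t, B x t -> B (A x) (s * t)) -> (forall x t, B x t -> B (G x) (g * t)) -> (forall x t, B' x t -> B' (A x) (h * t)) -> (forall x t, B' x t -> B' (G x) (h' * t)) ->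
 (forall x t, B x t -> nm x <= t) -> (forall x t, B' x t -> nm x <= C0 * t) -> B x t -> B' x t' -> forall m, nm (((A +v G) ^^ (2 * m)) x) <= (t + C0 * t') * (16 * mu) ^ m.
Proof.
 intros HB HB' Hs Hh Ht Ht' HC Hsg Hhh H1 H2 H3 H4 H5 H6 Hx Hx' m. rewrite <- (@wsum_total (2 * m) (S (2 * m))) by lia. rewrite vsum_app2.
 have Hmu : 0 <= mu ^ m by (apply pow_le; nra). have Hct : 0 <= C0 * t' by now apply mul_ge0.
 have Hp : forall a b j, 0 <= a <= b -> (j <= m)%nat -> a * b <= mu -> a ^ (2 * m - j) * b ^ j <= mu ^ m.
 { intros a b j Hab Hj Hm. le_mid ((a * b) ^ m). 2: apply pow_incr; nra. replace (2 * m - j)%nat with (m + (m - j))%nat by lia. rewrite pow_add, Rpow_mult_distr. replace (b ^ m) with (b ^ (m - j) * b ^ j) by (rewrite <- pow_add; f_equal; lia).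
  have Q1 : a ^ (m - j) <= b ^ (m - j) by (apply pow_incr; auto). rewrite Rmult_assoc. apply mul_le_l. apply pow_le; lra. apply mul_le_r; auto. apply pow_le; lra. }
 eapply Rle_trans. apply vsum_nm with (M := 2 ^ (2 * m) * mu ^ m * (t + C0 * t')).
 - intros j Hj. have H2m : 0 <= 2 ^ (2 * m) by (apply pow_le; lra). destruct (Nat.le_gt_cases j m) as [Hjm|Hjm].
  + have Q := H5 _ _ (@wsum_bound B s g x t HB ltac:(lra) ltac:(lra) Ht H1 H2 Hx (2 * m)%nat j ltac:(lia)). le_by Q. apply Rmult_le_compat; try lra. 2: apply mul_le_l; auto; apply Hp; auto; lra. repeat apply mul_ge0; auto; apply pow_le; lra.
  + have Q := H6 _ _ (@wsum_bound B' h h' x t' HB' ltac:(lra) ltac:(lra) Ht' H3 H4 Hx' (2 * m)%nat j ltac:(lia)). le_by Q. le_mid (C0 * (2 ^ (2 * m) * mu ^ m * t')).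
  apply mul_le_l; auto. apply mul_le_r; auto. apply mul_le_l; auto. rewrite Rmult_comm. replace j with (2 * m - (2 * m - j))%nat at 1 by lia. apply Hp; auto. lia. lra.
  assert (0 <= 2 ^ (2 * m) * mu ^ m) by (apply mul_ge0; auto). nra.
 - rewrite pow_mult, Rpow_mult_distr. replace (2 ^ 2) with 4 by ring. replace (16 ^ m) with (4 ^ m * 4 ^ m) by (rewrite <- Rpow_mult_distr; f_equal; ring). have Q : INR (S (2 * m)) <= 4 ^ m.
  { clear. induction m. cbn. lra. replace (2 * S m)%nat with (S (S (2 * m))) by lia. cbn [pow]. rewrite !S_INR in *. have Q := pow_le 4 m. have R0 := pos_INR (2 * m). lra. }
  assert (0 <= 4 ^ m) by (apply pow_le; lra). replace ((t + C0 * t') * (4 ^ m * 4 ^ m * mu ^ m)) with (4 ^ m * (4 ^ m * mu ^ m * (t + C0 * t'))) by ring. apply mul_le_r; auto. repeat apply mul_ge0; lra.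
Qed.
End Words.

(** * Normal ordering of the powers of ad a + ad b *)

Section Sum.
Variables (Z : CBanach) (al be ga : bop Z Z).
Hypothesis Hga : al ** be -v be ** al = ga.
Let D := al +v be.
(** The binomial sum with all [al] to the left of all [be]: what the M-th power of al + be would be
    if the two commuted. *)
Fixpoint SM M : bop Z Z := match M with O => bid Z | S M => al ** SM M +v SM M ** be end.
Lemma SM_small (B : Z -> R -> Prop) d C0 : cone B -> 0 <= d -> 0 <= C0 -> (forall p x t, B x t -> B ((al ^^ p) x) (C0 * d ^ p * t)) -> (forall p x t, B x t -> B ((be ^^ p) x) (C0 * d ^ p * t)) ->
 forall M x t, B x t -> B (SM M x) (C0 * C0 * (2 * d) ^ M * t).
Proof.
 intros [B0 [Bm Ba]] Hd HC H1 H2 M. have H : forall p q x t, B x t -> B ((al ^^ p) (SM M ((be ^^ q) x))) (C0 * C0 * d ^ (p + q) * (2 * d) ^ M * t).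
 { induction M; intros p q x t Hx. cbn [SM]. rewrite b1A. eapply Bm. apply H1, H2, Hx. right. rewrite pow_add, pow_O. ring.
  replace ((al ^^ p) (SM (S M) ((be ^^ q) x))) with ((al ^^ S p) (SM M ((be ^^ q) x)) +v (al ^^ p) (SM M ((be ^^ S q) x))).
  eapply Bm. apply Ba. apply IHM, Hx. apply IHM, Hx. right. rewrite Nat.add_succ_r. cbn [pow Nat.add]. ring. cbn [SM]. rewrite baA, bD, !bmA. f_equal. rewrite bpow_S, bmA. auto. }
 intros x t Hx. have Q := H O O x t Hx. cbn [bpow Nat.add pow] in Q. rewrite !b1A, Rmult_1_r in Q. auto.
Qed.
(** Raising the exponent creates the error [be, D^M], and each commutator of be with D is -ga; so
    every error term carries a factor [ga]. The constant depends only on [k2] and [M], which allows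
    [rho] to be chosen after it. *)
Lemma Gam_small k2 M : 0 <= k2 -> exists K, 0 <= K /\ forall (B : Z -> R -> Prop) rho, 0 <= rho -> cone B -> (forall x t, B x t -> B (-v x) t) ->
 (forall x t, B x t -> B (al x) (k2 * t)) -> (forall x t, B x t -> B (be x) (k2 * t)) -> (forall x t, B x t -> B (ga x) (rho * t)) ->
 forall x t, B x t -> B ((D ^^ M -v SM M) x) (K * rho * t).
Proof.
 intros Hk. set (k4 := k2 + k2). set (e := fix e M := match M with O => 0 | S M => k4 ^ M + k4 * e M end). have Hk4 : 0 <= k4 by (unfold k4; lra).
 have He : forall M, 0 <= e M. { induction M0; cbn [e]. lra. assert (0 <= k4 ^ M0) by now apply pow_le. nra. }
 have Hcom : forall (B : Z -> R -> Prop) rho, 0 <= rho -> cone B -> (forall x t, B x t -> B (-v x) t) ->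
  (forall x t, B x t -> B (al x) (k2 * t)) -> (forall x t, B x t -> B (be x) (k2 * t)) -> (forall x t, B x t -> B (ga x) (rho * t)) ->
  forall n, (forall x t, B x t -> B ((D ^^ n) x) (k4 ^ n * t)) /\ forall x t, B x t -> B ((be ** D ^^ n -v D ^^ n ** be) x) (e n * rho * t).
 { intros B rho Hr [B0 [Bm Ba]] Bn Hal Hbe Hgam. have HD : forall x t, B x t -> B (D x) (k4 * t). { intros x t Hx. unfold D. rewrite baA. eapply Bm. apply Ba; [apply Hal, Hx|apply Hbe, Hx]. unfold k4. lra. }
  induction n as [|n [I1 I2]]. split; intros x t Hx; cbn [bpow pow e]. rewrite b1A. eapply Bm. apply Hx. lra. replace ((be ** bid Z -v bid Z ** be) x) with (0v : Z). eapply Bm. apply B0. lra. rewrite baA, boA, !bmA, !b1A. vring.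
  split; intros x t Hx. cbn [bpow]. rewrite bmA. eapply Bm. apply HD, I1, Hx. cbn [pow]. lra.
  replace ((be ** D ^^ S n -v D ^^ S n ** be) x) with (-v ga ((D ^^ n) x) +v D ((be ** D ^^ n -v D ^^ n ** be) x)). eapply Bm. apply Ba. apply Bn, Hgam, I1, Hx. apply HD, I2, Hx. cbn [e]. right; ring.
  rewrite <- Hga. unfold D. cbn [bpow]. set (Dn := (al +v be) ^^ n). bpush. vring. }
 induction M as [|M [K [HK IH]]]. exists 0. split. lra. intros B rho Hr [B0 [Bm Ba]] Bn H1 H2 H3 x t Hx. cbn [bpow SM]. rewrite vaddN. rewrite b0A. eapply Bm. apply B0. lra.
 exists (k4 * K + e M). split. specialize (He M). nra. intros B rho Hr HB Bn H1 H2 H3 x t Hx. destruct (Hcom B rho Hr HB Bn H1 H2 H3 M) as [_ I2]. specialize (IH B rho Hr HB Bn H1 H2 H3). destruct HB as [B0 [Bm Ba]].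
 replace ((D ^^ S M -v SM (S M)) x) with (al ((D ^^ M -v SM M) x) +v (D ^^ M -v SM M) (be x) +v (be ** D ^^ M -v D ^^ M ** be) x).
 eapply Bm. apply Ba. apply Ba. apply H1, IH, Hx. apply IH, H2, Hx. apply I2, Hx. unfold k4. right; ring.
 unfold D. cbn [bpow SM]. set (Dn := (al +v be) ^^ M). bpush. vring.
Qed.
End Sum.

(** * The sum of two Engel elements *)

Section EngelSum.
Variables (X : CBanach) (LL L0 : bop X X -> Prop) (a b : bop X X).
Hypothesis (SL : @vsubspace (BL X) LL) (LLb : forall S T, LL S -> LL T -> LL (S ** T -v T ** S)) (HL : forall T, L0 T -> LL T).
Hypothesis (HL0 : @vsubspace (BL X) L0) (HLb : forall S T, L0 S -> L0 T -> L0 (S ** T -v T ** S)) (HLc : forall T, L0 T -> cpt T).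
Hypothesis HES : Esolv L0.
Hypothesis (Ha : L0 a) (Hb : L0 b).
Definition engelb x := forall d, 0 < d -> exists M, 0 <= M /\ forall n z, LL z -> nm (adn x n z) <= M * d ^ n * nm z.
Definition ad (x : bop X X) : bop (BL X) (BL X) := Lm x -v Rm x.
Lemma adE x z : ad x z = x ** z -v z ** x.
Proof. unfold ad. rewrite baA, boA, LmE, RmE. auto. Qed.
Lemma ad_pow x n z : (ad x ^^ n) z = adn x n z.
Proof. induction n; cbn [bpow adn]. apply b1A. now rewrite bmA, IHn, adE. Qed.
Lemma ad_add x y : ad (x +v y) = ad x +v ad y.
Proof. bext z. rewrite baA, !adE. bring. Qed.
(** [BW] for a, b and R [a,b]: a word without commutator is bounded by the norms, and a word with
    one is quasinilpotent. The bound kap on R [a,b] becomes kap/R on [a,b]. *)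
Lemma adapted_norm R : 0 < R -> exists Nn M, isnm Nn M /\ let kap := nm a + nm b + 1 in
 (forall x, Nn (a x) <= kap * Nn x) /\ (forall x, Nn (b x) <= kap * Nn x) /\ forall x, Nn ((a ** b -v b ** a) x) <= kap / R * Nn x.
Proof.
 intros HR. destruct SL as [_ [_ _]]. destruct HL0 as [L00 [La Ls]]. set (c := a ** b -v b ** a). have Hc : L0 c by now apply HLb. have Na := nm_ge0 a. have Nb := nm_ge0 b.
 set (f := fun i => match i with O => a | 1%nat => b | _ => R *v c end : bop X X). have Hf : forall i, L0 (f i) by (intros [|[|i]]; cbn; auto).
 destruct (@BW X f 3%nat (nm a + nm b) (nm a + nm b + 1)) as [Nn [M [HN Hn]]].
 - lra.
 - intros i _. exists (RtoC 0), (f i). split; [|split]. bring. auto. rewrite Cmod_0. lra.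
 - intros w Hw Hlen. have Hp : 0 <= (nm a + nm b) ^ length w by (apply pow_le; lra). destruct (in_dec Nat.eq_dec 2%nat w) as [Hi|Hi].
  + apply rb_le with 0; auto. apply (@word_quasinilpotent X L0 HL0 HLb HLc HES f a b 2%nat w); auto. now exists (RtoC R).
  + apply rb_nmle. clear Hlen Hp. induction w as [|i w IH]; cbn [W length pow]. apply nm_id. have Q : nm (W f w) <= (nm a + nm b) ^ length w. { apply IH. intros j Hj. apply Hw. now right. intros Hj. apply Hi. now right. } le_by nm_comp. apply Rmult_le_compat; auto; try apply nm_ge0.
  have Hi3 := Hw i (or_introl eq_refl). destruct i as [|[|[|i]]]; cbn [f]; try lra; try lia. exfalso. apply Hi. now left.
 - exists Nn, M. split; auto. split; [|split]. intros x. apply (Hn O); lia. intros x. apply (Hn 1%nat); lia.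
  intros x. destruct HN as [_ [_ [_ Hs]]]. have Q := Hn 2%nat x ltac:(lia). cbn [f] in Q. replace (c x) with (RtoC (/ R) *v (R *v c) x). 2: { rewrite bsA, vsA, <- RtoC_mult, Rinv_l by lra. apply vs1. }
  le_by Hs. have HRi := inv_gt0 _ HR. rewrite Cmod_R, Rabs_pos_eq by lra. le_mid (/ R * ((nm a + nm b + 1) * Nn x)). apply mul_le_l; lra. right. field. lra.
Qed.
(** The choices are made in this order: eta, then the decay rate d and its constants, then M, then
    rho, and only then the adapted norm. *)
Theorem engel_add : engelb a -> engelb b -> engelb (a +v b).
Proof.
 intros Ea Eb eta He. set (D := ad a +v ad b). set (Dn := nm D + 1). have HDn : 1 <= Dn by (unfold Dn; assert (Q := nm_ge0 D); lra).
 set (d := Rmin (eta ^ 2 / (8 * Dn)) (Dn / 2)). have He2 : 0 < eta ^ 2 by (apply pow_lt; auto).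
 have Hd : 0 < d by (apply Rmin_glb_lt; apply div_gt0; lra). have Hd1 : 2 * d * Dn <= eta ^ 2 * (1/4). { have Q : d <= eta ^ 2 / (8 * Dn) by apply Rmin_l. apply Rle_div_r in Q; lra. }
 have Hd2 : 2 * d <= Dn by (have Q : d <= Dn / 2 by apply Rmin_r; lra).
 destruct (Ea d Hd) as [Ca [HCa Ca1]]. destruct (Eb d Hd) as [Cb [HCb Cb1]]. set (C0 := Ca + Cb). have HC0 : 0 <= C0 by (unfold C0; lra). set (c2 := C0 * C0). have Hc2 : 0 <= c2 by (apply mul_ge0; auto).
 (* [d] was chosen so that (2 d Dn)^M is at most eta^(2M) (1/4)^M; a large M then absorbs the
    constants, which do not depend on M, and gives s g <= mu. *)
 destruct (@pow_half_small (16 * (c2 * (1 + c2))) 1) as [M' HM']. lra. set (M := S M'). have HM := HM' M ltac:(unfold M; lia).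
 set (s := C0 * C0 * (2 * d) ^ M). set (g := Dn ^ M + s). set (mu := (eta ^ 2) ^ M / 16). have HDM : 1 <= Dn ^ M by (apply pow_R1_Rle; lra).
 have Hs0 : 0 <= s by (apply mul_ge0; auto; apply pow_le; lra). have Heta : 0 < (eta ^ 2) ^ M by (apply pow_lt; auto).
 have Hsg : s * g <= mu.
 { have Q1 : s <= c2 * Dn ^ M by (apply mul_le_l; auto; apply pow_incr; lra). have Q2 : s * Dn ^ M = c2 * (2 * d * Dn) ^ M by (unfold s; rewrite (Rpow_mult_distr (2 * d) Dn); unfold c2; ring).
  have Q3 : (2 * d * Dn) ^ M <= (eta ^ 2) ^ M * (1/4) ^ M. { rewrite <- Rpow_mult_distr. apply pow_incr. split; auto. repeat apply mul_ge0; lra. }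
  have Q4 : (1/4) ^ M <= (1/2) ^ M by (apply pow_incr; lra). have Q5 : s * g <= s * Dn ^ M * (1 + c2) by (unfold g; nra).
  have Q6 : (2 * d * Dn) ^ M <= (eta ^ 2) ^ M * (1/2) ^ M by (eapply Rle_trans; [apply Q3|apply mul_le_l; lra]). unfold mu. rewrite Q2 in Q5.
  have Q7 : c2 * (2 * d * Dn) ^ M * (1 + c2) <= c2 * ((eta ^ 2) ^ M * (1/2) ^ M) * (1 + c2). { apply mul_le_r. lra. now apply mul_le_l. }
  have Q8 : (16 * (c2 * (1 + c2)) * (1 / 2) ^ M) * (eta ^ 2) ^ M <= 1 * (eta ^ 2) ^ M by (apply mul_le_r; lra). lra. }
 have Hmu : 0 < mu by (unfold mu; lra). set (kap := nm a + nm b + 1). have Hkap : 1 <= kap. { unfold kap. have Na := nm_ge0 a. have Nb := nm_ge0 b. lra. }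
 have Hga : ad a ** ad b -v ad b ** ad a = ad (a ** b -v b ** a). { bext z. rewrite baA, boA, !bmA, !adE. bring. }
 destruct (@Gam_small (BL X) (ad a) (ad b) _ Hga (2 * kap) M) as [K [HK HG]]. lra. set (h := (2 * (2 * kap)) ^ M). have Hh1 : 1 <= h by (apply pow_R1_Rle; lra).
 (* Makes the error term, of size K rho in the adapted norm, smaller than mu/h, where h bounds the
    normally ordered part in that norm. *)
 set (rho := Rmin 1 mu / ((K + 1) * h)). have Hmin : 0 < Rmin 1 mu by (apply Rmin_glb_lt; lra). have Hrho : 0 < rho by (apply div_gt0; auto; apply Rmult_lt_0_compat; lra).
 assert (Hh' : K * rho * h <= Rmin 1 mu). { le_mid ((K + 1) * rho * h). apply mul_le_r. lra. apply mul_le_r; lra. right. unfold rho. field. lra. }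
 have Hm1 := Rmin_l 1 mu. have Hm2 := Rmin_r 1 mu. have HKr : 0 <= K * rho by (apply mul_ge0; lra).
 have HKh : K * rho <= h by nra. have HhK : h * (K * rho) <= mu by lra.
 destruct (@adapted_norm (2 * kap / rho)) as [Nn [Mn [HN [Na [Nb Nc]]]]]. apply div_gt0; lra. fold kap in Na, Nb, Nc. replace (kap / (2 * kap / rho)) with (rho / 2) in Nc by (field; lra).
 have Nn0 : forall x, 0 <= Nn x by (intros; eapply isnm_ge0; eauto). destruct HN as [HMn [HN1 [HN2 HN3]]]. have Nneg : forall x, Nn (-v x) <= Nn x. { intros x. replace (-v x) with (RtoC (-1) *v x) by vring. le_by HN3. rewrite Cmod_R, Rabs_left by lra. lra. }
 (* The first size lives on the Lie algebra alone, where the Engel estimates hold; the second is the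
    operator bound for the adapted norm. *)
 set (B := fun (x : BL X) t => LL x /\ nm x <= t). set (B' := fun (x : BL X) t => 0 <= t /\ forall y, Nn (bf x y) <= t * Nn y). destruct SL as [SL0 [SLa SLs]].
 have HB : cone B. { split; [|split]. split; auto. rewrite nm0; lra. intros x t u [H1 H2] H. split; auto; lra. intros x y t u [H1 H2] [H3 H4]. split; auto. le_by nm_tri. lra. }
 assert (HB' : cone B'). { split; [|split]. split. lra. intros y. rewrite b0A. replace (0v : X) with (0 *v (0v : X)) by vring. le_by HN3. rewrite Cmod_0. lra. intros x t u [H1 H2] H. split. lra. intros y. le_by H2. apply mul_le_r; auto. intros x y t u [H1 H2] [H3 H4]. split. lra. intros z. rewrite baA. le_by HN2. specialize (H2 z). specialize (H4 z). lra. }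
 have HBn : forall x t, B' x t -> B' (-v x) t. { intros x t [H1 H2]. split; auto. intros y. rewrite boA. le_by Nneg. auto. }
 have Had : forall x k, 0 <= k -> (forall y, Nn (bf x y) <= k * Nn y) -> forall z t, B' z t -> B' (ad x z) (2 * k * t).
 { intros x k Hk Hx z t [H1 H2]. split. repeat apply mul_ge0; lra. intros y. rewrite adE, baA, boA, !bmA. le_by HN2. have Q1 := Nneg (z (x y)). have Q2 := Hx (z y). have Q3 := H2 (x y). have Q4 : k * Nn (z y) <= k * (t * Nn y) by (apply mul_le_l; auto). have Q5 : t * Nn (x y) <= t * (k * Nn y) by (apply mul_le_l; auto). lra. }
 have Hpw : forall x, (forall y, Nn (bf x y) <= kap * Nn y) -> forall p z t, B' z t -> B' ((ad x ^^ p) z) (1 * (2 * kap) ^ p * t).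
 { intros x Hx p. induction p; intros z t Hz. cbn [bpow pow]. rewrite b1A, !Rmult_1_l. auto. cbn [bpow]. rewrite bmA. replace (1 * (2 * kap) ^ S p * t) with (2 * kap * (1 * (2 * kap) ^ p * t)) by (cbn [pow]; ring). apply Had; auto. lra. }
 have HBp : forall x Cx, L0 x -> 0 <= Cx <= C0 -> (forall n z, LL z -> nm (adn x n z) <= Cx * d ^ n * nm z) -> forall p z t, B z t -> B ((ad x ^^ p) z) (C0 * d ^ p * t).
 { intros x Cx Hx HCx H p z t [H1 H2]. split. rewrite ad_pow. apply (@adn_in X LL LLb); auto. rewrite ad_pow. eapply Rle_trans. apply H; auto. assert (0 <= d ^ p) by (apply pow_le; lra). apply Rmult_le_compat; auto. apply mul_ge0; lra. apply nm_ge0. apply mul_le_r; lra. }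
 set (A := SM (ad a) (ad b) M). have HA : forall x t, B x t -> B (A x) (s * t). { apply SM_small; auto. lra. apply HBp with Ca; auto. unfold C0; lra. apply HBp with Cb; auto. unfold C0; lra. }
 assert (HA' : forall x t, B' x t -> B' (A x) (h * t)). { intros x t Hx. replace h with (1 * 1 * (2 * (2 * kap)) ^ M) by (unfold h; ring). apply (@SM_small (BL X) (ad a) (ad b) B' (2 * kap) 1); auto; lra. }
 have HDB : forall n x, LL x -> LL ((D ^^ n) x) /\ nm ((D ^^ n) x) <= Dn ^ n * nm x.
 { intros n x Hx. split. unfold D. rewrite <- ad_add, ad_pow. apply (@adn_in X LL LLb); auto. le_by nm_app. apply mul_le_r. apply nm_ge0. le_by bpow_nm. apply pow_incr. split. apply nm_ge0. unfold Dn; lra. }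
 have HGm : forall x t, B x t -> B ((D ^^ M -v A) x) (g * t).
 { intros x t Hx. destruct (HA x t Hx) as [A1 A2]. destruct Hx as [H1 H2]. destruct (HDB M x H1) as [D1 D2]. rewrite baA, boA. split. now apply vsub_minus. le_by nm_sub. unfold g. have Q : Dn ^ M * nm x <= Dn ^ M * t by (apply mul_le_l; lra). lra. }
 assert (HGm' : forall x t, B' x t -> B' ((D ^^ M -v A) x) (K * rho * t)). { apply HG; auto. lra. apply Had; auto; lra. apply Had; auto; lra. intros x t Hx. replace rho with (2 * (rho / 2)) by field. apply Had; auto; lra. }
 exists ((Dn / eta + 1) ^ (2 * M) * (1 + Mn * Mn)). have Hde : 0 <= Dn / eta by (apply div_ge0; lra). split. apply mul_ge0. apply pow_le; lra. nra.
 (* Write n = 2 M m + r: the bulk is given by [wsum_power], and the remaining r <= 2M factors cost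
    at most a constant times eta^r. *)
 have Hun : forall n z, LL z -> nm z <= 1 -> nm (adn (a +v b) n z) <= (Dn / eta + 1) ^ (2 * M) * (1 + Mn * Mn) * eta ^ n.
 { intros n z Hz Hz1. set (m := (n / (2 * M))%nat). set (r := (n mod (2 * M))%nat). have En : n = (r + M * (2 * m))%nat by (unfold m, r; assert (Q := Nat.div_mod_eq n (2 * M)); lia). have Hr : (r <= 2 * M)%nat by (unfold r; assert (Q := Nat.mod_upper_bound n (2 * M) ltac:(unfold M; lia)); lia).
  rewrite <- ad_pow, ad_add. fold D. rewrite En at 1. rewrite bpow_add, bmA, bpow_mul.
  have Q : nm (((D ^^ M) ^^ (2 * m)) z) <= (1 + Mn * Mn) * (16 * mu) ^ m.
  { replace (D ^^ M) with (A +v (D ^^ M -v A)) by bring. apply (@wsum_power (BL X) A (D ^^ M -v A) B B' s g h (K * rho) mu Mn z 1 Mn); auto; try lra. unfold g; lra.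
  intros x t [_ H2]. auto. intros x t [H1 H2]. apply nm_le. apply mul_ge0; lra. intros y. le_by HN1. le_by H2. replace (Mn * t * nm y) with (t * (Mn * nm y)) by ring. apply mul_le_l; auto. apply HN1.
  split; auto. split. lra. intros y. le_by HN1. apply mul_le_l. lra. le_by nm_app. le_mid (1 * nm y). apply mul_le_r; auto. apply nm_ge0. rewrite Rmult_1_l. apply HN1. }
  replace (16 * mu) with ((eta ^ 2) ^ M) in Q by (unfold mu; field). replace (((eta ^ 2) ^ M) ^ m) with (eta ^ (2 * M * m)) in Q by (rewrite !pow_mult; auto).
  have LLw : LL (((D ^^ M) ^^ (2 * m)) z) by (rewrite <- bpow_mul; now apply HDB). le_by (HDB r _ LLw). le_mid (Dn ^ r * ((1 + Mn * Mn) * eta ^ (2 * M * m))). apply mul_le_l; auto. apply pow_le; lra.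
  rewrite En, pow_add. replace (M * (2 * m))%nat with (2 * M * m)%nat by lia. have Q2 : Dn ^ r <= (Dn / eta + 1) ^ (2 * M) * eta ^ r. { replace Dn with (Dn / eta * eta) at 1 by (field; lra). rewrite Rpow_mult_distr. apply mul_le_r. apply pow_le; lra. le_mid ((Dn / eta + 1) ^ r). apply pow_incr; lra. apply Rle_pow; auto; lra. }
  have Q3 : 0 <= (1 + Mn * Mn) * eta ^ (2 * M * m) by (apply mul_ge0; [nra|apply pow_le; lra]). le_mid ((Dn / eta + 1) ^ (2 * M) * eta ^ r * ((1 + Mn * Mn) * eta ^ (2 * M * m))). apply mul_le_r; auto. right; ring. }
 intros n z Hz. destruct (classic (z = 0v)) as [->|Hnz]. rewrite <- ad_pow, b0, !nm0. lra. have Hp := nm_pos Hnz. have Hip := inv_gt0 _ Hp.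
 have Q := Hun n (RtoC (/ nm z) *v z) (SLs _ _ Hz). rewrite nm_RC in Q by lra. rewrite Rinv_l in Q by lra. specialize (Q (Rle_refl 1)). rewrite <- ad_pow, bZ, nm_RC in Q by lra. rewrite ad_pow in Q. apply Rmult_le_reg_l with (/ nm z); auto. le_by Q. right. field. lra.
Qed.
End EngelSum.

(** * From raw operators, roots and suprema to bounded operators and geometric bounds *)

Lemma rootn_lt v d n : (0 < n)%nat -> 0 < d -> (v < d ^ n -> rootn v n < d) /\ (rootn v n < d -> v < d ^ n).
Proof.
 intros Hn Hd. have Hnp : 0 < INR n by now apply lt_0_INR. have Hi := inv_gt0 _ Hnp. have Hdn : 0 < d ^ n by now apply pow_lt. unfold rootn. destruct (Rlt_dec 0 v) as [Hv|Hv]; [|lra].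
 have E1 : Rpower (d ^ n) (/ INR n) = d. { rewrite <- Rpower_pow, Rpower_mult, Rinv_r, Rpower_1; auto; lra. }
 split; intros H. rewrite <- E1. unfold Rpower. apply exp_increasing, Rmult_lt_compat_l, ln_increasing; auto.
 apply Rnot_le_lt. intros Hle. apply (Rlt_irrefl d). eapply Rle_lt_trans. 2: apply H. rewrite <- E1 at 1. apply Rle_Rpower_l; lra.
Qed.
Lemma rootn_ge0 v n : 0 <= rootn v n.
Proof. unfold rootn. destruct (Rlt_dec 0 v). left. apply exp_pos. lra. Qed.
Lemma Rsup_lub (P : R -> Prop) M : (exists r, P r) -> (forall r, P r -> r <= M) -> is_lub P (Rsup P).
Proof. intros H1 H2. unfold Rsup. apply epsilon_spec. destruct (completeness P) as [m Hm]. now exists M. auto. now exists m. Qed.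
Section Bridge.
Variable X : CBanach.
(** Compactness implies boundedness: along unit vectors whose images have norms tending to infinity,
    no subsequence of images could converge. *)
Lemma compact_bop (T : op X) : compact_op X T -> exists T' : bop X X, bf T' = T /\ cpt T'.
Proof.
 intros [[HD HZ] Hc]. have HB : exists M, forall x, nm (T x : X) <= M * nm x.
 { have Hb : exists M, forall x : X, nm x <= 1 -> nm (T x : X) <= M.
  { contra Hn. have Hs : forall n, exists x : X, nm x <= 1 /\ INR n < nm (T x : X). { intros n. contra H. apply Hn. exists (INR n). intros x Hx. apply Rnot_lt_le. intros Hl. apply H. now exists x. }
  destruct (fun_choice Hs) as [u Hu]. destruct (Hc u (fun n => proj1 (Hu n))) as [p [l [Hp Hl]]]. destruct (Hl 1 Rlt_0_1) as [N HN]. destruct (INR_unbounded (nm l + 1)) as [K HK].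
  set (n := (N + K)%nat). specialize (HN n ltac:(unfold n; lia)). have Q := proj2 (Hu (p n)). have Q2 := incr_ge Hp n. have Q3 : INR K <= INR (p n) by (apply le_INR; unfold n in *; lia). have Q4 := nm_tri (T (u (p n)) -v l : X) l. replace (T (u (p n)) -v l +v l) with (T (u (p n)) : X) in Q4 by vring. lra. }
  destruct Hb as [M HM]. exists M. intros x. destruct (classic (x = 0v)) as [->|Hx]. replace (T 0v) with (0v : X). rewrite !nm0. lra. replace (0v : X) with (0 *v (0v : X)) at 2 by vring. rewrite HZ. vring.
  have Hp := nm_pos Hx. have Hi := inv_gt0 _ Hp. have Q := HM (RtoC (/ nm x) *v x). rewrite HZ, !nm_RC in Q by lra. rewrite Rinv_l in Q by lra. specialize (Q (Rle_refl 1)). apply Rmult_le_reg_l with (/ nm x); auto. le_by Q. right. field. lra. }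
 exists (@Bop X X T (conj HD (conj HZ HB))). split; auto. intros u Hu. apply cv_prec. intros p Hp. destruct (Hc (fun n => u (p n))) as [q [l [Hq Hl]]]. intros n. apply Hu. exists q, l. auto.
Qed.
Lemma opnorm_bf (T : bop X X) : opnorm X (bf T) = nm T.
Proof.
 apply is_lub_u with (fun r => exists x, vnorm X x <= 1 /\ r = vnorm X (bf T x)). apply Rsup_lub with (nm T). exists (vnorm X (bf T 0v)), 0v. split; auto. rewrite nm0. lra. intros r [x [Hx ->]]. now apply nm_app1.
 split. intros r [x [Hx ->]]. now apply nm_app1. intros m Hm. apply nm_le1. intros x Hx. apply Hm. now exists x.
Qed.
Lemma bracket_bf (S T : bop X X) : bracket X (bf S) (bf T) = bf (S ** T -v T ** S). Proof. reflexivity. Qed.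
Lemma opsub_bf (S T : bop X X) : opsub X (bf S) (bf T) = bf (S -v T). Proof. reflexivity. Qed.
Lemma iter_bf (S T : bop X X) n : Nat.iter n (bracket X (bf S)) (bf T) = bf (adn S n T).
Proof. induction n; auto. change (bracket X (bf S) (Nat.iter n (bracket X (bf S)) (bf T)) = bf (adn S (Datatypes.S n) T)). now rewrite IHn. Qed.
Lemma bf_inj (S T : bop X X) : bf S = bf T -> S = T.
Proof. intros H. bext x. now rewrite H. Qed.
(** The bound [B0] on the bracket makes the sets under [Rsup] bounded above, so that [Rsup] is a
    genuine supremum. The limit then controls all n beyond some N, and B0^n the finitely many
    others. *)
Lemma engel_in_bound (L : op X -> Prop) q a B0 : engel_in X L q a -> (forall x, L x -> L (bracket X a x)) -> 0 <= B0 -> (forall x, L x -> q (bracket X a x) <= B0 * q x) ->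
 forall d, 0 < d -> exists M, 0 <= M /\ forall n x, L x -> q x <= 1 -> q (Nat.iter n (bracket X a) x) <= M * d ^ n.
Proof.
 intros [_ He] HLa HB Hq d Hd. destruct (He d Hd) as [N HN]. have Hdd : 0 <= B0 / d by (apply div_ge0; lra). exists ((B0 / d + 1) ^ N + 1). have H1 : 0 <= (B0 / d + 1) ^ N by (apply pow_le; lra). split. lra.
 have Hb : forall n x, L x -> q x <= 1 -> L (Nat.iter n (bracket X a) x) /\ q (Nat.iter n (bracket X a) x) <= B0 ^ n.
 { induction n; intros x Hx Hx1. auto. change (Nat.iter (S n) (bracket X a) x) with (bracket X a (Nat.iter n (bracket X a) x)). destruct (IHn x Hx Hx1) as [I1 I2]. split. now apply HLa. eapply Rle_trans. now apply Hq. now apply mul_le_l. }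
 intros n x Hx Hx1. have Hdn : 0 < d ^ n by now apply pow_lt. destruct (Nat.le_gt_cases n N) as [Hn|Hn].
 - le_by (Hb n x Hx Hx1). le_mid ((B0 / d + 1) ^ n * d ^ n). rewrite <- Rpow_mult_distr. apply pow_incr. split; auto. replace ((B0 / d + 1) * d) with (B0 + d) by (field; lra). lra. apply mul_le_r. lra. assert ((B0 / d + 1) ^ n <= (B0 / d + 1) ^ N) by (apply Rle_pow; auto; lra). lra.
 - specialize (HN n ltac:(lia)). unfold Rdist in HN. rewrite Rminus_0_r, Rabs_pos_eq in HN by apply rootn_ge0. apply (rootn_lt _ (Nat.le_lt_trans _ _ _ (Nat.le_0_l N) Hn) Hd) in HN. le_mid (d ^ n). 2: nra. left. eapply Rle_lt_trans. 2: apply HN. apply (@Rsup_lub _ (B0 ^ n)). 3: now exists x. eexists; exists x; eauto. intros r [y [Hy [Hy1 ->]]]. now apply Hb.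
Qed.
Lemma engel_in_intro (L : op X -> Prop) q a : L a -> (exists x, L x /\ q x <= 1) ->
 (forall d, 0 < d -> exists M, 0 <= M /\ forall n x, L x -> q x <= 1 -> q (Nat.iter n (bracket X a) x) <= M * d ^ n) -> engel_in X L q a.
Proof.
 intros Ha [x0 [Hx0 Hx1]] H. split; auto. intros eps He. destruct (H (eps / 2)) as [M [HM HMn]]. lra. destruct (@pow_half_small M 1 Rlt_0_1) as [N HN]. exists (S N). intros n Hn. unfold Rdist. rewrite Rminus_0_r, Rabs_pos_eq by apply rootn_ge0.
 apply rootn_lt; auto. lia. apply Rle_lt_trans with (M * (eps / 2) ^ n). 2: { specialize (HN n ltac:(lia)). replace (eps / 2) with (1/2 * eps) by field. rewrite Rpow_mult_distr. assert (0 < eps ^ n) by now apply pow_lt. nra. }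
 apply (@Rsup_lub _ (M * (eps / 2) ^ n)). eexists; exists x0; eauto. intros r [y [Hy [Hy1 ->]]]. now apply HMn. intros r [y [Hy [Hy1 ->]]]. now apply HMn.
Qed.
Definition img (I : bop X X -> Prop) : op X -> Prop := fun T => exists T', I T' /\ bf T' = T.
Lemma qnorm_spec (I : bop X X -> Prop) : I 0v -> forall T : bop X X, (forall i, I i -> qnorm X (img I) (bf T) <= nm (T -v i)) /\ 0 <= qnorm X (img I) (bf T) /\
 forall eps, 0 < eps -> exists i, I i /\ nm (T -v i) < qnorm X (img I) (bf T) + eps.
Proof.
 intros I0 T. set (P := fun r => exists i, img I i /\ - r = opnorm X (opsub X (bf T) i)). have HP : forall r, P r <-> exists i, I i /\ - r = nm (T -v i).
 { intros r. split. intros [i [[i' [Hi <-]] E]]. exists i'. split. auto. rewrite <- opnorm_bf. exact E. intros [i [Hi E]]. exists (bf i). split. now exists i. rewrite E, <- opnorm_bf. auto. }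
 have Hl : is_lub P (Rsup P). { apply Rsup_lub with 0. exists (- nm (T -v 0v)). apply HP. exists 0v. split; auto. ring. intros r Hr. apply HP in Hr. destruct Hr as [i [_ E]]. have Q := nm_ge0 (T -v i). lra. }
 destruct Hl as [Hu Hm]. unfold qnorm, Rinf. change (Rsup _) with (Rsup P). split; [|split].
 - intros i Hi. have Q : - nm (T -v i) <= Rsup P. { apply Hu, HP. exists i. split; auto. ring. } lra.
 - have Q : Rsup P <= 0. { apply Hm. intros r Hr. apply HP in Hr. destruct Hr as [i [_ E]]. have Q := nm_ge0 (T -v i). lra. } lra.
 - intros eps He. contra Hn. have Q : Rsup P <= Rsup P - eps. { apply Hm. intros r Hr. apply HP in Hr. destruct Hr as [i [Hi E]]. apply Rnot_lt_le. intros Hlt. apply Hn. exists i. split; auto. lra. } lra.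
Qed.
Lemma adn_scal (c : C) (S T : bop X X) n : adn S n (c *v T) = c *v adn S n T.
Proof. induction n; auto. cbn [adn]. rewrite IHn. bring. Qed.
(** All members of [L0] being compact, ideals of raw operators and of bounded operators correspond;
    the quotient norm is turned into approximation by elements of [I]. *)
Lemma E_solvable_bop (L0 : op X -> Prop) : lie_subalg X L0 -> (forall T, L0 T -> compact_op X T) -> E_solvable X L0 -> Esolv (fun T : bop X X => L0 (bf T)).
Proof.
 intros [Z0 [ZD [ZS ZB]]] Hcp HE I SI IL II IC [x0 [Hx0 Hx0I]]. destruct SI as [I0 [Ia Is]]. have Hmem : forall T : bop X X, img I (bf T) -> I T. { intros T [T' [HT E]]. apply bf_inj in E. now subst. }
 have Hbop : forall T, L0 T -> exists T' : bop X X, bf T' = T. { intros T HT. destruct (compact_bop (Hcp T HT)) as [T' [H _]]. now exists T'. }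
 destruct (HE (img I)) as [J [JL [JI [[J0 [Ja [Js Jb]]] [Jid [_ [[y [Jy Hy]] Hen]]]]]]].
 - split; [|split; [|split]].
  + intros T [T' [HT <-]]. auto.
  + split; [|split; [|split]]. now exists 0v. intros S T [S' [HS <-]] [T' [HT <-]]. exists (S' +v T'). split; auto. intros c T [T' [HT <-]]. exists (c *v T'). split. exact (Is c T' HT). auto. intros S T [S' [HS <-]] [T' [HT <-]]. exists (S' ** T' -v T' ** S'). split; auto.
  + intros a x Ha [x' [Hx <-]]. destruct (Hbop a Ha) as [a' <-]. exists (a' ** x' -v x' ** a'). split; auto.
  + intros u x Hu Hx Hl. destruct (Hbop x Hx) as [x' <-]. destruct (fun_choice Hu) as [v Hv]. exists x'. split; auto. apply (IC v); auto. intros n; apply Hv. intros eps He. destruct (Hl eps He) as [N HN]. exists N. intros n Hn. specialize (HN n Hn). destruct (Hv n) as [_ E]. rewrite <- E, opsub_bf, opnorm_bf in HN. unfold Rdist in HN. rewrite Rminus_0_r, Rabs_pos_eq in HN; auto. apply nm_ge0.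
 - exists (bf x0). split; auto.
 - exists (fun T : bop X X => J (bf T)). split; [|split; [|split; [|split]]].
  + split; [|split]. exact J0. intros x z Hx Hz. exact (Ja _ _ Hx Hz). intros c x Hx. exact (Js c _ Hx).
  + intros x Hx. now apply JL.
  + intros a x Ha Hx. exact (Jid _ _ Ha Hx).
  + destruct (Hbop y (JL y Jy)) as [y' <-]. exists y'. split; auto. intros H. apply Hy. now exists y'.
  + intros x z d Hx Hz Hd. assert (Hx0' := JL _ Hx). have Nx := nm_ge0 x. have Nz := nm_ge0 z.
  destruct (@engel_in_bound J (qnorm X (img I)) (bf x) (2 * nm x) (Hen _ Hx)) with (d := d) as [M [HM HMn]]; auto. lra.
  { intros T HT. destruct (Hbop T (JL T HT)) as [T' <-]. rewrite bracket_bf. apply le_epsilon. intros e He. set (e' := e / (2 * nm x + 1)). assert (He' : 0 < e') by (apply div_gt0; lra). destruct (proj2 (proj2 (qnorm_spec I0 T')) e' He') as [i [Hi Hin]].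
  le_by (proj1 (qnorm_spec I0 (x ** T' -v T' ** x)) (x ** i -v i ** x)). now apply II. replace ((x ** T' -v T' ** x) -v (x ** i -v i ** x)) with (x ** (T' -v i) -v (T' -v i) ** x) by bring. le_by nm_sub. have Q1 := nm_comp x (T' -v i). have Q2 := nm_comp (T' -v i) x.
  have Q3 : nm x * nm (T' -v i) <= nm x * (qnorm X (img I) (bf T') + e') by (apply mul_le_l; lra). have Q4 : (2 * nm x + 1) * e' = e by (unfold e'; field; lra). lra. }
  exists ((nm z + 1) * (M + 1)). split. apply mul_ge0; lra. intros n. set (c := / (nm z + 1)). have Hc : 0 < c by (apply inv_gt0; lra). have Hcz : c * (nm z + 1) = 1 by (unfold c; field; lra).
  have Q1 : qnorm X (img I) (bf (c *v z)) <= 1. { le_by (proj1 (qnorm_spec I0 _) 0v I0). replace (c *v z -v 0v) with (c *v z : BL X) by vring. rewrite nm_RC by lra. nra. }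
  (* The infimum in the quotient norm need not be attained; an excess of d^n is allowed, whence M +
     1. The scaling by [c] brings z into the unit ball, and nm z + 1 undoes it. *)
  assert (Hd' : 0 < d ^ n) by now apply pow_lt. have Q2 := HMn n _ (Js (RtoC c) _ Hz) Q1. change (opscal X (RtoC c) (bf z)) with (bf (c *v z : bop X X)) in Q2. rewrite iter_bf, adn_scal in Q2. destruct (proj2 (proj2 (qnorm_spec I0 (c *v adn x n z))) _ Hd') as [i [Hi Hin]].
  exists (RtoC (nm z + 1) *v i). split. apply Is; auto. replace (adn x n z -v RtoC (nm z + 1) *v i) with (RtoC (nm z + 1) *v (c *v adn x n z -v i)). 2: { bstep ((RtoC (nm z + 1) * RtoC c)%C *v adn x n z -v RtoC (nm z + 1) *v i). rewrite <- RtoC_mult, (Rmult_comm _ c), Hcz, vs1. auto. }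
  rewrite nm_RC, Rmult_assoc by lra. apply mul_le_l; lra.
Qed.
Lemma engel_bop (L : op X -> Prop) a : lie_subalg X L -> (forall T, L T -> compact_op X T) -> engel_elem X L (bf a) <-> L (bf a) /\ engelb (fun T => L (bf T)) a.
Proof.
 intros [Z0 [ZD [ZS ZB]]] Hcp. have Hbop : forall T, L T -> exists T' : bop X X, bf T' = T. { intros T HT. destruct (compact_bop (Hcp T HT)) as [T' [H _]]. now exists T'. } have Na := nm_ge0 a. split.
 - intros He. split. apply He. intros d Hd. destruct (engel_in_bound (B0 := 2 * nm a) He) with (d := d) as [M [HM HMn]]; auto. intros x Hx. apply ZB; auto. apply He. lra.
  { intros T HT. destruct (Hbop T HT) as [T' <-]. rewrite bracket_bf, !opnorm_bf. le_by nm_sub. have Q1 := nm_comp a T'. have Q2 := nm_comp T' a. lra. }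
  exists M. split; auto. intros n z Hz. destruct (classic (z = 0v)) as [->|Hnz]. replace (0v : bop X X) with (0 *v (0v : bop X X)) by vring. rewrite adn_scal. rewrite !nm_RC by lra. lra. have Hp := nm_pos Hnz. have Hi := inv_gt0 _ Hp.
  have Q := HMn n _ (ZS (RtoC (/ nm z)) _ Hz). change (opscal X (RtoC (/ nm z)) (bf z)) with (bf (RtoC (/ nm z) *v z : bop X X)) in Q. rewrite iter_bf, !opnorm_bf, adn_scal, !nm_RC in Q by lra. rewrite Rinv_l in Q by lra. specialize (Q (Rle_refl 1)). apply Rmult_le_reg_l with (/ nm z); auto. le_by Q. right. field. lra.
 - intros [Ha He]. apply engel_in_intro; auto. exists (opzero X). split; auto. change (opzero X) with (bf (0v : bop X X)). rewrite opnorm_bf, nm0. lra.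
  intros d Hd. destruct (He d Hd) as [M [HM HMn]]. exists M. split; auto. intros n T HT H1. destruct (Hbop T HT) as [T' <-]. rewrite iter_bf, opnorm_bf in *. eapply Rle_trans. now apply HMn. assert (0 <= d ^ n) by (apply pow_le; lra). assert (0 <= M * d ^ n) by now apply mul_ge0. nra.
Qed.
End Bridge.
Theorem mainTheorem4 (X : CBanach) (L L0 : op X -> Prop)
 (hL : lie_subalg X L) (hLc : forall T, L T -> compact_op X T)
 (hL0 : lie_subalg X L0) (hL0L : subset_op X L0 L)
 (hE : E_solvable X L0)
 (a b : op X) (ha0 : L0 a) (hb0 : L0 b)
 (ha : engel_elem X L a) (hb : engel_elem X L b) :
 engel_elem X L (opadd X a b).
Proof.
 have hL0c : forall T, L0 T -> compact_op X T by auto. destruct (compact_bop (hL0c a ha0)) as [a' [<- ca]]. destruct (compact_bop (hL0c b hb0)) as [b' [<- cb]].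
 apply engel_bop in ha; auto. apply engel_bop in hb; auto. change (opadd X (bf a') (bf b')) with (bf (a' +v b')). apply engel_bop; auto. destruct (hL) as [Z0 [ZD [ZS ZB]]]. destruct (hL0) as [Y0 [YD [YS YB]]]. split. apply ZD; auto.
 apply (@engel_add X (fun T => L (bf T)) (fun T => L0 (bf T)) a' b'); auto; try tauto.
 - split; [|split]. exact Z0. intros S T HS HT. exact (ZD _ _ HS HT). intros c T HT. exact (ZS c _ HT).
 - intros S T HS HT. exact (ZB _ _ HS HT).
 - split; [|split]. exact Y0. intros S T HS HT. exact (YD _ _ HS HT). intros c T HT. exact (YS c _ HT).
 - intros S T HS HT. exact (YB _ _ HS HT).
 - intros T HT. destruct (compact_bop (hL0c _ HT)) as [T' [E HT']]. apply bf_inj in E. now subst.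
 - exact (E_solvable_bop hL0 hL0c hE).
Qed.
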